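(* Let $f\in L^2(0,T;\mathbb{V}^\star)$, $u=(u_i)_i\in \mathbb{L}^\infty$ and $\rho^0=(\rho^0_i)_i\in\mathbb{L}^2$. Then there exists a unique weak solution $\rho=(\rho_i)_i\in\mathbb{W}(0,T)$ of the Fokker--Planck problem on the star graph with source $f$, drift $u$ and initial datum $\rho^0$. In addition, there exists a constant $C>0$ depending on $T$, $\underline{D}$, $\bar D$, and continuously on $\|u\|_{\mathbb{L}^\infty}$, such that $$\|\rho\|_{\mathcal{C}([0,T];\mathbb{L}^2)}+\|\rho\|_{L^2(0,T;\mathbb{V})}\le C\left(\|\rho^0\|_{\mathbb{L}^2}+\|f\|_{L^2(0,T;\mathbb{V}^\star)}\right)$$ and $$\|\rho\|_{\mathbb{W}(0,T)}\le C\left(\|\rho^0\|_{\mathbb{L}^2}+\|f\|_{L^2(0,T;\mathbb{V}^\star)}\right).$$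
   Context: Fix $N\ge 1$, $T>0$, lengths $l_i>0$ and constants $D_i>0$, $i=1,\dots,N$; set $\bar D=\max_i D_i$, $\underline{D}=\min_i D_i$, $Q_i=(0,l_i)\times(0,T)$. The star graph has $N$ edges $(0,l_i)$ joined at the common vertex $x=0$. Spaces: $\mathbb{L}^2=\prod_{i=1}^N L^2(0,l_i)$ with $\|v\|_{\mathbb{L}^2}^2=\sum_i\|v_i\|_{L^2(0,l_i)}^2$; $\mathbb{L}^\infty=\prod_{i=1}^N L^\infty(Q_i)$ with $\|u\|_{\mathbb{L}^\infty}=\sum_i\|u_i\|_{L^\infty(Q_i)}$; $\mathbb{H}^1=\prod_{i=1}^N H^1(0,l_i)$ with $\|v\|_{\mathbb{H}^1}^2=\sum_i\|v_i\|_{H^1(0,l_i)}^2$; $$\mathbb{V}=\{\varphi\in\mathbb{H}^1:\ \varphi_i(0)=\varphi_j(0)\ (i\ne j),\ \varphi_i(l_i)=0,\ i,j=1,\dots,N\}$$ with the $\mathbb{H}^1$ norm, a Hilbert space. $\mathbb{V}^\star$ is its dual, and $\mathbb{L}^2$ is identified with its dual so that $\mathbb{V}\hookrightarrow\mathbb{L}^2\hookrightarrow\mathbb{V}^\star$. $\mathbb{W}(0,T)=\{\rho\in L^2(0,T;\mathbb{V}):\rho_t\in L^2(0,T;\mathbb{V}^\star)\}$ with $\|\rho\|_{\mathbb{W}(0,T)}^2=\|\rho\|_{L^2(0,T;\mathbb{V})}^2+\|\rho_t\|_{L^2(0,T;\mathbb{V}^\star)}^2$; it embeds continuously in $\mathcal{C}([0,T];\mathbb{L}^2)$.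 The Fokker--Planck problem with source $f=(f_i)_i$, drift $u$ and initial datum $\rho^0$ is, formally, for $i,j=1,\dots,N$ and $t\in(0,T)$: $\partial_t\rho_i-D_i\partial_x^2\rho_i-\partial_x(u_i\rho_i)=f_i$ in $Q_i$; $\rho_i(x,0)=\rho_i^0(x)$; $\sum_{i=1}^N[D_i\partial_x\rho_i(0,t)+u_i(0,t)\rho_i(0,t)]=0$; $\rho_i(0,t)=\rho_j(0,t)$ for $i\neq j$; $\rho_i(l_i,t)=0$. A weak solution is a function $\rho\in\mathbb{W}(0,T)$ such that $\rho(\cdot,0)=\rho^0$ in $\mathbb{L}^2$ and, for all $\varphi=(\varphi_i)_i\in\mathbb{V}$, $$\sum_{i=1}^N\frac{d}{dt}(\rho_i(\cdot),\varphi_i)_{L^2(0,l_i)}+\mathcal{F}[u](\rho(\cdot),\varphi)=\langle f(\cdot),\varphi\rangle_{\mathbb{V}^\star,\mathbb{V}}\quad\text{in }\mathcal{D}'(0,T),$$ where at (a.e.) time $t$ $$\mathcal{F}[u](\rho,\varphi)=\sum_{i=1}^N\int_0^{l_i}\left(D_i\frac{\partial\rho_i}{\partial x}+u_i\rho_i\right)\frac{\partial\varphi_i}{\partial x}\,dx.$$ ''$C$ depends on $T,\underline D,\bar D$ and continuously on $\|u\|_{\mathbb{L}^\infty}$'' means that $C$ is the value of a function of $(T,\underline D,\bar D,\|u\|_{\mathbb{L}^\infty})$, continuous in the last argument, and does not depend on $f$ or $\rho^0$. *)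

(* Defs.v *)
From mathcomp Require Import all_boot all_order all_algebra.
From mathcomp Require Import all_classical all_reals all_analysis.

Set Implicit Arguments.
Unset Strict Implicit.
Unset Printing Implicit Defensive.
Import Order.TTheory GRing.Theory Num.Theory.
Import numFieldNormedType.Exports.

Local Open Scope classical_set_scope.
Local Open Scope ring_scope.

(* Elements of Lebesgue, Sobolev and Bochner spaces are represented by
   functions, not by classes of a.e. equal functions: a space is given by a
   membership predicate and a seminorm whose kernel is a.e. equality. *)

Section sobolev_interval.
Context {R : realType}.
Implicit Types (l T : R) (v g w : R -> R).

Notation mu := (@lebesgue_measure R).

Definition in_L2 l v : Prop := v \_ `]0, l[%classic \in Lfun mu 2%:E.

Definition norm_L2 l v : R := fine 'N[mu]_2%:E[EFin \o (v \_ `]0%R, l[%classic)]%E.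

Definition inner_L2 l v w : R := \int[mu]_(x in `]0, l[) (v x * w x).

Definition test_function T (eta : R -> R) : Prop :=
  (forall (n : nat) (x : R), derivable (derive1n n eta) x 1) /\
  (exists a b : R, [/\ 0 < a, b < T &
     forall x, x \notin `[a, b] -> eta x = 0]).

Definition weak_derivative l v g : Prop :=
  forall phi, test_function l phi ->
    \int[mu]_(x in `]0, l[) (v x * derive1 phi x) =
    - \int[mu]_(x in `]0, l[) (g x * phi x).

Definition in_H1 l v : Prop :=
  in_L2 l v /\ exists g, in_L2 l g /\ weak_derivative l v g.

(* The weak derivative in L^2(0, l), unique up to a.e. equality. *)
Definition wderive l v : R -> R :=
  xget (cst 0) [set g | in_L2 l g /\ weak_derivative l v g].

Definition norm_H1 l v : R :=
  Num.sqrt (norm_L2 l v ^+ 2 + norm_L2 l (wderive l v) ^+ 2).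

(* Boundary values of a class in H^1(0, l) are those of its continuous
   representative on [0, l], which is unique on [0, l]. *)
Definition trace l v (x : R) : R :=
  xget (cst 0) [set w | {within `[0, l], continuous w} /\
    {ae mu, forall y, y \in `]0, l[ -> w y = v y}] x.

End sobolev_interval.

(* (S, nrm) is a seminormed space carried by E.  Both the membership in S and
   the convergence of the simple functions are required for a.e. time only. *)
Section bochner.
Context {R : realType} {E : zmodType}.
Variables (T : R) (S : set E) (nrm : E -> R).

Notation mu := (@lebesgue_measure R).

Definition simple_valued (s : R -> E) : Prop :=
  [/\ finite_set (range s), (forall t, S (s t)) &
      forall e, measurable (s @^-1` [set e])].

Definition strongly_measurable (f : R -> E) : Prop :=
  exists2 s : nat -> R -> E, (forall k, simple_valued (s k)) &
    {ae mu, forall t, t \in `]0, T[ ->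
       S (f t) /\ nrm (s k t - f t) @[k --> \oo] --> (0 : R)}.

Definition bochner_norm_ereal (f : R -> E) : \bar R :=
  'N[mu]_2%:E[EFin \o ((nrm \o f) \_ `]0%R, T[%classic)]%E.

Definition in_L2_bochner (f : R -> E) : Prop :=
  strongly_measurable f /\ (bochner_norm_ereal f < +oo)%E.

Definition norm_L2_bochner (f : R -> E) : R := fine (bochner_norm_ereal f).

Definition in_C_bochner (f : R -> E) : Prop :=
  forall t, t \in `[0, T] ->
    S (f t) /\
    nrm (f s - f t) @[s --> within `[0, T]%classic (nbhs t)] --> (0 : R).

Definition norm_C_bochner (f : R -> E) : R :=
  sup [set nrm (f t) | t in `[0, T]%classic].

End bochner.

Section star_graph.
Context {R : realType} {N : nat}.
Variables (l : 'I_N -> R).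

Notation mu := (@lebesgue_measure R).
Notation mu2 := (@lebesgue_measure R \x @lebesgue_measure R)%E.

Definition graph_fun : Type := 'I_N -> R -> R.

Implicit Types (v w phi : graph_fun) (F : graph_fun -> R).

Definition LL2 : set graph_fun := [set v | forall i, in_L2 (l i) (v i)].

Definition norm_LL2 v : R := Num.sqrt (\sum_i norm_L2 (l i) (v i) ^+ 2).

Definition inner_LL2 v w : R := \sum_i inner_L2 (l i) (v i) (w i).

Definition ae_equal v w : Prop :=
  forall i, {ae mu, forall x, x \in `]0, l i[ -> v i x = w i x}.

Definition HH1 : set graph_fun := [set v | forall i, in_H1 (l i) (v i)].

Definition norm_HH1 v : R := Num.sqrt (\sum_i norm_H1 (l i) (v i) ^+ 2).

Definition VV : set graph_fun :=
  [set phi | [/\ HH1 phi,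
     (forall i j, i != j ->
        trace (l i) (phi i) 0 = trace (l j) (phi j) 0) &
     (forall i, trace (l i) (phi i) (l i) = 0)]].

(* A functional on V is a function on all of graph_fun whose values outside V
   are irrelevant. *)
Definition VVdual : set (graph_fun -> R) :=
  [set F | (forall (a : R) phi psi, VV phi -> VV psi ->
              F (fun i x => a * phi i x + psi i x) = a * F phi + F psi) /\
           (exists M : R, forall phi, VV phi -> `|F phi| <= M * norm_HH1 phi)].

Definition norm_VVdual F : R :=
  sup [set `|F phi| | phi in [set phi | VV phi /\ norm_HH1 phi <= 1]].

Variable T : R.

Definition in_L2V (rho : R -> graph_fun) : Prop :=
  in_L2_bochner T VV norm_HH1 rho.
Definition norm_L2V (rho : R -> graph_fun) : R :=
  norm_L2_bochner T norm_HH1 rho.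

Definition in_L2Vdual (f : R -> graph_fun -> R) : Prop :=
  in_L2_bochner T VVdual norm_VVdual f.
Definition norm_L2Vdual (f : R -> graph_fun -> R) : R :=
  norm_L2_bochner T norm_VVdual f.

(* g = rho_t as V^*-valued distributions on (0, T), where rho(t) in V is seen
   in V^* through phi |-> (rho(t), phi)_{L^2}; the identity between vector
   integrals in V^* is tested against every phi in V. *)
Definition time_derivative (rho : R -> graph_fun) (g : R -> graph_fun -> R) :
    Prop :=
  forall eta phi, test_function T eta -> VV phi ->
    \int[mu]_(t in `]0, T[) (inner_LL2 (rho t) phi * derive1 eta t) =
    - \int[mu]_(t in `]0, T[) (g t phi * eta t).

Definition in_W (rho : R -> graph_fun) : Prop :=
  in_L2V rho /\ exists g, in_L2Vdual g /\ time_derivative rho g.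

Definition time_derive (rho : R -> graph_fun) : R -> graph_fun -> R :=
  xget (fun _ _ => 0) [set g | in_L2Vdual g /\ time_derivative rho g].

Definition norm_W (rho : R -> graph_fun) : R :=
  Num.sqrt (norm_L2V rho ^+ 2 + norm_L2Vdual (time_derive rho) ^+ 2).

(* The embedding of W(0, T) into C([0, T]; L^2): the representative of rho
   that is continuous on [0, T], for a.e. equality in time. *)
Definition continuous_version (rho : R -> graph_fun) : R -> graph_fun :=
  xget (fun _ _ _ => 0)
    [set r | in_C_bochner T LL2 norm_LL2 r /\
             {ae mu, forall t, t \in `]0, T[ -> ae_equal (r t) (rho t)}].

Definition norm_CL2 (rho : R -> graph_fun) : R :=
  norm_C_bochner T norm_LL2 (continuous_version rho).

(* u i (x, t) is the drift on edge i at position x and time t. *)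
Definition Q (i : 'I_N) : set (R * R) := `]0, l i[%classic `*` `]0, T[%classic.

Definition in_LLoo (u : 'I_N -> R * R -> R) : Prop :=
  forall i, u i \_ (Q i) \in Lfun mu2 +oo%E.

Definition norm_LLoo (u : 'I_N -> R * R -> R) : R :=
  \sum_i fine 'N[mu2]_+oo[EFin \o (u i \_ (Q i))]%E.

Variable D : 'I_N -> R.

Definition FP_form (u : 'I_N -> R * R -> R) (t : R) v phi : R :=
  \sum_i \int[mu]_(x in `]0, l i[)
    ((D i * wderive (l i) (v i) x + u i (x, t) * v i x) *
     wderive (l i) (phi i) x).

(* The identity in D'(0, T) is tested against eta, the time derivative of each
   (rho_i, phi_i) being moved onto eta. *)
Definition weak_solution (f : R -> graph_fun -> R) (u : 'I_N -> R * R -> R)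
    (rho0 : graph_fun) (rho : R -> graph_fun) : Prop :=
  [/\ in_W rho,
      ae_equal (continuous_version rho 0) rho0 &
      forall phi eta, VV phi -> test_function T eta ->
        \sum_i (- \int[mu]_(t in `]0, T[)
                    (inner_L2 (l i) (rho t i) (phi i) * derive1 eta t))
        + \int[mu]_(t in `]0, T[) (FP_form u t (rho t) phi * eta t)
        = \int[mu]_(t in `]0, T[) (f t phi * eta t)].

End star_graph.

(* Main.v *)
(** The form [a(v, w) = (v, w) + sum_i D_i (v_i', w_i')] is a scalar product on V
    for which the embedding of V in L2 is compact, so V has an a-orthogonal basis
    [e_j], orthonormal in L2, with [a(e_j, w) = la_j (e_j, w)]. Testing against
    [e_j] turns the problem into the system [c_j' = f_j - S_j(c) - la_j c_j] for
    the coefficients [c_j = (rho, e_j)], where [S], which collects the drift and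
    the term [-c_j], satisfies [sum_j S_j(c)^2 / la_j <= const * sum_j c_j^2].
    The scalar estimate for [z' = h - la z] makes the Picard iteration of this
    system converge, which gives existence. Conversely the coefficients of any
    element of W(0, T) are absolutely continuous, and summing the equations for
    [c_j^2] gives the energy identity, the continuous representative and, with
    coercivity and Gronwall's lemma, the bounds and uniqueness. *)

Require Import Defs.
From mathcomp Require Import all_boot all_order all_algebra.
From mathcomp Require Import all_classical all_reals all_analysis.
From mathcomp Require Import measurable_realfun ess_sup_inf.
From mathcomp Require Import ring lra.
Set Implicit Arguments.
Unset Strict Implicit.
Unset Printing Implicit Defensive.
Import Order.TTheory GRing.Theory Num.Theory.
Import numFieldNormedType.Exports.
Local Open Scope classical_set_scope.
Local Open Scope ring_scope.

(** * Integration of real functions *)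

(** Coefficients in a fixed basis take the place of Galerkin approximation and of regularisation in
    time: an element of W(0, T) becomes a countable family of scalar absolutely continuous
    functions, whose product rule is Fubini on a triangle, and the chain rule for the squared norm
    follows by dominated convergence. The drift costs one space derivative, a factor of order the
    square root of [la j]; the dissipation of the scalar equations returns exactly this, so the
    iteration asks for no smallness, only for an exponential weight in time. The obstacle throughout
    is null sets and measurability: vectors are functions, weak derivatives and continuous versions
    are chosen by [xget], and the weak equation holds separately for each test function. The
    countable basis gathers the exceptional times into one null set. Both forms are only
    semi-definite and a basis vector may be zero, so that the index set is always [nat]. The bounds
    avoid the Poincare inequality, whose constant contains the lengths: the L2 part of the H1 norm
    is paid for by the Gronwall exponent. *)

Section nonmeasurable.
Context d (T : measurableType d) (R : realType) (mu : {measure set T -> \bar R}).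
Import HBSimple HBNNSimple.
Local Open Scope ereal_scope.

(** The integral of a nonnegative function is a supremum over the simple functions below it, and
    cutting such a function off on a measurable null set keeps its integral. This covers integrands
    of unknown measurability, such as those built from the representatives [rho t]. *)
Lemma ge0_integral_ae_le (D : set T) (f g : T -> \bar R) :
  (forall x, D x -> 0 <= f x) -> (forall x, D x -> 0 <= g x) ->
  {ae mu, forall x, D x -> f x <= g x} ->
  \int[mu]_(x in D) f x <= \int[mu]_(x in D) g x.
Proof.
move=> f0 g0 [N [mN N0 subN]].
rewrite integral_mkcond [leRHS]integral_mkcond.
have f0' x : 0 <= (f \_ D) x by apply: erestrict_ge0.
have g0' x : 0 <= (g \_ D) x by apply: erestrict_ge0.
rewrite (ge0_integralTE _ f0') (ge0_integralTE _ g0').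
apply: ge_ereal_sup => _ [h /= hf <-].
apply: ereal_sup_ubound.
have mCN := measurableC mN.
have pE x : (proj_nnsfun h mCN) x = (h x * (x \in ~` N)%:R)%R.
  by rewrite -indicE.
set p := proj_nnsfun h mCN in pE *.
exists p.
  move=> x; rewrite pE.
  have [xN|xN] := boolP (x \in ~` N).
    rewrite mulr1 (le_trans (hf x))// !patchE.
    case: ifPn => // xD; apply/not_notP => fg.
    move: xN; rewrite inE; apply; apply: subN => /= H; apply: fg.
    by apply: H; rewrite inE in xD.
  by rewrite mulr0.
have mhx : measurable_fun [set: T] (EFin \o h) by apply/measurable_EFinP.
have mpx : measurable_fun [set: T] (EFin \o p) by apply/measurable_EFinP.
rewrite -!integralT_nnsfun.
have h0 x : [set: T] x -> 0 <= (EFin \o h) x by rewrite /= lee_fin.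
have p0 x : [set: T] x -> 0 <= (EFin \o p) x.
  by move=> _; rewrite /comp lee_fin pE mulr_ge0.

have eh := ge0_negligible_integral mN measurableT mhx h0 N0.
have ep := ge0_negligible_integral mN measurableT mpx p0 N0.
apply: etrans ep (etrans _ (esym eh)).
apply: eq_integral => x; rewrite inE => -[_ xN].
by rewrite /comp pE mem_set// mulr1.
Qed.

Lemma integral_ae_cong (D : set T) (f g : T -> \bar R) :
  {ae mu, forall x, D x -> f x = g x} ->
  \int[mu]_(x in D) f x = \int[mu]_(x in D) g x.
Proof.
move=> fg; rewrite integralE [RHS]integralE; congr (_ - _);
 apply/eqP; rewrite eq_le; apply/andP; split; apply: ge0_integral_ae_le => //;
 apply: filterS fg => x H Dx; rewrite ?funeposE ?funenegE /= H //.
Qed.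

End nonmeasurable.

Section real_integrals.
Context d (T : measurableType d) (R : realType) (mu : {measure set T -> \bar R}).
Variables (D : set T) (mD : measurable D).
Implicit Types f g h : T -> R.
Local Notation itg f := (mu.-integrable D (EFin \o f)).
Local Notation II f := (Rintegral mu D f).

Lemma Rintegral_ae_cong f g :
  {ae mu, forall x, D x -> f x = g x} -> II f = II g.
Proof.
move=> fg; rewrite /Rintegral; congr fine; apply: integral_ae_cong.
by apply: filterS fg => x H Dx; rewrite /= H.
Qed.

Lemma itg_measurable f : itg f -> measurable_fun D f.
Proof. by move=> /measurable_int /measurable_EFinP. Qed.


Lemma itg_ae_le f g : measurable_fun D f -> itg g ->
  {ae mu, forall x, D x -> `|f x| <= g x} -> itg f.
Proof.
move=> mf /integrableP[mg goo] fg; apply/integrableP; split.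
  exact/measurable_EFinP.
apply: le_lt_trans goo; apply: ge0_integral_ae_le => //.
apply: filterS fg => x H Dx; rewrite /= lee_fin; apply: le_trans (H Dx) _.
exact: ler_norm.
Qed.

Lemma itgZ f r : itg f -> itg (fun x => r * f x).
Proof. by move=> /(integrableZl mD r); apply: eq_integrable. Qed.

Lemma itgD f g : itg f -> itg g -> itg (fun x => f x + g x).
Proof. by move=> hf hg; have := integrableD mD hf hg; apply: eq_integrable. Qed.

Lemma itgN f : itg f -> itg (fun x => - f x).
Proof. by move=> /(itgZ (-1)); apply: eq_integrable => // x _ /=; rewrite mulN1r. Qed.

Lemma itgB f g : itg f -> itg g -> itg (fun x => f x - g x).
Proof. by move=> hf /itgN hg; exact: itgD. Qed.

Lemma itg_norm f : itg f -> itg (fun x => `|f x|).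
Proof. exact: integrable_norm. Qed.

Lemma itg0 : itg (fun=> 0).
Proof. exact: integrable0. Qed.

Lemma itg_sum (I : Type) (s : seq I) (P : pred I) (F : I -> T -> R) :
  (forall i, P i -> itg (F i)) -> itg (fun x => \sum_(i <- s | P i) F i x).
Proof.
move=> HF; elim: s => [|i s IH].
  by under eq_fun do rewrite big_nil; exact: itg0.
under eq_fun do rewrite big_cons.
case: (boolP (P i)) => Pi; last exact: IH.
by apply: itgD => //; exact: HF.
Qed.

Lemma IntZ f r : itg f -> II (fun x => r * f x) = r * II f.
Proof. exact: RintegralZl. Qed.

Lemma IntD f g : itg f -> itg g -> II (fun x => f x + g x) = II f + II g.
Proof. exact: RintegralD. Qed.

Lemma IntB f g : itg f -> itg g -> II (fun x => f x - g x) = II f - II g.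
Proof. exact: RintegralB. Qed.

Lemma Int0 : II (fun=> 0) = 0.
Proof. by rewrite /Rintegral integral0. Qed.

Lemma Int_sum (I : Type) (s : seq I) (P : pred I) (F : I -> T -> R) :
  (forall i, P i -> itg (F i)) ->
  II (fun x => \sum_(i <- s | P i) F i x) = \sum_(i <- s | P i) II (F i).
Proof.
move=> HF; elim: s => [|i s IH].
  by under eq_fun do rewrite big_nil; rewrite big_nil Int0.
under eq_fun do rewrite big_cons.
rewrite big_cons; case: (boolP (P i)) => Pi; last exact: IH.
by rewrite IntD ?IH//; [exact: HF|exact: itg_sum].
Qed.

Lemma Int_ae_ge0 f : {ae mu, forall x, D x -> 0 <= f x} -> 0 <= II f.
Proof.
move=> f0; rewrite (@Rintegral_ae_cong _ (fun x => `|f x|)).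
  by apply: Rintegral_ge0 => x _.
by apply: filterS f0 => x H Dx; rewrite ger0_norm// H.
Qed.

Lemma Int_ae_le f g : itg f -> itg g ->
  {ae mu, forall x, D x -> f x <= g x} -> II f <= II g.
Proof.
move=> hf hg fg; rewrite -subr_ge0 -IntB//; apply: Int_ae_ge0.
by apply: filterS fg => x H Dx; rewrite subr_ge0 H.
Qed.

Lemma le_norm_Int f : itg f -> `|II f| <= II (fun x => `|f x|).
Proof. exact: le_normr_Rintegral. Qed.

Lemma EFin_Int f : itg f -> (II f)%:E = (\int[mu]_(x in D) (f x)%:E)%E.
Proof. by move=> hf; rewrite /Rintegral fineK//; apply: integrable_fin_num. Qed.

Lemma Int_dct (f_ : nat -> T -> R) f g :
  (forall n, measurable_fun D (f_ n)) -> measurable_fun D f ->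
  {ae mu, forall x, D x -> f_ ^~ x @ \oo --> f x} -> itg g ->
  {ae mu, forall x, D x -> forall n, `|f_ n x| <= g x} ->
  itg f /\ II (f_ n) @[n --> \oo] --> II f.
Proof.
move=> mf_ mf cf ig fg.
have [|||//||] := @dominated_convergence _ _ _ mu D mD (fun n => EFin \o f_ n)
  (EFin \o f) (EFin \o g).
- by move=> n; exact/measurable_EFinP.
- exact/measurable_EFinP.
- by apply: filterS cf => x H Dx; apply: cvg_EFin; [exact: nearW|exact: H].
- by apply: filterS fg => x H n Dx; rewrite /= lee_fin H.
move=> hf _ cvI; split => //.
by apply: fine_cvg; rewrite -/(Rintegral mu D f) EFin_Int.
Qed.

Lemma ae_eq0_of_Int f : itg f -> {ae mu, forall x, D x -> 0 <= f x} ->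
  II f = 0 -> {ae mu, forall x, D x -> f x = 0}.
Proof.
move=> hf f0 If0.
have mf : measurable_fun D (EFin \o f) by apply: measurable_int hf.
have := @ae_eq_integral_abs _ _ _ mu D mD (EFin \o f) mf.
case=> + _; move=> /(_ _)[].
  rewrite (@integral_ae_cong _ _ _ mu D _ (EFin \o f)).
    by rewrite -EFin_Int// If0.
  by apply: filterS f0 => x H Dx; rewrite /= ger0_norm// H.
by move=> N [mN N0 sN]; exists N; split => // x H; apply: sN => H'; apply: H => /= /H' [].
Qed.

(** The absolute value of the limit is almost everywhere the lower limit of the sequence, so one use
    of Fatou's lemma gives both integrability and the bound. *)
Lemma Int_fatou (f_ : nat -> T -> R) f B :
  (forall n, itg (f_ n)) -> (forall n x, D x -> 0 <= f_ n x) ->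
  measurable_fun D f ->
  {ae mu, forall x, D x -> f_ ^~ x @ \oo --> f x} ->
  (forall n, II (f_ n) <= B) ->
  itg f /\ II f <= B.
Proof.
move=> hf f0 mf cf fB.
have F : (\int[mu]_(x in D) `|(f x)%:E| <= B%:E)%E.
  have fE : {ae mu, forall x, D x ->
      `|(f x)%:E|%E = limn_einf (fun n => (f_ n x)%:E)}.
    apply: filterS cf => x H Dx.
    have cx : (f_ n x)%:E @[n --> \oo] --> (f x)%:E.
      by apply: cvg_EFin; [exact: nearW|exact: H].
    rewrite is_cvg_limn_einfE; last by apply/cvg_ex; exists (f x)%:E.
    rewrite (cvg_lim _ cx)//= ger0_norm//.
    by apply: (cvgr_to_ge (H Dx)); apply: nearW => n; exact: f0.
  rewrite (integral_ae_cong fE).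
  apply: le_trans (@fatou _ _ _ mu D mD (fun n => EFin \o f_ n) _ _) _.
  - by move=> n; exact: measurable_int (hf n).
  - by move=> n x Dx; rewrite lee_fin f0.
  rewrite limn_einf_lim; apply: lime_le; first exact: is_cvg_einfs.
  apply: nearW => n; apply: ge_ereal_inf => /=.
  exists (\int[mu]_(x in D) (EFin \o f_ n) x)%E; first by exists n => //=.
  by rewrite -EFin_Int// lee_fin.
have hI : itg f.
  apply/integrableP; split; first exact/measurable_EFinP.
  by apply: le_lt_trans F _; rewrite ltry.
split=> //; rewrite -lee_fin EFin_Int//; apply: le_trans F.
rewrite -EFin_Int// -(EFin_Int (itg_norm hI)) lee_fin.
apply: Int_ae_le => //; first exact: itg_norm.
by apply: aeW => x _; exact: ler_norm.
Qed.

Lemma itg_bounded f M : (mu D < +oo)%E -> measurable_fun D f ->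
  (forall x, D x -> `|f x| <= M) -> itg f.
Proof.
move=> Dfin mf fM; apply: measurable_bounded_integrable => //.
exists M; split; rewrite ?num_real// => y My x Dx.
by apply: le_trans (fM x Dx) (ltW My).
Qed.

Lemma itg_cst r : (mu D < +oo)%E -> itg (fun=> r).
Proof.
by move=> Dfin; apply: (@itg_bounded _ `|r|) => //; exact: measurable_cst.
Qed.

End real_integrals.

Section real_lemmas.
Context (R : realType).
Implicit Types A B C e : R.

(** The discriminant argument behind every Cauchy-Schwarz inequality below: for integrals, for
    abstract forms, for sums over edges and for tails of series. It also yields the eigenvalue
    equation, in the case [A = 0]. *)
Lemma discr_le A B C : (forall t, 0 <= A + t * (B *+ 2) + t ^+ 2 * C) ->
  B ^+ 2 <= A * C.
Proof.
move=> H; have C0 : 0 <= C.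
  rewrite leNgt; apply/negP => C0.
  have A0 : 0 <= A by have := H 0; rewrite mul0r addr0 expr0n mul0r addr0.
  (* Averaging the values at [1 + q] and at its opposite removes the linear term; [q] is large
     enough for the remaining quadratic part to outweigh [A]. *)
  set q := (1 + A + `|B|) / - C.
  have q0 : 0 < q.
    by apply: divr_gt0; [have := normr_ge0 B; lra|rewrite oppr_gt0].
  have qC : q * - C = 1 + A + `|B| by rewrite /q divfK// oppr_eq0 lt_eqF.
  have H1 := H (1 + q); have H2 := H (- (1 + q)).
  have : 0 <= A + (1 + q) ^+ 2 * C by move: H1 H2; rewrite sqrrN; lra.
  have -> : (1 + q) ^+ 2 * C = C + (q * C) * 2 + q * (q * C) by ring.
  have -> : q * C = - (1 + A + `|B|) by rewrite -qC mulrN opprK.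
  have : 0 <= q * (1 + A + `|B|) by rewrite mulr_ge0 ?ltW//; have := normr_ge0 B; lra.
  have := normr_ge0 B; lra.
have [C00|Cn0] := eqVneq C 0.
  rewrite C00 mulr0; have [->|Bn0] := eqVneq B 0; first by rewrite expr0n.
  (* At this [t] the affine function takes the value [-1]. *)
  exfalso; have := H (- (A + 1) / (B *+ 2)).
  rewrite C00 mulr0 addr0 divfK; last by rewrite mulrn_eq0.
  by lra.
have Cp : 0 < C by rewrite lt_neqAle eq_sym Cn0.
have := H (- B / C).
have -> : A + - B / C * (B *+ 2) + (- B / C) ^+ 2 * C = A - B ^+ 2 / C by field.
by rewrite subr_ge0 ler_pdivrMr.
Qed.

End real_lemmas.

(** * Square integrable functions and the completeness of L2 *)

Section L2.
Context d (T : measurableType d) (R : realType) (mu : {measure set T -> \bar R}).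
Variables (D : set T) (mD : measurable D).
Implicit Types f g h : T -> R.
Local Notation itg f := (mu.-integrable D (EFin \o f)).
Local Notation II f := (Rintegral mu D f).

Definition sqint f : Prop :=
  measurable_fun D f /\ itg (fun x => f x ^+ 2).

Lemma sqint_mul f g : sqint f -> sqint g -> itg (fun x => f x * g x).
Proof.
move=> [mf f2] [mg g2]; apply: (itg_ae_le _ (itgD mD f2 g2)).
  exact: measurable_funM.
apply: aeW => x _; rewrite normrM -(real_normK (num_real (f x))).
rewrite -(real_normK (num_real (g x))).
by have := sqr_ge0 (`|f x| - `|g x|); have := sqr_ge0 (`|f x| + `|g x|); nra.
Qed.

Lemma sqintZ f r : sqint f -> sqint (fun x => r * f x).
Proof.
move=> [mf f2]; split; first exact: measurable_funM.
by under eq_fun do rewrite exprMn; exact: itgZ.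
Qed.

Lemma sqintD f g : sqint f -> sqint g -> sqint (fun x => f x + g x).
Proof.
move=> hf hg; have fg := sqint_mul hf hg.
move: hf hg => [mf f2] [mg g2]; split; first exact: measurable_funD.
apply: (@eq_integrable _ _ _ _ _ mD
  (EFin \o (fun x => (f x ^+ 2 + 2 * (f x * g x)) + g x ^+ 2))).
  by move=> x _ /=; congr EFin; ring.
by apply: itgD => //; apply: itgD => //; exact: itgZ.
Qed.

Lemma sqintN f : sqint f -> sqint (fun x => - f x).
Proof. by move=> /(sqintZ (-1)); under eq_fun do rewrite mulN1r. Qed.

Lemma sqintB f g : sqint f -> sqint g -> sqint (fun x => f x - g x).
Proof. by move=> hf /sqintN; exact: sqintD. Qed.


Lemma sqint_ae_le f g : measurable_fun D f -> sqint g ->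
  {ae mu, forall x, D x -> `|f x| <= `|g x|} -> sqint f.
Proof.
move=> mf [mg g2] fg; split=> //; apply: (itg_ae_le _ g2).
  exact: measurable_funX.
apply: filterS fg => x H Dx; rewrite ger0_norm ?sqr_ge0//.
by rewrite -(real_normK (num_real (f x))) -(real_normK (num_real (g x))) lerXn2r ?nnegrE ?H.
Qed.

Lemma Int_sqr_ge0 f : 0 <= II (fun x => f x ^+ 2).
Proof. by apply: Rintegral_ge0 => x _; exact: sqr_ge0. Qed.

Lemma Int_cauchy_schwarz f g : sqint f -> sqint g ->
  II (fun x => f x * g x) ^+ 2 <= II (fun x => f x ^+ 2) * II (fun x => g x ^+ 2).
Proof.
move=> hf hg; apply: discr_le => t.
have fg := sqint_mul hf hg.
have -> : II (fun x => f x ^+ 2) + t * (II (fun x => f x * g x) *+ 2) +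
          t ^+ 2 * II (fun x => g x ^+ 2) = II (fun x => (f x + t * g x) ^+ 2).
  rewrite -mulr_natr (mulrC _ 2%:R) mulrA -(IntZ mD _ fg) -(IntZ mD _ hg.2).
  rewrite -(IntD mD hf.2 (itgZ mD _ fg)) -(IntD mD); first last.
  - exact: itgZ hg.2.
  - by apply: itgD => //; [exact: hf.2|exact: itgZ].
  by apply: eq_Rintegral => x _; ring.
exact: Int_sqr_ge0.
Qed.

(* [f_] may diverge on a null set that is not measurable; it is cut off on a
   Borel null set containing it. *)
Lemma ae_limit_measurable (f_ : nat -> T -> R) :
  (forall n, measurable_fun D (f_ n)) ->
  {ae mu, forall x, D x -> cvgn (f_ ^~ x)} ->
  exists2 f : T -> R, measurable_fun D f &
    {ae mu, forall x, D x -> f_ ^~ x @ \oo --> f x}.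
Proof.
move=> mf [N [mN N0 sN]].
have cvN x : D x -> ~ N x -> cvgn (f_ ^~ x).
  by move=> Dx Nx; apply/not_notP => nc; apply: Nx; apply: sN => H; exact/nc/H.
exists (fun x => limn (fun n => f_ n x * \1_(~` N) x)).
  apply: (@measurable_fun_cvg _ _ _ _ (fun n x => f_ n x * \1_(~` N) x)).
    move=> n; apply: measurable_funM => //.
    by apply: measurable_indic; exact: measurableC.
  move=> x Dx; have [Nx|Nx] := pselect (N x).
    rewrite indicE memNset; last by move=> /(_ Nx).
    under eq_fun do rewrite mulr0.
    by rewrite lim_cst//; exact: cvg_cst.
  rewrite indicE mem_set//; under eq_fun do rewrite mulr1.
  exact: cvN.
exists N; split => // x H; apply: contrapT => Nx; apply: H => Dx.
rewrite indicE mem_set//; under [X in _ --> limn X]eq_fun do rewrite mulr1.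
exact: cvN.
Qed.

(** Beppo Levi: the sum of the series has a finite integral, hence is finite almost everywhere. *)
Lemma ae_series_cvg (g_ : nat -> T -> R) B :
  (forall n, itg (g_ n)) -> (forall n x, 0 <= g_ n x) ->
  (forall K, \sum_(k < K) II (g_ k) <= B) ->
  {ae mu, forall x, D x -> cvgn (series (g_ ^~ x))}.
Proof.
move=> hg g0 gB.
pose G x := (\sum_(k <oo) (g_ k x)%:E)%E.
have G0 x : (0 <= G x)%E by apply: nneseries_ge0 => k _ _; rewrite lee_fin.
have mG : measurable_fun D G.
  apply: ge0_emeasurable_sum; first by move=> k x _ _; rewrite lee_fin.
  by move=> k _; exact: measurable_int (hg k).
have iG : mu.-integrable D G.
  apply/integrableP; split => //.
  under eq_integral do rewrite gee0_abs//.
  rewrite integral_nneseries//; first last.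
  - by move=> n x _; rewrite lee_fin.
  - by move=> n; exact: measurable_int (hg n).
  apply: (@le_lt_trans _ _ B%:E); last exact: ltry.
  apply: lime_le.
    by apply: is_cvg_nneseries => n _ _; apply: integral_ge0 => x _; rewrite lee_fin.
  apply: nearW => n; under eq_bigr do rewrite -EFin_Int//.
  by rewrite sumEFin lee_fin big_mkord.
apply: filterS (integrable_ae mD iG) => x H Dx.
have Gx := H Dx.
apply: nondecreasing_is_cvgn.
  by apply: nondecreasing_series => k _ _; exact: g0.
exists (fine (G x)) => _ [n _ <-].
rewrite -lee_fin fineK// /series /= -sumEFin.
by apply: nneseries_lim_ge => k _ _; rewrite lee_fin.
Qed.

(** A fast subsequence has increments summable in L1, so it converges almost everywhere; Fatou's
    lemma then shows that its pointwise limit is the limit in L2 of the whole sequence. *)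
Lemma riesz_fischer (f_ : nat -> T -> R) : (mu D < +oo)%E ->
  (forall n, sqint (f_ n)) ->
  (forall e, 0 < e -> exists N, forall m n, (N <= m)%N -> (N <= n)%N ->
     II (fun x => (f_ m x - f_ n x) ^+ 2) <= e) ->
  exists2 f : T -> R, sqint f &
    forall e, 0 < e -> exists N, forall n, (N <= n)%N ->
     II (fun x => (f_ n x - f x) ^+ 2) <= e.
Proof.
move=> Dfin hf cf.
have /choice[N0 N0P] : forall k, exists N, forall m n, (N <= m)%N -> (N <= n)%N ->
    II (fun x => (f_ m x - f_ n x) ^+ 2) <= 4^-1 ^+ k.
  by move=> k; apply: cf; rewrite exprn_gt0.
(* Summing the successors of the [N0 i] gives indices that increase with [k] and exceed both [N0 k]
   and [k]. *)
pose ph k := (\sum_(i < k.+1) (N0 i).+1)%N.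
have phN k : (N0 k <= ph k)%N by rewrite /ph big_ord_recr /= (leq_trans (leqnSn _))// leq_addl.
have phk k : (k <= ph k)%N.
  apply: (@leq_trans (\sum_(i < k.+1) 1)%N); first by rewrite sum1_card card_ord.
  exact: leq_sum.
have phS k : (ph k <= ph k.+1)%N by rewrite /ph (big_ord_recr k.+1) /= leq_addr.
pose De k x := f_ (ph k.+1) x - f_ (ph k) x.
have sDe k : sqint (De k) by apply: sqintB.
have De2 k : II (fun x => De k x ^+ 2) <= 4^-1 ^+ k.
  by apply: N0P; rewrite (leq_trans (phN k))// phS.
pose M := fine (mu D).
have i1 : itg (fun=> 1) by exact: itg_cst.
have iDe k : itg (fun x => `|De k x|).
  apply: (itg_ae_le _ (itgD mD (sDe k).2 i1)).
    by apply: measurableT_comp => //; exact: (sDe k).1.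
  by apply: aeW => x _; rewrite normr_id -(real_normK (num_real (De k x)));
   have := sqr_ge0 (`|De k x| - 1); have := sqr_ge0 (`|De k x|); nra.
(* From [y <= 2 ^+ k * y ^+ 2 + 2^-1 ^+ k]: a squared L2 norm below [4^-1 ^+ k] and the finite
   measure [M] give a geometric bound in L1. *)
have IDe k : II (fun x => `|De k x|) <= 2^-1 ^+ k * (1 + M).
  have -> : 2^-1 ^+ k * (1 + M) = 2 ^+ k * 4^-1 ^+ k + 2^-1 ^+ k * M.
    have -> : 4^-1 = 2^-1 * 2^-1 :> R by field.
    by rewrite exprMn mulrA -exprMn mulfV// expr1n mul1r; ring.
  have IM : II (fun=> 2^-1 ^+ k) = 2^-1 ^+ k * M by rewrite Rintegral_cst.
  have ic : itg (fun=> 2^-1 ^+ k) by exact: itg_cst.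
  rewrite -IM.
  apply: (@le_trans _ _ (2 ^+ k * II (fun x => De k x ^+ 2) + II (fun=> 2^-1 ^+ k))).
    rewrite -(IntZ mD _ (sDe k).2) -(IntD mD)//; last exact: itgZ (sDe k).2.
    apply: Int_ae_le => //.
      by apply: itgD => //; exact: itgZ (sDe k).2.
    apply: aeW => x _; rewrite -(real_normK (num_real (De k x))).
    set y := `|De k x|; have y0 : 0 <= y by rewrite normr_ge0.
    rewrite -(ler_pM2l (_ : 0 < 2 ^+ k)); last by rewrite exprn_gt0.
    rewrite mulrDr -exprMn mulfV// expr1n mulrA -expr2 -exprMn.
    have := sqr_ge0 (2 ^+ k * y - 1); have := sqr_ge0 (2 ^+ k * y + 1); nra.
  by rewrite lerD2r ler_wpM2l ?exprn_ge0.
have M0 : 0 <= M by rewrite fine_ge0.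
have := @ae_series_cvg (fun k x => `|De k x|) (2 * (1 + M)) iDe.
move=> /(_ (fun n x => normr_ge0 _)).
have sB K : \sum_(k < K) II (fun x => `|De k x|) <= 2 * (1 + M).
  apply: le_trans (ler_sum _ (fun (k : 'I_K) _ => IDe k)) _.
  rewrite -mulr_suml ler_wpM2r ?addr_ge0//.
  have : \sum_(i < K) 2^-1 ^+ i = 2 - 2 * 2^-1 ^+ K :> R.
    elim: K => [|K IH]; first by rewrite big_ord0 expr0 mulr1 subrr.
    by rewrite big_ord_recr /= IH exprS; field.
  move=> ->; rewrite gerBl mulr_ge0// exprn_ge0//.
move=> /(_ sB) aecv.
have aec : {ae mu, forall x, D x -> cvgn (fun k => f_ (ph k) x)}.
  apply: filterS aecv => x H Dx.
  have /normed_cvg c1 : cvgn [normed series (De ^~ x)].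
    rewrite (_ : [normed series (De ^~ x)] = series (fun k => `|De k x|))//.
    exact: H.
  have -> : (fun k => f_ (ph k) x) = (fun k => series (De ^~ x) k + f_ (ph 0%N) x).
    apply/funext => k; rewrite /series /= telescope_sumr//.
    by rewrite subrK.
  by apply: is_cvgD => //; exact: is_cvg_cst.
have [f mf fl] := ae_limit_measurable (fun k => (hf (ph k)).1) aec.
(* With [n] fixed, Fatou's lemma along the subsequence turns the Cauchy bound into a bound on the
   distance to [f]. It also shows that [f] is a difference of square integrable functions. *)
have key e : 0 < e -> exists N, forall n, (N <= n)%N ->
    sqint (fun x => f_ n x - f x) /\ II (fun x => (f_ n x - f x) ^+ 2) <= e.
  move=> e0; have [N NP] := cf e e0; exists N => n Nn.
  have mfn : measurable_fun D (fun x => f_ n x - f x).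
    by apply: measurable_funB => //; exact: (hf n).1.
  pose q k := ph (k + N)%N.
  pose F k x := (f_ n x - f_ (q k) x) ^+ 2.
  have h1 k : itg (F k) by exact: (sqintB (hf _) (hf _)).2.
  have h2 k x : D x -> 0 <= F k x by move=> _; exact: sqr_ge0.
  have h3 : measurable_fun D (fun x => (f_ n x - f x) ^+ 2).
    exact: measurable_funX.
  have h4 : {ae mu, forall x, D x -> F ^~ x @ \oo --> (f_ n x - f x) ^+ 2}.
    apply: filterS fl => x H Dx; rewrite /F expr2; under eq_fun do rewrite expr2.
    have c : f_ n x - f_ (q k) x @[k --> \oo] --> f_ n x - f x.
      by apply: cvgB; [exact: cvg_cst|have := H Dx; rewrite -(cvg_shiftn N)].
    exact: cvgM.
  have h5 k : II (F k) <= e.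
    by apply: NP => //; rewrite (leq_trans _ (phk _))// leq_addl.
  by have [] := Int_fatou mD h1 h2 h3 h4 h5.
exists f.
  have [N /(_ N (leqnn N))[h _]] := key 1 ltr01.
  have -> : f = (fun x => f_ N x - (f_ N x - f x)).
    by apply/funext => x; rewrite opprB addrC subrK.
  exact: sqintB.
by move=> e e0; have [N H] := key e e0; exists N => n /H[].
Qed.

End L2.

(** * Primitives *)

Section prim.
Context (R : realType).
Notation mu := (@lebesgue_measure R).
Implicit Types (f g : R -> R) (t s T : R).

Definition prim f t := \int[mu]_(s in `]0, t[) f s.

Local Notation L1 T f := (mu.-integrable `]0, T[ (EFin \o f)).

Lemma measurable_oo a b : measurable (`]a, b[%classic : set (measurableTypeR R)).
Proof. by []. Qed.

Lemma mu_oo_fin a b : (mu `]a, b[ < +oo)%E.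
Proof.
have [ab|ba] := leP a b; last first.
  by rewrite set_itv_ge ?measure0// bnd_simp -leNgt ltW.
by rewrite lebesgue_measure_itv /=; case: ifP => _; rewrite -?EFinB ?ltry.
Qed.

Lemma Int_cst_oo a b (r : R) : a <= b -> \int[mu]_(x in `]a, b[) r = r * (b - a).
Proof.
move=> ab; rewrite Rintegral_cst//; congr (_ * _).
rewrite -[LHS]/(fine (mu _)) lebesgue_measure_itv/=; case: ifPn => //.
rewrite lte_fin -leNgt => ba; have -> : a = b by apply/eqP; rewrite eq_le ab.
by rewrite subrr.
Qed.

Lemma L1S T t f : L1 T f -> t <= T -> L1 t f.
Proof.
move=> h tT; apply: integrableS h => //.
by apply: subset_itvl; rewrite bnd_simp.
Qed.

Lemma L1_closed T f : L1 T f -> mu.-integrable `[0, T] (EFin \o f).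
Proof.
move=> /integrableP[mf foo]; apply/integrableP; split.
  exact: emeasurable_fun_itv_cc mf.
rewrite integral_itv_bndoo//.
by apply: measurableT_comp.
Qed.

Lemma prim_closed T f : L1 T f -> prim f T = \int[mu]_(s in `[0, T]) f s.
Proof.
move=> /integrableP[mf foo]; rewrite /prim /Rintegral; congr fine.
by rewrite [RHS]integral_itv_bndoo.
Qed.

Lemma prim_le0 f t : t <= 0 -> prim f t = 0.
Proof.
by move=> t0; rewrite /prim set_itv_ge ?Rintegral_set0// bnd_simp -leNgt.
Qed.

Lemma prim_cont T f : 0 <= T -> L1 T f -> {within `[0, T], continuous (prim f)}.
Proof.
move=> T0 h; have := parameterized_integral_continuous T0 (L1_closed h).
apply: subspace_eq_continuous => x; rewrite inE/= in_itv/= => /andP[x0 xT].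
by rewrite /from_subspace (prim_closed (L1S h xT)).
Qed.

Lemma primB T f s t : L1 T f -> 0 <= s -> s <= t -> t <= T ->
  prim f t - prim f s = \int[mu]_(r in `]s, t[) f r.
Proof.
move=> h s0 st tT; have ht := L1S h tT; have hs := L1S ht st.
rewrite (prim_closed hs) (prim_closed ht) Rintegral_itvB ?bnd_simp//; last first.
  exact: L1_closed.
rewrite -Rintegral_itv_bndo_bndc//.
by apply: integrableS ht => //; apply: subset_itvr; rewrite bnd_simp.
Qed.

Lemma prim_measurable T f : L1 T f -> measurable_fun `]0, T[ (prim f).
Proof.
move=> h; have [T0|T0] := leP 0 T; last first.
  by rewrite set_itv_ge; [exact: measurable_fun_set0|rewrite bnd_simp -leNgt ltW].
apply: (@measurable_funS _ _ _ _ `[0, T]) => //.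
  exact: subset_itv_oo_cc.
by apply: subspace_continuous_measurable_fun => //; exact: prim_cont.
Qed.

Lemma prim_le T f t : L1 T f -> t <= T ->
  `|prim f t| <= \int[mu]_(r in `]0, T[) `|f r|.
Proof.
move=> h tT; apply: le_trans (le_norm_Int _ (L1S h tT)) _ => //.
rewrite -lee_fin !EFin_Int//; [|exact: itg_norm h|exact: itg_norm (L1S h tT)].
apply: ge0_subset_integral => //.
- by have /measurable_int := itg_norm h.
- by apply: subset_itvl; rewrite bnd_simp.
Qed.

Lemma itg_mul_prim T f g : L1 T f -> L1 T g -> L1 T (fun x => f x * prim g x).
Proof.
move=> hf hg; set M := \int[mu]_(r in `]0, T[) `|g r|.
apply: (itg_ae_le _ (itgZ _ M (itg_norm hf))) => //.
  by apply: measurable_funM; [exact: itg_measurable hf|exact: prim_measurable].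
apply: aeW => x; rewrite /= in_itv/= => /andP[_ xT].
by rewrite normrM mulrC ler_wpM2r// prim_le// ltW.
Qed.

Notation mR := (measurableTypeR R).

Lemma ae_everywhere (P : R -> Prop) : (forall x, P x) -> {ae mu, forall x, P x}.
Proof. by move=> PP; apply: (@aeW _ _ _ mu P). Qed.

Lemma ae_mono (P Q : R -> Prop) : (forall x, P x -> Q x) ->
  {ae mu, forall x, P x} -> {ae mu, forall x, Q x}.
Proof.
move=> PQ [N [mN N0 sN]]; exists N; split => // x H; apply: sN => Px.
exact/H/PQ.
Qed.

Lemma ae_and (P Q : R -> Prop) : {ae mu, forall x, P x} -> {ae mu, forall x, Q x} ->
  {ae mu, forall x, P x /\ Q x}.
Proof.
move=> [N [mN N0 sN]] [M [mM M0 sM]]; exists (N `|` M).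
have mNM : measurable (N `|` M) by exact: measurableU.
split => //.
  have := measureU0 mN mM M0 => E.
  by apply: etrans E N0.
move=> x H; apply: contrapT => /not_orP[xN xM]; apply: H; split.
  by apply: contrapT => nP; exact/xN/sN.
by apply: contrapT => nQ; exact/xM/sM.
Qed.

Lemma ae_alln (P : nat -> R -> Prop) : (forall n, {ae mu, forall x, P n x}) ->
  {ae mu, forall x, forall n, P n x}.
Proof. by move=> H; apply: (@ae_foralln _ _ _ mu P). Qed.

Lemma itv_dct T (f_ : nat -> R -> R) f g :
  (forall n, measurable_fun `]0, T[ (f_ n)) -> measurable_fun `]0, T[ f ->
  {ae mu, forall x, x \in `]0, T[ -> f_ ^~ x @ \oo --> f x} -> L1 T g ->
  {ae mu, forall x, x \in `]0, T[ -> forall n, `|f_ n x| <= g x} ->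
  L1 T f /\ \int[mu]_(x in `]0, T[) f_ n x @[n --> \oo] --> \int[mu]_(x in `]0, T[) f x.
Proof.
move=> mf_ mf cf ig fg.
have mD : measurable (`]0, T[%classic : set (measurableTypeR R)) by [].
exact: (@Int_dct _ _ _ mu _ mD _ _ _ mf_ mf cf ig fg).
Qed.

Let lt_set : set (mR * mR) := [set z | z.2 < z.1].

Let measurable_lt_set : measurable lt_set.
Proof.
have : measurable_fun [set: mR * mR] (fun z : mR * mR => z.2 < z.1).
  by apply: measurable_fun_ltr; [exact: measurable_snd|exact: measurable_fst].
by move=> /(_ measurableT [set true] I); rewrite setTI.
Qed.

(* Fubini on the triangle [r < s < t]. *)
Lemma Int_mul_prim T f g : L1 T f -> L1 T g ->
  \int[mu]_(s in `]0, T[) (f s * prim g s) =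
  \int[mu]_(r in `]0, T[) (g r * (prim f T - prim f r)).
Proof.
move=> hf hg.
pose F := f \_ `]0, T[; pose G := g \_ `]0, T[.
pose h (z : mR * mR) := F z.1 * G z.2 * \1_lt_set z.
have mD : measurable (`]0, T[%classic : set (measurableTypeR R)) by [].
have hF : mu.-integrable setT (EFin \o F).
  by rewrite /F -restrict_EFin; apply/(@integrable_mkcond _ _ _ mu _ _ mD).
have hG : mu.-integrable setT (EFin \o G).
  by rewrite /G -restrict_EFin; apply/(@integrable_mkcond _ _ _ mu _ _ mD).
have mF := itg_measurable hF; have mG := itg_measurable hG.
have mh : measurable_fun setT h.
  apply: measurable_funM; last exact: measurable_indic.
  apply: measurable_funM; first exact: measurableT_comp mF measurable_fst.
  exact: measurableT_comp mG measurable_snd.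
have ih : (mu \x mu)%E.-integrable setT (EFin \o h).
  apply/integrable12ltyP; first exact/measurable_EFinP.
  set MG := \int[mu]_r `|G r|.
  apply: (@le_lt_trans _ _ (\int[mu]_s (`|F s| * MG)%:E)%E); last first.
    have := itgZ measurableT MG (itg_norm hF).
    move=> /(integrable_lty measurableT); under eq_integral do rewrite /= mulrC.
    by [].
  apply: ge0_integral_ae_le.
  - by move=> x _; apply: integral_ge0.
  - move=> x _; rewrite lee_fin mulr_ge0//; apply: Rintegral_ge0 => y _ //.
  apply: aeW => s _.
  rewrite -(IntZ measurableT _ (itg_norm hG)).
  rewrite (EFin_Int measurableT (itgZ measurableT _ (itg_norm hG))).
  apply: ge0_integral_ae_le.
  - by move=> y _.
  - by move=> y _; rewrite lee_fin mulr_ge0.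
  apply: aeW => r _; rewrite /= lee_fin /h /= !normrM.
  rewrite ler_piMr ?mulr_ge0// indicE.
  by case: (_ \in _); rewrite ?normr1 ?normr0.
have := @Fubini _ _ _ _ R mu mu (EFin \o h) ih.
have inner1 s : `]0, T[%classic s ->
    (\int[mu]_r (EFin \o h) (s, r))%E = (f s * prim g s)%:E.
  move=> sD; have sT : s <= T by move: sD; rewrite /= in_itv/= => /andP[_ /ltW].
  rewrite /prim -(IntZ _ _ (L1S hg sT))// (EFin_Int _ (itgZ _ _ (L1S hg sT)))//.
  rewrite [RHS]integral_mkcond; apply: eq_integral => r _.
  rewrite /h /F /G /= !patchE mem_set// indicE.
  have [rs|rs] := ltP r s; last first.
    rewrite (memNset (A := lt_set)) ?mulr0; last by rewrite /lt_set/= ltNge rs.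
    by rewrite memNset//= in_itv/= (ltNge r s) rs andbF.
  rewrite (_ : (s, r) \in lt_set)// ?mulr1; last by rewrite inE.
  have [r0|r0] := ltP 0 r.
    rewrite mem_set; last by rewrite /= in_itv/= r0 (lt_le_trans rs).
    by rewrite mem_set//= in_itv/= r0.
  rewrite memNset ?mulr0; last by rewrite /= in_itv/= ltNge r0.
  by rewrite memNset//= in_itv/= ltNge r0.
have inner2 r : `]0, T[%classic r ->
    (\int[mu]_s (EFin \o h) (s, r))%E = (g r * (prim f T - prim f r))%:E.
  move=> rD; have [r0 rT] : 0 < r /\ r < T.
    by move: rD; rewrite /= in_itv/= => /andP.
  rewrite (primB hf (ltW r0) (ltW rT))//.
  have hfr : mu.-integrable `]r, T[ (EFin \o f).
    by apply: integrableS hf => //; apply: subset_itvr; rewrite bnd_simp ltW.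
  rewrite -(IntZ _ _ hfr)// (EFin_Int _ (itgZ _ _ hfr))//.
  rewrite [RHS]integral_mkcond; apply: eq_integral => s _.
  rewrite /h /F /G /= !patchE (mem_set rD) indicE.
  have [rs|rs] := ltP r s; last first.
    rewrite (memNset (A := lt_set)) ?mulr0; last by rewrite /lt_set/= ltNge rs.
    by rewrite memNset//= in_itv/= ltNge rs.
  rewrite (_ : (s, r) \in lt_set) ?mulr1; last by rewrite inE.
  have [sT|sT] := ltP s T.
    rewrite mem_set; last by rewrite /= in_itv/= sT (lt_trans r0).
    by rewrite mem_set/= ?in_itv/= ?rs// mulrC.
  rewrite memNset ?mul0r; last by rewrite /= in_itv/= (ltNge s) sT andbF.
  by rewrite memNset//= in_itv/= (ltNge s) sT andbF.
have out1 : (\int[mu]_s \int[mu]_r (EFin \o h) (s, r) =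
    \int[mu]_(s in `]0%R, T[) (f s * prim g s)%:E)%E.
  rewrite [RHS]integral_mkcond; apply: eq_integral => s _; rewrite patchE.
  case: ifPn => sD; first by rewrite inner1//; rewrite inE in sD.
  rewrite (_ : (fun r => _) = cst 0%E) ?integral0//; apply/funext => r.
  by rewrite /h /F/= patchE (negbTE sD) !mul0r.
have out2 : (\int[mu]_r \int[mu]_s (EFin \o h) (s, r) =
    \int[mu]_(r in `]0%R, T[) (g r * (prim f T - prim f r))%:E)%E.
  rewrite [RHS]integral_mkcond; apply: eq_integral => r _; rewrite patchE.
  case: ifPn => rD; first by rewrite inner2//; rewrite inE in rD.
  rewrite (_ : (fun s => _) = cst 0%E) ?integral0//; apply/funext => s.
  by rewrite /h /F /G/= !patchE (negbTE rD) mulr0 mul0r.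
by rewrite out1 out2 => E; rewrite /Rintegral E.
Qed.

(** Integration by parts for primitives of integrable functions: the two products are integrals over
    the two triangles of the square, and [Int_mul_prim] exchanges one for the other. *)
Lemma prim_mul T f g : L1 T f -> L1 T g ->
  prim f T * prim g T =
  \int[mu]_(s in `]0, T[) (f s * prim g s + g s * prim f s).
Proof.
move=> hf hg; rewrite IntD//; [|exact: itg_mul_prim..].
rewrite Int_mul_prim//.
have -> : \int[mu]_(r in `]0, T[) (g r * (prim f T - prim f r)) =
    \int[mu]_(r in `]0, T[) (prim f T * g r - g r * prim f r).
  by apply: eq_Rintegral => r _; ring.
rewrite IntB//; [|exact: itgZ|exact: itg_mul_prim].
by rewrite subrK IntZ.
Qed.

End prim.

(** * Test functions and weak derivatives *)

Section smooth.
Context (R : realType).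
Implicit Types (f g : R -> R).

(** Successive derivatives given by witnesses: closure under sums, products and affine changes of
    variable is then an induction that never computes an iterated [derive1n]. *)
Fixpoint diffn n f : Prop :=
  if n is n'.+1 then
    exists f', (forall x, is_derive x (1 : R) f (f' x)) /\ diffn n' f'
  else True.

Lemma diffn_le n m f : (m <= n)%N -> diffn n f -> diffn m f.
Proof.
elim: n m f => [|n IH] [|m] f //= mn [f' [df h]].
by exists f'; split => //; exact: IH.
Qed.

Lemma diffnD n f g : diffn n f -> diffn n g -> diffn n (fun x => f x + g x).
Proof.
elim: n f g => [//|n IH] f g /= [f' [df hf]] [g' [dg hg]].
exists (fun x => f' x + g' x); split; last exact: IH.
by move=> x; apply: is_deriveD.
Qed.

Lemma diffnZ n f r : diffn n f -> diffn n (fun x => r * f x).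
Proof.
elim: n f => [//|n IH] f /= [f' [df hf]].
exists (fun x => r * f' x); split; last exact: IH.
by move=> x; apply: is_deriveZ.
Qed.

Lemma diffnM n f g : diffn n f -> diffn n g -> diffn n (fun x => f x * g x).
Proof.
elim: n f g => [//|n IH] f g hf hg.
have hf1 := diffn_le (leqnSn n) hf; have hg1 := diffn_le (leqnSn n) hg.
move: hf hg => /= [f' [df hf]] [g' [dg hg]].
exists (fun x => f x * g' x + g x * f' x); split; last by apply: diffnD; exact: IH.
by move=> x; apply: is_deriveM.
Qed.

Lemma diffn_affine n f c e : diffn n f -> diffn n (fun x => f (c * x + e)).
Proof.
elim: n f => [//|n IH] f /= [f' [df hf]].
exists (fun x => c * f' (c * x + e)); split; last by apply: diffnZ; exact: IH.
move=> x; rewrite mulrC.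
apply: (@is_derive1_comp _ f (fun y => c * y + e)).
apply: (is_derive_eq (is_deriveD (@is_deriveZ _ _ _ id c x 1 1 _)
  (is_derive_cst e x 1))).
by rewrite addr0 /GRing.scale /= mulr1.
Qed.

Lemma diffn_derivable f : (forall n, diffn n f) ->
  forall n x, derivable (derive1n n f) x 1.
Proof.
move=> hf n; elim: n f hf => [|n IH] f hf x.
  by have /= [f' [df _]] := hf 1%N; exact: ex_derive.
rewrite /derive1n iterSr; apply: IH => m.
have /= [f' [df h]] := hf m.+1.
rewrite (_ : derive1 f = f')//; apply/funext => y.
by rewrite derive1E; apply: derive_val.
Qed.

(** The family generated by the classical smooth function that is flat at 0, the case [k = 0]. The
    powers of [x^-1] make it closed under differentiation. *)
Definition flat k (x : R) : R := if 0 < x then x^-1 ^+ k * expR (- x^-1) else 0.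

Lemma flat_ge0 k x : 0 <= flat k x.
Proof.
rewrite /flat; case: ltP => // x0.
by rewrite mulr_ge0 ?exprn_ge0 ?invr_ge0 ?expR_ge0// ltW.
Qed.

(** The exponential series dominates the term of degree [k.+2]. A quadratic bound is what
    differentiability at 0, with derivative 0, requires. *)
Lemma flat_le k x : flat k x <= (k.+2)`!%:R * x ^+ 2.
Proof.
rewrite /flat; case: ltP => [x0|_]; last by rewrite mulr_ge0 ?sqr_ge0.
have y0 : 0 < x^-1 by rewrite invr_gt0.
set y := x^-1 in y0 *.
rewrite expRN ler_pdivrMr ?expR_gt0//.
have xE : x = y^-1 by rewrite /y invrK.
apply: (@le_trans _ _ ((k.+2)`!%:R * x ^+ 2 * (y ^+ k.+2 / (k.+2)`!%:R))).
  have fk : ((k.+2)`!%:R : R) != 0 by rewrite pnatr_eq0 -lt0n fact_gt0.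
  have -> : (k.+2)`!%:R * x ^+ 2 * (y ^+ k.+2 / (k.+2)`!%:R) = x ^+ 2 * y ^+ k.+2.
    by field.
  have -> : y ^+ k.+2 = y ^+ k * y ^+ 2 by rewrite -exprD addn2.
  by rewrite mulrCA -exprMn xE mulVf ?gt_eqF// expr1n mulr1.
apply: ler_wpM2l; first by rewrite mulr_ge0 ?sqr_ge0.
by apply: le_trans (expR_ge1Dxn k.+1 (ltW y0)); rewrite lerDr.
Qed.

Lemma is_derive_flat k x :
  is_derive x (1 : R) (flat k) (flat k.+2 x - k%:R * flat k.+1 x).
Proof.
have [x0|x0|->] := ltgtP x 0.
- have -> : flat k.+2 x - k%:R * flat k.+1 x = 0.
    by rewrite /flat ltNge (ltW x0) /= mulr0 subrr.
  apply: (@near_eq_is_derive _ _ _ (cst 0)).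
  near=> y; have y0 : y < 0 by near: y; exact: lt_nbhsl.
  by rewrite /flat ltNge (ltW y0).
- have nr : \near x, (fun y => y^-1 ^+ k * expR (- y^-1)) x = flat k x.
    near=> y; have y0 : 0 < y by near: y; exact: lt_nbhsr.
    by rewrite /flat y0.
  apply: (near_eq_is_derive nr) => {nr}.
  have dV : is_derive x (1 : R) (fun y => y^-1) (- x ^- 2).
    have xn0 : id x != 0 by rewrite gt_eqF.
    apply: (is_derive_eq (is_deriveV xn0 (is_derive_id x 1))).
    by rewrite /GRing.scale /= mulr1.
  have dE s : is_derive s (1 : R) (fun s => expR (- s)) (- expR (- s)).
    apply: (is_derive_eq (is_derive1_comp (is_derive_expR (- s)) (is_deriveNid s 1))).
    by rewrite mulrN1.
  have dX s : is_derive s (1 : R) (fun s : R => s ^+ k) (k%:R * s ^+ k.-1).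
    have := is_deriveX k (is_derive_id s (1 : R)); rewrite exprfctE => h.
    by apply: (is_derive_eq h); rewrite /GRing.scale /= mulr1.
  have dg s : is_derive s (1 : R) (fun s => s ^+ k * expR (- s))
     (s ^+ k *: (- expR (- s)) + expR (- s) *: (k%:R * s ^+ k.-1)).
    by apply: is_deriveM.
  apply: (is_derive_eq (is_derive1_comp (dg (x^-1)) dV)).
  rewrite /flat x0 /GRing.scale /=.
  case: k {dX dg} => [|k] /=; rewrite ?expr0 ?exprS; field; rewrite ?gt_eqF//.
- have -> : flat k.+2 0 - k%:R * flat k.+1 0 = 0 by rewrite /flat ltxx mulr0 subrr.
  (* By [flat_le] the difference quotient at 0 is bounded by a multiple of the absolute value of
     [h]. *)
  have cv : h^-1 *: ((flat k \o shift 0) (h *: (1 : R)) - flat k 0) @[h --> 0^'] --> (0 : R).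
    apply/cvgrPdist_le => e e0; near=> h.
    have hn0 : h != 0 by near: h; exact: nbhs_dnbhs_neq.
    rewrite sub0r normrN /= addr0 /GRing.scale /= mulr1 {2}/flat ltxx subr0.
    have C0 : (0 : R) < (k.+2)`!%:R by rewrite ltr0n fact_gt0.
    rewrite normrM normfV ger0_norm ?flat_ge0// mulrC ler_pdivrMr ?normr_gt0//.
    apply: le_trans (flat_le _ _) _; rewrite -(real_normK (num_real h)) expr2 mulrA.
    rewrite ler_wpM2r// mulrC -ler_pdivlMr//.
    by near: h; apply: dnbhs0_le; rewrite divr_gt0.
  by apply: DeriveDef; [apply/cvg_ex; exists 0|exact/cvg_lim].
Unshelve. all: by end_near. Qed.

Lemma diffn_flat n k : diffn n (flat k).
Proof.
elim: n k => [//|n IH] k /=.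
exists (fun x => flat k.+2 x - k%:R * flat k.+1 x); split.
  by move=> x; exact: is_derive_flat.
apply: diffnD => //; under eq_fun do rewrite -mulNr; exact: diffnZ.
Qed.

Lemma flat0_le1 x : flat 0 x <= 1.
Proof.
rewrite /flat; case: ltP => // x0.
by rewrite expr0 mul1r -expR0 ler_expR oppr_le0 invr_ge0 ltW.
Qed.

Lemma flat0_cvg c : 0 < c -> flat 0 (n.+1%:R * c) @[n --> \oo] --> (1 : R).
Proof.
move=> c0.
have E n : flat 0 (n.+1%:R * c) = expR (- (harmonic n * c^-1)).
  by rewrite /flat mulr_gt0// expr0 mul1r invfM.
under eq_fun do rewrite E.
rewrite -expR0; apply: continuous_cvg; first exact: continuous_expR.
rewrite -oppr0; apply: cvgN; rewrite -(mul0r c^-1).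
by apply: cvgM; [exact: cvg_harmonic|exact: cvg_cst].
Qed.

(* Smooth functions in [0, 1] supported in [a, b] that converge pointwise to
   the indicator function of ]a, b[. *)
Definition bump a b n x := flat 0 (n.+1%:R * (x - a)) * flat 0 (n.+1%:R * (b - x)).

Lemma diffn_bump a b n m : diffn m (bump a b n).
Proof.
apply: diffnM.
  have := diffn_affine n.+1%:R (n.+1%:R * - a) (diffn_flat m 0).
  by under eq_fun do rewrite -mulrDr.
have := diffn_affine (- n.+1%:R) (n.+1%:R * b) (diffn_flat m 0).
by under eq_fun do rewrite mulNr addrC -mulrBr.
Qed.

Lemma bump_ge0 a b n x : 0 <= bump a b n x.
Proof. by rewrite mulr_ge0 ?flat_ge0. Qed.

Lemma bump_le1 a b n x : bump a b n x <= 1.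
Proof. by rewrite mulr_ile1 ?flat_ge0 ?flat0_le1. Qed.

Lemma bump_out a b n x : ~~ (a < x < b) -> bump a b n x = 0.
Proof.
rewrite negb_and -!leNgt /bump /flat => /orP[xa|xb].
  by rewrite (ltNge 0) pmulr_rle0// subr_le0 xa /= mul0r.
by rewrite [X in _ * X](_ : _ = 0) ?mulr0// (ltNge 0) pmulr_rle0// subr_le0 xb.
Qed.

Lemma bump_cvg a b x : a < x < b -> bump a b n x @[n --> \oo] --> (1 : R).
Proof.
move=> /andP[ax xb]; rewrite -[1]mulr1.
by apply: cvgM; apply: flat0_cvg; rewrite subr_gt0.
Qed.

Lemma diffn_continuous f : diffn 1 f -> continuous f.
Proof.
move=> [f' [df _]] x; apply/differentiable_continuous/derivable1_diffP.
exact: ex_derive.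
Qed.

End smooth.

(** * Distributions on an interval and weak derivatives *)

Section distributions.
Context (R : realType).
Notation mu := (@lebesgue_measure R).
Implicit Types (f g v w : R -> R) (l a b T : R).
Local Notation L1 T f := (mu.-integrable `]0, T[ (EFin \o f)).

Lemma bump_test l a b n : 0 < a -> b < l -> test_function l (bump a b n).
Proof.
move=> a0 bl; split.
  by apply: diffn_derivable => m; exact: diffn_bump.
exists a, b; split => // x; rewrite in_itv/= => xab; apply: bump_out.
by apply: contra xab => /andP[/ltW-> /ltW->].
Qed.

Lemma continuous_L1 T f : continuous f -> L1 T f.
Proof.
move=> cf; have [T0|T0] := ltP 0 T; last first.
  by rewrite set_itv_ge ?bnd_simp -?leNgt//; exact: integrable_set0.
apply: (@integrableS _ _ _ mu `[0, T]) => //; first exact: subset_itv_oo_cc.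
apply: continuous_compact_integrable; first exact: segment_compact.
exact: continuous_subspaceT.
Qed.

Lemma L1_mul_continuous T f g : L1 T f -> continuous g ->
  L1 T (fun x => f x * g x).
Proof.
move=> hf cg; have [T0|T0] := leP 0 T; last first.
  by rewrite set_itv_ge ?bnd_simp -?leNgt ?(ltW T0)//; exact: integrable_set0.
have cng : {within `[0, T], continuous (fun x => `|g x|)}.
  apply: continuous_subspaceT => x.
  by apply: (@continuous_comp _ _ _ g Num.norm); [exact: cg|exact: norm_continuous].
have [c _ gc] := EVT_max T0 cng.
apply: (itg_ae_le _ (itgZ _ `|g c| (itg_norm hf))) => //.
  by apply: measurable_funM; [exact: itg_measurable hf|exact: itg_measurable (continuous_L1 T cg)].
apply: ae_everywhere => x xT; rewrite normrM mulrC ler_wpM2r//; apply: gc.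
exact: (subset_itv_oo_cc xT).
Qed.

Lemma continuous_measurable_itv T f : continuous f -> measurable_fun `]0, T[ f.
Proof. by move=> /(@continuous_L1 T) /itg_measurable. Qed.

Lemma Int_bump_cvg l w a b : L1 l w -> 0 < a -> b < l ->
  \int[mu]_(x in `]0, l[) (w x * bump a b n x) @[n --> \oo] -->
  \int[mu]_(x in `]a, b[) w x.
Proof.
move=> hw a0 bl.
have measurable_oo : measurable (`]a, b[%classic : set (measurableTypeR R)) by [].
have -> : \int[mu]_(x in `]a, b[) w x = \int[mu]_(x in `]0, l[) (w \_ `]a, b[) x.
  rewrite -Rintegral_mkcondr; congr Rintegral; apply/seteqP; split => x [].
    rewrite /= in_itv/= => /andP[ax xb]; rewrite !in_itv/=.
    by rewrite ax xb (lt_trans a0 ax) (lt_trans xb bl).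
  by [].
pose h n x := w x * bump a b n x.
have mw := itg_measurable hw.
have mb n : measurable_fun `]0, l[ (bump a b n).
  by apply: continuous_measurable_itv; apply/diffn_continuous/diffn_bump.
have mh n : measurable_fun `]0, l[ (h n) by exact: measurable_funM.
have ch x : `]0, l[%classic x -> h ^~ x @ \oo --> (w \_ `]a, b[) x.
  move=> _; rewrite patchE; case: ifPn => [|].
    rewrite inE/= in_itv/= => xab; rewrite /h -[X in _ --> X]mulr1.
    by apply: cvgM; [exact: cvg_cst|exact: bump_cvg].
  rewrite notin_setE/= in_itv/= => /negP xab.
  by rewrite /h; under eq_fun do rewrite bump_out// mulr0; exact: cvg_cst.
have ml : measurable_fun `]0, l[ (w \_ `]a, b[).
  exact: (measurable_fun_cvg mh ch).
have hb : {ae mu, forall x, `]0, l[%classic x -> forall n, `|h n x| <= `|w x|}.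
  apply: ae_everywhere => x _ n; rewrite /h normrM ler_piMr// ger0_norm ?bump_ge0//.
  exact: bump_le1.
by have [] := itv_dct mh ml (ae_everywhere ch) (itg_norm hw) hb.
Qed.

(** Lebesgue differentiation: at almost every point [w] is the derivative of its primitive, which
    the hypothesis makes locally constant inside []0, l[]. *)
Lemma ae0_of_Int_oo l w : L1 l w ->
  (forall a b, 0 < a -> a < b -> b < l -> \int[mu]_(x in `]a, b[) w x = 0) ->
  {ae mu, forall x, x \in `]0, l[ -> w x = 0}.
Proof.
move=> hw w0; pose f := w \_ `]0, l[.
have mD : measurable (`]0, l[%classic : set (measurableTypeR R)) by [].
have hf : mu.-integrable setT (EFin \o f).
  by rewrite /f -restrict_EFin; apply/(@integrable_mkcond _ _ _ mu _ _ mD).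
have hfS (i : interval R) : mu.-integrable [set` i] (EFin \o f).
  by apply: integrableS hf.
have lf : locally_integrable setT f by apply: open_integrable_locally => //; exact: openT.
have := @FTC1Ny R f (fun y => hfS _) lf.
apply: ae_mono => x [dF Fx]; rewrite in_itv/= => /andP[x0 xl].
have <- : f x = w x by rewrite /f patchE mem_set//= in_itv/= x0.
rewrite -Fx.
pose F y := \int[mu]_(t in `]-oo, y]) f t.
have FE y z : 0 < y -> y < z -> z < l -> F z = F y.
  move=> y0 yz zl; apply/eqP; rewrite -subr_eq0; apply/eqP.
  rewrite /F Rintegral_itvB//; last by rewrite bnd_simp ltW.
  rewrite -Rintegral_itv_bndo_bndc//.
  rewrite -(w0 y z)//; apply: eq_Rintegral => t; rewrite inE/= in_itv/= => /andP[yt tz].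
  by rewrite /f patchE mem_set//= in_itv/= (lt_trans y0 yt) (lt_trans tz zl).
have nr : \forall y \near x, cst (F x) y = F y.
  near=> y; rewrite /cst.
  have y0 : 0 < y by near: y; exact: lt_nbhsr.
  have yl : y < l by near: y; exact: lt_nbhsl.
  have [yx|xy|->//] := ltgtP y x; first by rewrite (FE y x).
  by rewrite (FE x y).
have h : is_derive x (1 : R) F 0.
  by apply: (near_eq_is_derive nr); exact: is_derive_cst.
by rewrite -/F derive1E; exact: derive_val.
Unshelve. all: by end_near. Qed.

(** Bumps tend to the indicator of a subinterval, so the integral of [w] over every subinterval
    vanishes. *)
Lemma fundamental_lemma l w : L1 l w ->
  (forall phi, test_function l phi ->
     \int[mu]_(x in `]0, l[) (w x * phi x) = 0) ->
  {ae mu, forall x, x \in `]0, l[ -> w x = 0}.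
Proof.
move=> hw w0; apply: ae0_of_Int_oo => // a b a0 ab bl.
have E n : \int[mu]_(x in `]0, l[) (w x * bump a b n x) = 0.
  by apply: w0; exact: bump_test.
have := Int_bump_cvg hw a0 bl; under eq_fun do rewrite E.
by move=> /cvg_lim <- //; rewrite lim_cst.
Qed.

(** The vanishing mean is what makes the primitive zero to the right of the support; to the left it
    is zero in any case. *)
Lemma prim_test l th a b : (forall n, diffn n th) -> 0 < a -> a < l -> b < l ->
  (forall x, ~~ (a < x < b) -> th x = 0) ->
  \int[mu]_(x in `]0, l[) th x = 0 ->
  test_function l (prim th) /\ forall x, is_derive x (1 : R) (prim th) (th x).
Proof.
move=> dth a0 al bl th0 I0.
have cth : continuous th by apply: diffn_continuous; exact: (dth 1%N).
have ith T : L1 T th by exact: continuous_L1.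
have pa x : x <= a -> prim th x = 0.
  move=> xa; rewrite /prim (@eq_Rintegral _ _ _ _ _ (fun=> 0)) ?Int0// => y.
  rewrite inE/= in_itv/= => /andP[_ yx]; apply: th0.
  by rewrite negb_and -leNgt (le_trans (ltW yx) xa).
have dp x : is_derive x (1 : R) (prim th) (th x).
  have [xa|xa] := ltP x a.
    rewrite th0; last by rewrite negb_and -leNgt ltW.
    have nr : \forall y \near x, cst (0 : R) y = prim th y.
      near=> y; rewrite /cst pa//.
      have yl : y < a by near: y; exact: lt_nbhsl.
      exact: ltW.
    by apply: (near_eq_is_derive nr); exact: is_derive_cst.
  have x0 : 0 < x by exact: lt_le_trans a0 xa.
  have xx1 : x < x + 1 by rewrite ltrDl.
  have [d e] := continuous_FTC1_closed xx1 (L1_closed (ith (x + 1))) x0 (cth x).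
  have -> : prim th = fun x => \int[mu]_(t in `[0, x]) th t.
    by apply/funext => y; rewrite prim_closed.
  exact: (DeriveDef d (etrans (esym (derive1E _ _)) e)).
split => //; split.
  apply: diffn_derivable => -[//|n] /=.
  by exists th; split.
exists a, (Num.max a b); split => //; first by rewrite gt_max bl al.
move=> x; rewrite in_itv/= negb_and -!ltNge => /orP[/ltW|]; first exact: pa.
rewrite gt_max => /andP[ax bx].
have [xl|lx] := leP x l.
  apply/eqP; rewrite -I0 -/(prim th l) eq_sym -subr_eq0.
  rewrite (primB (ith l) _ xl)// ?ltW// ?(lt_trans a0)//.
  rewrite (@eq_Rintegral _ _ _ _ _ (fun=> 0)) ?Int0// => y.
  rewrite inE/= in_itv/= => /andP[xy _]; apply: th0.
  by rewrite negb_and -!leNgt (ltW (lt_trans bx xy)) orbT.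
rewrite -[RHS]I0 -/(prim th l); apply/eqP; rewrite -subr_eq0.
rewrite (primB (ith x) _ (ltW lx))// ?ltW// ?(lt_trans a0)//.
rewrite (@eq_Rintegral _ _ _ _ _ (fun=> 0)) ?Int0// => y.
rewrite inE/= in_itv/= => /andP[ly _]; apply: th0.
by rewrite negb_and -!leNgt (ltW (lt_trans bl ly)) orbT.
Unshelve. all: by end_near. Qed.

(* du Bois-Reymond: two unit-mass bumps differ by the derivative of a test
   function. *)
Lemma du_bois_reymond l w : 0 < l -> L1 l w ->
  (forall phi, test_function l phi ->
     \int[mu]_(x in `]0, l[) (w x * derive1 phi x) = 0) ->
  exists k, {ae mu, forall x, x \in `]0, l[ -> w x = k}.
Proof.
move=> l0 hw w0.
(* The middle third of the interval serves as a reference. *)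
pose c := l / 3; pose d := 2 * c.
have c0 : 0 < c by rewrite divr_gt0.
have cd : c < d by rewrite /d ltr_pMl// ltr1n.
have dl : d < l by rewrite /d /c; move: l0; lra.
have d0 : 0 < d by exact: lt_trans cd.
pose J a b := \int[mu]_(x in `]a, b[) w x.
(* The mean of [w] over any subinterval equals its mean over the reference interval; that common
   mean is the constant sought. *)
have key a b : 0 < a -> a < b -> b < l -> (d - c) * J a b = (b - a) * J c d.
  move=> a0 ab bl.
  pose I1 n := \int[mu]_(x in `]0, l[) bump a b n x.
  pose I2 n := \int[mu]_(x in `]0, l[) bump c d n x.
  have i1 a' b' n : L1 l (bump a' b' n).
    by apply: continuous_L1; apply/diffn_continuous/diffn_bump.
  have one : L1 l (fun=> 1) by apply: itg_cst => //; exact: mu_oo_fin.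
  have mass a' b' : 0 < a' -> a' < b' -> b' < l ->
      \int[mu]_(x in `]0, l[) bump a' b' n x @[n --> \oo] --> b' - a'.
    move=> a0' ab' bl'; have := Int_bump_cvg one a0' bl'.
    rewrite (Int_cst_oo _ (ltW ab')) mul1r.
    suff -> : (fun n => \int[mu]_(x in `]0, l[) (1 * bump a' b' n x)) =
      (fun n => \int[mu]_(x in `]0, l[) bump a' b' n x) by [].
    by apply/funext => n; apply: eq_Rintegral => x _; rewrite mul1r.
  have iw a' b' n : L1 l (fun x => w x * bump a' b' n x).
    apply: (itg_ae_le _ (itg_norm hw)).
      apply: measurable_funM; first exact: itg_measurable hw.
      exact: itg_measurable (i1 a' b' n).
    apply: aeW => x _; rewrite normrM ler_piMr// ger0_norm ?bump_ge0//.
    exact: bump_le1.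
  have E n : I2 n * \int[mu]_(x in `]0, l[) (w x * bump a b n x) =
             I1 n * \int[mu]_(x in `]0, l[) (w x * bump c d n x).
    (* Each bump is weighted by the mass of the other one, so that [th] has mean zero and its
       primitive is a test function. *)
    pose th x := I2 n * bump a b n x + - I1 n * bump c d n x.
    have [] := @prim_test l th (Num.min a c) (Num.max b d).
    - by move=> m; apply: diffnD; apply: diffnZ; exact: diffn_bump.
    - by rewrite lt_min a0.
    - by rewrite gt_min (lt_trans ab bl).
    - by rewrite gt_max bl.
    - move=> x H; rewrite /th !bump_out ?mulr0 ?addr0//; apply: contra H => /andP[h1 h2].
        by rewrite gt_min h1 orbT lt_max h2 orbT.
      by rewrite gt_min h1 lt_max h2.
    - have mD : measurable (`]0, l[%classic : set (measurableTypeR R)) by [].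
      rewrite (IntD mD (itgZ mD (I2 n) (i1 a b n)) (itgZ mD (- I1 n) (i1 c d n))).
      rewrite (IntZ mD _ (i1 a b n)) (IntZ mD _ (i1 c d n)) -/(I1 n) -/(I2 n).
      by rewrite mulNr (mulrC (I2 n)) subrr.
    move=> /w0 H dth; move: H.
    have -> : derive1 (prim th) = th.
      by apply/funext => x; rewrite derive1E; exact: derive_val.
    have -> : \int[mu]_(x in `]0, l[) (w x * th x) =
        \int[mu]_(x in `]0, l[) (I2 n * (w x * bump a b n x) + - I1 n * (w x * bump c d n x)).
      by apply: eq_Rintegral => x _; rewrite /th; ring.
    have mD : measurable (`]0, l[%classic : set (measurableTypeR R)) by [].
    rewrite (IntD mD (itgZ mD (I2 n) (iw a b n)) (itgZ mD (- I1 n) (iw c d n))).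
    rewrite (IntZ mD _ (iw a b n)) (IntZ mD _ (iw c d n)).
    by rewrite mulNr => /eqP; rewrite subr_eq0 => /eqP.
  have h1 : I2 n * \int[mu]_(x in `]0, l[) (w x * bump a b n x) @[n --> \oo]
      --> (d - c) * J a b.
    by apply: cvgM; [exact: mass|exact: Int_bump_cvg].
  have h2 : I1 n * \int[mu]_(x in `]0, l[) (w x * bump c d n x) @[n --> \oo]
      --> (b - a) * J c d.
    by apply: cvgM; [exact: mass|exact: Int_bump_cvg].
  move: h1; under eq_fun do rewrite E.
  by move=> /cvg_lim <- //; move/cvg_lim: h2 => ->.
pose k := J c d / (d - c); exists k.
have lk : L1 l (fun=> k) by apply: itg_cst => //; exact: mu_oo_fin.
have := @ae0_of_Int_oo l (fun x => w x - k) (itgB _ hw lk).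
move=> H; have : {ae mu, forall x, x \in `]0, l[ -> w x - k = 0}.
  apply: H => // a b a0 ab bl.
  have sub : `]a, b[ `<=` `]0, l[.
    by apply: subset_itv; rewrite bnd_simp ltW.
  have iS f : L1 l f -> mu.-integrable `]a, b[ (EFin \o f).
    by move=> hf; apply: integrableS hf.
  rewrite IntB//; [|exact: iS..].
  rewrite (Int_cst_oo _ (ltW ab)).
  have dc : d - c != 0 by rewrite subr_eq0 gt_eqF.
  apply/eqP; rewrite subr_eq0 /k; apply/eqP; apply: (mulfI dc).
  by rewrite -/(J a b) key//; field.
by apply: ae_mono => x h /h /eqP; rewrite subr_eq0 => /eqP.
Qed.

Lemma test_derive l phi : test_function l phi ->
  [/\ forall x, is_derive x (1 : R) phi (derive1 phi x),
      continuous phi, continuous (derive1 phi), phi 0 = 0 & phi l = 0].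
Proof.
move=> [dphi [a [b [a0 bl phi0]]]].
have d0 x : is_derive x (1 : R) phi (derive1 phi x).
  by apply: DeriveDef; [exact: (dphi 0%N)|rewrite derive1E].
split => //.
- move=> x; apply/differentiable_continuous/derivable1_diffP; exact: (dphi 0%N).
- move=> x; apply/differentiable_continuous/derivable1_diffP; exact: (dphi 1%N).
- by apply: phi0; rewrite in_itv/= leNgt a0.
- by apply: phi0; rewrite in_itv/= andbC leNgt bl.
Qed.

Lemma test_prim l phi x : test_function l phi -> 0 <= x ->
  phi x = prim (derive1 phi) x.
Proof.
move=> tphi; have [dphi cphi cdphi p0 _] := test_derive tphi.
rewrite le_eqVlt => /predU1P[<-|x0]; first by rewrite prim_le0.
rewrite prim_closed; last exact: continuous_L1.
have := @continuous_FTC2 R (derive1 phi) phi 0 x x0 (continuous_subspaceT cdphi).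
rewrite /Rintegral => -> //=; first by rewrite p0 subr0.
split => //.
- by apply: cvg_at_right_filter; exact: cphi.
- by apply: cvg_at_left_filter; exact: cphi.
Qed.

(** Integration by parts gives the weak derivative of [prim g]; for the other direction
    [du_bois_reymond] is applied to [v - prim g]. The explicit primitive is the form in which
    Sobolev functions, in space and in time, are handled from here on. *)
Lemma weak_derivativeP l v g : 0 < l -> L1 l v -> L1 l g ->
  weak_derivative l v g <->
  exists k, {ae mu, forall x, x \in `]0, l[ -> v x = k + prim g x}.
Proof.
move=> l0 hv hg.
have lphi phi : test_function l phi -> L1 l (derive1 phi).
  by move=> /test_derive[_ _ c _ _]; exact: continuous_L1.
have ibp phi : test_function l phi ->
    \int[mu]_(x in `]0, l[) (prim g x * derive1 phi x) =
    - \int[mu]_(x in `]0, l[) (g x * phi x).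
  move=> tphi; have hphi := lphi _ tphi.
  have [_ _ _ _ pl] := test_derive tphi.
  have := prim_mul hg hphi; rewrite -(test_prim tphi (ltW l0)) pl mulr0 => /esym.
  rewrite IntD//; [|exact: itg_mul_prim..].
  move=> /eqP; rewrite addr_eq0 => /eqP E.
  have -> : \int[mu]_(x in `]0, l[) (g x * phi x) =
            \int[mu]_(x in `]0, l[) (g x * prim (derive1 phi) x).
    apply: eq_Rintegral => x; rewrite inE/= in_itv/= => /andP[/ltW x0 _].
    by rewrite -(test_prim tphi).
  by rewrite E opprK; apply: eq_Rintegral => x _; rewrite mulrC.
have iprim phi : test_function l phi -> L1 l (fun x => prim g x * derive1 phi x).
  move=> tphi; have := itg_mul_prim (lphi _ tphi) hg.
  by apply: eq_integrable => // x _ /=; rewrite mulrC.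
split=> [wd|[k vk] phi tphi]; last first.
  rewrite -ibp//; have [_ _ _ p0 pl] := test_derive tphi.
  have -> : \int[mu]_(x in `]0, l[) (v x * derive1 phi x) =
     \int[mu]_(x in `]0, l[) (k * derive1 phi x + prim g x * derive1 phi x).
    apply: Rintegral_ae_cong; apply: ae_mono vk => x H xl.
    by rewrite H// mulrDl.
  rewrite IntD//; [|by apply: itgZ => //; exact: lphi|exact: iprim].
  rewrite IntZ//; last exact: lphi.
  by rewrite -/(prim (derive1 phi) l) -(test_prim tphi (ltW l0)) pl mulr0 add0r.
have lpg : L1 l (prim g).
  have one : L1 l (fun=> 1) by apply: itg_cst => //; exact: mu_oo_fin.
  have := itg_mul_prim one hg.
  by apply: eq_integrable => // x _ /=; rewrite mul1r.
have [|k hk] := @du_bois_reymond l (fun x => v x - prim g x) l0 (itgB (measurable_oo 0 l) hv lpg).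
  move=> phi tphi.
  have hvp : L1 l (fun x => v x * derive1 phi x).
    by have [_ _ c _ _] := test_derive tphi; exact: L1_mul_continuous.
  have -> : \int[mu]_(x in `]0, l[) ((v x - prim g x) * derive1 phi x) =
     \int[mu]_(x in `]0, l[) (v x * derive1 phi x - prim g x * derive1 phi x).
    by apply: eq_Rintegral => x _; rewrite mulrBl.
  by rewrite IntB//; [rewrite wd// ibp// subrr|exact: iprim].
by exists k; apply: ae_mono hk => x H /H /eqP; rewrite subr_eq => /eqP.
Qed.

End distributions.

(** The limit of the inequality for [e] and then [d] tending to 0. Combined with [ip_young] it gives
    semicontinuity of a squared norm along a convergent sequence. *)
Lemma le_of_young (R : realType) (x y : R) : 0 <= y ->
  (forall d e, 0 < d -> 0 < e -> x <= (1 + d) * (y + e) + (1 + d^-1) * e) ->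
  x <= y.
Proof.
move=> y0 H; apply/ler_addgt0Pr => h h0.
(* This makes [d * y] at most [h / 2]; the terms in [e] add up to [q * e], which is [h / 2] for the
   [e] used below. *)
pose d := h / (2 * (y + 1)).
have y1 : 0 < y + 1 by rewrite ltr_wpDl.
have d0 : 0 < d by rewrite divr_gt0// mulr_gt0.
pose q := 2 + d + d^-1.
have q0 : 0 < q by rewrite addr_gt0 ?invr_gt0// addr_gt0.
have e0 : 0 < h / 2 / q by rewrite !divr_gt0.
apply: le_trans (H _ _ d0 e0) _.
have -> : (1 + d) * (y + h / 2 / q) + (1 + d^-1) * (h / 2 / q) =
  y + d * y + h / 2 / q * q by rewrite /q; field; rewrite !gt_eqF//; nra.
rewrite divfK ?gt_eqF// -addrA lerD2l.
have : d * y <= h / 2.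
  rewrite /d mulrAC ler_pdivrMr ?mulr_gt0//; nra.
by lra.
Qed.

(** * Spectral bases in semi-inner product spaces *)

Section semi_inner_product.
Context (R : realType) (E : lmodType R).
Variables (S : set E) (p : E -> E -> R).

Definition subspace_set : Prop :=
  [/\ S 0, (forall x y, S x -> S y -> S (x + y)) &
      (forall (r : R) x, S x -> S (r *: x))].

Definition semi_ip : Prop :=
  [/\ (forall x y, S x -> S y -> p x y = p y x),
      (forall x y z, S x -> S y -> S z -> p (x + y) z = p x z + p y z),
      (forall (r : R) x z, S x -> S z -> p (r *: x) z = r * p x z) &
      (forall x, S x -> 0 <= p x x)].

Hypotheses (hS : subspace_set) (hp : semi_ip).

Lemma sub0 : S 0. Proof. by case: hS. Qed.
Lemma subD x y : S x -> S y -> S (x + y). Proof. by case: hS => _ h _; exact: h. Qed.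
Lemma subZ r x : S x -> S (r *: x). Proof. by case: hS => _ _ h; exact: h. Qed.
Lemma subN x : S x -> S (- x). Proof. by move=> h; rewrite -scaleN1r; exact: subZ. Qed.
Lemma subB x y : S x -> S y -> S (x - y).
Proof. by move=> h /subN; exact: subD. Qed.
Lemma sub_sum (I : Type) (s : seq I) (P : pred I) (F : I -> E) :
  (forall i, P i -> S (F i)) -> S (\sum_(i <- s | P i) F i).
Proof.
by move=> H; elim/big_ind: _ => //; [exact: sub0|exact: subD].
Qed.

Lemma ipC x y : S x -> S y -> p x y = p y x. Proof. by case: hp => h _ _ _; exact: h. Qed.
Lemma ipDl x y z : S x -> S y -> S z -> p (x + y) z = p x z + p y z.
Proof. by case: hp => _ h _ _; exact: h. Qed.
Lemma ipZl r x z : S x -> S z -> p (r *: x) z = r * p x z.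
Proof. by case: hp => _ _ h _; exact: h. Qed.
Lemma ip_ge0 x : S x -> 0 <= p x x. Proof. by case: hp => _ _ _; exact. Qed.
Lemma ipDr x y z : S x -> S y -> S z -> p z (x + y) = p z x + p z y.
Proof. by move=> hx hy hz; rewrite ipC ?ipDl ?(ipC hz)//; exact: subD. Qed.
Lemma ipZr r x z : S x -> S z -> p z (r *: x) = r * p z x.
Proof. by move=> hx hz; rewrite ipC ?ipZl ?(ipC hz)//; exact: subZ. Qed.
Lemma ip0l z : S z -> p 0 z = 0.
Proof. by move=> hz; rewrite -(scale0r (0 : E)) ipZl ?mul0r//; exact: sub0. Qed.
Lemma ip0r z : S z -> p z 0 = 0.
Proof. by move=> hz; rewrite ipC ?ip0l//; exact: sub0. Qed.
Lemma ipNl x z : S x -> S z -> p (- x) z = - p x z.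
Proof. by move=> hx hz; rewrite -scaleN1r ipZl// mulN1r. Qed.
Lemma ipNr x z : S x -> S z -> p z (- x) = - p z x.
Proof. by move=> hx hz; rewrite -scaleN1r ipZr// mulN1r. Qed.
Lemma ipBl x y z : S x -> S y -> S z -> p (x - y) z = p x z - p y z.
Proof. by move=> hx hy hz; rewrite ipDl ?ipNl//; exact: subN. Qed.
Lemma ipBr x y z : S x -> S y -> S z -> p z (x - y) = p z x - p z y.
Proof. by move=> hx hy hz; rewrite ipDr ?ipNr//; exact: subN. Qed.

Lemma ip_suml (I : Type) (s : seq I) (P : pred I) (F : I -> E) z :
  (forall i, P i -> S (F i)) -> S z ->
  p (\sum_(i <- s | P i) F i) z = \sum_(i <- s | P i) p (F i) z.
Proof.
move=> HF hz; elim: s => [|i s IH]; first by rewrite !big_nil ip0l.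
rewrite !big_cons; case: ifP => Pi; last exact: IH.
by rewrite ipDl ?IH//; [exact: HF|exact: sub_sum].
Qed.

Lemma ip_sumr (I : Type) (s : seq I) (P : pred I) (F : I -> E) z :
  (forall i, P i -> S (F i)) -> S z ->
  p z (\sum_(i <- s | P i) F i) = \sum_(i <- s | P i) p z (F i).
Proof.
move=> HF hz; rewrite ipC ?ip_suml//; last exact: sub_sum.
by apply: eq_bigr => i Pi; rewrite ipC//; exact: HF.
Qed.

Lemma ip_sqD x y : S x -> S y -> p (x + y) (x + y) = p x x + 2 * p x y + p y y.
Proof.
move=> hx hy; rewrite ipDl ?ipDr ?(ipC hy hx)//; last exact: subD.
by ring.
Qed.

Lemma ip_sqB x y : S x -> S y -> p (x - y) (x - y) = p x x - 2 * p x y + p y y.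
Proof.
move=> hx hy; rewrite ip_sqD ?ipNr ?ipNl//; [|exact: subN..].
by ring.
Qed.

Lemma ip_sqBC x y : S x -> S y -> p (x - y) (x - y) = p (y - x) (y - x).
Proof. by move=> hx hy; rewrite !ip_sqB// (ipC hy hx); ring. Qed.

Lemma ip_sqZ r x : S x -> p (r *: x) (r *: x) = r ^+ 2 * p x x.
Proof. by move=> hx; rewrite ipZl ?ipZr ?mulrA//; exact: subZ. Qed.

Lemma ip_cauchy_schwarz x y : S x -> S y -> p x y ^+ 2 <= p x x * p y y.
Proof.
move=> hx hy; apply: discr_le => t.
have -> : p x x + t * (p x y *+ 2) + t ^+ 2 * p y y =
          p (x + t *: y) (x + t *: y).
  rewrite ip_sqD ?ip_sqZ ?ipZr//; [ring|exact: subZ].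
by apply: ip_ge0; apply: subD => //; exact: subZ.
Qed.

Lemma ip_norm_le x y : S x -> S y ->
  `|p x y| <= Num.sqrt (p x x) * Num.sqrt (p y y).
Proof.
move=> hx hy; rewrite -sqrtrM ?ip_ge0// -sqrtr_sqr ler_wsqrtr//.
exact: ip_cauchy_schwarz.
Qed.

Lemma ip_triangle x y : S x -> S y ->
  Num.sqrt (p (x + y) (x + y)) <= Num.sqrt (p x x) + Num.sqrt (p y y).
Proof.
move=> hx hy; rewrite -(ger0_norm (addr_ge0 (sqrtr_ge0 _) (sqrtr_ge0 _))).
rewrite -sqrtr_sqr ler_wsqrtr// sqrrD !sqr_sqrtr ?ip_ge0// ip_sqD//.
rewrite lerD2r lerD2l mulr_natl lerMn2r /=.
by apply: le_trans (ip_norm_le hx hy); exact: ler_norm.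
Qed.

(** The square of [d *: x - y], divided by [d], is nonnegative. *)
Lemma ip_young d x y : 0 < d -> S x -> S y ->
  p (x + y) (x + y) <= (1 + d) * p x x + (1 + d^-1) * p y y.
Proof.
move=> d0 hx hy.
have := ip_ge0 (subB (subZ d hx) hy).
rewrite ip_sqB ?ip_sqZ ?ipZl//; last exact: subZ.
rewrite ip_sqD// => H; have : 0 <= d^-1 * (d ^+ 2 * p x x - 2 * (d * p x y) + p y y).
  by rewrite mulr_ge0// invr_ge0 ltW.
have -> : d^-1 * (d ^+ 2 * p x x - 2 * (d * p x y) + p y y) =
  d * p x x - 2 * p x y + d^-1 * p y y by field; rewrite gt_eqF.
by move=> {}H; lra.
Qed.

Lemma ip_sqB_le x y : S x -> S y ->
  p (x - y) (x - y) <= 2 * p x x + 2 * p y y.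
Proof.
move=> hx hy; rewrite ip_sqB//.
by have := ip_ge0 (subD hx hy); rewrite ip_sqD//; lra.
Qed.

End semi_inner_product.

Section ultra.
Context (R : realType).

(* An ultrafilter finer than the cofinite one turns boundedness of finitely
   many scalar sequences into convergence. *)
Lemma bounded_ultra (U : set_system nat) (FU : UltraFilter U) (x : nat -> R) M :
  (forall n, `|x n| <= M) ->
  forall e, 0 < e -> exists2 A, U A & forall m n, A m -> A n -> `|x m - x n| <= e.
Proof.
move=> xM e e0.
have : compact (`[- M, M]%classic : set R) by exact: segment_compact.
move=> /(_ (x @ U) _)[].
  rewrite /= nbhs_simpl /=.
  have -> : x @^-1` `[- M, M] = setT.
    by apply/seteqP; split => // n _; rewrite /= in_itv/= -ler_norml.
  exact: filterT.
move=> l [_ cl].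
have bl : nbhs l (ball l (e / 2)) by apply: nbhsx_ballx; rewrite divr_gt0.
exists (x @^-1` (ball l (e / 2))).
  have [//|UC] := in_ultra_setVsetC (x @^-1` (ball l (e / 2))) FU.
  have [y [/= yC yB]] := cl (~` ball l (e / 2)) _ UC bl.
  by exfalso; exact: yC.
move=> m n; rewrite /= /ball/= => hm hn.
have -> : x m - x n = (l - x n) - (l - x m) by ring.
apply: le_trans (ler_normB _ _) _.
by move: hm hn; lra.
Qed.

End ultra.

(** * Eigenvectors of one form with respect to another, for a compact embedding *)

Section spectral.
Context (R : realType) (E : lmodType R).
Variables (S : set E) (a b : E -> E -> R).
Hypotheses (hS : subspace_set S) (ha : semi_ip S a) (hb : semi_ip S b).
Hypothesis ba : forall x, S x -> b x x <= a x x.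
(** Together with [ba], this says that both forms have the same null vectors, the substitute for
    definiteness. *)
Hypothesis definite : forall x, S x -> b x x = 0 -> a x x = 0.
Hypothesis complete : forall u : nat -> E, (forall n, S (u n)) ->
  (forall e, 0 < e -> exists N, forall m n, (N <= m)%N -> (N <= n)%N ->
     a (u m - u n) (u m - u n) <= e) ->
  exists2 v, S v & forall e, 0 < e -> exists N, forall n, (N <= n)%N ->
     a (u n - v) (u n - v) <= e.
(** Compactness of the embedding of [(S, a)] into [(S, b)], in quantitative form: up to a small
    multiple of [a], the square norm [b] is controlled by finitely many bounded functionals. For the
    graph these are point values on a grid. *)
Hypothesis compactness : forall e, 0 < e -> exists (I : finType) (L : I -> E -> R) (K : R),
  [/\ (forall k x y, S x -> S y -> L k (x - y) = L k x - L k y),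
      (forall k x, S x -> L k x ^+ 2 <= K * a x x) &
      (forall x, S x -> b x x <= e * a x x + \sum_k L k x ^+ 2)].

(** A single ultrafilter makes all the scalar sequences Cauchy for all tolerances, so no nested
    subsequences are extracted: [ph j] is any index beyond [j] in the first [j.+1] chosen sets,
    which meet because they belong to a filter. *)
Lemma compact_extract (u : nat -> E) M :
  (forall n, S (u n)) -> (forall n, a (u n) (u n) <= M) ->
  exists2 ph : nat -> nat, (forall j, (j <= ph j)%N) &
    forall e, 0 < e -> exists N, forall i j, (N <= i)%N -> (N <= j)%N ->
      b (u (ph i) - u (ph j)) (u (ph i) - u (ph j)) <= e.
Proof.
move=> uS uM.
have [U [UU sub]] := ultraFilterLemma (eventually_filter : ProperFilter eventually).
have M0 : 0 <= M by apply: le_trans (uM 0%N); exact: (ip_ge0 ha (uS _)).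
have key e : 0 < e -> exists2 A, U A &
    forall i j, A i -> A j -> b (u i - u j) (u i - u j) <= e.
  (* The squared [a]-norm of a difference is at most [4 * M], so the part weighted by [e1] stays
     below [e / 2]. *)
  move=> e0; pose e1 := e / (2 * (4 * M + 1)).
  have e10 : 0 < e1 by rewrite divr_gt0// mulr_gt0// ltr_wpDl ?mulr_ge0.
  have [I [L [K [LB LK bL]]]] := compactness e10.
  (* Being at most 1, [del] bounds its own square, so the sum of the squared functionals also stays
     below [e / 2]. *)
  pose del := Num.min 1 (e / (2 * #|I|.+1%:R)).
  have del0 : 0 < del by rewrite lt_min ltr01 divr_gt0// mulr_gt0.
  have /choice[A AP] : forall k, exists A, U A /\
      forall i j, A i -> A j -> `|L k (u i) - L k (u j)| <= del.
    move=> k.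
    have [n|A UA AP] := @bounded_ultra R U UU (fun n => L k (u n)) (1 + `|K| * M) _ _ del0.
      have h : L k (u n) ^+ 2 <= `|K| * M.
        apply: le_trans (LK _ _ (uS n)) _.
        apply: (@le_trans _ _ (`|K| * a (u n) (u n))).
          by rewrite ler_wpM2r ?ler_norm//; exact: (ip_ge0 ha (uS _)).
        by rewrite ler_wpM2l.
      rewrite -(real_normK (num_real (L k (u n)))) in h.
      by have := sqr_ge0 (`|L k (u n)| - 1); move: h; nra.
    by exists A.
  exists [set n | forall k, A k n].
    by apply: filter_forall => k; have [] := AP k.
  move=> i j Ai Aj.
  apply: le_trans (bL _ (subB hS (uS i) (uS j))) _.
  have h1 : a (u i - u j) (u i - u j) <= 4 * M.
    have := ip_sqB_le hS ha (uS i) (uS j).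
    by have := uM i; have := uM j; lra.
  have h2 : e1 * a (u i - u j) (u i - u j) <= e / 2.
    rewrite /e1 mulrAC ler_pdivrMr; last by rewrite mulr_gt0// ltr_wpDl ?mulr_ge0.
    have -> : e / 2 * (2 * (4 * M + 1)) = e * (4 * M + 1) by field.
    by rewrite ler_pM2l//; lra.
  have h3 : \sum_k L k (u i - u j) ^+ 2 <= e / 2.
    apply: (@le_trans _ _ (\sum_(k : I) (e / (2 * #|I|.+1%:R)))).
      apply: ler_sum => k _; rewrite LB//.
      have [_ /(_ i j (Ai k) (Aj k))] := AP k.
      set y := (_ - _); rewrite -(real_normK (num_real y)) => yd.
      have d1 : del <= 1 by rewrite ge_min lexx.
      have d2 : del <= e / (2 * #|I|.+1%:R) by rewrite ge_min lexx orbT.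
      apply: (@le_trans _ _ (del * 1)); last by rewrite mulr1.
      by rewrite expr2 ler_pM// (le_trans yd d1).
    rewrite sumr_const -[_ *+ _]mulr_natr -/(#|I|).
    have -> : e / (2 * #|I|.+1%:R) * #|I|%:R = e / 2 * (#|I|%:R / #|I|.+1%:R).
      by rewrite invfM; ring.
    apply: ler_piMr; first by apply/ltW; rewrite divr_gt0.
    by rewrite ler_pdivrMr// mul1r ler_nat.
  by lra.
have /choice[A AP] : forall k : nat, exists A, U A /\
    forall i j, A i -> A j -> b (u i - u j) (u i - u j) <= k.+1%:R^-1.
  move=> k; have k0 : (0 : R) < k.+1%:R^-1 by rewrite invr_gt0.
  by have [A UA HA] := key _ k0; exists A.
have /choice[ph phP] : forall j : nat, exists n : nat, (j <= n)%N /\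
    forall k, (k <= j)%N -> A k n.
  move=> j.
  have : U ([set n | (j <= n)%N] `&` [set n | forall k : 'I_j.+1, A k n]).
    apply: filterI; first by apply: sub; exists j.
    by apply: filter_forall => k; have [] := AP k.
  move=> /filter_ex[n [jn An]]; exists n; split => // k kj.
  exact: (An (Ordinal (kj : (k < j.+1)%N))).
exists ph; first by move=> j; have [] := phP j.
move=> e e0.
have [k ke] : exists k : nat, k.+1%:R^-1 <= e.
  exists (Num.truncn e^-1); rewrite invf_ple ?posrE//.
  by apply/ltW; rewrite truncnS_gt.
exists k => i j ki kj; apply: le_trans ke.
have [_ hi] := phP i; have [_ hj] := phP j.
by have [_] := AP k; apply; [exact: hi|exact: hj].
Qed.

(* Rayleigh quotient: the infimum of [a w w] over [b w w = 1] in a closed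
   subspace [W] is attained, and the minimiser is an eigenvector. *)
Lemma rayleigh (W : set E) : subspace_set W -> W `<=` S ->
  (forall (u : nat -> E) v, (forall n, W (u n)) -> S v ->
     (forall e, 0 < e -> exists N, forall n, (N <= n)%N ->
       a (u n - v) (u n - v) <= e) -> W v) ->
  (exists2 w, W w & b w w != 0) ->
  exists (e : E) (la : R), [/\ W e, b e e = 1, 1 <= la,
    (forall w, W w -> a e w = la * b e w) &
    (forall w, W w -> la * b w w <= a w w)].
Proof.
move=> hW WS clW [w0 Ww0 bw0].
pose A := [set a w w | w in [set w | W w /\ b w w = 1]].
have normalize w : W w -> b w w != 0 ->
    W ((Num.sqrt (b w w))^-1 *: w) /\
    b ((Num.sqrt (b w w))^-1 *: w) ((Num.sqrt (b w w))^-1 *: w) = 1.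
  move=> Ww bw; split; first exact: (subZ hW).
  rewrite (ip_sqZ hS hb)//; last exact: WS.
  by rewrite exprVn sqr_sqrtr ?mulVf//; apply: (ip_ge0 hb); exact: WS.
have A0 : A !=set0.
  have [h1 h2] := normalize _ Ww0 bw0.
  by eexists; exists ((Num.sqrt (b w0 w0))^-1 *: w0).
have Alb : lbound A 1.
  by move=> _ [w [Ww bw] <-]; rewrite -bw; apply: ba; exact: WS.
pose la := inf A.
have iA : has_inf A by split => //; exists 1.
have la1 : 1 <= la by exact: lb_le_inf.
have lab w : W w -> la * b w w <= a w w.
  move=> Ww; have Sw := WS _ Ww.
  have [->|bw] := eqVneq (b w w) 0; first by rewrite mulr0; exact: (ip_ge0 ha).
  have bw0' : 0 < b w w by rewrite lt_neqAle eq_sym bw; exact: (ip_ge0 hb).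
  have [h1 h2] := normalize _ Ww bw.
  have : la <= a ((Num.sqrt (b w w))^-1 *: w) ((Num.sqrt (b w w))^-1 *: w).
    by apply: ge_inf; [exists 1|exists ((Num.sqrt (b w w))^-1 *: w)].
  rewrite (ip_sqZ hS ha)// exprVn sqr_sqrtr; last exact: ltW.
  by rewrite mulrC ler_pdivlMr.
have /choice[u uP] : forall n : nat, exists u, [/\ W u, b u u = 1 &
    a u u <= la + n.+1%:R^-1].
  move=> n; have n0 : (0 : R) < n.+1%:R^-1 by rewrite invr_gt0.
  have [_ [w [Ww bw] <-] aw] := inf_adherent n0 iA.
  by exists w; split => //; exact: ltW.
have uW n : W (u n) by have [] := uP n.
have uS n : S (u n) by exact/WS/uW.
have ub n : b (u n) (u n) = 1 by have [] := uP n.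
have ua n : a (u n) (u n) <= la + n.+1%:R^-1 by have [] := uP n.
have uM n : a (u n) (u n) <= la + 1.
  by apply: le_trans (ua n) _; rewrite lerD2l invf_le1// ler1n.
have [ph phj phC] := compact_extract uS uM.
pose v j := u (ph j).
have va j : a (v j) (v j) <= la + j.+1%:R^-1.
  apply: le_trans (ua _) _; rewrite lerD2l lef_pV2 ?posrE// ler_nat ltnS.
  exact: phj.
have inv_small e : 0 < e -> exists N : nat, forall n, (N <= n)%N ->
    n.+1%:R^-1 <= e :> R.
  move=> e0; exists (Num.truncn e^-1) => n Nn; rewrite invf_ple ?posrE//.
  apply: (@le_trans _ _ (Num.truncn e^-1).+1%:R); first by apply/ltW; rewrite truncnS_gt.
  by rewrite ler_nat ltnS.
(* The parallelogram argument: [a] of a sum is at least [la] times [b] of the sum, which is close to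
   4 because the extracted unit vectors are [b]-Cauchy. Hence [a] of a difference is small. *)
have vC e : 0 < e -> exists N, forall m n, (N <= m)%N -> (N <= n)%N ->
    a (v m - v n) (v m - v n) <= e.
  move=> e0; have e60 : 0 < e / 8 by rewrite divr_gt0.
  have [N1 N1P] := inv_small _ e60.
  have lap : 0 < la by exact: lt_le_trans la1.
  have e70 : 0 < e / (2 * la) by rewrite divr_gt0// mulr_gt0.
  have [N2 N2P] := phC _ e70.
  exists (maxn N1 N2) => m n; rewrite !geq_max => /andP[m1 m2] /andP[n1 n2].
  have h6 := lab _ (subD hW (uW (ph m)) (uW (ph n))).
  have h5 := N2P _ _ m2 n2; have h4 := va m; have h3 := va n.
  have h2 := N1P _ m1; have h1 := N1P _ n1.
  rewrite /v in h3 h4 *.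
  rewrite (ip_sqB hS hb (uS _) (uS _)) !ub in h5.
  rewrite (ip_sqD hS ha (uS _) (uS _)) (ip_sqD hS hb (uS _) (uS _)) !ub in h6.
  rewrite (ip_sqB hS ha (uS _) (uS _)).
  set x := a (u (ph m)) (u (ph n)) in h6 *.
  set y := b (u (ph m)) (u (ph n)) in h5 h6 *.
  have : la * (1 - 2 * y + 1) <= e / 2.
    have -> : e / 2 = la * (e / (2 * la)) by field; rewrite gt_eqF.
    by rewrite ler_pM2l.
  have -> : la * (1 - 2 * y + 1) = 2 * la - 2 * (la * y) by ring.
  have E6 : la * (1 + 2 * y + 1) = 2 * la + 2 * (la * y) by ring.
  rewrite E6 in h6; move: h1 h2 h3 h4 h6; set z := la * y.
  move=> h1 h2 h3 h4 h6 h7.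
  have aux (A' B X Z L P Q F : R) : P <= F / 8 -> Q <= F / 8 -> B <= L + P ->
    A' <= L + Q -> 2 * L + 2 * Z <= A' + 2 * X + B -> 2 * L - 2 * Z <= F / 2 ->
    A' - 2 * X + B <= F.
    by lra.
  exact: (aux _ _ _ _ _ _ _ _ h1 h2 h3 h4 h6 h7).
have [e Se ev] := complete (fun n => uS (ph n)) vC.
have We : W e by apply: clW Se ev => n; exact: uW.
have near_e d : 0 < d -> exists n, [/\ n.+1%:R^-1 <= d, a (e - v n) (e - v n) <= d &
    a (v n - e) (v n - e) <= d].
  move=> d0; have [N1 N1P] := inv_small _ d0; have [N2 N2P] := ev _ d0.
  exists (maxn N1 N2); split; first by apply: N1P; rewrite leq_maxl.
    by rewrite (ip_sqBC hS ha Se (uS _)); apply: N2P; rewrite leq_maxr.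
  by apply: N2P; rewrite leq_maxr.
(* Semicontinuity along the minimising sequence, by [le_of_young]. *)
have ae : a e e <= la.
  apply: le_of_young; first exact: le_trans la1.
  move=> d h d0 h0; have [n [n1 n2 _]] := near_e _ h0.
  have -> : a e e = a (v n + (e - v n)) (v n + (e - v n)) by rewrite addrC subrK.
  apply: le_trans (ip_young hS ha d0 (uS _) (subB hS Se (uS _))) _.
  apply: lerD; apply: ler_wpM2l => //; first by rewrite addr_ge0// ltW.
    by apply: le_trans (va n) _; rewrite lerD2l.
  by rewrite addr_ge0// invr_ge0 ltW.
have be : 1 <= b e e.
  apply: le_of_young; first exact: (ip_ge0 hb).
  move=> d h d0 h0; have [n [_ _ n2]] := near_e _ h0.
  apply: (@le_trans _ _ (b (e + (v n - e)) (e + (v n - e)))).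
    by rewrite addrC subrK ub.
  apply: le_trans (ip_young hS hb d0 Se (subB hS (uS _) Se)) _.
  apply: lerD; apply: ler_wpM2l => //; first by rewrite addr_ge0// ltW.
  - by rewrite lerDl ltW.
  - by rewrite addr_ge0// invr_ge0 ltW.
  - by apply: le_trans (ba _) n2; exact: (subB hS (uS _) Se).
have la0 : 0 < la by exact: lt_le_trans la1.
(* The chain [la * b e e <= a e e <= la] closes, so the limit is again normalised. *)
have be1 : b e e = 1.
  apply/eqP; rewrite eq_le be andbT -(ler_pM2l la0) mulr1.
  exact: le_trans (lab _ We) ae.
have ae1 : a e e = la.
  by apply/eqP; rewrite eq_le ae /=; have := lab _ We; rewrite be1 mulr1.
exists e, la; split => // w Ww; have Sw := WS _ Ww.
(* The difference [a - la * b] at [e + t *: w] is a nonnegative quadratic in [t] that vanishes at 0;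
   its linear coefficient must vanish. *)
apply/eqP; rewrite -subr_eq0 -sqrf_eq0 eq_le sqr_ge0 andbT.
have := @discr_le R 0 (a e w - la * b e w) (a w w - la * b w w).
rewrite mul0r; apply => t.
have := lab _ (subD hW We (subZ hW t Ww)).
have Stw := subZ hS t Sw.
rewrite (ip_sqD hS ha Se Stw) (ip_sqD hS hb Se Stw) (ip_sqZ hS ha _ Sw) (ip_sqZ hS hb _ Sw).
rewrite (ipZr hS ha _ Sw Se) (ipZr hS hb _ Sw Se) ae1 be1 => H.
by rewrite -subr_ge0 in H; apply: le_trans H _; rewrite le_eqVlt; apply/orP; left; apply/eqP; ring.
Qed.

Definition orth (s : seq E) : set E := [set w | S w /\ forall x, x \in s -> b x w = 0].

(** The existential precedes the hypothesis on [s], so that [choice] yields a total function on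
    lists. When [b] vanishes on the complement the pair [(0, 1)] is returned and the recursion goes
    on with zero vectors. *)
Lemma eigen_step (s : seq E) : exists el : E * R,
  (forall x, x \in s -> S x) ->
  [/\ orth s el.1, 1 <= el.2, (b el.1 el.1 = 1 \/ el.1 = 0 /\ forall w, orth s w -> b w w = 0),
     (forall w, orth s w -> a el.1 w = el.2 * b el.1 w) &
     (forall w, orth s w -> el.2 * b w w <= a w w)].
Proof.
have [sS|nsS] := pselect (forall x, x \in s -> S x); last by exists (0, 0).
have hW : subspace_set (orth s).
  split.
  - by split; [exact: (sub0 hS)|move=> x /sS Sx; exact: (ip0r hS hb)].
  - move=> x y [Sx x0] [Sy y0]; split; first exact: (subD hS).
    by move=> z zs; rewrite (ipDr hS hb)// ?x0 ?y0 ?addr0//; exact: sS.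
  - move=> r x [Sx x0]; split; first exact: (subZ hS).
    by move=> z zs; rewrite (ipZr hS hb)// ?x0 ?mulr0//; exact: sS.
have WS : orth s `<=` S by move=> x [].
have [nz|z] := pselect (exists2 w, orth s w & b w w != 0); last first.
  exists (0, 1) => _; have hz w : orth s w -> b w w = 0.
    by move=> Ww; apply/eqP/negPn/negP => bw; apply: z; exists w.
  split => //=; first exact: (sub0 hW).
  - by right.
  - by move=> w [Sw _]; rewrite (ip0l hS ha)// (ip0l hS hb)// mulr0.
  - by move=> w Ww; rewrite hz// mulr0; apply: (ip_ge0 ha); exact: WS.
have [|e [la [We be la1 ae lab]]] := rayleigh hW WS _ nz; last first.
  by exists (e, la) => _; split => //; left.
(* The complement is closed: orthogonality for [b] passes to limits for [a], because [b] is
   dominated by [a]. *)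
move=> u v uW Sv uv; split => // x xs; have Sx := sS _ xs.
apply/eqP; rewrite -sqrf_eq0 eq_le sqr_ge0 andbT.
apply/ler_addgt0Pr => d d0; rewrite add0r.
have bx : 0 <= b x x by exact: (ip_ge0 hb).
have d1 : 0 < d / (b x x + 1) by rewrite divr_gt0// ltr_wpDl.
have [N /(_ N (leqnn N)) h] := uv _ d1.
have [SuN /(_ _ xs) xu] := uW N.
have -> : b x v = - b x (u N - v) by rewrite (ipBr hS hb)// xu sub0r opprK.
rewrite sqrrN; apply: le_trans (ip_cauchy_schwarz hS hb Sx (subB hS SuN Sv)) _.
apply: (@le_trans _ _ ((b x x + 1) * (d / (b x x + 1)))).
  apply: ler_pM => //; first by apply: (ip_ge0 hb); exact: (subB hS).
    by rewrite lerDl.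
  by apply: le_trans (ba _) h; exact: (subB hS).
by rewrite mulrC divfK// gt_eqF// ltr_wpDl.
Qed.

Theorem spectral_basis : exists (e : nat -> E) (la : nat -> R),
  [/\ forall n, S (e n), forall n, 1 <= la n,
      forall i j, i != j -> b (e i) (e j) = 0,
      forall n, b (e n) (e n) = 1 \/ e n = 0 &
      (forall n w, S w -> a (e n) w = la n * b (e n) w) /\
      forall w, S w -> forall d, 0 < d -> exists N, forall n, (N <= n)%N ->
        a (w - \sum_(i < n) b (e i) w *: e i) (w - \sum_(i < n) b (e i) w *: e i) <= d].
Proof.
have [g gP] := choice eigen_step.
pose sq n := iter n (fun s => rcons s (g s).1) [::].
pose e n := (g (sq n)).1; pose la n := (g (sq n)).2.
have sqE n : sq n = mkseq e n.
  elim: n => // n IH; rewrite /sq iterS -/(sq n) {1}IH.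
  by rewrite /mkseq -addn1 iotaD map_cat /= cats1.
have sqS n : forall x, x \in sq n -> S x.
  elim: n => // n IH x; rewrite /sq iterS -/(sq n) mem_rcons inE => /predU1P[->|/IH//].
  by have [[]] := gP (sq n) IH.
have H n := gP (sq n) (@sqS n).
have eS n : S (e n) by have [[]] := H n.
have orthP n w : S w -> (forall i, (i < n)%N -> b (e i) w = 0) -> orth (sq n) w.
  move=> Sw h; split => // x; rewrite sqE => /mapP[i].
  by rewrite mem_iota add0n => /andP[_ ?] ->; exact: h.
have lt0 i j : (i < j)%N -> b (e i) (e j) = 0.
  move=> ij; have [[_ h] _ _ _ _] := H j; apply: h.
  by rewrite sqE; apply/mapP; exists i => //; rewrite mem_iota.
have b0 i j : i != j -> b (e i) (e j) = 0.
  by case: ltngtP => // ij _; [exact: lt0|rewrite (ipC hb)// lt0].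
have be n : b (e n) (e n) = 1 \/ e n = 0 /\ forall w, orth (sq n) w -> b w w = 0.
  by have [_ _ h _ _] := H n.
have la1 n : 1 <= la n by have [_ h _ _ _] := H n.
pose P n w := \sum_(i < n) b (e i) w *: e i.
have PS n w : S w -> S (P n w).
  by move=> Sw; apply: (sub_sum hS) => i _; apply: (subZ hS).
have bP n w j : S w -> b (e j) (P n w) = if (j < n)%N then b (e j) w else 0.
  move=> Sw; rewrite /P (ip_sumr hS hb)//; last by move=> i _; apply: (subZ hS).
  have E0 (i : 'I_n) : (i : nat) != j -> b (e j) (b (e i) w *: e i) = 0.
    by move=> ij; rewrite (ipZr hS hb)// b0 ?mulr0// eq_sym.
  case: ltnP => jn; last first.
    by apply: big1 => i _; apply: E0; rewrite neq_ltn (leq_trans (ltn_ord i) jn).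
  rewrite (bigD1 (Ordinal jn))//= big1 ?addr0.
    rewrite (ipZr hS hb)//; have [->|[-> _]] := be j; first by rewrite mulr1.
    by rewrite !(ip0l hS hb) ?mulr0//; exact: (sub0 hS).
  by move=> i ij; apply: E0; apply: contra ij => /eqP ij; apply/eqP/val_inj.
(* [eigen_step] gives the eigen equation on the orthogonal complement only. Strong induction extends
   it to [S]: [e n] is [a]-orthogonal to its predecessors, so the projection of [w] on them
   contributes nothing. *)
have eig n w : S w -> a (e n) w = la n * b (e n) w.
  elim/ltn_ind: n w => n IH w Sw.
  have SPw := PS n w Sw.
  have aP : a (e n) (P n w) = 0.
    rewrite (ip_sumr hS ha)//; last by move=> i _; apply: (subZ hS).
    apply: big1 => i _; rewrite (ipZr hS ha)// (ipC ha)// IH// ?ltn_ord//.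
    by rewrite lt0 ?mulr0.
  have ow : orth (sq n) (w - P n w).
    apply: orthP; first exact: (subB hS).
    by move=> i ni; rewrite (ipBr hS hb)// bP// ni subrr.
  have [_ _ _ h _] := H n.
  have h1 : a (e n) (w - P n w) = la n * b (e n) (w - P n w) by exact: h.
  rewrite (ipBr hS ha Sw SPw (eS n)) (ipBr hS hb Sw SPw (eS n)) in h1.
  by move: h1; rewrite aP bP// ltnn !subr0.
(* A nontrivial vector orthogonal to the whole system would bound every [la n] by its Rayleigh
   quotient. Compactness would then bring two of the [e n] close together, whereas distinct
   orthonormal vectors are at squared distance 2. *)
have total w : S w -> (forall n, b (e n) w = 0) -> b w w = 0.
  move=> Sw w0; have [[n [_ z]]|nz] := pselect (exists n, e n = 0 /\ forall w, orth (sq n) w -> b w w = 0).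
    by apply: z; apply: orthP.
  have be1 n : b (e n) (e n) = 1 by have [//|h] := be n; exfalso; apply: nz; exists n.
  have law n : la n * b w w <= a w w.
    by have [_ _ _ _ h] := H n; apply: h; exact: orthP.
  apply/eqP; rewrite eq_le (ip_ge0 hb)// andbT leNgt; apply/negP => bw.
  have aM n : a (e n) (e n) <= a w w / b w w.
    by rewrite eig// be1 mulr1 ler_pdivlMr.
  have [ph phj phC] := compact_extract eS aM.
  have [N NP] := phC 1 ltr01.
  (* Large enough for [ph j], which is at least [j], to differ from [ph N]. *)
  pose j := ((ph N).+1 + N)%N.
  have jN : (N <= j)%N by rewrite leq_addl.
  have := NP N j (leqnn N) jN.
  rewrite (ip_sqB hS hb)// !be1 b0 ?mulr0; first by lra.
  by rewrite neq_ltn (leq_trans _ (phj j))// leq_addr.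
exists e, la; split => //.
  by move=> n; have [->|[-> _]] := be n; [left|right].
split=> // w Sw.
pose c i := la i * b (e i) w ^+ 2.
have c0 i : 0 <= c i by rewrite mulr_ge0 ?sqr_ge0//; exact: le_trans (la1 i).
have PE m n : (m <= n)%N ->
    \sum_(m <= i < n) b (e i) w *: e i = P n w - P m w.
  move=> mn; rewrite /P -!(big_mkord xpredT (fun i => b (e i) w *: e i)).
  by rewrite (big_cat_nat (leq0n m) mn) /= addrAC subrr add0r.
have aPP m n : (m <= n)%N ->
    a (P n w - P m w) (P n w - P m w) = \sum_(m <= i < n) c i.
  move=> mn; rewrite -PE//.
  rewrite (ip_suml hS ha); last 2 first.
  - by move=> i _; apply: (subZ hS).
  - by apply: (sub_sum hS) => i _; apply: (subZ hS).
  rewrite big_nat [RHS]big_nat; apply: eq_bigr => i /andP[mi ni].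
  rewrite (ipZl ha)//; last by apply: (sub_sum hS) => k _; apply: (subZ hS).
  rewrite eig//; last by apply: (sub_sum hS) => k _; apply: (subZ hS).
  have -> : b (e i) (\sum_(m <= k < n) b (e k) w *: e k) = b (e i) w.
    rewrite PE//.
    rewrite (ipBr hS hb) ?bP//; [|exact: PS|exact: PS].
    by rewrite ni ltnNge mi /= subr0.
  by rewrite /c; ring.
have cle n : \sum_(0 <= i < n) c i <= a w w.
  have := ip_ge0 ha (subB hS Sw (PS n w Sw)).
  rewrite (ip_sqB hS ha)//; last exact: PS.
  have -> : a w (P n w) = \sum_(0 <= i < n) c i.
    rewrite (ip_sumr hS ha)//; last by move=> i _; apply: (subZ hS).
    rewrite big_mkord; apply: eq_bigr => i _.
    by rewrite (ipZr hS ha)// (ipC ha)// eig// /c; ring.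
  have := aPP 0%N n (leq0n n).
  have -> : P 0%N w = 0 by rewrite /P big_ord0.
  by rewrite subr0 => ->; lra.
have cC d : 0 < d -> exists N, forall m n, (N <= m)%N -> (m <= n)%N ->
    \sum_(m <= i < n) c i <= d.
  move=> d0.
  have cv : cvgn (series c).
    apply: nondecreasing_is_cvgn; first by apply: nondecreasing_series.
    by exists (a w w) => _ [n _ <-]; exact: cle.
  move/cauchy_cvgP: cv => /cauchy_seriesP /(_ d d0).
  move=> [[A B] /= [[N1 _ h1] [N2 _ h2]] AB].
  exists (maxn N1 N2) => m n; rewrite geq_max => /andP[m1 m2] mn.
  have : A m /\ B n by split; [exact: h1|apply: h2; exact: leq_trans mn].
  by move=> /(AB (m, n)) /=; rewrite ger0_norm ?sumr_ge0// => /ltW.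
have [|v Sv Pv] := complete (fun n => PS n w Sw).
  move=> d d0; have [N NP] := cC _ d0; exists N => m n Nm Nn.
  have [mn|/ltnW nm] := leqP m n.
    by rewrite (ip_sqBC hS ha) ?aPP//; [exact: NP|exact: PS..].
  by rewrite aPP//; exact: NP.
(* The limit [v] of the partial sums has the same coefficients as [w], so [total] and [definite]
   make the difference a null vector of both forms. *)
have vw : a (w - v) (w - v) = 0.
  apply: definite; first exact: (subB hS).
  apply: total; first exact: (subB hS).
  move=> j; apply/eqP; rewrite -sqrf_eq0 eq_le sqr_ge0 andbT.
  apply/ler_addgt0Pr => d d0; rewrite add0r; have [N NP] := Pv _ d0.
  pose n := (j.+1 + N)%N.
  have Nn : (N <= n)%N by rewrite leq_addl.
  have -> : b (e j) (w - v) = b (e j) (P n w - v).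
    rewrite !(ipBr hS hb)//; last exact: PS.
    by rewrite bP// ifT// leq_addr.
  apply: le_trans (ip_cauchy_schwarz hS hb (eS j) (subB hS (PS n w Sw) Sv)) _.
  apply: (@le_trans _ _ (1 * d)); last by rewrite mul1r.
  apply: ler_pM; [exact: (ip_ge0 hb)|apply: (ip_ge0 hb); exact: (subB hS (PS n w Sw) Sv)| |].
    by have [->|[-> _]] := be j => //; rewrite (ip0l hS hb)//; exact: (sub0 hS).
  by apply: le_trans (ba _) (NP _ Nn); exact: (subB hS (PS n w Sw) Sv).
move=> d d0; have d20 : 0 < d / 2 by rewrite divr_gt0.
have [N NP] := Pv _ d20; exists N => n Nn; rewrite -/(P n w).
have -> : w - P n w = (w - v) - (P n w - v) by rewrite opprB addrA subrK.
apply: le_trans (ip_sqB_le hS ha (subB hS Sw Sv) (subB hS (PS n w Sw) Sv)) _.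
by rewrite vw mulr0 add0r; have := NP _ Nn; lra.
Qed.

End spectral.

(** * Absolutely continuous coefficients *)

Section absolutely_continuous.
Context (R : realType).
Notation mu := (@lebesgue_measure R).
Implicit Types (f g h c p q w z : R -> R) (T k t s : R).
Local Notation L1 T f := (mu.-integrable `]0, T[ (EFin \o f)).

(** Absolute continuity on [[0, T]] with the initial value and the derivative carried as data,
    instead of recovered almost everywhere. *)
Definition AC T k g c : Prop :=
  L1 T g /\ forall t, 0 <= t -> t <= T -> c t = k + prim g t.

Lemma eq_prim f g t : {in `]0, t[, f =1 g} -> prim f t = prim g t.
Proof. by move=> fg; apply: eq_Rintegral => x; rewrite inE => /fg. Qed.

Lemma primD T f g t : L1 T f -> L1 T g -> t <= T ->
  prim (fun x => f x + g x) t = prim f t + prim g t.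
Proof. by move=> hf hg tT; apply: (IntD (measurable_oo 0 t) (L1S hf tT) (L1S hg tT)). Qed.

Lemma primZ T (r : R) f t : L1 T f -> t <= T ->
  prim (fun x => r * f x) t = r * prim f t.
Proof. by move=> hf tT; apply: (IntZ (measurable_oo 0 t) _ (L1S hf tT)). Qed.

Lemma prim_cst k t : 0 <= t -> prim (fun=> k) t = k * t.
Proof. by move=> t0; rewrite /prim Int_cst_oo// subr0. Qed.

Lemma L1_cst T k : L1 T (fun=> k).
Proof. exact: (itg_cst (measurable_oo 0 T) k (mu_oo_fin 0 T)). Qed.

Lemma L1D T f g : L1 T f -> L1 T g -> L1 T (fun x => f x + g x).
Proof. exact: (itgD (measurable_oo 0 T)). Qed.

Lemma L1B T f g : L1 T f -> L1 T g -> L1 T (fun x => f x - g x).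
Proof. exact: (itgB (measurable_oo 0 T)). Qed.

Lemma L1Z T (r : R) f : L1 T f -> L1 T (fun x => r * f x).
Proof. exact: (itgZ (measurable_oo 0 T)). Qed.

Lemma L1_sum T (I : Type) (s : seq I) (P : pred I) (F : I -> R -> R) :
  (forall i, P i -> L1 T (F i)) -> L1 T (fun x => \sum_(i <- s | P i) F i x).
Proof. exact: (itg_sum (measurable_oo 0 T)). Qed.

Lemma L1_eq T f g : L1 T f -> {in `]0, T[, f =1 g} -> L1 T g.
Proof.
move=> hf fg; apply: eq_integrable hf => //.
by move=> x; rewrite inE => /fg /= ->.
Qed.

Lemma L1_ae_le T f g : measurable_fun `]0, T[ f -> L1 T g ->
  {ae mu, forall x, x \in `]0, T[ -> `|f x| <= g x} -> L1 T f.
Proof. by move=> mf hg fg; apply: (itg_ae_le _ hg). Qed.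

Lemma L1_bounded T f k : measurable_fun `]0, T[ f ->
  (forall x, x \in `]0, T[ -> `|f x| <= k) -> L1 T f.
Proof. by move=> mf fk; apply: (L1_ae_le mf (L1_cst T k)); apply: ae_everywhere. Qed.

Lemma prim_ae_le T f g t : L1 T f -> L1 T g -> t <= T ->
  {ae mu, forall x, x \in `]0, T[ -> f x <= g x} -> prim f t <= prim g t.
Proof.
move=> hf hg tT fg; apply: (Int_ae_le (measurable_oo 0 t) (L1S hf tT) (L1S hg tT)).
apply: ae_mono fg => x H /= xt; apply: H.
by move: xt; rewrite !in_itv/= => /andP[-> xt]; rewrite (lt_le_trans xt).
Qed.

Lemma prim_ae_ge0 T f t : t <= T ->
  {ae mu, forall x, x \in `]0, T[ -> 0 <= f x} -> 0 <= prim f t.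
Proof.
move=> tT fg; apply: Int_ae_ge0.
apply: ae_mono fg => x H /= xt; apply: H.
by move: xt; rewrite !in_itv/= => /andP[-> xt]; rewrite (lt_le_trans xt).
Qed.

Lemma prim_mono T f s t : L1 T f ->
  {ae mu, forall x, x \in `]0, T[ -> 0 <= f x} -> 0 <= s -> s <= t -> t <= T ->
  prim f s <= prim f t.
Proof.
move=> hf f0 s0 st tT; rewrite -subr_ge0 (primB hf s0 st tT); apply: Int_ae_ge0.
apply: ae_mono f0 => x H /= xt; apply: H.
move: xt; rewrite !in_itv/= => /andP[sx xt].
by rewrite (le_lt_trans s0 sx) (lt_le_trans xt).
Qed.

Lemma AC0 T k g c : 0 <= T -> AC T k g c -> c 0 = k.
Proof. by move=> T0 [_ /(_ 0 (lexx _) T0) ->]; rewrite prim_le0 ?addr0. Qed.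

Lemma AC_continuous T k g c : 0 <= T -> AC T k g c -> {within `[0, T], continuous c}.
Proof.
move=> T0 [hg E].
have : {within `[0, T], continuous (fun t => k + prim g t)}.
  move=> x; apply: continuousD; first exact: cvg_cst.
  exact: prim_cont.
apply: subspace_eq_continuous => x; rewrite inE/= in_itv/= => /andP[x0 xT].
by rewrite /from_subspace E.
Qed.

Lemma AC_bounded T k g c : 0 <= T -> AC T k g c ->
  exists M, forall t, 0 <= t -> t <= T -> `|c t| <= M.
Proof.
move=> T0 [hg E]; eexists => t t0 tT; rewrite E//.
apply: (@le_trans _ _ (`|k| + `|prim g t|)); first exact: ler_normD.
by apply: lerD => //; exact: prim_le hg tT.
Qed.

Lemma within_continuous_measurable T (c : R -> R) : {within `[0, T], continuous c} ->
  measurable_fun `]0, T[ c.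
Proof.
move=> cc; apply: (@measurable_funS _ _ _ _ `[0, T]) => //.
  exact: subset_itv_oo_cc.
exact: subspace_continuous_measurable_fun.
Qed.

Lemma AC_measurable T k g c : 0 <= T -> AC T k g c -> measurable_fun `]0, T[ c.
Proof. by move=> T0 /(AC_continuous T0) /within_continuous_measurable. Qed.

Lemma AC_mulL1 T k g c h : 0 <= T -> AC T k g c -> L1 T h ->
  L1 T (fun x => h x * c x).
Proof.
move=> T0 hc hh; have [M cM] := AC_bounded T0 hc.
apply: (L1_ae_le _ (L1Z M (itg_norm hh))).
  by apply: measurable_funM; [exact: itg_measurable hh|exact: AC_measurable hc].
apply: ae_everywhere => x; rewrite in_itv/= => /andP[/ltW x0 /ltW xT].
by rewrite normrM mulrC ler_wpM2r// cM.
Qed.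

Lemma AC_L1 T k g c : 0 <= T -> AC T k g c -> L1 T c.
Proof.
move=> T0 hc; apply: (L1_eq (AC_mulL1 T0 hc (L1_cst T 1))).
by move=> x _; rewrite mul1r.
Qed.

Lemma AC_mul T (k1 k2 : R) (g1 g2 c1 c2 : R -> R) : 0 <= T ->
  AC T k1 g1 c1 -> AC T k2 g2 c2 ->
  AC T (k1 * k2) (fun t => g1 t * c2 t + g2 t * c1 t) (fun t => c1 t * c2 t).
Proof.
move=> T0 h1 h2; have [hg1 E1] := h1; have [hg2 E2] := h2.
have i1 := AC_mulL1 T0 h2 hg1; have i2 := AC_mulL1 T0 h1 hg2.
split; first exact: L1D.
move=> t t0 tT; rewrite E1// E2//.
have e1 := itg_mul_prim (L1S hg1 tT) (L1S hg2 tT).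
have e2 := itg_mul_prim (L1S hg2 tT) (L1S hg1 tT).
have j1 := L1S hg1 tT; have j2 := L1S hg2 tT.
have -> : prim (fun t => g1 t * c2 t + g2 t * c1 t) t =
  prim (fun t => (k2 * g1 t + k1 * g2 t) + (g1 t * prim g2 t + g2 t * prim g1 t)) t.
  apply: eq_prim => s; rewrite in_itv/= => /andP[/ltW s0 /ltW st].
  by rewrite E1 ?E2 ?(le_trans st)//; ring.
rewrite (@primD t)//; [|by apply: L1D; exact: L1Z|exact: L1D].
rewrite (@primD t)//; [|exact: L1Z..].
rewrite !(@primZ t)//.
have -> : prim (fun t => g1 t * prim g2 t + g2 t * prim g1 t) t = prim g1 t * prim g2 t.
  by rewrite prim_mul.
by ring.
Qed.

Lemma AC_expR T k : AC T 1 (fun t => k * expR (k * t)) (fun t => expR (k * t)).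
Proof.
have d x : is_derive x (1 : R) (fun t => expR (k * t)) (k * expR (k * x)).
  have dk : is_derive x (1 : R) (fun t => k * t) (k *: 1).
    exact: (@is_deriveZ _ _ _ id k x 1 1).
  apply: (is_derive_eq (is_derive1_comp (is_derive_expR (k * x)) dk)).
  by rewrite /GRing.scale /= mulr1 mulrC.
have ce : continuous (fun t => expR (k * t)).
  by move=> x; apply/differentiable_continuous/derivable1_diffP; apply: ex_derive.
have cke : continuous (fun t => k * expR (k * t)).
  by move=> x; apply: cvgM; [exact: cvg_cst|exact: ce].
split; first exact: continuous_L1.
move=> t; rewrite le_eqVlt => /predU1P[<- _|t0 _].
  by rewrite prim_le0// mulr0 expR0 addr0.
rewrite prim_closed; last exact: continuous_L1.
have := @continuous_FTC2 R (fun t => k * expR (k * t)) (fun t => expR (k * t)) 0 t t0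
  (continuous_subspaceT cke).
rewrite /Rintegral => -> //=; first by rewrite mulr0 expR0; ring.
- split.
  + by move=> x _; apply: ex_derive.
  + by apply: cvg_at_right_filter; exact: ce.
  + by apply: cvg_at_left_filter; exact: ce.
- by move=> x _; rewrite derive1E; exact: derive_val.
Qed.

Lemma AC_sqr T k g c : 0 <= T -> AC T k g c ->
  AC T (k ^+ 2) (fun t => 2 * (g t * c t)) (fun t => c t ^+ 2).
Proof.
move=> T0 h; have [hg E] := AC_mul T0 h h; split.
  by apply: (L1_eq hg) => t _; ring.
move=> t t0 tT; rewrite expr2 E// -expr2; congr (_ + _).
by apply: eq_prim => s _; ring.
Qed.

(** Variation of constants: integrate [h] against [expR (la * s)], starting from [y0], then damp by
    [expR (- la * t)]. *)
Lemma duhamel T (la y0 : R) h : 0 <= T -> L1 T h ->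
  exists z, AC T y0 (fun t => h t - la * z t) z.
Proof.
move=> T0 hh.
pose w t := y0 + prim (fun s => h s * expR (la * s)) t.
have hw : AC T y0 (fun s => h s * expR (la * s)) w.
  by split => //; exact: AC_mulL1 T0 (AC_expR T la) hh.
exists (fun t => w t * expR (- la * t)).
have [h1 h2] := AC_mul T0 hw (AC_expR T (- la)).
have eq1 : {in `]0, T[, (fun t => h t * expR (la * t) * expR (- la * t) +
    - la * expR (- la * t) * w t) =1 (fun t => h t - la * (w t * expR (- la * t)))}.
  by move=> t _; rewrite -mulrA -expRD mulNr subrr expR0; ring.
split; first exact: L1_eq h1 eq1.
move=> t t0 tT; rewrite h2// mulr1; congr (_ + _); apply: eq_prim => s.
rewrite in_itv/= => /andP[s0 st]; apply: eq1.
by rewrite in_itv/= s0 (lt_le_trans st).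
Qed.

(** The integrating factor is [expR (- ka * t)]. The dissipation [q] is carried along, so that one
    inequality bounds the energy at time [t] and the time integral of [q] up to [t]. *)
Lemma gronwall T (E0 ka : R) p (E : R -> R) q (be : R -> R) : 0 <= T -> 0 <= ka -> AC T E0 p E ->
  L1 T q -> L1 T be -> (forall t, 0 <= t -> t <= T -> 0 <= E t) ->
  {ae mu, forall t, t \in `]0, T[ -> 0 <= q t} ->
  {ae mu, forall t, t \in `]0, T[ -> 0 <= be t} ->
  {ae mu, forall t, t \in `]0, T[ -> p t + q t <= ka * E t + be t} ->
  forall t, 0 <= t -> t <= T ->
    E t + prim q t <= expR (ka * T) * (E0 + prim be T).
Proof.
move=> T0 ka0 hE hq hbe E00 q0 be0 H t t0 tT.
have [i1 h1] := AC_mul T0 hE (AC_expR T (- ka)).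
have eT : 0 < expR (- ka * T) by exact: expR_gt0.
have e_le s : s \in `]0, T[ -> expR (- ka * T) <= expR (- ka * s) /\ expR (- ka * s) <= 1.
  rewrite in_itv/= => /andP[s0 sT]; rewrite -[X in _ /\ _ <= X]expR0 !ler_expR.
  by rewrite !mulNr lerN2 ler_wpM2l ?(ltW sT)// oppr_le0 mulr_ge0// ltW.
(* On the left the integrating factor is replaced by its minimum over [[0, T]]; on the right it is
   at most 1. *)
have step : expR (- ka * T) * (E t + prim q t) <= E0 + prim be t.
  have nt : expR (- ka * T) * E t <= E t * expR (- ka * t).
    rewrite mulrC ler_wpM2l ?E00// ler_expR !mulNr lerN2; exact: ler_wpM2l.
  have main : E t * expR (- ka * t) + expR (- ka * T) * prim q t <= E0 + prim be t.
    rewrite h1// mulr1 -addrA lerD2l -(@primZ T)//.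
    rewrite -(@primD T)//; last exact: L1Z.
    apply: prim_ae_le hbe tT _; first by apply: L1D => //; exact: L1Z.
    have aq := ae_and q0 (ae_and be0 H).
    apply: ae_mono aq => s [qs [bs Hs]] sT; have {}qs := qs sT; have {}bs := bs sT.
    have {}Hs := Hs sT; have [e1 e2] := e_le s sT.
    have e0 : 0 < expR (- ka * s) by exact: expR_gt0.
    have : expR (- ka * T) * q s <= expR (- ka * s) * q s by rewrite ler_wpM2r.
    have : expR (- ka * s) * (p s + q s) <= expR (- ka * s) * (ka * E s + be s).
      by rewrite ler_pM2l.
    have : expR (- ka * s) * be s <= be s by rewrite ler_piMl.
    move: (expR _) => A; move: (expR _) => B.
    by rewrite !mulrDr; lra.
  by rewrite mulrDr; apply: le_trans main; rewrite lerD2r.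
have eE : expR (- ka * T) * expR (ka * T) = 1 by rewrite -expRD mulNr addNr expR0.
rewrite -(ler_pM2l eT) [X in _ <= X]mulrA eE mul1r.
apply: le_trans step _; rewrite lerD2l.
exact: prim_mono hbe be0 t0 tT (lexx _).
Qed.

End absolutely_continuous.

(** * Sequences of scalar functions: uniform tails in time and the energy identity *)

Section sequences_of_coefficients.
Context (R : realType).
Notation mu := (@lebesgue_measure R).
Implicit Types (T t : R) (la k : nat -> R) (g c h : nat -> R -> R).
Local Notation L1 T f := (mu.-integrable `]0, T[ (EFin \o f)).

Lemma series_cauchy (a : nat -> R) (B : R) : (forall j, 0 <= a j) ->
  (forall J, \sum_(0 <= j < J) a j <= B) ->
  forall e : R, 0 < e -> exists N, forall m n, (N <= m)%N ->
    \sum_(m <= j < n) a j <= e.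
Proof.
move=> a0 aB e e0.
have cv : cvgn (series a).
  apply: nondecreasing_is_cvgn; first by apply: nondecreasing_series.
  by exists B => _ [n _ <-]; exact: aB.
move/cauchy_cvgP: cv => /cauchy_seriesP /(_ e e0).
move=> [[P Q] /= [[N1 _ h1] [N2 _ h2]] PQ].
exists (maxn N1 N2) => m n; rewrite geq_max => /andP[m1 m2].
have [mn|nm] := leqP m n; last by rewrite big_geq ?(ltnW nm)// ltW.
have : P m /\ Q n by split; [exact: h1|apply: h2; exact: leq_trans mn].
by move=> /(PQ (m, n)) /=; rewrite ger0_norm ?sumr_ge0// => /ltW.
Qed.

Lemma sum_le_mono (a : nat -> R) m n p : (forall j, 0 <= a j) -> (n <= p)%N ->
  \sum_(m <= j < n) a j <= \sum_(m <= j < p) a j.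
Proof.
move=> a0 np; have [mn|nm] := leqP m n.
  by rewrite (big_cat_nat mn np) /= lerDl sumr_ge0.
by rewrite [X in X <= _]big_geq ?(ltnW nm)// sumr_ge0.
Qed.

Lemma sum_tail_le (a : nat -> R) m n : (forall j, 0 <= a j) ->
  \sum_(m <= j < n) a j <= \sum_(0 <= j < n) a j.
Proof.
move=> a0; have [mn|nm] := leqP m n.
  by rewrite (big_cat_nat (leq0n m) mn) /= lerDr sumr_ge0.
by rewrite [X in X <= _]big_geq ?(ltnW nm)// sumr_ge0.
Qed.

(** The share of mode [j] in the squared [a]-norm of a vector with coefficients [c], plus its share
    in the squared dual norm of a functional with coefficients [g]. *)
Definition energy la g c j t : R := la j * c j t ^+ 2 + g j t ^+ 2 / la j.

Lemma energy_ge la g c j t : 0 < la j ->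
  `|2 * (g j t * c j t)| <= energy la g c j t.
Proof.
move=> la0; rewrite /energy.
have E (s : R) : s ^+ 2 = 1 -> 0 <= la j * c j t ^+ 2 + g j t ^+ 2 / la j + s * (2 * (g j t * c j t)).
  move=> s1; have -> : la j * c j t ^+ 2 + g j t ^+ 2 / la j + s * (2 * (g j t * c j t))
     = (la j * c j t + s * g j t) ^+ 2 / la j + (1 - s ^+ 2) * (g j t ^+ 2 / la j).
    by field; rewrite gt_eqF.
  by rewrite s1 subrr mul0r addr0 divr_ge0 ?sqr_ge0// ltW.
have s1 : (-1 : R) ^+ 2 = 1 by rewrite sqrrN expr1n.
have h1 := E 1 (expr1n _ _); have h2 := E (-1) s1.
by rewrite ler_norml; apply/andP; split; move: h1 h2; lra.
Qed.

Section embedding.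
Variables (T : R) (la k : nat -> R) (g c : nat -> R -> R).
Hypotheses (T0 : 0 < T) (la1 : forall j, 1 <= la j).
Hypothesis hc : forall j, AC T (k j) (g j) (c j).
Hypothesis hL1 : forall j, L1 T (energy la g c j).

Let la0 j : 0 < la j. Proof. exact: lt_le_trans (la1 j). Qed.

Let energy_ge0 j t : 0 <= energy la g c j t.
Proof.
by apply: addr_ge0; [apply: mulr_ge0|apply: divr_ge0]; rewrite ?sqr_ge0//; exact: ltW.
Qed.

(** The embedding of W(0, T) into continuous functions, one mode at a time: [c j t ^+ 2] differs
    from [c j s ^+ 2] by at most the integrated energy, and averaging over [s] produces the factor
    [T^-1]. *)
Lemma coef_sq_le j t : 0 <= t -> t <= T ->
  c j t ^+ 2 <= (T^-1 + 1) * prim (energy la g c j) T.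
Proof.
move=> t0 tT; have sT s : s \in `]0, T[ -> 0 <= s /\ s <= T.
  by rewrite in_itv/= => /andP[/ltW ? /ltW ?].
have [hd Ed] := AC_sqr (ltW T0) (hc j).
set d := fun t => 2 * (g j t * c j t) in hd Ed.
have dle s u : 0 <= s -> s <= u -> u <= T ->
    `|prim d u - prim d s| <= prim (energy la g c j) T.
  move=> s0 su uT; rewrite (primB hd s0 su uT).
  have sub : `]s, u[ `<=` `]0, T[ by apply: subset_itv; rewrite bnd_simp.
  have iS f : L1 T f -> mu.-integrable `]s, u[ (EFin \o f).
    by move=> hf; apply: integrableS hf.
  apply: le_trans (le_norm_Int (measurable_oo s u) (iS _ hd)) _.
  apply: (@le_trans _ _ (\int[mu]_(r in `]s, u[) energy la g c j r)).
    apply: (Int_ae_le (measurable_oo s u) (itg_norm (iS _ hd)) (iS _ (hL1 j))).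
    by apply: ae_everywhere => x _; exact: energy_ge.
  rewrite -(primB (hL1 j) s0 su uT).
  apply: (@le_trans _ _ (prim (energy la g c j) u)).
    by rewrite gerBl; apply: (@prim_ae_ge0 _ T); [exact: le_trans uT|exact: ae_everywhere].
  by apply: (prim_mono (hL1 j)) => //; [exact: ae_everywhere|exact: le_trans su].
have key s : s \in `]0, T[ -> c j t ^+ 2 <= c j s ^+ 2 + prim (energy la g c j) T.
  move=> /sT[s0 s1]; rewrite (Ed _ t0 tT) (Ed _ s0 s1) -addrA lerD2l.
  have [st|/ltW ts] := leP s t.
    by have := dle _ _ s0 st tT; move=> /ler_normlP[_]; lra.
  by have := dle _ _ t0 ts s1; move=> /ler_normlP[]; lra.
have ic2 : L1 T (fun s => c j s ^+ 2).
  apply: (L1_ae_le _ (hL1 j)); first by apply: measurable_funX; exact: AC_measurable (ltW T0) (hc j).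
  apply: ae_everywhere => s _; rewrite ger0_norm ?sqr_ge0// /energy.
  by apply: ler_wpDr; [rewrite divr_ge0 ?sqr_ge0// ltW|rewrite ler_peMl ?sqr_ge0].
set e := prim (energy la g c j) T in key *.
have : prim (fun=> c j t ^+ 2) T <= prim (fun s => c j s ^+ 2 + e) T.
  apply: (@prim_ae_le _ T) => //; [exact: L1_cst|by apply: L1D => //; exact: L1_cst|exact: ae_everywhere].
rewrite (@primD _ T)//; last exact: L1_cst.
rewrite !(prim_cst _ (ltW T0)).
have : prim (fun s => c j s ^+ 2) T <= e.
  apply: (@prim_ae_le _ T) => //; apply: ae_everywhere => s _; rewrite /energy.
  by apply: ler_wpDr; [rewrite divr_ge0 ?sqr_ge0// ltW|rewrite ler_peMl ?sqr_ge0].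
move=> h1 h2; have {h1 h2} h : c j t ^+ 2 * T <= e + e * T.
  by apply: le_trans h2 _; rewrite lerD2r.
have -> : (T^-1 + 1) * e = (e + e * T) / T by field; rewrite gt_eqF.
by rewrite ler_pdivlMr.
Qed.

Variable B : R.
Hypothesis hB : forall J, \sum_(0 <= j < J) prim (energy la g c j) T <= B.

(** The majorants given by [coef_sq_le] are summable and independent of [t]. *)
Lemma uniform_tails (e : R) : 0 < e -> exists N, forall m n t, (N <= m)%N ->
  0 <= t -> t <= T -> \sum_(m <= j < n) c j t ^+ 2 <= e.
Proof.
move=> e0.
have C0 : 0 < T^-1 + 1 by rewrite addr_gt0 ?invr_gt0.
have p0 j : 0 <= prim (energy la g c j) T by apply: (@prim_ae_ge0 _ T) => //; exact: ae_everywhere.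
have [N NP] := series_cauchy p0 hB (divr_gt0 e0 C0).
exists N => m n t Nm t0 tT.
apply: (@le_trans _ _ (\sum_(m <= j < n) (T^-1 + 1) * prim (energy la g c j) T)).
  by apply: ler_sum => j _; exact: coef_sq_le.
by rewrite -mulr_sumr mulrC -ler_pdivlMr//; exact: NP.
Qed.

Lemma coef_sum_le J t : 0 <= t -> t <= T ->
  \sum_(0 <= j < J) c j t ^+ 2 <= (T^-1 + 1) * B.
Proof.
move=> t0 tT.
apply: (@le_trans _ _ (\sum_(0 <= j < J) (T^-1 + 1) * prim (energy la g c j) T)).
  by apply: ler_sum => j _; exact: coef_sq_le.
rewrite -mulr_sumr ler_wpM2l//; first by rewrite addr_ge0// invr_ge0 ltW.
Qed.

(** Finite sums satisfy the identity by the product rule; [G] dominates them, so it passes to the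
    limit under the time integral. This is the chain rule for the squared L2 norm of an element of
    W(0, T). *)
Lemma energy_identity (G p : R -> R) : L1 T G -> measurable_fun `]0, T[ p ->
  {ae mu, forall t, t \in `]0, T[ -> forall J,
     \sum_(0 <= j < J) energy la g c j t <= G t} ->
  {ae mu, forall t, t \in `]0, T[ ->
     \sum_(0 <= j < J) (2 * (g j t * c j t)) @[J --> \oo] --> p t} ->
  exists E : R -> R, [/\ AC T (E 0) p E &
    forall t, 0 <= t -> t <= T ->
      \sum_(0 <= j < J) c j t ^+ 2 @[J --> \oo] --> E t].
Proof.
move=> hG mp GP pP.
have hd j : L1 T (fun t => 2 * (g j t * c j t)) by have [] := AC_sqr (ltW T0) (hc j).
have Ed j t : 0 <= t -> t <= T -> c j t ^+ 2 = k j ^+ 2 + prim (fun t => 2 * (g j t * c j t)) t.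
  by move=> t0 tT; have [_ ->] := AC_sqr (ltW T0) (hc j).
pose E t := limn (fun J => \sum_(0 <= j < J) c j t ^+ 2).
have cvE t : 0 <= t -> t <= T -> \sum_(0 <= j < J) c j t ^+ 2 @[J --> \oo] --> E t.
  move=> t0 tT; apply: (@nondecreasing_is_cvgn _ (series (fun j => c j t ^+ 2))).
    by apply: nondecreasing_series => j _ _; exact: sqr_ge0.
  by exists ((T^-1 + 1) * B) => _ [n _ <-]; exact: coef_sum_le.
pose S J t := \sum_(0 <= j < J) (2 * (g j t * c j t)).
have hS J : L1 T (S J) by apply: L1_sum.
have bS : {ae mu, forall t, t \in `]0, T[ -> forall J, `|S J t| <= G t}.
  apply: ae_mono GP => t H tT J; apply: le_trans (H tT J).
  by apply: le_trans (ler_norm_sum _ _ _) _; apply: ler_sum => j _; exact: energy_ge.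
have [hp _] := itv_dct (fun J => itg_measurable (hS J)) mp pP hG bS.
exists E; split=> //; split=> // t t0 tT.
have sub x : x \in `]0, t[ -> x \in `]0, T[.
  by rewrite !in_itv/= => /andP[-> xt]; rewrite (lt_le_trans xt).
have [_ cp] : L1 t p /\ prim (S J) t @[J --> \oo] --> prim p t.
  apply: (@itv_dct _ t S p G).
  - by move=> J; have h := L1S (hS J) tT; exact: itg_measurable h.
  - by have h := L1S hp tT; exact: itg_measurable h.
  - by apply: ae_mono pP => x H /sub; exact: H.
  - exact: L1S hG tT.
  - by apply: ae_mono bS => x H /sub; exact: H.
have E2 J : \sum_(0 <= j < J) c j t ^+ 2 = \sum_(0 <= j < J) c j 0 ^+ 2 + prim (S J) t.
  have -> : prim (S J) t = \sum_(0 <= j < J) prim (fun t => 2 * (g j t * c j t)) t.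
    exact: (Int_sum (measurable_oo 0 t) _ (fun j _ => L1S (hd j) tT)).
  rewrite -big_split /=; apply: eq_bigr => j _; rewrite (Ed j t t0 tT) (Ed j 0 (lexx 0) (ltW T0)).
  by rewrite [X in _ = _ + X + _]prim_le0// addr0.
have c1 : \sum_(0 <= j < J) c j t ^+ 2 @[J --> \oo] --> E 0 + prim p t.
  under eq_fun do rewrite E2.
  by apply: cvgD => //; apply: cvE => //; exact: ltW.
by have := cvg_unique _ (cvE t t0 tT) c1; apply; exact: Rhausdorff.
Qed.

End embedding.

End sequences_of_coefficients.

(** * An infinite system of linear differential equations *)

Section picard.
Context (R : realType).
Notation mu := (@lebesgue_measure R).
Local Notation L1 T f := (mu.-integrable `]0, T[ (EFin \o f)).
Implicit Types (t : R) (x y : nat -> R).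

Lemma AC_add (T : R) (k1 k2 : R) (g1 g2 c1 c2 : R -> R) :
  AC T k1 g1 c1 -> AC T k2 g2 c2 ->
  AC T (k1 + k2) (fun t => g1 t + g2 t) (fun t => c1 t + c2 t).
Proof.
move=> [h1 E1] [h2 E2]; split; first exact: L1D.
by move=> t t0 tT; rewrite E1// E2// (primD h1 h2 tT); ring.
Qed.

Lemma AC_eq (T : R) (k k' : R) (g g' c c' : R -> R) :
  AC T k g c -> k = k' -> {in `]0, T[, g =1 g'} ->
  (forall t, 0 <= t -> t <= T -> c t = c' t) -> AC T k' g' c'.
Proof.
move=> [h E] kk gg cc; split; first exact: L1_eq h gg.
move=> t t0 tT; rewrite -cc// E// kk; congr (_ + _); apply: eq_prim => s.
by rewrite in_itv/= => /andP[s0 st]; apply: gg; rewrite in_itv/= s0 (lt_le_trans st).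
Qed.

(* The energy estimate of the scalar equation z' = h - la z. *)
Lemma duhamel_energy (T la y0 : R) (h z : R -> R) : 0 < T -> 0 < la ->
  AC T y0 (fun t => h t - la * z t) z -> L1 T (fun t => h t ^+ 2) ->
  forall t, 0 <= t -> t <= T ->
  z t ^+ 2 + prim (fun s => la * z s ^+ 2) t <=
  y0 ^+ 2 + prim (fun s => h s ^+ 2 / la) t.
Proof.
move=> T0 la0 hz hh t t0 tT.
have [hd Ed] := AC_sqr (ltW T0) hz.
have iz2 : L1 T (fun s => la * z s ^+ 2).
  apply: L1Z; have := AC_mulL1 (ltW T0) hz (AC_L1 (ltW T0) hz).
  by move=> H; apply: (L1_eq H) => s _; rewrite expr2.
have ih2 : L1 T (fun s => h s ^+ 2 / la).
  by apply: (L1_eq (L1Z la^-1 hh)) => s _; rewrite mulrC.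
rewrite Ed// -addrA lerD2l -(primD hd iz2 tT).
apply: (prim_ae_le (L1D hd iz2) ih2 tT); apply: ae_everywhere => s _.
(* Expanding this square gives precisely the gap between the two sides. *)
have : 0 <= (h s - la * z s) ^+ 2 / la by rewrite divr_ge0 ?sqr_ge0// ltW.
have -> : (h s - la * z s) ^+ 2 / la = h s ^+ 2 / la - 2 * (h s * z s) + la * z s ^+ 2.
  by field; rewrite gt_eqF.
by move=> H; rewrite -subr_ge0; apply: le_trans H _; rewrite le_eqVlt; apply/orP; left; apply/eqP; ring.
Qed.

Variables (T M2 : R) (la : nat -> R) (U : nat -> nat -> R -> R).
Hypotheses (T0 : 0 < T) (la1 : forall j, 1 <= la j) (M20 : 0 <= M2).
Hypothesis mU : forall j k, measurable_fun `]0, T[ (U j k).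
(** The matrix [U] is bounded from l2 into the weighted l2 with weights [1 / la j]: the output lies
    in a weaker space, and [duhamel_energy] leads back to l2. *)
Hypothesis HU : forall t J n x, t \in `]0, T[ ->
  \sum_(0 <= j < J) (\sum_(0 <= k < n) x k * U j k t) ^+ 2 / la j <=
  M2 * \sum_(0 <= k < n) x k ^+ 2.

Let la0 j : 0 < la j. Proof. exact: lt_le_trans (la1 j). Qed.

Definition opS x j t := limn (fun n => \sum_(0 <= k < n) x k * U j k t).

(** [HU] applied to [x] with its first [m] entries cancelled; it gives the Cauchy criterion for the
    series defining [opS]. *)
Lemma opS_part t j m n x : t \in `]0, T[ -> (m <= n)%N ->
  (\sum_(m <= k < n) x k * U j k t) ^+ 2 <= la j * M2 * \sum_(m <= k < n) x k ^+ 2.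
Proof.
move=> tT mn; pose x' k := if (m <= k)%N then x k else 0.
(* With [j.+1] rows, the wanted row is the last term of a sum of nonnegative terms. *)
have := HU j.+1 n x' tT.
have cut (F : nat -> R) (G : nat -> R) : (forall k, (k < m)%N -> G k = 0) ->
    (forall k, (m <= k)%N -> G k = F k) ->
    \sum_(0 <= k < n) G k = \sum_(m <= k < n) F k.
  move=> G0 GF; rewrite (big_cat_nat (leq0n m) mn) /= big_nat big1 ?add0r.
    by rewrite big_nat [RHS]big_nat; apply: eq_bigr => k /andP[mk _]; exact: GF.
  by move=> k /andP[_ km]; exact: G0.
rewrite (cut (fun k => x k ^+ 2)); first last.
- by move=> k mk; rewrite /x' mk.
- by move=> k km; rewrite /x' leqNgt km /= expr0n.
move=> H; rewrite mulrAC -mulrA mulrC -ler_pdivrMr// (mulrC _ M2).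
apply: le_trans H; rewrite big_nat_recr//= (cut (fun k => x k * U j k t)); first last.
- by move=> k mk; rewrite /x' mk.
- by move=> k km; rewrite /x' leqNgt km /= mul0r.
by rewrite lerDr sumr_ge0// => i _; rewrite divr_ge0 ?sqr_ge0// ltW.
Qed.

Definition ell2 x (A : R) := forall n, \sum_(0 <= k < n) x k ^+ 2 <= A.

Lemma opS_cvg x A t j : t \in `]0, T[ -> ell2 x A ->
  \sum_(0 <= k < n) x k * U j k t @[n --> \oo] --> opS x j t.
Proof.
move=> tT xA.
suff : cvgn (series (fun k => x k * U j k t)) by [].
apply/cauchy_cvgP/cauchy_seriesP => e e0.
pose C := la j * M2 + 1.
have C0 : 0 < C by rewrite ltr_wpDl// mulr_ge0// ltW.
have d0 : 0 < (e / 2) ^+ 2 / C by rewrite divr_gt0// exprn_gt0// divr_gt0.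
have [N NP] := series_cauchy (fun k => sqr_ge0 (x k)) xA d0.
exists ([set m | (N <= m)%N], [set: nat]).
  by split; [exists N|exact: filterT].
move=> [m n] [/= Nm _].
have [mn|nm] := leqP m n; last by rewrite big_geq ?normr0// ltnW.
apply: (@le_lt_trans _ _ (e / 2)); last by rewrite ltr_pdivrMr// ltr_pMr// ltr1n.
rewrite -(@ler_pXn2r _ 2%N) ?nnegrE// ?divr_ge0 ?(ltW e0)//.
rewrite real_normK ?num_real//.
apply: le_trans (opS_part j x tT mn) _.
apply: (@le_trans _ _ (C * \sum_(m <= k < n) x k ^+ 2)).
  by apply: ler_wpM2r; [apply: sumr_ge0 => i _; exact: sqr_ge0|rewrite /C lerDl].
by rewrite mulrC -ler_pdivlMr//; exact: NP.
Qed.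

Lemma cvg_nat_sum (J : nat) (h : nat -> nat -> R) (l : nat -> R) :
  (forall j, h j n @[n --> \oo] --> l j) ->
  \sum_(0 <= j < J) h j n @[n --> \oo] --> \sum_(0 <= j < J) l j.
Proof.
move=> hl; elim: J => [|J IH].
  by rewrite big_geq//; under eq_fun do rewrite big_geq//; exact: cvg_cst.
rewrite big_nat_recr//=; under eq_fun do rewrite big_nat_recr//=.
exact: cvgD.
Qed.

Lemma sum_limit_le (J : nat) (h : nat -> nat -> R) (l : nat -> R) (A : R) :
  (forall j, h j n @[n --> \oo] --> l j) ->
  (\forall n \near \oo, \sum_(0 <= j < J) h j n <= A) -> \sum_(0 <= j < J) l j <= A.
Proof. by move=> hl hA; apply: cvgr_to_le (cvg_nat_sum hl) hA. Qed.

Lemma cvg_sqr (F : nat -> R) (l : R) : F n @[n --> \oo] --> l ->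
  F n ^+ 2 @[n --> \oo] --> l ^+ 2.
Proof. by move=> h; rewrite expr2; under eq_fun do rewrite expr2; exact: cvgM. Qed.

Lemma opS_le x A t J : t \in `]0, T[ -> ell2 x A ->
  \sum_(0 <= j < J) opS x j t ^+ 2 / la j <= M2 * A.
Proof.
move=> tT xA.
apply: (@sum_limit_le J (fun j n => (\sum_(0 <= k < n) x k * U j k t) ^+ 2 / la j)).
  by move=> j; apply: cvgM; [apply: cvg_sqr; exact: opS_cvg tT xA|exact: cvg_cst].
apply: nearW => n; apply: le_trans (HU J n x tT) _.
exact: ler_wpM2l.
Qed.

Lemma opS_sq_le x A t j : t \in `]0, T[ -> ell2 x A ->
  opS x j t ^+ 2 <= la j * M2 * A.
Proof.
move=> tT xA; have := opS_le j.+1 tT xA; rewrite big_nat_recr//= => H.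
rewrite -mulrA mulrC -ler_pdivrMr//; apply: le_trans H.
by rewrite lerDr sumr_ge0// => i _; rewrite divr_ge0 ?sqr_ge0// ltW.
Qed.

Lemma opSD x y A B t j : t \in `]0, T[ -> ell2 x A -> ell2 y B ->
  opS (fun k => x k + y k) j t = opS x j t + opS y j t.
Proof.
move=> tT xA yB; rewrite [LHS]/opS.
rewrite (_ : (fun n => _) = (fun n => \sum_(0 <= k < n) x k * U j k t +
    \sum_(0 <= k < n) y k * U j k t)); last first.
  by apply/funext => n; rewrite -big_split /=; apply: eq_bigr => k _; rewrite mulrDl.
apply/cvg_lim => //.
by apply: cvgD; [exact: opS_cvg tT xA|exact: opS_cvg tT yB].
Qed.

Lemma opSB x y A B t j : t \in `]0, T[ -> ell2 x A -> ell2 y B ->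
  opS (fun k => x k - y k) j t = opS x j t - opS y j t.
Proof.
move=> tT xA yB; rewrite [LHS]/opS.
rewrite (_ : (fun n => _) = (fun n => \sum_(0 <= k < n) x k * U j k t -
    \sum_(0 <= k < n) y k * U j k t)); last first.
  by apply/funext => n; rewrite -sumrB; apply: eq_bigr => k _; rewrite mulrBl.
apply/cvg_lim => //.
by apply: cvgB; [exact: opS_cvg tT xA|exact: opS_cvg tT yB].
Qed.

Lemma opS0 j t : opS (fun=> 0) j t = 0.
Proof.
rewrite /opS; under eq_fun do under eq_bigr do rewrite mul0r.
by under eq_fun do rewrite big1_eq; rewrite lim_cst.
Qed.

Lemma opS_measurable (z : nat -> R -> R) A j :
  (forall k, measurable_fun `]0, T[ (z k)) ->
  (forall t, t \in `]0, T[ -> ell2 (z^~ t) A) ->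
  measurable_fun `]0, T[ (fun t => opS (z^~ t) j t).
Proof.
move=> mz zA.
apply: (@measurable_fun_cvg _ _ _ _ (fun n t => \sum_(0 <= k < n) z k t * U j k t)).
  by move=> n; apply: measurable_sum => k; exact: measurable_funM.
by move=> t tT; apply: opS_cvg (zA t tT).
Qed.

Lemma opS_L1 (z : nat -> R -> R) A j : 0 <= A ->
  (forall k, measurable_fun `]0, T[ (z k)) ->
  (forall t, t \in `]0, T[ -> ell2 (z^~ t) A) ->
  L1 T (fun t => opS (z^~ t) j t) /\ L1 T (fun t => opS (z^~ t) j t ^+ 2).
Proof.
move=> A0 mz zA; have m := @opS_measurable z A j mz zA.
have b t : t \in `]0, T[ -> opS (z^~ t) j t ^+ 2 <= la j * M2 * A.
  by move=> tT; exact: opS_sq_le (zA t tT).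
split.
  apply: (@L1_bounded _ _ _ (1 + la j * M2 * A)) => // t tT; have := b t tT.
  set s := opS _ _ _; rewrite -(real_normK (num_real s)).
  by have := sqr_ge0 (`|s| - 1); have := normr_ge0 s; nra.
apply: (@L1_bounded _ _ _ (la j * M2 * A)); first exact: measurable_funX.
by move=> t tT; rewrite ger0_norm ?sqr_ge0// b.
Qed.

(** Integrating the weight [expR (ka * t)] divides by [ka], so one Picard step contracts squared
    norms by [M2 / ka], at most [4^-1]. The added 1 keeps [ka] positive when [M2] is 0. *)
Let ka : R := 4 * M2 + 1.

Let ka0 : 0 < ka. Proof. by rewrite ltr_wpDl// mulr_ge0. Qed.

(** An exponentially weighted supremum norm in time, for which the Picard map contracts on the whole
    of [[0, T]] at once. *)
Definition grows (z : nat -> R -> R) (A : R) := forall t, 0 <= t -> t <= T ->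
  ell2 (z^~ t) (A * expR (ka * t)).

Lemma grows_ell2 z A t : 0 <= A -> grows z A -> 0 <= t -> t <= T ->
  ell2 (z^~ t) (A * expR (ka * T)).
Proof.
move=> A0 zA t0 tT n; apply: le_trans (zA t t0 tT n) _.
by rewrite ler_wpM2l// ler_expR ler_wpM2l// ltW.
Qed.

Let in_oo t : t \in `]0, T[ -> 0 <= t /\ t <= T.
Proof. by rewrite in_itv/= => /andP[/ltW ? /ltW ?]. Qed.

(** As in [eigen_step], the hypotheses stand under the existential so that [choice] produces a map
    that can be iterated. The bound combines [duhamel_energy] for each mode with [opS_le] under the
    time integral. *)
Lemma picard_step (z : nat -> R -> R) : exists z' : nat -> R -> R,
  (forall k, measurable_fun `]0, T[ (z k)) -> (exists2 A, 0 <= A & grows z A) ->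
  (forall j, AC T 0 (fun t => - opS (z^~ t) j t - la j * z' j t) (z' j)) /\
  forall A, 0 <= A -> grows z A -> grows z' (A / 4).
Proof.
have [[mz [A A0 zA]]|nh] := pselect ((forall k, measurable_fun `]0, T[ (z k)) /\
    exists2 A, 0 <= A & grows z A); last first.
  by exists z => h1 h2; exfalso; apply: nh.
have eA : 0 <= A * expR (ka * T) by rewrite mulr_ge0// expR_ge0.
have zT t : t \in `]0, T[ -> ell2 (z^~ t) (A * expR (ka * T)).
  by move=> /in_oo[t0 tT]; exact: grows_ell2.
have hS j : L1 T (fun t => - opS (z^~ t) j t).
  have [h _] := opS_L1 j eA mz zT.
  by apply: (L1_eq (L1Z (-1) h)) => t _; rewrite mulN1r.
have hS2 j : L1 T (fun t => (- opS (z^~ t) j t) ^+ 2).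
  have [_ h] := opS_L1 j eA mz zT.
  by apply: (L1_eq h) => t _; rewrite sqrrN.
have /choice[z' z'P] : forall j, exists z', AC T 0 (fun t => - opS (z^~ t) j t - la j * z' t) z'.
  by move=> j; exact: duhamel (ltW T0) (hS j).
exists z' => _ _; split => // A' A'0 zA' t t0 tT J.
have step j : z' j t ^+ 2 <= prim (fun s => opS (z^~ s) j s ^+ 2 / la j) t.
  have := duhamel_energy T0 (la0 j) (z'P j) (hS2 j) t0 tT.
  rewrite expr0n add0r; have -> : prim (fun s => (- opS (z^~ s) j s) ^+ 2 / la j) t =
    prim (fun s => opS (z^~ s) j s ^+ 2 / la j) t.
    by apply: eq_prim => s _; rewrite sqrrN.
  apply: le_trans; rewrite lerDl; apply: (@prim_ae_ge0 _ T) => //; apply: ae_everywhere => s _.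
  by rewrite mulr_ge0 ?sqr_ge0// ltW.
apply: le_trans (ler_sum _ (fun j _ => step j)) _.
have hSl j : L1 T (fun s => opS (z^~ s) j s ^+ 2 / la j).
  have [_ h] := opS_L1 j eA mz zT.
  by apply: (L1_eq (L1Z (la j)^-1 h)) => s _; rewrite mulrC.
have <- : prim (fun s => \sum_(0 <= j < J) opS (z^~ s) j s ^+ 2 / la j) t =
    \sum_(0 <= j < J) prim (fun s => opS (z^~ s) j s ^+ 2 / la j) t.
  exact: (Int_sum (measurable_oo 0 t) _ (fun j _ => L1S (hSl j) tT)).
have [he Ee] := AC_expR T ka.
apply: (@le_trans _ _ (prim (fun s => A' / 4 * (ka * expR (ka * s))) t)).
  apply: (@prim_ae_le _ T) => //; [exact: L1_sum|exact: L1Z|].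
  apply: ae_everywhere => s sT; have [s0 s1] := in_oo sT.
  apply: le_trans (opS_le J sT (zA' s s0 s1)) _.
  have -> : A' / 4 * (ka * expR (ka * s)) = (ka / 4) * (A' * expR (ka * s)) by ring.
  apply: ler_wpM2r; first by rewrite mulr_ge0 ?expR_ge0.
  by rewrite /ka; lra.
rewrite (@primZ _ T)// ler_wpM2l ?divr_ge0//.
by rewrite (Ee t t0 tT) lerDr.
Qed.

Variables (f : nat -> R -> R) (y0 : nat -> R) (Bf B0 : R).
Hypotheses (hf : forall j, L1 T (f j)) (hf2 : forall j, L1 T (fun t => f j t ^+ 2)).
Hypothesis fB : forall J, \sum_(0 <= j < J) prim (fun t => f j t ^+ 2 / la j) T <= Bf.
Hypothesis yB : ell2 y0 B0.

Let A0 : R := B0 + Bf.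

Let B0_ge0 : 0 <= B0. Proof. by have := yB 0; rewrite big_geq. Qed.
Let Bf_ge0 : 0 <= Bf. Proof. by have := fB 0; rewrite big_geq. Qed.
Let A0_ge0 : 0 <= A0. Proof. exact: addr_ge0. Qed.

Let hfl j : L1 T (fun t => f j t ^+ 2 / la j).
Proof. by apply: (L1_eq (L1Z (la j)^-1 (hf2 j))) => s _; rewrite mulrC. Qed.

Lemma picard_base : exists z : nat -> R -> R,
  (forall j, AC T (y0 j) (fun t => f j t - la j * z j t) (z j)) /\ grows z A0.
Proof.
have /choice[z zP] : forall j, exists z, AC T (y0 j) (fun t => f j t - la j * z t) z.
  by move=> j; exact: duhamel (ltW T0) (hf j).
exists z; split=> // t t0 tT J.
have step j : z j t ^+ 2 <= y0 j ^+ 2 + prim (fun s => f j s ^+ 2 / la j) T.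
  have := duhamel_energy T0 (la0 j) (zP j) (hf2 j) t0 tT => H.
  apply: (@le_trans _ _ (y0 j ^+ 2 + prim (fun s => f j s ^+ 2 / la j) t)).
    apply: le_trans H; rewrite lerDl; apply: (@prim_ae_ge0 _ T) => //; apply: ae_everywhere => s _.
    by rewrite mulr_ge0 ?sqr_ge0// ltW.
  rewrite lerD2l; apply: (prim_mono (hfl j)) => //; apply: ae_everywhere => s _.
  by rewrite divr_ge0 ?sqr_ge0// ltW.
apply: le_trans (ler_sum _ (fun j _ => step j)) _.
rewrite big_split /=; apply: (@le_trans _ _ A0); first exact: lerD (yB J) (fB J).
by rewrite ler_peMr// -expR0 ler_expR mulr_ge0// ltW.
Qed.

(** [Z n] is the correction added at step [n]: only the first one sees the source and the initial
    value, and the following ones solve equations with zero initial value driven by their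
    predecessor. *)
Lemma picard_sequence : exists Z : nat -> nat -> R -> R,
  [/\ forall j, AC T (y0 j) (fun t => f j t - la j * Z 0%N j t) (Z 0%N j),
      forall n j, AC T 0 (fun t => - opS ((Z n)^~ t) j t - la j * Z n.+1 j t) (Z n.+1 j) &
      forall n, grows (Z n) (A0 * 4^-1 ^+ n)].
Proof.
have [z0 [z0P z0g]] := picard_base.
have [g gP] := choice picard_step.
pose Z n := iter n g z0.
have A4 n : 0 <= A0 * 4^-1 ^+ n by rewrite mulr_ge0// exprn_ge0.
have ex n : grows (Z n) (A0 * 4^-1 ^+ n) -> exists2 A : R, 0 <= A & grows (Z n) A.
  by move=> h; exists (A0 * 4^-1 ^+ n).
have inv n : (forall k, measurable_fun `]0, T[ (Z n k)) /\ grows (Z n) (A0 * 4^-1 ^+ n).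
  elim: n => [|n [IH1 IH2]].
    rewrite expr0 mulr1; split => // k.
    exact: AC_measurable (ltW T0) (z0P k).
  have [h1 h2] := gP (Z n) IH1 (ex n IH2).
  split; first by move=> k; exact: AC_measurable (ltW T0) (h1 k).
  by rewrite exprSr mulrA; exact: h2.
exists Z; split => //; last by move=> n; have [] := inv n.
move=> n j; have [IH1 IH2] := inv n.
by have [h1 h2] := gP (Z n) IH1 (ex n IH2).
Qed.

(* The tails of a series whose n-th term has squared norm at most A 4^-n. *)
Lemma geometric_tails (Z : nat -> nat -> R) (A : R) : 0 <= A ->
  (forall n, ell2 (Z n) (A * 4^-1 ^+ n)) ->
  forall m d, ell2 (fun j => \sum_(m <= n < m + d) Z n j) (4 * (A * 4^-1 ^+ m)).
Proof.
move=> A'0 ZA m d; elim: d m => [|d IH] m J.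
  rewrite addn0 big1 ?mulr_ge0 ?exprn_ge0// => j _.
  by rewrite big_geq// expr0n.
have E j : \sum_(m <= n < m + d.+1) Z n j = Z m j + \sum_(m.+1 <= n < m.+1 + d) Z n j.
  by rewrite big_ltn ?addnS ?addSn// ltnS leq_addr.
apply: (@le_trans _ _ (\sum_(0 <= j < J) (2 * Z m j ^+ 2 +
    2 * (\sum_(m.+1 <= n < m.+1 + d) Z n j) ^+ 2))).
  apply: ler_sum => j _; rewrite E; set a := Z m j; set b := bigop _ _ _.
  have := sqr_ge0 (a - b); have -> : (a - b) ^+ 2 = a ^+ 2 - 2 * (a * b) + b ^+ 2 by ring.
  have -> : (a + b) ^+ 2 = a ^+ 2 + 2 * (a * b) + b ^+ 2 by ring.
  lra.
rewrite big_split /= -!mulr_sumr.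
have := ZA m J; have := IH m.+1 J; rewrite exprS.
set X := \sum_(0 <= j < J) _ ^+ 2; set Y := \sum_(0 <= j < J) Z m j ^+ 2.
set q := 4^-1 ^+ m => h1 h2.
(* The constant 4 is the fixed point of [x = 2 + 2 * x / 4], which arises from bounding the square
   of a sum by twice the sum of the squares. *)
have -> : 4 * (A * q) = 2 * (A * q) + 2 * (4 * (A * (4^-1 * q))) by field.
by apply: lerD; rewrite ler_pM2l.
Qed.

(* Each Picard iterate solves decoupled scalar equations, so that only [U] has
   to be bounded from l2 into the weighted space of [la]. *)
Theorem picard_solution : exists (c S : nat -> R -> R) (B : R),
  let g j t := f j t - S j t - la j * c j t in
  [/\ forall j, AC T (y0 j) (g j) (c j),
      forall j, L1 T (energy la g c j),
      forall J, \sum_(0 <= j < J) prim (energy la g c j) T <= B &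
      forall t j, t \in `]0, T[ ->
        \sum_(0 <= k < n) c k t * U j k t @[n --> \oo] --> S j t].
Proof.
have [Z [Z0 ZS Zg]] := picard_sequence.
pose A := A0 * expR (ka * T).
have A_ge0 : 0 <= A by rewrite mulr_ge0// expR_ge0.
have ZA n t : 0 <= t -> t <= T -> ell2 ((Z n)^~ t) (A * 4^-1 ^+ n).
  move=> t0 tT; rewrite /A mulrAC; apply: grows_ell2 => //.
  by rewrite mulr_ge0// exprn_ge0.
have mZ n j : measurable_fun `]0, T[ (Z n j).
  by case: n => [|n]; [exact: AC_measurable (ltW T0) (Z0 j)|exact: AC_measurable (ltW T0) (ZS n j)].
pose Y m j t := \sum_(0 <= n < m) Z n j t.
have tails m d t : 0 <= t -> t <= T ->
    ell2 (fun j => Y (m + d)%N j t - Y m j t) (4 * (A * 4^-1 ^+ m)).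
  move=> t0 tT; have := geometric_tails A_ge0 (fun n => ZA n t t0 tT) m d.
  suff -> : (fun j => Y (m + d)%N j t - Y m j t) = (fun j => \sum_(m <= n < m + d) Z n j t) by [].
  apply/funext => j; rewrite /Y (big_cat_nat (leq0n m) (leq_addr d m)) /=.
  by rewrite addrAC subrr add0r.
have YA m t : 0 <= t -> t <= T -> ell2 ((Y m)^~ t) (4 * A).
  move=> t0 tT J; have := tails 0%N m t t0 tT J; rewrite expr0 mulr1 add0n.
  by under eq_bigr do rewrite {2}/Y big_geq// subr0.
have mY m j : measurable_fun `]0, T[ (Y m j) by apply: measurable_sum.
(* The partial sum [Y m.+1] is the Picard iterate of [Y m], starting from [Y 0 = 0]. *)
have ACY m j : AC T (y0 j) (fun t => f j t - opS ((Y m)^~ t) j t - la j * Y m.+1 j t) (Y m.+1 j).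
  elim: m => [|m IH].
    apply: (AC_eq (Z0 j)) => //.
      move=> t _; rewrite /Y big_nat1; have -> : (fun j => \sum_(0 <= n < 0) Z n j t) = (fun=> 0).
        by apply/funext => i; rewrite big_geq.
      by rewrite opS0 subr0.
    by move=> t _ _; rewrite /Y big_nat1.
  apply: (AC_eq (AC_add IH (ZS m j))); first by rewrite addr0.
    move=> t tT; have [t0 t1] := in_oo tT.
    have -> : (Y m.+1)^~ t = (fun k => Y m k t + Z m k t).
      by apply/funext => k; rewrite /Y big_nat_recr.
    rewrite (opSD j tT (YA m t t0 t1) (ZA m t t0 t1)).
    have -> : Y m.+2 j t = Y m.+1 j t + Z m.+1 j t by rewrite /Y [LHS]big_nat_recr.
    by ring.
  by move=> t _ _; rewrite [RHS]big_nat_recr.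
have q0 : `|4^-1 : R| < 1 by rewrite ger0_norm// invf_lt1// ltr1n.
have small (e : R) : 0 < e -> exists m0, forall m, (m0 <= m)%N -> 4 * (A * 4^-1 ^+ m) <= e.
  move=> e0.
  have : 4 * (A * 4^-1 ^+ m) @[m --> \oo] --> 4 * (A * 0).
    by apply: cvgM; [exact: cvg_cst|apply: cvgM; [exact: cvg_cst|exact: cvg_expr]].
  rewrite !mulr0 => /cvgrPdist_le /(_ e e0) [m0 _ h]; exists m0 => m /h /=.
  by rewrite sub0r normrN ger0_norm// mulr_ge0// mulr_ge0// exprn_ge0.
pose c j t := limn (fun m => Y m j t).
have cvc j t : 0 <= t -> t <= T -> Y m j t @[m --> \oo] --> c j t.
  move=> t0 tT; suff : cvgn (series (fun n => Z n j t)) by [].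
  apply/cauchy_cvgP/cauchy_seriesP => e e0.
  have d0 : 0 < (e / 2) ^+ 2 by rewrite exprn_gt0// divr_gt0.
  have [m0 hm0] := small _ d0.
  exists ([set m | (m0 <= m)%N], [set: nat]).
    by split; [exists m0|exact: filterT].
  move=> [m n] [/= Nm _].
  have [mn|nm] := leqP m n; last by rewrite big_geq ?normr0// ltnW.
  apply: (@le_lt_trans _ _ (e / 2)); last by rewrite ltr_pdivrMr// ltr_pMr// ltr1n.
  rewrite -(@ler_pXn2r _ 2%N) ?nnegrE// ?divr_ge0 ?(ltW e0)//.
  rewrite real_normK ?num_real//.
  have := geometric_tails A_ge0 (fun n => ZA n t t0 tT) m (n - m)%N j.+1.
  rewrite subnKC// big_nat_recr//= => H.
  apply: le_trans (hm0 m Nm); apply: le_trans H; rewrite lerDr.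
  by apply: sumr_ge0 => i _; exact: sqr_ge0.
have cT m t : 0 <= t -> t <= T -> ell2 (fun j => c j t - Y m j t) (4 * (A * 4^-1 ^+ m)).
  move=> t0 tT J.
  apply: (@sum_limit_le J (fun j n => (Y n j t - Y m j t) ^+ 2)).
    move=> j; apply: cvg_sqr; apply: cvgB; last exact: cvg_cst.
    exact: cvc.
  exists m => // n /= mn; have := tails m (n - m)%N t t0 tT J.
  by rewrite subnKC.
have cA t : 0 <= t -> t <= T -> ell2 (c^~ t) (4 * A).
  move=> t0 tT J; have := cT 0%N t t0 tT J; rewrite expr0 mulr1.
  by under eq_bigr do rewrite /Y big_geq// subr0.
have mc j : measurable_fun `]0, T[ (c j).
  apply: (@measurable_fun_cvg _ _ _ _ (fun m => Y m j)) => // t tT.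
  by have [t0 t1] := in_oo tT; exact: cvc.
pose S j t := opS (c^~ t) j t.
have A4_ge0 : 0 <= 4 * A by rewrite mulr_ge0.
have cAo t : t \in `]0, T[ -> ell2 (c^~ t) (4 * A).
  by move=> /in_oo[t0 t1]; exact: cA.
have iS j : L1 T (S j) /\ L1 T (fun t => S j t ^+ 2) by exact: opS_L1 A4_ge0 mc cAo.
have cvS j t : t \in `]0, T[ -> opS ((Y m)^~ t) j t @[m --> \oo] --> S j t.
  move=> tT; have [t0 t1] := in_oo tT; apply/cvgrPdist_le => e e0.
  pose C := la j * M2 + 1.
  have C0 : 0 < C by rewrite ltr_wpDl// mulr_ge0// ltW.
  have d0 : 0 < e ^+ 2 / C by rewrite divr_gt0// exprn_gt0.
  have [m0 hm0] := small _ d0; exists m0 => // m /= mm0.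
  rewrite -(opSB j tT (cA t t0 t1) (YA m t t0 t1)).
  rewrite -(@ler_pXn2r _ 2%N) ?nnegrE ?(ltW e0)// real_normK ?num_real//.
  apply: le_trans (opS_sq_le j tT (cT m t t0 t1)) _.
  apply: (@le_trans _ _ (C * (e ^+ 2 / C))); last by rewrite mulrC divfK// gt_eqF.
  apply: ler_pM; rewrite ?mulr_ge0 ?exprn_ge0 ?(ltW (la0 j))//; first by rewrite /C lerDl.
  exact: hm0.
pose g j t := f j t - S j t - la j * c j t.
have YA1 m j t : t \in `]0, T[ -> `|Y m j t| <= 1 + 4 * A.
  move=> /in_oo[t0 t1]; have := YA m t t0 t1 j.+1; rewrite big_nat_recr//= => H.
  have : Y m j t ^+ 2 <= 4 * A.
    by apply: le_trans H; rewrite lerDr; apply: sumr_ge0 => i _; exact: sqr_ge0.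
  set y := Y m j t; rewrite -(real_normK (num_real y)) => h.
  by have := sqr_ge0 (`|y| - 1); have := normr_ge0 y; move: h; nra.
have S1 m j t : t \in `]0, T[ -> `|opS ((Y m)^~ t) j t| <= 1 + la j * M2 * (4 * A).
  move=> tT; have [t0 t1] := in_oo tT; have := opS_sq_le j tT (YA m t t0 t1).
  set y := opS _ _ _; rewrite -(real_normK (num_real y)) => h.
  by have := sqr_ge0 (`|y| - 1); have := normr_ge0 y; move: h; nra.
have ACc j : AC T (y0 j) (g j) (c j).
  pose gm m t := f j t - opS ((Y m)^~ t) j t - la j * Y m.+1 j t.
  (* For a fixed mode this dominates the right-hand sides of all iterates, because both the iterates
     and their images under [opS] are bounded uniformly in the step and in time. *)
  pose G t := `|f j t| + (1 + la j * M2 * (4 * A) + la j * (1 + 4 * A)).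
  have hG : L1 T G by apply: L1D; [exact: itg_norm (hf j)|exact: L1_cst].
  have hgm m : L1 T (gm m) by have [] := ACY m j.
  have cg t : t \in `]0, T[ -> gm m t @[m --> \oo] --> g j t.
    move=> tT; have [t0 t1] := in_oo tT.
    apply: cvgB; first by apply: cvgB; [exact: cvg_cst|exact: cvS].
    apply: cvgM; first exact: cvg_cst.
    by have := cvc j t t0 t1; rewrite -(cvg_shiftS (fun m => Y m j t)).
  have bg t : t \in `]0, T[ -> forall m, `|gm m t| <= G t.
    move=> tT m; rewrite /gm /G.
    apply: le_trans (ler_normB _ _) _; rewrite addrA; apply: lerD.
      apply: le_trans (ler_normB _ _) _; apply: lerD => //.
      by apply: S1.
    by rewrite normrM (ger0_norm (ltW (la0 j))) ler_wpM2l ?(ltW (la0 j))// YA1.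
  have mg : measurable_fun `]0, T[ (g j).
    apply: (@measurable_fun_cvg _ _ _ _ gm) => //.
    by move=> m; exact: itg_measurable (hgm m).
  have [hg _] := itv_dct (fun m => itg_measurable (hgm m)) mg (ae_everywhere cg) hG (ae_everywhere bg).
  split => // t t0 tT.
  have sub (x : R) : x \in `]0, t[ -> x \in `]0, T[.
    by rewrite !in_itv/= => /andP[-> xt]; rewrite (lt_le_trans xt).
  have [_ cp] : L1 t (g j) /\ prim (gm m) t @[m --> \oo] --> prim (g j) t.
    apply: (@itv_dct _ t gm (g j) G).
    - by move=> m; have h := L1S (hgm m) tT; exact: itg_measurable h.
    - by have h := L1S hg tT; exact: itg_measurable h.
    - by apply: ae_everywhere => x /sub; exact: cg.
    - exact: L1S hG tT.
    - by apply: ae_everywhere => x /sub; exact: bg.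
  have c1 : Y m.+1 j t @[m --> \oo] --> y0 j + prim (g j) t.
    have E m : Y m.+1 j t = y0 j + prim (gm m) t by have [_ ->] := ACY m j.
    by under eq_fun do rewrite E; apply: cvgD => //; exact: cvg_cst.
  have c2 : Y m.+1 j t @[m --> \oo] --> c j t.
    by have := cvc j t t0 tT; rewrite -(cvg_shiftS (fun m => Y m j t)).
  by have := cvg_unique _ c2 c1; apply; exact: Rhausdorff.
pose h j t := f j t - S j t.
have hAC j : AC T (y0 j) (fun t => h j t - la j * c j t) (c j) by exact: ACc.
have mh j : measurable_fun `]0, T[ (h j).
  by apply: measurable_funB; [exact: itg_measurable (hf j)|exact: itg_measurable (iS j).1].
have hSl j : L1 T (fun t => S j t ^+ 2 / la j).
  by apply: (L1_eq (L1Z (la j)^-1 (iS j).2)) => s _; rewrite mulrC.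
have h_le j t : h j t ^+ 2 <= 2 * f j t ^+ 2 + 2 * S j t ^+ 2.
  rewrite /h; have := sqr_ge0 (f j t + S j t); set a := f j t; set b := S j t.
  have -> : (a + b) ^+ 2 = a ^+ 2 + 2 * (a * b) + b ^+ 2 by ring.
  have -> : (a - b) ^+ 2 = a ^+ 2 - 2 * (a * b) + b ^+ 2 by ring.
  by lra.
have h2 j : L1 T (fun t => h j t ^+ 2).
  apply: (L1_ae_le (measurable_funX _ (mh j)) (L1D (L1Z 2 (hf2 j)) (L1Z 2 (iS j).2))).
  by apply: ae_everywhere => t _; rewrite ger0_norm ?sqr_ge0.
have hl2 j : L1 T (fun t => h j t ^+ 2 / la j).
  by apply: (L1_eq (L1Z (la j)^-1 (h2 j))) => s _; rewrite mulrC.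
have ph j : prim (fun t => h j t ^+ 2 / la j) T <=
    2 * prim (fun t => f j t ^+ 2 / la j) T + 2 * prim (fun t => S j t ^+ 2 / la j) T.
  rewrite -!(@primZ _ T)// -(@primD _ T)//; [|exact: L1Z..].
  apply: (@prim_ae_le _ T) => //; first by apply: L1D; exact: L1Z.
  apply: ae_everywhere => t _.
  have -> : 2 * (f j t ^+ 2 / la j) + 2 * (S j t ^+ 2 / la j) =
    (2 * f j t ^+ 2 + 2 * S j t ^+ 2) / la j by ring.
  by apply: ler_wpM2r; [rewrite invr_ge0 ltW|exact: h_le].
have SB J : \sum_(0 <= j < J) prim (fun t => S j t ^+ 2 / la j) T <= M2 * (4 * A) * T.
  have -> : \sum_(0 <= j < J) prim (fun t => S j t ^+ 2 / la j) T =
      prim (fun t => \sum_(0 <= j < J) S j t ^+ 2 / la j) T.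
    by symmetry; exact: (Int_sum (measurable_oo 0 T) _ (fun j _ => hSl j)).
  rewrite -(prim_cst _ (ltW T0)); apply: (@prim_ae_le _ T) => //.
  - exact: L1_sum.
  - exact: L1_cst.
  - by apply: ae_everywhere => t tT; apply: opS_le => //; exact: cAo.
pose H := 2 * Bf + 2 * (M2 * (4 * A) * T).
have HB J : \sum_(0 <= j < J) prim (fun t => h j t ^+ 2 / la j) T <= H.
  apply: le_trans (ler_sum _ (fun j _ => ph j)) _.
  by rewrite big_split /= -!mulr_sumr; apply: lerD; rewrite ler_pM2l.
have ic2 j : L1 T (fun t => la j * c j t ^+ 2).
  apply: L1Z; have := AC_mulL1 (ltW T0) (ACc j) (AC_L1 (ltW T0) (ACc j)).
  by move=> HH; apply: (L1_eq HH) => s _; rewrite expr2.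
have mg j : measurable_fun `]0, T[ (g j) by have [hg _] := ACc j; exact: itg_measurable hg.
(* Since [g] is [h - la * c], its weighted square is at most twice those of [h] and of [la * c]; the
   term already present in [energy] turns 2 into 3. *)
have g_le j t : energy la g c j t <= 3 * (la j * c j t ^+ 2) + 2 * (h j t ^+ 2 / la j).
  rewrite /energy; have -> : g j t = h j t - la j * c j t by [].
  have : 0 <= (h j t + la j * c j t) ^+ 2 / la j by rewrite divr_ge0 ?sqr_ge0// ltW.
  have -> : (h j t + la j * c j t) ^+ 2 / la j =
    h j t ^+ 2 / la j + 2 * (h j t * c j t) + la j * c j t ^+ 2 by field; rewrite gt_eqF.
  have -> : (h j t - la j * c j t) ^+ 2 / la j =
    h j t ^+ 2 / la j - 2 * (h j t * c j t) + la j * c j t ^+ 2 by field; rewrite gt_eqF.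
  by lra.
have ie j : L1 T (energy la g c j).
  apply: (L1_ae_le _ (L1D (L1Z 3 (ic2 j)) (L1Z 2 (hl2 j)))).
    apply: measurable_funD; first exact: itg_measurable (ic2 j).
    by apply: measurable_funM; [exact: measurable_funX|exact: measurable_cst].
  apply: ae_everywhere => t _; rewrite ger0_norm ?g_le//.
  by apply: addr_ge0; [apply: mulr_ge0|apply: divr_ge0]; rewrite ?sqr_ge0//; exact: ltW.
(* By [duhamel_energy] the integral of [la j * c j t ^+ 2] is at most the squared initial
   coefficient plus the weighted integral of [h j t ^+ 2]; [B0] and [H] bound the sums of these. *)
exists c, S, (3 * (B0 + H) + 2 * H); split => //.
  move=> J.
  have pe j : prim (energy la g c j) T <=
      3 * (y0 j ^+ 2 + prim (fun t => h j t ^+ 2 / la j) T) + 2 * prim (fun t => h j t ^+ 2 / la j) T.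
    apply: (@le_trans _ _ (3 * prim (fun t => la j * c j t ^+ 2) T +
       2 * prim (fun t => h j t ^+ 2 / la j) T)).
      rewrite -!(@primZ _ T)// -(@primD _ T)//; [|exact: L1Z..].
      apply: (@prim_ae_le _ T) => //; first by apply: L1D; exact: L1Z.
      by apply: ae_everywhere => t _; exact: g_le.
    rewrite lerD2r ler_pM2l//.
    have := duhamel_energy T0 (la0 j) (hAC j) (h2 j) (ltW T0) (lexx T).
    by apply: le_trans; rewrite lerDr sqr_ge0.
  apply: le_trans (ler_sum _ (fun j _ => pe j)) _.
  rewrite big_split /= -!mulr_sumr big_split /=.
  by apply: lerD; rewrite ler_pM2l//; apply: lerD => //; exact: yB.
by move=> t j tT; exact: opS_cvg tT (cAo t tT).
Qed.

End picard.

(** * L2 and H1 on an interval *)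

Section L2_interval.
Context (R : realType).
Notation mu := (@lebesgue_measure R).
Implicit Types (l T x t : R) (f g v w h : R -> R).
Local Notation L1 T f := (mu.-integrable `]0, T[ (EFin \o f)).
Local Notation Sq T f := (sqint mu `]0, T[ f).
Local Notation II T f := (\int[mu]_(x in `]0, T[) f x).

Lemma Lnorm2_restrict T f :
  ('N[mu]_2%:E[EFin \o (f \_ `]0%R, T[%classic)])%E =
  ((\int[mu]_(x in `]0%R, T[) (f x ^+ 2)%:E) `^ 2^-1)%E.
Proof.
rewrite unlock; congr poweR; rewrite [RHS]integral_mkcond.
apply: eq_integral => x _; rewrite !patchE /comp patchE.
case: ifPn => _; last by rewrite /= normr0 powR0// pnatr_eq0.
by rewrite /= powR_mulrn// real_normK// num_real.
Qed.

Lemma Lnorm2_ae T f h : Sq T h ->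
  {ae mu, forall x, x \in `]0, T[ -> f x = h x} ->
  ('N[mu]_2%:E[EFin \o (f \_ `]0%R, T[%classic)])%E =
  (Num.sqrt (II T (fun x => h x ^+ 2)))%:E.
Proof.
move=> [mh ih] fh; rewrite Lnorm2_restrict.
rewrite (@integral_ae_cong _ _ _ mu _ _ (fun x => (h x ^+ 2)%:E)); last first.
  by apply: ae_mono fh => x H /= xT; rewrite H.
by rewrite -(EFin_Int (measurable_oo 0 T) ih) poweR_EFin powR12_sqrt// Int_sqr_ge0.
Qed.

Lemma Lnorm2_lty T f h : measurable_fun `]0, T[ h ->
  {ae mu, forall x, x \in `]0, T[ -> f x = h x} ->
  ('N[mu]_2%:E[EFin \o (f \_ `]0%R, T[%classic)] < +oo)%E -> Sq T h.
Proof.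
move=> mh fh; rewrite Lnorm2_restrict.
rewrite (@integral_ae_cong _ _ _ mu _ _ (fun x => (h x ^+ 2)%:E)); last first.
  by apply: ae_mono fh => x H /= xT; rewrite H.
move=> /lty_poweRy H; split => //; apply/integrableP; split.
  by apply/measurable_EFinP; exact: measurable_funX.
under eq_integral do rewrite /= ger0_norm ?sqr_ge0//.
by apply: H; rewrite invr_neq0// pnatr_eq0.
Qed.

Lemma in_L2P l v : in_L2 l v <-> Sq l v.
Proof.
split=> [|hv].
  rewrite /in_L2 inE => /andP[]; rewrite inE/= => mv; rewrite inE/= => fv.
  apply: Lnorm2_lty fv; last exact: ae_everywhere.
  have mD := measurable_oo 0 l.
  by have := (measurable_restrictT _ mD).2 mv.
rewrite /in_L2 inE; apply/andP; split; rewrite inE/=.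
  by apply/(measurable_restrictT _ (measurable_oo 0 l)); exact: hv.1.
by rewrite /finite_norm (Lnorm2_ae hv (ae_everywhere (fun x _ => erefl (v x)))) ltry.
Qed.

Lemma norm_L2E l v : Sq l v -> norm_L2 l v = Num.sqrt (II l (fun x => v x ^+ 2)).
Proof.
by move=> hv; rewrite /norm_L2 (Lnorm2_ae hv (ae_everywhere (fun x _ => erefl (v x)))).
Qed.

Lemma norm_L2_sqr l v : Sq l v -> norm_L2 l v ^+ 2 = inner_L2 l v v.
Proof. by move=> hv; rewrite norm_L2E// sqr_sqrtr ?Int_sqr_ge0. Qed.

Lemma Sq_cst l (k : R) : Sq l (fun=> k).
Proof. by split; [exact: measurable_cst|exact: (L1_cst l (k ^+ 2))]. Qed.

Lemma SqL1 l v : Sq l v -> L1 l v.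
Proof.
move=> hv; have h1 : Sq l (fun=> 1).
  exact: Sq_cst.
have h : L1 l (fun x => v x * 1) := sqint_mul (measurable_oo 0 l) hv h1.
by apply: (L1_eq h) => x _; rewrite mulr1.
Qed.

Lemma SqD l v w : Sq l v -> Sq l w -> Sq l (fun x => v x + w x).
Proof. exact: (sqintD (measurable_oo 0 l)). Qed.

Lemma SqB l v w : Sq l v -> Sq l w -> Sq l (fun x => v x - w x).
Proof. exact: (sqintB (measurable_oo 0 l)). Qed.

Lemma SqZ l (r : R) v : Sq l v -> Sq l (fun x => r * v x).
Proof. exact: (sqintZ (measurable_oo 0 l)). Qed.

Lemma Sq_mul l v w : Sq l v -> Sq l w -> L1 l (fun x => v x * w x).
Proof. exact: (sqint_mul (measurable_oo 0 l)). Qed.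

Lemma prim_cauchy_schwarz l g s t : Sq l g -> 0 <= s -> s <= t -> t <= l ->
  (prim g t - prim g s) ^+ 2 <= (t - s) * II l (fun x => g x ^+ 2).
Proof.
move=> hg s0 st tl; rewrite (primB (SqL1 hg) s0 st tl).
have sub : `]s, t[ `<=` `]0, l[ by apply: subset_itv; rewrite bnd_simp.
have iS f : L1 l f -> mu.-integrable `]s, t[ (EFin \o f).
  by move=> hf; apply: integrableS hf.
have sg : sqint mu `]s, t[ g.
  split; last exact: iS hg.2.
  by have := iS _ (SqL1 hg) => h; exact: itg_measurable h.
have s1 : sqint mu `]s, t[ (fun=> 1).
  split; first exact: measurable_cst.
  by apply: iS; exact: (L1_cst l (1 ^+ 2)).
have := Int_cauchy_schwarz (measurable_oo s t) s1 sg.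
have -> : \int[mu]_(x in `]s, t[) (1 * g x) = \int[mu]_(x in `]s, t[) g x.
  by apply: eq_Rintegral => x _; rewrite mul1r.
have -> : \int[mu]_(x in `]s, t[) (1 ^+ 2 : R) = t - s.
  have -> : (1 : R) ^+ 2 = 1 by rewrite expr1n.
  by rewrite (Int_cst_oo _ st) mul1r.
move=> H; apply: le_trans H _; rewrite ler_wpM2l ?subr_ge0//.
rewrite -(primB hg.2 s0 st tl) -/(prim (fun x => g x ^+ 2) l).
apply: (@le_trans _ _ (prim (fun x => g x ^+ 2) t)).
  rewrite gerBl; apply: (@prim_ae_ge0 _ l); first exact: le_trans tl.
  by apply: ae_everywhere => x _; exact: sqr_ge0.
apply: (prim_mono hg.2) => //; last exact: le_trans st.
by apply: ae_everywhere => x _; exact: sqr_ge0.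
Qed.

Lemma ae_dense T (P : R -> Prop) : {ae mu, forall x, x \in `]0, T[ -> P x} ->
  forall a b, 0 <= a -> a < b -> b <= T -> exists y, [/\ a < y, y < b & P y].
Proof.
move=> [N [mN N0 sN]] a b a0 ab bT; apply: contrapT => nP.
have sub : `]a, b[ `<=` N.
  move=> y; rewrite /= in_itv/= => /andP[ay yb]; apply: sN => /= H.
  apply: nP; exists y; split => //; apply: H.
  by rewrite in_itv/= (le_lt_trans a0 ay) (lt_le_trans yb bT).
have : (mu `]a, b[ <= mu N)%E by apply: le_measure; rewrite ?inE//; exact: measurable_oo.
have -> : mu N = 0%E by exact: N0.
have := lebesgue_measure_itv `]a, b[; rewrite /= lte_fin ab => ->.
by rewrite -EFinB lee_fin leNgt subr_gt0 ab.
Qed.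

(** Points of equality are dense. The conclusion includes the end points, which is how traces and
    initial values are identified. *)
Lemma within_continuous_ae_eq T (v w : R -> R) : 0 < T ->
  {within `[0, T], continuous v} -> {within `[0, T], continuous w} ->
  {ae mu, forall x, x \in `]0, T[ -> v x = w x} ->
  forall x, x \in `[0, T] -> v x = w x.
Proof.
move=> T0 cv cw vw x xT; apply/eqP; rewrite -subr_eq0; apply/eqP.
have cd : {within `[0, T], continuous (fun x => v x - w x)}.
  by move=> y; apply: continuousB; [exact: cv|exact: cw].
set d := fun x => v x - w x in cd *.
have /subspace_continuousP /(_ x xT) /cvgrPdist_lt cx := cd.
rewrite -[LHS]/(d x); apply/eqP; rewrite -normr_le0; apply/ler_addgt0Pr => e e0.
rewrite add0r; have := cx e e0; rewrite near_withinE.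
move=> /nbhs_ballP[r /= r0 hr].
have [y [y1 y2 y3]] : exists y, [/\ y \in `[0, T], `|x - y| < r & v y = w y].
  move: xT; rewrite in_itv/= => /andP[x0 xT].
  (* A nearby point of equality is taken to the right of [x], except at [T], where it is taken to
     the left. *)
  have [xlt|xge] := ltP x T.
    have m1 : x < Num.min T (x + r) by rewrite lt_min xlt ltrDl.
    have m2 : Num.min T (x + r) <= T by rewrite ge_min lexx.
    have [y [y1 y2 y3]] := ae_dense vw x0 m1 m2.
    exists y; split => //.
      rewrite in_itv/= (le_trans x0 (ltW y1)) /=.
      by move: y2; rewrite lt_min => /andP[/ltW].
    rewrite ltr0_norm ?subr_lt0// opprB ltrBlDl.
    by move: y2; rewrite lt_min => /andP[_].
  have m1 : 0 <= Num.max 0 (T - r) by rewrite le_max lexx.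
  have m2 : Num.max 0 (T - r) < T by rewrite gt_max T0 gtrBl.
  have [y [y1 y2 y3]] := ae_dense vw m1 m2 (lexx _).
  have ET : x = T by apply/eqP; rewrite eq_le xT xge.
  move: y1; rewrite gt_max => /andP[y1 y1'].
  exists y; split => //; first by rewrite in_itv/= !ltW.
  by rewrite ET ger0_norm ?subr_ge0 ?(ltW y2)// ltrBlDl -ltrBlDr.
have H : `|d x - d y| < e := hr y y2 y1.
have dy : d y = 0 by rewrite /d y3 subrr.
by move: H; rewrite dy subr0 => /ltW.
Qed.

(** The working form of membership in H1: [k] is the trace at 0 and [g] the weak derivative. *)
Definition Hrep l v (k : R) g : Prop :=
  [/\ Sq l v, Sq l g & {ae mu, forall x, x \in `]0, l[ -> v x = k + prim g x}].

Lemma in_H1P l v : 0 < l -> in_H1 l v <-> exists k g, Hrep l v k g.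
Proof.
move=> l0; split=> [[/in_L2P hv [g [/in_L2P hg wd]]]|[k [g [hv hg vk]]]].
  have [k hk] := (weak_derivativeP l0 (SqL1 hv) (SqL1 hg)).1 wd.
  by exists k, g.
split; first exact/in_L2P.
exists g; split; first exact/in_L2P.
by apply/(weak_derivativeP l0 (SqL1 hv) (SqL1 hg)); exists k.
Qed.

Lemma wderiveP l v : in_H1 l v -> Sq l (wderive l v) /\ weak_derivative l v (wderive l v).
Proof.
move=> [hv [g hg]]; rewrite /wderive.
by have [/in_L2P] := xgetPex (cst 0) (ex_intro _ g hg : exists g, [set g | in_L2 l g /\ weak_derivative l v g] g).
Qed.

Lemma weak_derivative_unique l v g h : Sq l g -> Sq l h ->
  weak_derivative l v g -> weak_derivative l v h ->
  {ae mu, forall x, x \in `]0, l[ -> g x = h x}.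
Proof.
move=> hg hh wg wh.
have := @fundamental_lemma R l (fun x => g x - h x) (L1B (SqL1 hg) (SqL1 hh)).
have H : forall phi, test_function l phi -> II l (fun x => (g x - h x) * phi x) = 0.
  move=> phi tphi; have [_ c _ _ _] := test_derive tphi.
  have -> : II l (fun x => (g x - h x) * phi x) = II l (fun x => g x * phi x - h x * phi x).
    by apply: eq_Rintegral => x _; rewrite mulrBl.
  rewrite (IntB (measurable_oo 0 l)); [|exact: L1_mul_continuous (SqL1 hg) c|exact: L1_mul_continuous (SqL1 hh) c].
  by apply/eqP; rewrite subr_eq0 -eqr_opp -wg// -wh.
by move=> /(_ H); apply: ae_mono => x /[apply] /eqP; rewrite subr_eq0 => /eqP.
Qed.

Lemma Hrep_wderive l v k g : 0 < l -> Hrep l v k g ->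
  {ae mu, forall x, x \in `]0, l[ -> wderive l v x = g x}.
Proof.
move=> l0 hr; have hH : in_H1 l v by apply/in_H1P => //; exists k, g.
have [hw wd] := wderiveP hH; have [hv hg vk] := hr.
apply: weak_derivative_unique wd _ => //.
by apply/(weak_derivativeP l0 (SqL1 hv) (SqL1 hg)); exists k.
Qed.

Lemma Hrep_trace l v k g x : 0 < l -> Hrep l v k g -> x \in `[0, l] ->
  trace l v x = k + prim g x.
Proof.
move=> l0 [hv hg vk] xl.
have cg : {within `[0, l], continuous (fun x => k + prim g x)}.
  move=> y; apply: continuousD; first exact: cvg_cst.
  exact: (prim_cont (ltW l0) (SqL1 hg)).
have ex : exists w, [set w : R -> R | {within `[0, l], continuous w} /\
    {ae mu, forall y, y \in `]0, l[ -> w y = v y}] w.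
  exists (fun x => k + prim g x); split => //.
  by apply: ae_mono vk => y H /H.
have [cw aw] := xgetPex (cst 0) ex.
rewrite /trace; apply: (within_continuous_ae_eq l0 cw cg _ xl).
by apply: ae_mono (ae_and aw vk) => y [h1 h2] yl; rewrite h1// h2.
Qed.

Lemma Hrep_lin l v1 k1 g1 v2 k2 g2 (r : R) : Hrep l v1 k1 g1 -> Hrep l v2 k2 g2 ->
  Hrep l (fun x => r * v1 x + v2 x) (r * k1 + k2) (fun x => r * g1 x + g2 x).
Proof.
move=> [hv1 hg1 vk1] [hv2 hg2 vk2]; split.
- by apply: SqD => //; exact: SqZ.
- by apply: SqD => //; exact: SqZ.
- apply: ae_mono (ae_and vk1 vk2) => x [h1 h2] xl; rewrite h1// h2//.
  have xl' : x <= l by move: xl; rewrite in_itv/= => /andP[_ /ltW].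
  rewrite (primD (L1Z r (SqL1 hg1)) (SqL1 hg2) xl') (primZ r (SqL1 hg1) xl').
  by ring.
Qed.

Lemma inner_L2C l v w : inner_L2 l v w = inner_L2 l w v.
Proof. by apply: eq_Rintegral => x _; rewrite mulrC. Qed.

Lemma inner_L2_lin l (r : R) u v w : Sq l u -> Sq l v -> Sq l w ->
  inner_L2 l (fun x => r * u x + v x) w = r * inner_L2 l u w + inner_L2 l v w.
Proof.
move=> hu hv hw; rewrite /inner_L2.
rewrite -(IntZ (measurable_oo 0 l) _ (Sq_mul hu hw)).
rewrite -(IntD (measurable_oo 0 l) (L1Z r (Sq_mul hu hw)) (Sq_mul hv hw)).
by apply: eq_Rintegral => x _; ring.
Qed.

Lemma inner_L2_ae l u v w z :
  {ae mu, forall x, x \in `]0, l[ -> u x = v x} ->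
  {ae mu, forall x, x \in `]0, l[ -> w x = z x} ->
  inner_L2 l u w = inner_L2 l v z.
Proof.
move=> uv wz; apply: Rintegral_ae_cong.
by apply: ae_mono (ae_and uv wz) => x [h1 h2] xl; rewrite h1// h2.
Qed.

Lemma inner_L2_ge0 l v : 0 <= inner_L2 l v v.
Proof. by apply: Rintegral_ge0 => x _; rewrite -expr2 sqr_ge0. Qed.

Lemma inner_L2_eq0 l v : Sq l v -> inner_L2 l v v = 0 ->
  {ae mu, forall x, x \in `]0, l[ -> v x = 0}.
Proof.
move=> hv v0.
have := @ae_eq0_of_Int _ _ _ mu _ (measurable_oo 0 l) _ (Sq_mul hv hv).
have h0 : {ae mu, forall x, x \in `]0, l[ -> 0 <= v x * v x}.
  by apply: ae_everywhere => x _; rewrite -expr2 sqr_ge0.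
move=> /(_ h0 v0); apply: ae_mono => x H /H /eqP.
by rewrite mulf_eq0 orbb => /eqP.
Qed.

End L2_interval.

(** * The energy space of the star graph *)

Section star_space.
Context (R : realType) (N : nat).
Notation mu := (@lebesgue_measure R).
Local Notation E := ('I_N -> R -> R^o).
Variable l : 'I_N -> R.
Hypotheses (N1 : (0 < N)%N) (l0 : forall i, 0 < l i).
Implicit Types (v w phi : E) (D : 'I_N -> R).
Local Notation L1 T f := (mu.-integrable `]0, T[ (EFin \o f)).
Local Notation Sq T f := (sqint mu `]0, T[ f).
Local Notation II T f := (\int[mu]_(x in `]0, T[) f x).
Local Notation b := (inner_LL2 l).

Lemma inner_L20l T f : inner_L2 T (fun=> 0 : R) f = 0.
Proof.
rewrite /inner_L2; have -> : (fun x => 0 * f x) = (fun=> 0) by apply/funext => x; rewrite mul0r.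
exact: Int0.
Qed.

(** A single [k] for all edges expresses continuity at the common vertex; the second clause is the
    Dirichlet condition at the free ends. *)
Definition graph_rep v (k : R) (g : 'I_N -> R -> R) : Prop :=
  forall i, Hrep (l i) (v i) k (g i) /\ k + prim (g i) (l i) = 0.

Definition gderive v : 'I_N -> R -> R := fun i => wderive (l i) (v i).

Definition gdot D v w : R :=
  \sum_i D i * inner_L2 (l i) (gderive v i) (gderive w i).

(* Adding the L2 product makes every eigenvalue of this form at least 1. *)
Definition energy_form D v w : R := b v w + gdot D v w.

Let li_cc i : (l i : R) \in `[0, l i].
Proof. by rewrite in_itv/= lexx ltW. Qed.

Let l0_cc i : (0 : R) \in `[0, l i].
Proof. by rewrite in_itv/= lexx ltW. Qed.

Lemma graph_rep_gderive v k g : graph_rep v k g ->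
  forall i, {ae mu, forall x, x \in `]0, l i[ -> gderive v i x = g i x}.
Proof. by move=> h i; have [h1 _] := h i; exact: Hrep_wderive h1. Qed.

Lemma graph_rep_VV v k g : graph_rep v k g -> VV l v.
Proof.
move=> h; split.
- by move=> i; apply/in_H1P => //; exists k, (g i); have [] := h i.
- move=> i j _; have [hi _] := h i; have [hj _] := h j.
  by rewrite (Hrep_trace (l0 i) hi)// (Hrep_trace (l0 j) hj)// !prim_le0.
- by move=> i; have [hi hl] := h i; rewrite (Hrep_trace (l0 i) hi).
Qed.

Lemma VV_rep v : VV l v -> exists k, graph_rep v k (gderive v).
Proof.
move=> [hH htr hl]; pose i0 := Ordinal N1.
have rep i : exists k, Hrep (l i) (v i) k (gderive v i).
  have [k [g hg]] := (in_H1P (v i) (l0 i)).1 (hH i).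
  have hw := Hrep_wderive (l0 i) hg; have [hv hgS hk] := hg.
  have [sw wd] := wderiveP (hH i).
  have [k' hk'] := (weak_derivativeP (l0 i) (SqL1 hv) (SqL1 sw)).1 wd.
  by exists k'.
have [k kP] := choice rep.
exists (k i0) => i.
have ki : k i = k i0.
  have [->//|ne] := eqVneq i i0.
  have := htr i i0 ne; rewrite (Hrep_trace (l0 i) (kP i))//.
  by rewrite (Hrep_trace (l0 i0) (kP i0))// !prim_le0// !addr0.
rewrite -ki; split; first exact: kP.
by rewrite -(Hrep_trace (l0 i) (kP i))// hl.
Qed.

Lemma graph_rep_lin v1 k1 g1 v2 k2 g2 (r : R) :
  graph_rep v1 k1 g1 -> graph_rep v2 k2 g2 ->
  graph_rep (fun i x => r * v1 i x + v2 i x) (r * k1 + k2)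
    (fun i x => r * g1 i x + g2 i x).
Proof.
move=> h1 h2 i; have [a1 e1] := h1 i; have [a2 e2] := h2 i.
split; first exact: Hrep_lin.
have [_ s1 _] := a1; have [_ s2 _] := a2.
rewrite (primD (L1Z r (SqL1 s1)) (SqL1 s2) (lexx _)) (primZ r (SqL1 s1) (lexx _)).
by rewrite addrACA -mulrDr e1 e2 mulr0 addr0.
Qed.

Lemma graph_rep0 : graph_rep (fun _ _ => 0) 0 (fun _ _ => 0).
Proof.
have p0 t : prim (fun=> 0) t = 0 :> R by rewrite /prim Int0.
move=> i; split; last by rewrite p0 addr0.
have s0 : Sq (l i) (fun=> 0) := Sq_cst (l i) 0.
by split=> //; apply: ae_everywhere => x _; rewrite p0 addr0.
Qed.

Lemma subspace_VV : subspace_set (VV l : set E).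
Proof.
split.
- exact: graph_rep_VV graph_rep0.
- move=> v w /VV_rep[k h] /VV_rep[k' h'].
  have -> : v + w = (fun i x => 1 * v i x + w i x).
    by apply/funext => i; apply/funext => x; rewrite mul1r.
  exact: graph_rep_VV (graph_rep_lin 1 h h').
- move=> r v /VV_rep[k h].
  have -> : r *: v = (fun i x => r * v i x + 0).
    by apply/funext => i; apply/funext => x; rewrite addr0.
  exact: graph_rep_VV (graph_rep_lin r h graph_rep0).
Qed.

Lemma LL2P v : LL2 l v <-> forall i, Sq (l i) (v i).
Proof. by split=> h i; apply/in_L2P; exact: h. Qed.

Lemma subspace_LL2 : subspace_set (LL2 l : set E).
Proof.
split.
- by apply/LL2P => i; exact: Sq_cst.
- by move=> v w /LL2P hv /LL2P hw; apply/LL2P => i; exact: (SqD (hv i) (hw i)).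
- by move=> r v /LL2P hv; apply/LL2P => i; exact: (SqZ r (hv i)).
Qed.

Lemma VV_LL2 v : VV l v -> LL2 l v.
Proof. by move=> [h _ _] i; have [] := h i. Qed.

Lemma semi_ip_LL2 : semi_ip (LL2 l : set E) b.
Proof.
split.
- by move=> v w _ _; apply: eq_bigr => i _; exact: inner_L2C.
- move=> u v w /LL2P hu /LL2P hv /LL2P hw; rewrite -big_split/=; apply: eq_bigr => i _.
  rewrite -[inner_L2 _ (u i) _]mul1r -(inner_L2_lin 1 (hu i) (hv i) (hw i)).
  by apply: eq_Rintegral => x _; rewrite mul1r.
- move=> r v w /LL2P hv /LL2P hw; rewrite [RHS]big_distrr/=; apply: eq_bigr => i _.
  have := inner_L2_lin r (hv i) (Sq_cst (l i) 0) (hw i).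
  rewrite inner_L20l addr0 => <-.
  by apply: eq_Rintegral => x _; rewrite addr0.
- by move=> v _; apply: sumr_ge0 => i _; exact: inner_L2_ge0.
Qed.

Lemma gderive_Sq v i : VV l v -> Sq (l i) (gderive v i).
Proof. by move=> /VV_rep[k] /(_ i) [[]]. Qed.

Lemma gderive_lin (r : R) v w : VV l v -> VV l w -> forall i,
  {ae mu, forall x, x \in `]0, l i[ ->
    gderive (r *: v + w) i x = r * gderive v i x + gderive w i x}.
Proof.
move=> /VV_rep[k h] /VV_rep[k' h'] i.
exact: (graph_rep_gderive (graph_rep_lin r h h')).
Qed.

Lemma inner_gderive_lin (r : R) u v (w : E) i : VV l u -> VV l v -> VV l w ->
  inner_L2 (l i) (gderive (r *: u + v) i) (gderive w i) =
  r * inner_L2 (l i) (gderive u i) (gderive w i) + inner_L2 (l i) (gderive v i) (gderive w i).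
Proof.
move=> hu hv hw; rewrite -(inner_L2_lin r (gderive_Sq i hu) (gderive_Sq i hv) (gderive_Sq i hw)).
by apply: inner_L2_ae; [exact: gderive_lin|exact: ae_everywhere].
Qed.

Lemma gderive0_inner (v : E) i : inner_L2 (l i) (gderive 0 i) (gderive v i) = 0.
Proof.
rewrite (@inner_L2_ae _ _ _ (fun=> 0) _ (gderive v i)).
- exact: inner_L20l.
- exact: (graph_rep_gderive graph_rep0).
- exact: ae_everywhere.
Qed.

Lemma gdotC D v w : gdot D v w = gdot D w v.
Proof. by apply: eq_bigr => i _; rewrite inner_L2C. Qed.

Lemma gdotDl D u v w : VV l u -> VV l v -> VV l w ->
  gdot D (u + v) w = gdot D u w + gdot D v w.
Proof.
move=> hu hv hw; rewrite /gdot -big_split; apply: eq_bigr => i _ /=.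
by rewrite -mulrDr -{1}[u]scale1r inner_gderive_lin// mul1r.
Qed.

Lemma gdotZl D (r : R) v w : VV l v -> VV l w -> gdot D (r *: v) w = r * gdot D v w.
Proof.
move=> hv hw; have V0 : VV l (0 : E) := sub0 subspace_VV.
rewrite /gdot big_distrr/=; apply: eq_bigr => i _.
have H := inner_gderive_lin r i hv V0 hw.
have E0 : r *: v + 0 = r *: v := addr0 _.
by rewrite gderive0_inner E0 addr0 in H; rewrite H mulrCA.
Qed.

Lemma gdot_ge0 D v : (forall i, 0 <= D i) -> 0 <= gdot D v v.
Proof. by move=> D0; apply: sumr_ge0 => i _; rewrite mulr_ge0// inner_L2_ge0. Qed.

Lemma semi_ip_energy D : (forall i, 0 <= D i) -> semi_ip (VV l : set E) (energy_form D).
Proof.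
move=> D0; have [bC bD bZ bp] := semi_ip_LL2.
split.
- by move=> v w hv hw; rewrite /energy_form (bC _ _ (VV_LL2 hv) (VV_LL2 hw)) gdotC.
- move=> u v w hu hv hw.
  by rewrite /energy_form (bD _ _ _ (VV_LL2 hu) (VV_LL2 hv) (VV_LL2 hw)) gdotDl// addrACA.
- move=> r v w hv hw.
  by rewrite /energy_form (bZ _ _ _ (VV_LL2 hv) (VV_LL2 hw)) gdotZl// mulrDr.
- by move=> v hv; apply: addr_ge0; [exact: bp (VV_LL2 hv)|exact: gdot_ge0].
Qed.

Lemma energy_ge_L2 D v : (forall i, 0 <= D i) -> b v v <= energy_form D v v.
Proof. by move=> D0; rewrite lerDl gdot_ge0. Qed.

(** The Dirichlet condition turns the value at [x] into minus the integral of [g i] over []x, l i[],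
    to which Cauchy-Schwarz applies. *)
Lemma graph_rep_sup v k g : graph_rep v k g -> forall i x, x \in `[0, l i] ->
  (k + prim (g i) x) ^+ 2 <= l i * inner_L2 (l i) (g i) (g i).
Proof.
move=> h i x; rewrite in_itv/= => /andP[x0 xl]; have [[_ sg _] e] := h i.
have -> : k + prim (g i) x = - (prim (g i) (l i) - prim (g i) x).
  by move/eqP: e; rewrite addr_eq0 => /eqP ->; ring.
rewrite sqrrN; apply: le_trans (prim_cauchy_schwarz sg x0 xl (lexx _)) _.
by rewrite ler_wpM2r ?Int_sqr_ge0// gerBl.
Qed.

Lemma Sq_bound (T : R) (v : R -> R) (K : R) : 0 <= T -> Sq T v ->
  {ae mu, forall x, x \in `]0, T[ -> v x ^+ 2 <= K} -> inner_L2 T v v <= K * T.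
Proof.
move=> T0 sv H; rewrite -[K * T](prim_cst K T0).
by apply: (prim_ae_le sv.2 (L1_cst T K) (lexx _) H).
Qed.

Lemma poincare v k g : graph_rep v k g -> forall i,
  inner_L2 (l i) (v i) (v i) <= l i ^+ 2 * inner_L2 (l i) (g i) (g i).
Proof.
move=> h i; have [[sv sg vk] e] := h i.
have -> : l i ^+ 2 * inner_L2 (l i) (g i) (g i) = l i * inner_L2 (l i) (g i) (g i) * l i by ring.
apply: Sq_bound => //; first exact: ltW.
apply: ae_mono vk => x H xl; rewrite H//; apply: (graph_rep_sup h).
exact: subset_itv_oo_cc xl.
Qed.

Lemma Sq_prim T (k : R) g : 0 <= T -> L1 T g -> Sq T (fun x => k + prim g x).
Proof.
move=> T0 hg; have hA : AC T k g (fun x => k + prim g x) by split.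
by split; [exact: AC_measurable hA|exact: AC_L1 (AC_sqr T0 hA)].
Qed.

Lemma energy_form_le v k g D : graph_rep v k g ->
  energy_form D v v <= \sum_i (l i ^+ 2 + D i) * inner_L2 (l i) (g i) (g i).
Proof.
move=> h; rewrite /energy_form /inner_LL2 /gdot -big_split/=; apply: ler_sum => i _.
rewrite mulrDl; apply: lerD; first exact: poincare h _.
rewrite (_ : inner_L2 (l i) (gderive v i) (gderive v i) = inner_L2 (l i) (g i) (g i))//.
by apply: inner_L2_ae; exact: graph_rep_gderive h i.
Qed.

Lemma inner_gderive_le D v i : (forall i, 0 < D i) -> VV l v ->
  inner_L2 (l i) (gderive v i) (gderive v i) <= energy_form D v v / D i.
Proof.
move=> D0 hv; rewrite ler_pdivlMr// mulrC.
have h0 := ip_ge0 semi_ip_LL2 (VV_LL2 hv).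
have -> : energy_form D v v = b v v + gdot D v v by [].
rewrite -[leLHS]add0r; apply: lerD => //; rewrite /gdot (bigD1 i)//= lerDl.
by apply: sumr_ge0 => j _; rewrite mulr_ge0 ?inner_L2_ge0// ltW.
Qed.

(** A function that vanishes almost everywhere is represented by zero data, so its weak derivative
    vanishes almost everywhere as well. *)
Lemma energy_definite D v : VV l v -> b v v = 0 -> energy_form D v v = 0.
Proof.
move=> hv v0; rewrite /energy_form v0 add0r /gdot big1// => i _.
have /LL2P sv := VV_LL2 hv.
have vi0 : inner_L2 (l i) (v i) (v i) = 0.
  move: v0; rewrite /inner_LL2 => /eqP; rewrite psumr_eq0 => [|j _]; last exact: inner_L2_ge0.
  by move=> /allP/(_ i); rewrite mem_index_enum => /(_ isT)/eqP.
have ae0 := inner_L2_eq0 (sv i) vi0.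
have h0 : Hrep (l i) (v i) 0 (fun=> 0).
  split => //; first exact: Sq_cst.
  by apply: ae_mono ae0 => x H /H ->; rewrite add0r /prim Int0.
rewrite (@inner_L2_ae _ _ _ (fun=> 0) _ (gderive v i)); last 2 first.
- exact: Hrep_wderive (l0 i) h0.
- exact: ae_everywhere.
by rewrite inner_L20l mulr0.
Qed.

Lemma gderiveB v w : VV l v -> VV l w -> forall i,
  {ae mu, forall x, x \in `]0, l i[ ->
    gderive (v - w) i x = gderive v i x - gderive w i x}.
Proof.
move=> hv hw i; have := gderive_lin (-1) hw hv i.
have -> : -1 *: w + v = v - w by rewrite scaleN1r addrC.
by apply: ae_mono => x H /H ->; rewrite mulN1r addrC.
Qed.

(** The derivatives converge in L2 on each edge, and the limit vector is rebuilt as a primitive.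
    What has to be shown is that the edges agree at the vertex. *)
Lemma energy_complete D : (forall i, 0 < D i) ->
  forall u : nat -> E, (forall n, VV l (u n)) ->
  (forall e, 0 < e -> exists N, forall m n, (N <= m)%N -> (N <= n)%N ->
     energy_form D (u m - u n) (u m - u n) <= e) ->
  exists2 v, VV l v & forall e, 0 < e -> exists N, forall n, (N <= n)%N ->
     energy_form D (u n - v) (u n - v) <= e.
Proof.
move=> D0 u hu cu; pose i0 := Ordinal N1.
have G i : exists2 g, Sq (l i) g & forall e, 0 < e -> exists N, forall n, (N <= n)%N ->
    II (l i) (fun x => (gderive (u n) i x - g x) ^+ 2) <= e.
  apply: (riesz_fischer (measurable_oo 0 (l i)) (mu_oo_fin 0 (l i))) => [n|e e0]; first exact: gderive_Sq.
  have [M HM] := cu _ (mulr_gt0 e0 (D0 i)).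
  exists M => m n Mm Mn; have := HM m n Mm Mn.
  have -> : II (l i) (fun x => (gderive (u m) i x - gderive (u n) i x) ^+ 2) =
      inner_L2 (l i) (gderive (u m - u n) i) (gderive (u m - u n) i).
    apply: Rintegral_ae_cong; apply: ae_mono (gderiveB (hu m) (hu n) i) => x H xl.
    by rewrite H.
  rewrite -ler_pdivrMr//; apply: le_trans; apply: inner_gderive_le => //.
  exact: (subB subspace_VV).
have [g gP] := choice (fun i => (let: ex_intro2 g h1 h2 := G i in ex_intro _ g (conj h1 h2) : exists g, _ /\ _)).
have sg i := (gP i).1.
have K i : forall n, exists k, k + prim (gderive (u n) i) (l i) = 0 /\ graph_rep (u n) k (gderive (u n)).
  by move=> n; have [k h] := VV_rep (hu n); exists k; split => //; have [] := h i.
(* The vertex value of [u n] converges to each side; it does not depend on the edge. *)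
have kE i j : - prim (g i) (l i) = - prim (g j) (l j).
  have lim e : 0 < e -> exists M, forall n, (M <= n)%N -> forall k, graph_rep (u n) k (gderive (u n)) ->
      (k + prim (g i) (l i)) ^+ 2 <= e /\ (k + prim (g j) (l j)) ^+ 2 <= e.
    move=> e0.
    have one i' : exists M, forall n, (M <= n)%N -> forall k, graph_rep (u n) k (gderive (u n)) ->
      (k + prim (g i') (l i')) ^+ 2 <= e.
      have [M HM] := (gP i').2 _ (divr_gt0 e0 (l0 i')).
      exists M => n Mn k h; have [[_ sn _] e1] := h i'.
      have -> : k + prim (g i') (l i') = - prim (fun x => gderive (u n) i' x - g i' x) (l i').
        rewrite [X in - X](_ : _ = prim (gderive (u n) i') (l i') - prim (g i') (l i')); last first.
          exact: (IntB (measurable_oo 0 (l i')) (SqL1 sn) (SqL1 (sg i'))).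
        by move/eqP: e1; rewrite addr_eq0 => /eqP ->; rewrite opprB addrC.
      rewrite sqrrN; have := prim_cauchy_schwarz (SqB sn (sg i')) (lexx _) (ltW (l0 i')) (lexx _).
      rewrite (@prim_le0 _ _ 0 (lexx _)) !subr0 => /le_trans; apply.
      by rewrite mulrC -ler_pdivlMr//; exact: HM.
    have [M1 H1] := one i; have [M2 H2] := one j.
    exists (maxn M1 M2) => n; rewrite geq_max => /andP[h1 h2] k h.
    by split; [exact: H1 h|exact: H2 h].
  apply/eqP; rewrite -subr_eq0 -sqrf_eq0 eq_le sqr_ge0 andbT.
  apply/ler_addgt0Pr => e e0; rewrite add0r.
  have e4 : 0 < e / 4 by rewrite divr_gt0.
  have [M HM] := lim _ e4.
  have [k [_ h]] := K i M; have [A B] := HM M (leqnn _) k h.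
  have aux (x y z : R) : (z + x) ^+ 2 <= e / 4 -> (z + y) ^+ 2 <= e / 4 -> (- x - - y) ^+ 2 <= e.
    move=> h1 h2; have := sqr_ge0 ((z + x) + (z + y)); nra.
  exact: aux A B.
pose k := - prim (g i0) (l i0).
have rv : graph_rep (fun i x => k + prim (g i) x) k g.
  move=> i; split; last by rewrite /k (kE i0 i) addNr.
  split => //; last exact: ae_everywhere.
  exact: (Sq_prim _ (ltW (l0 i)) (SqL1 (sg i))).
exists (fun i x => k + prim (g i) x) => [|e e0]; first exact: graph_rep_VV rv.
set v : E := fun i x => _ in rv *.
have hv := graph_rep_VV rv.
(* The constant of [energy_form_le]: the energy of the difference is controlled by its derivatives
   alone. *)
pose S := \sum_i (l i ^+ 2 + D i).
have S0 : 0 <= S by apply: sumr_ge0 => i _; rewrite addr_ge0 ?sqr_ge0// ltW.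
have e1 : 0 < e / (S + 1) by rewrite divr_gt0// ltr_wpDl.
have [M HM] := choice (fun i => (gP i).2 _ e1).
exists (\sum_i M i)%N => n Mn.
have [kn rn] := VV_rep (subB subspace_VV (hu n) hv).
apply: le_trans (energy_form_le D rn) _.
apply: (@le_trans _ _ (S * (e / (S + 1)))); last first.
  by rewrite mulrCA ger_pMr// ler_pdivrMr ?mul1r ?lerDl// ltr_wpDl.
rewrite /S mulr_suml; apply: ler_sum => i _; apply: ler_wpM2l.
  by rewrite addr_ge0 ?sqr_ge0// ltW.
have Min : (M i <= n)%N by apply: leq_trans Mn; rewrite (bigD1 i)//= leq_addr.
apply: le_trans (HM i n Min); rewrite le_eqVlt; apply/orP; left; apply/eqP.
apply: Rintegral_ae_cong.
apply: ae_mono (ae_and (gderiveB (hu n) hv i) (graph_rep_gderive rv i)) => x [H1 H2] xl.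
by rewrite H1// H2.
Qed.

Lemma grid_point (h : R) n x : 0 <= x -> x <= n.+1%:R * h ->
  exists2 p : 'I_n.+1, p%:R * h <= x & x <= p.+1%:R * h.
Proof.
move=> x0; elim: n => [|n IH] xn.
  by exists ord0; rewrite ?mul0r.
have [le|gt] := leP x (n.+1%:R * h).
  by have [p p1 p2] := IH le; exists (widen_ord (leqnSn _) p).
by exists ord_max => //; exact: ltW.
Qed.

Lemma traceE v k g i x : graph_rep v k g -> x \in `[0, l i] ->
  trace (l i) (v i) x = k + prim (g i) x.
Proof. by move=> h; have [hr _] := h i; exact: Hrep_trace. Qed.

(** The functionals are weighted point values on a grid of each edge. Between grid points the
    function moves by at most the square root of the mesh times the integral of the squared
    derivative. *)
Lemma energy_compact D : (forall i, 0 < D i) ->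
  forall e, 0 < e -> exists (I : finType) (L : I -> E -> R) (K : R),
  [/\ (forall k x y, VV l x -> VV l y -> L k (x - y) = L k x - L k y),
      (forall k x, VV l x -> L k x ^+ 2 <= K * energy_form D x x) &
      (forall x, VV l x -> b x x <= e * energy_form D x x + \sum_k L k x ^+ 2)].
Proof.
move=> D0 e e0.
(* With at least [A i] cells on edge [i], the oscillation term [2 * l i ^+ 2 / n.+1%:R] is at most
   [e * D i]. *)
pose A i := 2 * l i ^+ 2 / (e * D i).
have A0 i : 0 <= A i.
  by rewrite divr_ge0 ?mulr_ge0 ?sqr_ge0// ltW.
pose n := Num.bound (\sum_i A i).
have nA i : A i <= n.+1%:R.
  apply: (@le_trans _ _ (\sum_i A i)).
    by rewrite (bigD1 i)//= lerDl sumr_ge0.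
  apply: (@le_trans _ _ n%:R); last by rewrite ler_nat.
  by apply: ltW; apply: archi_boundP; rewrite sumr_ge0.
pose pt i (p : 'I_n.+1) := p%:R * (l i / n.+1%:R).
have h0 i : 0 < l i / n.+1%:R by rewrite divr_gt0.
have ptS i (p : 'I_n.+1) : p.+1%:R * (l i / n.+1%:R) <= l i.
  by rewrite mulrCA ger_pMr// ler_pdivrMr// mul1r ler_nat.
have pt_in i p : pt i p \in `[0, l i].
  rewrite in_itv/= mulr_ge0 ?(ltW (h0 i))//= (le_trans _ (ptS i p))//.
  by rewrite ler_wpM2r ?(ltW (h0 i))// ler_nat.
(* The weight makes the square of [L q v] equal to [2 * l q.1] times the squared grid value: the
   factor 2 comes from splitting a square and the length from integrating over the edge. *)
pose L (q : 'I_N * 'I_n.+1) (v : E) : R :=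
  Num.sqrt (2 * l q.1) * trace (l q.1) (v q.1) (pt q.1 q.2).
pose K := \sum_i 2 * l i ^+ 2 / D i.
have K1 i : 0 <= 2 * l i ^+ 2 / D i by rewrite divr_ge0 ?mulr_ge0 ?sqr_ge0// ltW.
have a0 (v : E) : VV l v -> 0 <= energy_form D v v.
  by move=> hv; apply: (ip_ge0 (semi_ip_energy _) hv) => i; exact: ltW.
have LE q (v : E) k g : graph_rep v k g -> L q v ^+ 2 = 2 * l q.1 * (k + prim (g q.1) (pt q.1 q.2)) ^+ 2.
  by move=> h; rewrite /L (traceE h)// exprMn sqr_sqrtr// mulr_ge0// ltW.
exists ('I_N * 'I_n.+1)%type, L, K; split.
- move=> [i p] v w hv hw; have [k rv] := VV_rep hv; have [k' rw] := VV_rep hw.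
  have r : graph_rep (v - w) (-1 * k' + k) (fun i x => -1 * gderive w i x + gderive v i x).
    have -> : v - w = (fun i x => -1 * w i x + v i x).
      by apply/funext => j; apply/funext => x; rewrite mulN1r addrC.
    exact: graph_rep_lin.
  rewrite /L /= (traceE r)// (traceE rv)// (traceE rw)//.
  have pl : pt i p <= l i by move: (pt_in i p); rewrite in_itv/= => /andP[].
  have [[_ sv _] _] := rv i; have [[_ sw _] _] := rw i.
  rewrite (primD (L1Z (-1) (SqL1 sw)) (SqL1 sv) pl) (primZ (-1) (SqL1 sw) pl).
  have aux (c x y z t : R) : c * (-1 * t + x + (-1 * z + y)) = c * (x + y) - c * (t + z) by ring.
  exact: aux.
- move=> [i p] v hv; have [k rv] := VV_rep hv; rewrite (LE _ _ _ _ rv) /=.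
  apply: (@le_trans _ _ (2 * l i ^+ 2 / D i * energy_form D v v)).
    have H1 := graph_rep_sup rv (pt_in i p).
    have H2 := inner_gderive_le i D0 hv.
    apply: (@le_trans _ _ (2 * l i * (l i * inner_L2 (l i) (gderive v i) (gderive v i)))).
      by rewrite ler_pM2l// mulr_gt0.
    have aux (c g d z : R) : 0 <= c -> g <= z / d -> 2 * c * (c * g) <= 2 * c ^+ 2 / d * z.
      move=> c0 gA; apply: (@le_trans _ _ (2 * c * (c * (z / d)))).
        by rewrite ler_wpM2l ?mulr_ge0// ler_wpM2l.
      by rewrite le_eqVlt; apply/orP; left; apply/eqP; ring.
    by apply: aux => //; exact: ltW.
  apply: ler_wpM2r; first exact: a0.
  by rewrite /K (bigD1 i)//= lerDl sumr_ge0.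
move=> v hv; have [k rv] := VV_rep hv.
have -> : \sum_q L q v ^+ 2 = \sum_i \sum_p L (i, p) v ^+ 2.
  by rewrite pair_big; apply: eq_bigr => -[].
apply: (@le_trans _ _ (\sum_i (e * (D i * inner_L2 (l i) (gderive v i) (gderive v i))
   + \sum_p L (i, p) v ^+ 2))); last first.
  rewrite big_split/= lerD2r -mulr_sumr ler_pM2l//.
  rewrite -[leLHS]add0r; apply: lerD => //.
  exact: (ip_ge0 semi_ip_LL2 (VV_LL2 hv)).
apply: ler_sum => i _.
set G := inner_L2 (l i) (gderive v i) (gderive v i).
have G0 : 0 <= G by exact: inner_L2_ge0.
pose P := \sum_p (k + prim (gderive v i) (pt i p)) ^+ 2.
have -> : \sum_p L (i, p) v ^+ 2 = 2 * P * l i.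
  rewrite /P mulr_sumr mulr_suml; apply: eq_bigr => p _; rewrite (LE _ _ _ _ rv) /=; ring.
have [[sv sg vk] _] := rv i.
have /LL2P svv := VV_LL2 hv.
(* Each point is compared with the grid point to its left; [P] sums all squared grid values, so it
   bounds any of them. *)
apply: (@le_trans _ _ ((2 * P + 2 * (l i / n.+1%:R * G)) * l i)).
  apply: Sq_bound => //; first exact: ltW.
  apply: ae_mono vk => x H xl; rewrite H//.
  move: xl; rewrite in_itv/= => /andP[/ltW x0 /ltW xl].
  have [p p1 p2] : exists2 p : 'I_n.+1, p%:R * (l i / n.+1%:R) <= x & x <= p.+1%:R * (l i / n.+1%:R).
    by apply: grid_point => //; rewrite mulrCA divff ?mulr1.
  have := pt_in i p; rewrite in_itv/= => /andP[q0 ql].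
  have CS := prim_cauchy_schwarz sg q0 p1 xl.
  have CS2 : (prim (gderive v i) x - prim (gderive v i) (pt i p)) ^+ 2 <= l i / n.+1%:R * G.
    have GG : G = II (l i) (fun x => gderive v i x ^+ 2) by [].
    apply: le_trans CS _; rewrite -GG ler_wpM2r// lerBlDl.
    by apply: le_trans p2 _; rewrite /pt -natr1 mulrDl mul1r.
  have PP : (k + prim (gderive v i) (pt i p)) ^+ 2 <= P.
    by rewrite /P (bigD1 p)//= lerDl; apply: sumr_ge0 => q _; exact: sqr_ge0.
  have aux (s t c d : R) : (s - t) ^+ 2 <= d -> (k + t) ^+ 2 <= c -> (k + s) ^+ 2 <= 2 * c + 2 * d.
    by move=> H1 H2; have := sqr_ge0 ((k + t) - (s - t)); nra.
  exact: aux CS2 PP.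
rewrite mulrDl addrC; apply: lerD => //.
have -> : 2 * (l i / n.+1%:R * G) * l i = (2 * l i ^+ 2 / n.+1%:R) * G by ring.
rewrite [leRHS]mulrA; apply: ler_wpM2r => //.
rewrite ler_pdivrMr// [leRHS]mulrC -ler_pdivrMr ?mulr_gt0//; exact: nA.
Qed.

(** A test function placed on one edge and extended by zero lies in V, so [fundamental_lemma]
    applies edge by edge. *)
Lemma VV_dense (w : E) : LL2 l w -> (forall phi, VV l phi -> b w phi = 0) ->
  forall i, {ae mu, forall x, x \in `]0, l i[ -> w i x = 0}.
Proof.
move=> /LL2P sw w0 i; apply: (fundamental_lemma (SqL1 (sw i))) => eta teta.
have [deta ceta cdeta e0 el] := test_derive teta.
pose phi : E := fun j => if j == i then eta else fun=> 0.
have cSq j (h : R -> R) : continuous h -> Sq (l j) h.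
  move=> ch; split; first exact: continuous_measurable_itv.
  apply: (@continuous_L1 _ (l j) (fun x => h x ^+ 2)) => x.
  have -> : (fun x => h x ^+ 2) = (h \* h) by apply/funext => y /=; rewrite expr2.
  by apply: continuousM; exact: ch.
have hphi : VV l phi.
  apply: (@graph_rep_VV _ 0 (fun j => if j == i then derive1 eta else fun=> 0)) => j.
  have p0 (t : R) : prim (fun=> 0) t = 0 :> R by rewrite /prim Int0.
  rewrite /phi; case: eqP => [->|_]; last first.
    by have [] := graph_rep0 j.
  split; last by rewrite add0r -(test_prim teta (ltW (l0 i))).
  split; [exact: cSq|exact: cSq|].
  apply: ae_everywhere => x; rewrite /= in_itv/= => /andP[/ltW x0 _].
  by rewrite add0r -(test_prim teta x0).
have := w0 _ hphi; rewrite /inner_LL2 (bigD1 i)//= big1 ?addr0 => [|j ji].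
  by rewrite /phi eqxx.
by rewrite /phi (negbTE ji) inner_L2C inner_L20l.
Qed.

Lemma norm_LL2_sqr v : LL2 l v -> norm_LL2 l v ^+ 2 = b v v.
Proof.
move=> /LL2P sv; rewrite sqr_sqrtr; last by apply: sumr_ge0 => i _; exact: sqr_ge0.
by apply: eq_bigr => i _; rewrite norm_L2_sqr.
Qed.

Lemma norm_HH1_sqr v : VV l v -> norm_HH1 l v ^+ 2 = energy_form (fun=> 1) v v.
Proof.
move=> hv; have [hH _ _] := hv; have /LL2P sv := VV_LL2 hv.
rewrite sqr_sqrtr; last by apply: sumr_ge0 => i _; exact: sqr_ge0.
rewrite /energy_form /gdot /inner_LL2 -big_split; apply: eq_bigr => i _ /=.
rewrite sqr_sqrtr; last by rewrite addr_ge0 ?sqr_ge0.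
by rewrite mul1r !norm_L2_sqr//; exact: gderive_Sq.
Qed.

Lemma norm_HH1_ge0 v : 0 <= norm_HH1 l v. Proof. exact: sqrtr_ge0. Qed.
Lemma norm_LL2_ge0 v : 0 <= norm_LL2 l v. Proof. exact: sqrtr_ge0. Qed.

Theorem VV_spectral_basis D : (forall i, 0 < D i) -> exists (e : nat -> E) (la : nat -> R),
  [/\ forall n, VV l (e n), forall n, 1 <= la n,
      forall i j, i != j -> b (e i) (e j) = 0,
      forall n, b (e n) (e n) = 1 \/ e n = 0 &
      (forall n w, VV l w -> energy_form D (e n) w = la n * b (e n) w) /\
      forall w, VV l w -> forall d, 0 < d -> exists N, forall n, (N <= n)%N ->
        energy_form D (w - \sum_(i < n) b (e i) w *: e i)
          (w - \sum_(i < n) b (e i) w *: e i) <= d].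
Proof.
move=> D0; have D0' i : 0 <= D i by exact: ltW.
apply: spectral_basis.
- exact: subspace_VV.
- exact: semi_ip_energy.
- have [bC bD bZ bp] := semi_ip_LL2.
  split=> [x y hx hy|x y z hx hy hz|r x z hx hz|x hx].
  + by apply: bC; exact: VV_LL2.
  + by apply: bD; exact: VV_LL2.
  + by apply: bZ; exact: VV_LL2.
  + by apply: bp; exact: VV_LL2.
- by move=> x _; exact: energy_ge_L2.
- by move=> x hx; exact: energy_definite.
- exact: energy_complete.
- exact: energy_compact.
Qed.

End star_space.

Lemma cvg0_le (R : realType) (a c : nat -> R) : (\forall k \near \oo, `|a k| <= c k) ->
  c @ \oo --> (0 : R) -> a @ \oo --> (0 : R).
Proof.
move=> ac /cvgrPdist_lt c0; apply/cvgrPdist_lt => e e0.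
have := c0 e e0 => c0'; near=> k; rewrite sub0r normrN.
have h1 : `|a k| <= c k by near: k.
have h2 : `|0 - c k| < e by near: k.
by apply: le_lt_trans h1 _; apply: le_lt_trans h2; rewrite sub0r normrN ler_norm.
Unshelve. all: by end_near. Qed.

(** * Strong measurability *)

Section bochner_measurability.
Context (R : realType).
Notation mu := (@lebesgue_measure R).
Implicit Types (T t z : R).

(** For [z >= 0] this is the integer part of [z] capped at [M], written as a count of comparisons so
    that it depends on finitely many booleans. *)
Let steps (M : nat) z : R := \sum_(a < M) (nat_of_bool (a.+1%:R <= z)%R)%:R.

Let stepsP M z : 0 <= z ->
  (M%:R <= z -> steps M z = M%:R) /\ (z < M%:R -> z - 1 <= steps M z <= z).
Proof.
move=> z0; elim: M => [|M [IH1 IH2]].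
  by split=> [_|]; rewrite ?/steps ?big_ord0// ltNge z0.
rewrite /steps big_ord_recr /= -/(steps M z); split => [Mz|zM].
  have Mz' : M%:R <= z by apply: le_trans Mz; rewrite ler_nat.
  by rewrite (IH1 Mz') Mz natr1.
have -> : (M.+1%:R <= z) = false by rewrite leNgt zM.
rewrite addr0; have [Mz|zM'] := leP M%:R z; last exact: IH2.
by rewrite IH1// Mz lerBlDr natr1 ltW.
Qed.

(** Rounding down to the grid of mesh [1 / m] on the interval from [- k] to [k], which has
    [2 * k * m] cells. *)
Let quant (k m : nat) (x : R) : R := steps (2 * k * m) ((x + k%:R) * m%:R) / m%:R - k%:R.

Let quantP k m (x : R) : (0 < m)%N -> `|x| <= k%:R -> `|quant k m x - x| <= m%:R^-1.
Proof.
move=> m0; rewrite ler_norml => /andP[x1 x2].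
have m0' : 0 < m%:R :> R by rewrite ltr0n.
have z0 : 0 <= (x + k%:R) * m%:R by apply: mulr_ge0 => //; lra.
have [h1 h2] := stepsP (2 * k * m) z0.
have zM : (x + k%:R) * m%:R <= (2 * k * m)%:R.
  by rewrite !natrM ler_pM2r//; lra.
have E : quant k m x - x = (steps (2 * k * m) ((x + k%:R) * m%:R) - (x + k%:R) * m%:R) / m%:R.
  by rewrite /quant; field; rewrite gt_eqF.
have mi0 : 0 <= (m%:R : R)^-1 by rewrite invr_ge0 ltW.
rewrite E normrM (ger0_norm mi0) -[leRHS]mul1r; apply: ler_wpM2r => //.
have [lt|ge] := ltP ((x + k%:R) * m%:R) (2 * k * m)%:R.
  by have /andP[] := h2 lt; rewrite ler_norml; lra.
rewrite (h1 ge) (_ : _ - _ = 0) ?normr0//.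
by apply/eqP; rewrite subr_eq0 eq_le ge zM.
Qed.

Context (E : lmodType R).
Variables (S : set E) (nrm : E -> R).

Definition seminorm_on : Prop :=
  [/\ (forall x, S x -> 0 <= nrm x),
      (forall x y, S x -> S y -> nrm (x + y) <= nrm x + nrm y) &
      (forall (r : R) x, S x -> nrm (r *: x) = `|r| * nrm x)].

Hypotheses (hS : subspace_set S) (hn : seminorm_on).

Lemma seminorm_ge0 x : S x -> 0 <= nrm x. Proof. by case: hn => h _ _; exact: h. Qed.

Lemma seminorm_sum (I : Type) (s : seq I) (P : pred I) (F : I -> E) :
  (forall i, P i -> S (F i)) ->
  nrm (\sum_(i <- s | P i) F i) <= \sum_(i <- s | P i) nrm (F i).
Proof.
case: hn => _ nD nZ SF; elim: s => [|i s IH].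
  by rewrite !big_nil -(scale0r (0 : E)) nZ ?normr0 ?mul0r//; exact: sub0.
rewrite !big_cons; case: ifPn => // Pi.
have Ss : S (\sum_(j <- s | P j) F j) by apply: (sub_sum hS).
by apply: le_trans (nD _ _ (SF _ Pi) Ss) _; exact: lerD.
Qed.

Lemma seminormB x y : S x -> S y -> nrm (x - y) = nrm (y - x).
Proof.
case: hn => _ nD nZ Sx Sy; have := nZ (-1) _ (subB hS Sy Sx).
by rewrite scaleN1r opprB normrN1 mul1r.
Qed.

Lemma seminorm_dist x y : S x -> S y -> `|nrm x - nrm y| <= nrm (x - y).
Proof.
move=> Sx Sy; have [_ nD _] := hn; have Sxy := subB hS Sx Sy.
have h1 := nD _ _ Sxy Sy; have h2 := nD _ _ (subB hS Sy Sx) Sx.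
rewrite !subrK in h1 h2; rewrite (seminormB Sy Sx) in h2.
by rewrite ler_norml; lra.
Qed.

Lemma simple_valued_finite (J : finType) (G : J -> E) (p : R -> J) :
  (forall c, S (G c)) -> (forall c, measurable (p @^-1` [set c])) ->
  simple_valued S (G \o p).
Proof.
move=> SG mp; split=> [|t|e]; [|exact: SG|].
  apply: (@sub_finite_set _ _ (G @` [set: J])).
    by move=> _ [t _ <-]; exists (p t).
  exact/finite_image/finite_finset.
have -> : (G \o p) @^-1` [set e] = \bigcup_(c in [set c | G c = e]) (p @^-1` [set c]).
  by apply/seteqP; split=> [t <-|t [c <- <-]]//; exists (p t).
by apply: fin_bigcup_measurable; [exact: finite_finset|move=> c _; exact: mp].
Qed.

Lemma simple_valued_comp T (s : R -> E) (h : R -> E -> R) : simple_valued S s ->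
  (forall v, S v -> measurable_fun `]0, T[ (h^~ v)) ->
  measurable_fun `]0, T[ (fun t => h t (s t)).
Proof.
move=> [fs Ss ms] mh _ B mB.
have -> : `]0, T[ `&` (fun t => h t (s t)) @^-1` B =
    \bigcup_(v in range s) (s @^-1` [set v] `&` (`]0, T[ `&` (h^~ v) @^-1` B)).
  apply/seteqP; split=> [t [tT hB]|t [v [t' _ vE] [sv [tT hB]]]].
    by exists (s t).
  by split => //=; rewrite (sv : s t = v).
apply: (@fin_bigcup_measurable _ (measurableTypeR R)) => // v [t _ <-].
apply: (@measurableI _ (measurableTypeR R)); first exact: ms.
by apply: mh => //; exact: measurable_oo.
Qed.

(** Along the simple approximations [h t (s k t)] is measurable in [t], and the Lipschitz bound
    passes to the limit. The outcome is a measurable version, since [f] itself is an arbitrary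
    representative. *)
Lemma strongly_measurable_comp T (f : R -> E) (h : R -> E -> R) (K : R -> R) :
  strongly_measurable T S nrm f ->
  (forall v, S v -> measurable_fun `]0, T[ (h^~ v)) ->
  {ae mu, forall t, t \in `]0, T[ -> forall x y, S x -> S y ->
     `|h t x - h t y| <= K t * nrm (x - y)} ->
  exists2 g, measurable_fun `]0, T[ g &
    {ae mu, forall t, t \in `]0, T[ -> h t (f t) = g t}.
Proof.
move=> [s ss cs] mh hK.
have lim : {ae mu, forall t, t \in `]0, T[ -> h t (s k t) @[k --> \oo] --> h t (f t)}.
  apply: ae_mono (ae_and cs hK) => t [H1 H2] tT; have [Sf cf] := H1 tT.
  have {}H2 := H2 tT.
  have c0 : K t * nrm (s k t - f t) @[k --> \oo] --> (0 : R).
    by rewrite -[0](mulr0 (K t)); exact: cvgMr.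
  apply/subr_cvg0; apply: (cvg0_le _ c0).
  apply: nearW => k; apply: H2 => //.
  by have [_ H _] := ss k; exact: H.
have [g mg hg] := @ae_limit_measurable _ _ _ mu `]0, T[ (fun k t => h t (s k t))
  (fun k => simple_valued_comp (ss k) mh)
  (ae_mono (fun t H tT => cvgP _ (H tT)) lim).
exists g => //; apply: ae_mono (ae_and lim hg) => t [H1 H2] tT.
exact: (cvg_unique _ (H1 tT) (H2 tT)).
Qed.

Lemma strongly_measurable_norm T (f : R -> E) : strongly_measurable T S nrm f ->
  exists2 g, measurable_fun `]0, T[ g & {ae mu, forall t, t \in `]0, T[ -> nrm (f t) = g t}.
Proof.
move=> hf; apply: (strongly_measurable_comp (h := fun _ => nrm) (K := fun=> 1) hf).
  by move=> v _; exact: measurable_cst.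
by apply: ae_everywhere => t _ x y Sx Sy; rewrite mul1r; exact: seminorm_dist.
Qed.

(** The function [t |-> nrm (f t)] is exchanged for a measurable version [n], on which the integral
    calculus above can act. *)
Lemma in_L2_bochnerP T (f : R -> E) : in_L2_bochner T S nrm f <->
  strongly_measurable T S nrm f /\
  exists2 n, sqint mu `]0, T[ n & {ae mu, forall t, t \in `]0, T[ -> nrm (f t) = n t}.
Proof.
split=> [[sf ff]|[sf [n sn fn]]]; split => //.
  have [n mn fn] := strongly_measurable_norm sf.
  by exists n => //; exact: Lnorm2_lty mn fn ff.
by rewrite /bochner_norm_ereal (Lnorm2_ae sn fn) ltry.
Qed.

Lemma norm_L2_bochnerE T (f : R -> E) n : sqint mu `]0, T[ n ->
  {ae mu, forall t, t \in `]0, T[ -> nrm (f t) = n t} ->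
  norm_L2_bochner T nrm f = Num.sqrt (\int[mu]_(t in `]0, T[) (n t ^+ 2)).
Proof. by move=> sn fn; rewrite /norm_L2_bochner /bochner_norm_ereal (Lnorm2_ae sn fn). Qed.

Lemma in_L2_bochner_comp T (f : R -> E) (h : R -> E -> R) (K : R) : 0 <= K ->
  in_L2_bochner T S nrm f -> (forall v, S v -> measurable_fun `]0, T[ (h^~ v)) ->
  {ae mu, forall t, t \in `]0, T[ ->
     (forall x y, S x -> S y -> `|h t x - h t y| <= K * nrm (x - y)) /\
     forall x, S x -> `|h t x| <= K * nrm x} ->
  exists2 g, sqint mu `]0, T[ g & {ae mu, forall t, t \in `]0, T[ -> h t (f t) = g t}.
Proof.
move=> K0 /in_L2_bochnerP[sf [n sn fn]] mh hK.
have hK1 : {ae mu, forall t, t \in `]0, T[ -> forall x y, S x -> S y ->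
     `|h t x - h t y| <= K * nrm (x - y)}.
  by apply: ae_mono hK => t H tT; have [] := H tT.
have [g mg hg] := strongly_measurable_comp (K := fun=> K) sf mh hK1.
exists g => //; apply: (sqint_ae_le _ (sqintZ (measurable_oo 0 T) K sn)); first exact: mg.
have [s ss cs] := sf.
apply: ae_mono (ae_and (ae_and cs hK) (ae_and fn hg)) => t [[H1 H2] [H3 H4]] tT.
have [Sf _] := H1 tT; rewrite -(H4 tT) normrM (ger0_norm K0) -(H3 tT).
apply: le_trans ((H2 tT).2 _ Sf) _.
by apply: ler_wpM2l => //; exact: ler_norm.
Qed.

Lemma in_L2_bochner_ae T (f : R -> E) : in_L2_bochner T S nrm f ->
  {ae mu, forall t, t \in `]0, T[ -> S (f t)}.
Proof. by move=> [[s _ cs] _]; apply: ae_mono cs => t H tT; have [] := H tT. Qed.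

(* The k-th simple function rounds the first k coefficients to a grid whose
   mesh compensates the norms of the [d j]. *)
Lemma strongly_measurable_series T (f : R -> E) (y : nat -> R -> R) (d : nat -> E) :
  (forall j, measurable_fun `]0, T[ (y j)) -> (forall j, S (d j)) ->
  {ae mu, forall t, t \in `]0, T[ -> [/\ S (f t), exists M : R, forall j, `|y j t| <= M &
     nrm (\sum_(j < k) y j t *: d j - f t) @[k --> \oo] --> (0 : R)]} ->
  strongly_measurable T S nrm f.
Proof.
move=> my0 Sd H.
pose y' j := y j \_ `]0, T[.
have my j : measurable_fun setT (y' j) by rewrite /y'; apply/(measurable_restrictT _ (measurable_oo 0 T)); exact: my0.
pose W k := \sum_(j < k) nrm (d j).
(* Rounding [k] coefficients costs at most [W k / m k] in norm; this choice makes the cost at most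
   [1 / k.+1]. *)
pose m k := (Num.bound (k.+1%:R * W k)).+1.
have W0 k : 0 <= W k by apply: sumr_ge0 => j _; exact: seminorm_ge0.
have mW k : W k / (m k)%:R <= k.+1%:R^-1.
  rewrite ler_pdivrMr ?ltr0n// mulrC ler_pdivlMr ?ltr0n// mulrC.
  apply: (@le_trans _ _ (Num.bound (k.+1%:R * W k))%:R); last by rewrite ler_nat.
  by apply: ltW; apply: archi_boundP; rewrite mulr_ge0.
(* A rounded coefficient is recorded as the outcomes of its comparisons, an element of a finite type
   with measurable level sets. *)
pose code k (x : R) : {ffun 'I_(2 * k * m k) -> bool} := [ffun a : 'I_(2 * k * m k) => a.+1%:R <= (x + k%:R) * (m k)%:R].
pose val k (c : {ffun 'I_(2 * k * m k) -> bool}) : R :=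
  (\sum_a (nat_of_bool (c a))%:R) / (m k)%:R - k%:R.
have valE k x : val k (code k x) = quant k (m k) x.
  by rewrite /val /quant /steps; congr (_ / _ - _); apply: eq_bigr => a _; rewrite ffunE.
pose p k t : {ffun 'I_k -> {ffun 'I_(2 * k * m k) -> bool}} := [ffun j : 'I_k => code k (y' j t)].
pose G k (c : {ffun 'I_k -> {ffun 'I_(2 * k * m k) -> bool}}) : E := \sum_(j < k) val k (c j) *: d j.
exists (fun k => G k \o p k).
  move=> k; apply: simple_valued_finite => [c|c].
    by apply: (sub_sum hS) => j _; exact: (subZ hS).
  have -> : p k @^-1` [set c] = \bigcap_(j in [set: 'I_k]) \bigcap_(a in [set: 'I_(2 * k * m k)])
      [set t | (a.+1%:R <= (y' j t + k%:R) * (m k)%:R) = c j a].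
    apply/seteqP; split=> [t <- j _ a _|t H'] /=; first by rewrite !ffunE.
    apply/ffunP => j; apply/ffunP => a; rewrite !ffunE; exact: (H' j I a I).
  apply: (@fin_bigcap_measurable _ (measurableTypeR R)); first exact: finite_finset.
  move=> j _; apply: (@fin_bigcap_measurable _ (measurableTypeR R)); first exact: finite_finset.
  move=> a _.
  have mw : measurable_fun setT (fun t => (y' j t + k%:R) * (m k)%:R).
    by apply: measurable_funM => //; apply: measurable_funD.
  have mA : measurable [set t | a.+1%:R <= (y' j t + k%:R) * (m k)%:R].
    have := mw measurableT `[a.+1%:R, +oo[%classic (measurable_itv _); rewrite setTI.
    by congr measurable; apply/seteqP; split => t /=; rewrite in_itv/= andbT.
  case: (c j a); first exact: mA.
  have -> : [set t | (a.+1%:R <= (y' j t + k%:R) * (m k)%:R) = false] =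
      ~` [set t | a.+1%:R <= (y' j t + k%:R) * (m k)%:R].
    by apply/seteqP; split=> t /= => [->//|/negP/negbTE].
  exact: measurableC.
apply: ae_mono H => t H tT; have [Sf [M yM] cf] := H tT; split => //.
have Sy k : S (\sum_(j < k) y j t *: d j) by apply: (sub_sum hS) => j _; exact: (subZ hS).
have SG k c : S (G k c) by apply: (sub_sum hS) => j _; exact: (subZ hS).
have [_ nD nZ] := hn.
have y'E j : y' j t = y j t by rewrite /y' patchE mem_set.
have c1 : k.+1%:R^-1 + nrm (\sum_(j < k) y j t *: d j - f t) @[k --> \oo] --> (0 : R).
  have H0 := cvgD (@cvg_harmonic R) cf; rewrite addr0 in H0; apply: H0.
apply: (cvg0_le _ c1).
(* From this rank on, every coefficient at time [t] lies in the range that the rounding resolves. *)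
exists (Num.bound `|M|) => // k /= kM.
have Mk : M <= k%:R.
  apply: le_trans (ler_norm _) _; apply: (@le_trans _ _ (Num.bound `|M|)%:R).
    by apply: ltW; apply: archi_boundP.
  by rewrite ler_nat.
rewrite ger0_norm; last by apply: seminorm_ge0; exact: (subB hS).
have -> : G k (p k t) - f t = (G k (p k t) - \sum_(j < k) y j t *: d j) + (\sum_(j < k) y j t *: d j - f t).
  by rewrite addrA subrK.
have := nD _ _ (subB hS (SG k (p k t)) (Sy k)) (subB hS (Sy k) Sf).
move=> /le_trans; apply.
rewrite lerD2r; apply: le_trans (mW k); rewrite /W mulr_suml /G -sumrB.
apply: le_trans (seminorm_sum _ _) _.
  by move=> j _; apply: (subB hS); exact: (subZ hS).
apply: ler_sum => j _; rewrite -scalerBl nZ// [leRHS]mulrC ler_wpM2r ?seminorm_ge0//.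
rewrite /p ffunE valE y'E; apply: quantP => //.
exact: le_trans (yM j) Mk.
Qed.

End bochner_measurability.

Section convergence_to_zero.
Context (R : realType).
Implicit Types (a : nat -> R).

Lemma eps_cvg0 a : (forall n, 0 <= a n) ->
  (forall e, 0 < e -> exists N, forall n, (N <= n)%N -> a n <= e) -> a @ \oo --> (0 : R).
Proof.
move=> a0 H; apply/cvgrPdist_le => e /H[N HN]; exists N => // n /= Nn.
by rewrite sub0r normrN ger0_norm// HN.
Qed.

Lemma cvg0_eps a : a @ \oo --> (0 : R) ->
  forall e, 0 < e -> exists N, forall n, (N <= n)%N -> a n <= e.
Proof.
move=> /cvgrPdist_le H e e0; have [N _ HN] := H e e0; exists N => n Nn.
by have := HN n Nn; rewrite /= sub0r normrN; apply: le_trans; exact: ler_norm.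
Qed.

Lemma sqr_cvg0 a : a n ^+ 2 @[n --> \oo] --> (0 : R) -> a @ \oo --> (0 : R).
Proof.
move=> /cvg0_eps H; apply/cvgrPdist_le => e e0.
have [N HN] := H _ (exprn_gt0 2 e0); exists N => // n /= Nn.
by rewrite sub0r normrN -ler_sqr ?nnegrE ?(ltW e0)// real_normK ?num_real// HN.
Qed.

End convergence_to_zero.

(** * Orthogonal expansions *)

Section orthogonal_system.
Context (R : realType) (E : lmodType R).
Variables (S : set E) (p : E -> E -> R) (e : nat -> E).
Hypotheses (hS : subspace_set S) (hp : semi_ip S p) (Se : forall n, S (e n)).
Hypothesis orth : forall i j, i != j -> p (e i) (e j) = 0.
Implicit Types (x : nat -> R) (w z : E).

Lemma osum_in m n x : S (\sum_(m <= i < n) x i *: e i).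
Proof. by apply: (sub_sum hS) => i _; exact: (subZ hS). Qed.

Lemma osum_ip m n x w : S w ->
  p (\sum_(m <= i < n) x i *: e i) w = \sum_(m <= i < n) x i * p (e i) w.
Proof.
move=> Sw; rewrite (ip_suml hS hp)// => [|i _]; last exact: (subZ hS).
by apply: eq_bigr => i _; rewrite (ipZl hp).
Qed.

Lemma osum_coef m n x j : (m <= j < n)%N ->
  p (e j) (\sum_(m <= i < n) x i *: e i) = x j * p (e j) (e j).
Proof.
move=> jmn; rewrite (ip_sumr hS hp)// => [|i _]; last exact: (subZ hS).
rewrite (bigD1_seq j) ?mem_index_iota ?iota_uniq//= (ipZr hS hp)// big1 ?addr0// => i ij.
by rewrite (ipZr hS hp)// orth ?mulr0// eq_sym.
Qed.

Lemma osum_sqr m n x :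
  p (\sum_(m <= i < n) x i *: e i) (\sum_(m <= i < n) x i *: e i) =
  \sum_(m <= i < n) p (e i) (e i) * x i ^+ 2.
Proof.
rewrite osum_ip; last exact: osum_in.
by apply: eq_big_nat => i imn; rewrite osum_coef//; ring.
Qed.

Lemma ip_cvg_sqr (u : nat -> E) w : (forall n, S (u n)) -> S w ->
  p (u n - w) (u n - w) @[n --> \oo] --> (0 : R) ->
  (forall z, S z -> p z (u n) @[n --> \oo] --> p z w) /\
  p (u n) (u n) @[n --> \oo] --> p w w.
Proof.
move=> Su Sw h; have Suw n : S (u n - w) by exact: (subB hS).
have H z : S z -> p z (u n - w) @[n --> \oo] --> (0 : R).
  move=> Sz; apply: sqr_cvg0.
  have c : p z z * p (u n - w) (u n - w) @[n --> \oo] --> (0 : R).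
    by rewrite -[0](mulr0 (p z z)); exact: cvgMr.
  apply: (cvg0_le _ c); apply: nearW => n.
  by rewrite ger0_norm ?sqr_ge0//; exact: (ip_cauchy_schwarz hS hp).
split=> [z Sz|].
  apply/subr_cvg0; have -> : (fun n => p z (u n) - p z w) = (fun n => p z (u n - w)).
    by apply/funext => n; rewrite (ipBr hS hp).
  exact: H.
have -> : (fun n => p (u n) (u n)) = (fun n => p w w + 2 * p w (u n - w) + p (u n - w) (u n - w)).
  apply/funext => n; have {1 2}-> : u n = (u n - w) + w by rewrite subrK.
  rewrite (ip_sqD hS hp (Suw n) Sw) (ipC hp (Suw n) Sw); ring.
rewrite -[X in _ --> X]addr0; apply: cvgD => //.
rewrite -[X in _ --> X]addr0; apply: cvgD; first exact: cvg_cst.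
by rewrite -[0](mulr0 2); apply: cvgMr; exact: H.
Qed.

Lemma osum_complete x B :
  (forall u : nat -> E, (forall n, S (u n)) ->
    (forall d, 0 < d -> exists N, forall m n, (N <= m)%N -> (N <= n)%N ->
       p (u m - u n) (u m - u n) <= d) ->
    exists2 v, S v & forall d, 0 < d -> exists N, forall n, (N <= n)%N ->
       p (u n - v) (u n - v) <= d) ->
  (forall J, \sum_(0 <= j < J) p (e j) (e j) * x j ^+ 2 <= B) ->
  exists2 w, S w & let s n := \sum_(0 <= i < n) x i *: e i in
    p (s n - w) (s n - w) @[n --> \oo] --> (0 : R).
Proof.
move=> complete xB.
pose s n := \sum_(0 <= i < n) x i *: e i.
have Ss n : S (s n) by exact: osum_in.
have x0 j : 0 <= p (e j) (e j) * x j ^+ 2 by rewrite mulr_ge0 ?sqr_ge0//; exact: (ip_ge0 hp).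
have [d d0|w Sw H] := complete s Ss.
  have [N HN] := series_cauchy x0 xB d0; exists N.
  have aux m n : (N <= m)%N -> (m <= n)%N -> p (s n - s m) (s n - s m) <= d.
    move=> Nm mn; have -> : s n - s m = \sum_(m <= i < n) x i *: e i.
      by rewrite /s (big_cat_nat (leq0n m) mn) /= addrAC subrr add0r.
    by rewrite osum_sqr HN.
  move=> m n Nm Nn; have [mn|/ltnW nm] := leqP m n; last exact: (aux n m).
  by rewrite (ip_sqBC hS hp (Ss m) (Ss n)); exact: (aux m n).
exists w => //; apply: eps_cvg0 => //= n.
exact: (ip_ge0 hp (subB hS (Ss n) Sw)).
Qed.

(** The factor [p (e j) (e j)] is kept so that the lemma serves both forms: for [b] it is 1 or 0,
    for [a] it is [la j] or 0. *)
Lemma osum_limit x w : S w ->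
  (let s n := \sum_(0 <= i < n) x i *: e i in
    p (s n - w) (s n - w) @[n --> \oo] --> (0 : R)) ->
  (forall j, p (e j) w = x j * p (e j) (e j)) /\
  \sum_(0 <= i < n) p (e i) (e i) * x i ^+ 2 @[n --> \oo] --> p w w.
Proof.
move=> Sw /= h.
have [h1 h2] := ip_cvg_sqr (fun n => osum_in 0 n x) Sw h.
split=> [j|]; last by under eq_fun do rewrite -osum_sqr.
have h3 : p (e j) (\sum_(0 <= i < n) x i *: e i) @[n --> \oo] --> x j * p (e j) (e j).
  apply: cvg_near_cst; exists j.+1 => // n /= jn.
  by rewrite osum_coef.
exact: (cvg_unique _ (h1 _ (Se j)) h3).
Qed.

End orthogonal_system.

(** * Expansion of vectors and of bounded functionals in the spectral basis *)

Section expansion.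
Context (R : realType) (E : lmodType R).
Variables (S : set E) (a b : E -> E -> R) (e : nat -> E) (la : nat -> R).
Hypotheses (hS : subspace_set S) (ha : semi_ip S a) (hb : semi_ip S b).
Hypothesis ba : forall x, S x -> b x x <= a x x.
Hypotheses (Se : forall n, S (e n)) (la1 : forall n, 1 <= la n).
Hypothesis orth : forall i j, i != j -> b (e i) (e j) = 0.
Hypothesis unit : forall n, b (e n) (e n) = 1 \/ e n = 0.
Hypothesis eigen : forall n w, S w -> a (e n) w = la n * b (e n) w.
Hypothesis basis : forall w, S w -> forall d, 0 < d -> exists N, forall n, (N <= n)%N ->
  a (w - \sum_(i < n) b (e i) w *: e i) (w - \sum_(i < n) b (e i) w *: e i) <= d.
Implicit Types (w : E) (x : nat -> R).

Let la0 j : 0 < la j. Proof. exact: lt_le_trans (la1 j). Qed.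

Lemma basis_orth_a i j : i != j -> a (e i) (e j) = 0.
Proof. by move=> ij; rewrite eigen// orth// mulr0. Qed.

Lemma coef_unit j w : S w -> b (e j) w * b (e j) (e j) = b (e j) w.
Proof.
move=> Sw; have [->|->] := unit j; first by rewrite mulr1.
by rewrite !(ip0l hS hb) ?mul0r//; exact: (sub0 hS).
Qed.

Lemma basis_sqr w j : S w -> a (e j) (e j) * b (e j) w ^+ 2 = la j * b (e j) w ^+ 2.
Proof. by move=> Sw; rewrite eigen// expr2 mulrA -(mulrA (la j)) (mulrC (b (e j) (e j))) coef_unit// mulrA. Qed.

Lemma basis_cvg w : S w ->
  (let s n := \sum_(0 <= i < n) b (e i) w *: e i in
    a (s n - w) (s n - w) @[n --> \oo] --> (0 : R)).
Proof.
move=> Sw /=; have Ss n := osum_in hS Se 0 n (fun i => b (e i) w).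
apply: eps_cvg0 => [n|d /(basis Sw)[N HN]]; first by apply: (ip_ge0 ha); exact: (subB hS).
exists N => n Nn; rewrite (ip_sqBC hS ha)// big_mkord; exact: HN.
Qed.

Lemma parseval_a w : S w ->
  \sum_(0 <= i < n) la i * b (e i) w ^+ 2 @[n --> \oo] --> a w w.
Proof.
move=> Sw; have [_] := osum_limit hS ha Se basis_orth_a Sw (basis_cvg Sw).
by under eq_fun do under eq_bigr do rewrite basis_sqr//.
Qed.

Lemma parseval_b w : S w -> \sum_(0 <= i < n) b (e i) w ^+ 2 @[n --> \oo] --> b w w.
Proof.
move=> Sw; have Ss n := osum_in hS Se 0 n (fun i => b (e i) w).
have cb : (let s n := \sum_(0 <= i < n) b (e i) w *: e i in
    b (s n - w) (s n - w) @[n --> \oo] --> (0 : R)).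
  apply: (cvg0_le _ (basis_cvg Sw)); apply: nearW => n.
  have Sd := subB hS (Ss n) Sw.
  by rewrite ger0_norm ?ba//; exact: (ip_ge0 hb).
have [_] := osum_limit hS hb Se orth Sw cb.
have E1 i : b (e i) (e i) * b (e i) w ^+ 2 = b (e i) w ^+ 2.
  by rewrite expr2 mulrA (mulrC (b _ _)) coef_unit.
by under eq_fun do under eq_bigr do rewrite E1.
Qed.

Lemma sum_le_lim (y : nat -> R) (c : R) J : (forall j, 0 <= y j) ->
  \sum_(0 <= i < n) y i @[n --> \oo] --> c -> \sum_(0 <= i < J) y i <= c.
Proof.
move=> y0 h; apply: (cvgr_to_ge h); exists J => // n /= Jn.
exact: sum_le_mono.
Qed.

Lemma bessel_a w J : S w -> \sum_(0 <= i < J) la i * b (e i) w ^+ 2 <= a w w.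
Proof.
move=> Sw; apply: sum_le_lim (parseval_a Sw) => j.
by rewrite mulr_ge0 ?sqr_ge0// ltW.
Qed.

Variables (F : E -> R) (K : R).
Hypothesis linF : forall (r : R) v w, S v -> S w -> F (r *: v + w) = r * F v + F w.
Hypotheses (K0 : 0 <= K) (FK : forall w, S w -> `|F w| <= K * Num.sqrt (a w w)).

Lemma linF0 : F 0 = 0.
Proof.
have := linF 1 (sub0 hS) (sub0 hS); rewrite scaler0 addr0 mul1r => h.
by apply: (addrI (F 0)); rewrite addr0 -h.
Qed.

Lemma linF_sum m n x : F (\sum_(m <= i < n) x i *: e i) = \sum_(m <= i < n) x i * F (e i).
Proof.
have [mn|nm] := leqP m n; last by rewrite !big_geq ?linF0// ltnW.
elim: n mn => [|n IH]; first by rewrite leqn0 => /eqP ->; rewrite !big_geq ?linF0.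
rewrite leq_eqVlt => /predU1P[<-|]; first by rewrite !big_geq ?linF0.
rewrite ltnS => mn; rewrite !big_nat_recr//= addrC linF// ?IH 1?addrC//.
exact: osum_in.
Qed.

Lemma linFB v w : S v -> S w -> F (v - w) = F v - F w.
Proof.
move=> Sv Sw; have := linF (-1) Sw Sv.
by rewrite scaleN1r addrC => ->; rewrite mulN1r addrC.
Qed.

(** [F] is tested on the truncation of its own Riesz representative for [a], with coefficients
    [F (e j) / la j]: both its value there and the squared norm of that vector equal the sum. *)
Lemma dual_bessel J : \sum_(0 <= j < J) F (e j) ^+ 2 / la j <= K ^+ 2.
Proof.
pose x j := F (e j) / la j.
set s := \sum_(0 <= j < J) _.
have s0 : 0 <= s by apply: sumr_ge0 => j _; rewrite divr_ge0 ?sqr_ge0// ltW.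
have Fs : F (\sum_(0 <= i < J) x i *: e i) = s.
  by rewrite linF_sum; apply: eq_bigr => j _; rewrite /x; ring.
have as_ : a (\sum_(0 <= i < J) x i *: e i) (\sum_(0 <= i < J) x i *: e i) = s.
  rewrite (osum_sqr hS ha Se basis_orth_a); apply: eq_bigr => j _.
  rewrite eigen// /x; have [->|e0] := unit j; last by rewrite e0 linF0 !(mul0r, expr0n, mulr0).
  by field; rewrite gt_eqF.
have := FK (osum_in hS Se 0 J x); rewrite Fs as_ ger0_norm// => h.
have q0 := sqrtr_ge0 s.
have ss : s = Num.sqrt s ^+ 2 by rewrite sqr_sqrtr.
rewrite ss ler_pXn2r ?nnegrE//.
have [q00|qn0] := eqVneq (Num.sqrt s) 0; first by rewrite q00.
by move: h; rewrite {1}ss expr2 ler_pM2r// lt_neqAle eq_sym qn0.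
Qed.

Lemma dual_expansion w : S w ->
  \sum_(0 <= j < n) b (e j) w * F (e j) @[n --> \oo] --> F w.
Proof.
move=> Sw; have Ss n := osum_in hS Se 0 n (fun i => b (e i) w).
apply/subr_cvg0; apply: sqr_cvg0.
have c : K ^+ 2 * a (\sum_(0 <= i < n) b (e i) w *: e i - w) (\sum_(0 <= i < n) b (e i) w *: e i - w)
    @[n --> \oo] --> (0 : R).
  by rewrite -[X in _ --> X](mulr0 (K ^+ 2)); apply: cvgMr; exact: basis_cvg.
apply: (cvg0_le _ c); apply: nearW => n.
rewrite -linF_sum -linFB//; have Sd := subB hS (Ss n) Sw; have := FK Sd.
set d := _ - w in Sd *; move=> h.
rewrite normrX -(sqr_sqrtr (ip_ge0 ha Sd)) -exprMn ler_pXn2r ?nnegrE//.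
by rewrite mulr_ge0 ?sqrtr_ge0.
Qed.

(** Cauchy-Schwarz on the tail with weights [1 / la j] and [la j]. It bounds the truncation error of
    [F] in the dual norm, as strong measurability in the dual space requires. *)
Lemma dual_tail (tau : R) J w : S w ->
  (forall n, \sum_(J <= j < n) F (e j) ^+ 2 / la j <= tau) ->
  `|F w - \sum_(0 <= j < J) b (e j) w * F (e j)| <= Num.sqrt tau * Num.sqrt (a w w).
Proof.
move=> Sw ht.
have tau0 : 0 <= tau by have := ht 0; rewrite big_geq.
have aw0 := ip_ge0 ha Sw.
have H : (F w - \sum_(0 <= j < J) b (e j) w * F (e j)) ^+ 2 <= tau * a w w.
  have c : (\sum_(0 <= j < n) b (e j) w * F (e j) - \sum_(0 <= j < J) b (e j) w * F (e j)) ^+ 2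
      @[n --> \oo] --> (F w - \sum_(0 <= j < J) b (e j) w * F (e j)) ^+ 2.
    by apply: cvg_sqr; apply: cvgB; [exact: dual_expansion|exact: cvg_cst].
  apply: (cvgr_to_le c); exists J => // n /= Jn.
  rewrite (big_cat_nat (leq0n J) Jn) /= addrAC subrr add0r.
  apply: discr_le => t.
  (* The quadratic is split into the slack in [ht], the slack in the Bessel inequality, and a
     weighted sum of squares. *)
  have -> : tau + t * ((\sum_(J <= j < n) b (e j) w * F (e j)) *+ 2) + t ^+ 2 * a w w =
    (tau - \sum_(J <= j < n) F (e j) ^+ 2 / la j) + t ^+ 2 * (a w w - \sum_(J <= j < n) la j * b (e j) w ^+ 2)
     + \sum_(J <= j < n) la j * (F (e j) / la j + t * b (e j) w) ^+ 2.
    have -> : \sum_(J <= j < n) la j * (F (e j) / la j + t * b (e j) w) ^+ 2 =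
      \sum_(J <= j < n) F (e j) ^+ 2 / la j + t * ((\sum_(J <= j < n) b (e j) w * F (e j)) *+ 2)
       + t ^+ 2 * (\sum_(J <= j < n) la j * b (e j) w ^+ 2).
      rewrite -sumrMnl !mulr_sumr -!big_split; apply: eq_bigr => j _ /=.
      by field; rewrite gt_eqF.
    by ring.
  have h1 := ht n.
  have h2 : \sum_(J <= j < n) la j * b (e j) w ^+ 2 <= a w w.
    apply: le_trans (bessel_a n Sw); apply: sum_tail_le => j.
    by rewrite mulr_ge0 ?sqr_ge0// ltW.
  apply: addr_ge0; last by apply: sumr_ge0 => j _; rewrite mulr_ge0 ?sqr_ge0// ltW.
  by apply: addr_ge0; [rewrite subr_ge0|rewrite mulr_ge0 ?sqr_ge0 ?subr_ge0].
rewrite -sqrtrM// -sqrtr_sqr; exact: ler_wsqrtr.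
Qed.

Lemma dual_eq0 w : S w -> (forall j, F (e j) = 0) -> F w = 0.
Proof.
move=> Sw F0; have := dual_expansion Sw; under eq_fun do under eq_bigr do rewrite F0 mulr0.
under eq_fun do rewrite big1//.
by move=> h; apply/esym; apply: (cvg_unique _ (cvg_cst (0 : R)) h).
Qed.

End expansion.

(** * The drift term *)

Section sections_of_plane_sets.
Context (R : realType).
Notation mu := (@lebesgue_measure R).
Notation mu2 := (@lebesgue_measure R \x @lebesgue_measure R)%E.
Local Notation RR := (measurableTypeR R).

(** Tonelli applied to the indicator of a plane null set: almost every section has measure zero. *)
Lemma ae_sections (P : R * R -> Prop) : {ae mu2, forall z, P z} ->
  {ae mu, forall t, {ae mu, forall x, P (x, t)}}.
Proof.
move=> [N [mN N0 sN]].
have mf : measurable_fun setT (EFin \o (\1_N : RR * RR -> R)).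
  by apply/measurable_EFinP; exact: measurable_indic.
have f0 (z : RR * RR) : (0 <= (\1_N z : R)%:E)%E by rewrite lee_fin.
have F := @fubini_tonelli2 _ _ RR RR R mu mu _ mf f0.
have mG := @measurable_fun_fubini_tonelli_G _ _ RR RR R mu _ mf f0.
have GE (t : R) : fubini_G mu (EFin \o (\1_N : RR * RR -> R)) t = mu (ysection N t).
  rewrite /fubini_G -[in RHS](setIT (ysection N t)) -integral_indic//; last exact: measurable_ysection.
  by apply: eq_integral => x _; rewrite /= !indicE mem_ysection.
have I0 : (\int[mu]_t `|fubini_G mu (EFin \o (\1_N : RR * RR -> R)) t| = 0)%E.
  under eq_integral do rewrite GE gee0_abs//.
  under eq_integral do rewrite -GE.
  rewrite -F integral_indic// setIT; exact: N0.
have [M [mM M0 sM]] := (@ae_eq_integral_abs _ _ _ mu _ measurableT _ mG).1 I0.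
exists M; split => // t nt; apply: sM => Gt; apply: nt.
exists (ysection N t); split => //; first exact: measurable_ysection.
  by have := Gt I; rewrite GE.
by move=> x nP; rewrite ysectionE; exact: sN.
Qed.

(** Tonelli treats the positive and negative parts separately, and [fine] keeps measurability even
    at times where an integral is infinite. *)
Lemma Rintegral_section_measurable (g : R * R -> R) :
  measurable_fun (setT : set (RR * RR)) g ->
  measurable_fun (setT : set RR) (fun t => \int[mu]_x g (x, t)).
Proof.
move=> mg.
have mE : measurable_fun (setT : set (RR * RR)) (EFin \o g) by apply/measurable_EFinP.
apply: (measurableT_comp (fine_measurable measurableT)).
have -> : (fun t => (\int[mu]_x (g (x, t))%:E)%E) =
    (fun t => (fubini_G mu ((EFin \o g)^\+)%E t - fubini_G mu ((EFin \o g)^\-)%E t)%E).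
  apply/funext => t; rewrite (integralE mu setT (fun x => (g (x, t))%:E)) /fubini_G.
  by congr (_ - _)%E; apply: eq_integral => x _; rewrite ?funeposE ?funenegE.
apply: emeasurable_funB.
  apply: (@measurable_fun_fubini_tonelli_G _ _ RR RR) => //.
  exact: measurable_funepos.
apply: (@measurable_fun_fubini_tonelli_G _ _ RR RR) => //.
exact: measurable_funeneg.
Qed.

End sections_of_plane_sets.

Section drift.
Context (R : realType) (N : nat).
Notation mu := (@lebesgue_measure R).
Notation mu2 := (@lebesgue_measure R \x @lebesgue_measure R)%E.
Local Notation RR := (measurableTypeR R).
Local Notation E := ('I_N -> R -> R^o).
Variables (l : 'I_N -> R) (T : R).
Hypotheses (N1 : (0 < N)%N) (l0 : forall i, 0 < l i).
Implicit Types (v w : E) (D : 'I_N -> R) (u : 'I_N -> R * R -> R).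
Local Notation L1 T f := (mu.-integrable `]0, T[ (EFin \o f)).
Local Notation Sq T f := (sqint mu `]0, T[ f).
Local Notation II T f := (\int[mu]_(x in `]0, T[) f x).
Local Notation b := (inner_LL2 l).

Lemma norm_LLoo_ge0 u : 0 <= norm_LLoo l T u.
Proof. by apply: sumr_ge0 => i _; exact/fine_ge0/Lnorm_ge0. Qed.

Lemma ae_le_Lnormoo (f : R * R -> R) : f \in Lfun mu2 +oo%E ->
  {ae mu2, forall z, `|f z| <= fine 'N[mu2]_+oo[EFin \o f]%E}.
Proof.
rewrite inE => /andP[_]; rewrite inE /finite_norm/= => fin.
(* ['N[_]_+oo] is the essential supremum only if the whole space has positive measure; otherwise the
   whole space is an admissible exceptional set. *)
have [mpos|m0] := ltP 0%E (mu2 [set: RR * RR]); last first.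
  exists setT; split => //; apply/eqP; rewrite eq_le m0 measure_ge0//.
have := ess_sup_ge mu2 (abse \o (EFin \o f)).
have NE : 'N[mu2]_+oo[EFin \o f]%E = ess_sup mu2 (abse \o (EFin \o f)).
  by rewrite unlock /Lnorm mpos.
rewrite -NE; apply: filterS => z /= H.
rewrite -lee_fin fineK//.
by rewrite ge0_fin_numE// Lnorm_ge0.
Qed.

(* Truncating [u] at its essential bound makes every later estimate valid for
   all times instead of almost all. *)
Lemma drift_representative u : in_LLoo l T u -> exists v : 'I_N -> R * R -> R,
  [/\ forall i, measurable_fun (setT : set (RR * RR)) (v i),
      forall i z, `|v i z| <= norm_LLoo l T u &
      {ae mu, forall t, t \in `]0, T[ -> forall i,
         {ae mu, forall x, x \in `]0, l i[ -> v i (x, t) = u i (x, t)}}].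
Proof.
move=> hu; set M := norm_LLoo l T u.
pose f i := u i \_ (Q l T i).
exists (fun i z => Num.max (- M) (Num.min M (f i z))).
have M0 : 0 <= M := norm_LLoo_ge0 u.
split.
- move=> i; have := hu i; rewrite inE => /andP[]; rewrite inE/= => mf _.
  apply: (@measurable_maxr _ (RR * RR)%type); first exact: measurable_cst.
  by apply: (@measurable_minr _ (RR * RR)%type); first exact: measurable_cst.
- move=> i z; rewrite ler_norml le_max lexx /= ge_max ge_min lexx andbT.
  by rewrite (le_trans _ M0)// oppr_le0.
have H i : {ae mu, forall t, {ae mu, forall x, `|f i (x, t)| <= M}}.
  apply: (@ae_sections _ (fun z => `|f i z| <= M)).
  have [B [mB B0 sB]] := ae_le_Lnormoo (hu i).
  exists B; split => // z nz; apply: sB => H; apply: nz; apply: le_trans H _.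
  rewrite /M /norm_LLoo (bigD1 i)//= lerDl.
  by apply: sumr_ge0 => j _; exact/fine_ge0/Lnorm_ge0.
(* The finitely many edges are indexed by [nat] so that the countable intersection [ae_alln]
   applies. *)
have H' : {ae mu, forall t, forall i, {ae mu, forall x, `|f i (x, t)| <= M}}.
  pose P n t := forall i : 'I_N, (i : nat) = n -> {ae mu, forall x, `|f i (x, t)| <= M}.
  have : {ae mu, forall t, forall n, P n t}.
    apply: ae_alln => n; have [nN|Nn] := ltnP n N; last first.
      by apply: ae_everywhere => t i iE; move: Nn; rewrite -iE leqNgt ltn_ord.
    apply: ae_mono (H (Ordinal nN)) => t h i iE.
    by have -> : i = Ordinal nN by exact: val_inj.
  by apply: ae_mono => t h i; exact: (h i i erefl).
apply: ae_mono H' => t h tT i; apply: ae_mono (h i) => x.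
rewrite /f patchE => + xl; rewrite mem_set => [|//].
by rewrite ler_norml => /andP[h1 h2]; rewrite (min_idPr h2) (max_idPr h1).
Qed.

Definition drift_form u t v w : R :=
  \sum_i II (l i) (fun x => u i (x, t) * v i x * gderive l w i x).

Variables (u : 'I_N -> R * R -> R) (M : R).
Hypotheses (mu_ : forall i, measurable_fun (setT : set (RR * RR)) (u i)).
Hypothesis uM : forall i z, `|u i z| <= M.

Lemma bounded_mulS t i f : Sq (l i) f -> Sq (l i) (fun x => u i (x, t) * f x).
Proof.
move=> sf; have M0 : 0 <= M := le_trans (normr_ge0 _) (uM i (0, 0)).
have ms : measurable_fun `]0, l i[ (fun x => u i (x, t)).
  apply: (@measurable_funS _ _ RR _ setT) => //.
  exact: (@measurable_fun_pair1 _ _ _ RR RR RR _ t (mu_ i)).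
apply: (sqint_ae_le _ (sqintZ (measurable_oo 0 (l i)) M sf)).
  by apply: measurable_funM => //; exact: sf.1.
apply: ae_everywhere => x _; rewrite !normrM (ger0_norm M0).
by apply: ler_wpM2r.
Qed.

Lemma bounded_mulL1 t i f g : Sq (l i) f -> Sq (l i) g -> L1 (l i) (fun x => u i (x, t) * f x * g x).
Proof. by move=> sf sg; exact: (Sq_mul (bounded_mulS t sf) sg). Qed.

(** Cauchy-Schwarz over all edges at once: the quadratic in [r] dominates the integral of the
    squares of [u * v + r *] the derivative of [w], because [u ^+ 2] is at most [M ^+ 2]. *)
Lemma drift_form_sqr t v w : LL2 l v -> VV l w ->
  drift_form u t v w ^+ 2 <= M ^+ 2 * b v v * gdot l (fun=> 1) w w.
Proof.
move=> /LL2P sv hw; have sw i := gderive_Sq N1 l0 i hw.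
apply: discr_le => r.
have -> : M ^+ 2 * b v v + r * (drift_form u t v w *+ 2) + r ^+ 2 * gdot l (fun=> 1) w w =
  \sum_i (M ^+ 2 * inner_L2 (l i) (v i) (v i) + r * (II (l i) (fun x => u i (x, t) * v i x * gderive l w i x) *+ 2)
   + r ^+ 2 * inner_L2 (l i) (gderive l w i) (gderive l w i)).
  rewrite !big_split/= /inner_LL2 /gdot /drift_form -sumrMnl !mulr_sumr.
  by congr (_ + _); apply: eq_bigr => i _; rewrite mul1r.
apply: sumr_ge0 => i _.
have s1 := bounded_mulS t (sv i).
have s2 := SqD s1 (SqZ r (sw i)).
have P0 : 0 <= II (l i) (fun x => (u i (x, t) * v i x + r * gderive l w i x) ^+ 2).
  exact: Int_sqr_ge0.
apply: le_trans P0 _.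
have -> : II (l i) (fun x => (u i (x, t) * v i x + r * gderive l w i x) ^+ 2) =
  II (l i) (fun x => (u i (x, t) * v i x) ^+ 2) + r * (II (l i) (fun x => u i (x, t) * v i x * gderive l w i x) *+ 2)
   + r ^+ 2 * inner_L2 (l i) (gderive l w i) (gderive l w i).
  have i1 := s1.2; have i2 := Sq_mul s1 (sw i); have i3 := Sq_mul (sw i) (sw i).
  rewrite -mulr_natl mulrA -(IntZ (measurable_oo 0 (l i)) _ i2) -(IntZ (measurable_oo 0 (l i)) _ i3).
  rewrite -(IntD (measurable_oo 0 (l i)) i1 (L1Z _ i2)) -(IntD (measurable_oo 0 (l i)) (L1D i1 (L1Z _ i2)) (L1Z _ i3)).
  by apply: eq_Rintegral => x _; ring.
rewrite !lerD2r -(IntZ (measurable_oo 0 (l i)) _ (Sq_mul (sv i) (sv i))).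
apply: (Int_ae_le (measurable_oo 0 (l i)) s1.2 (L1Z _ (Sq_mul (sv i) (sv i)))).
apply: ae_everywhere => x _; rewrite exprMn -expr2 ler_wpM2r ?sqr_ge0//.
rewrite -[u i (x, t) ^+ 2](real_normK (num_real _)) ler_sqr ?nnegrE//.
exact: le_trans (uM i (x, t)).
Qed.

Lemma drift_form_le t v w : 0 <= M -> LL2 l v -> VV l w ->
  `|drift_form u t v w| <= M * Num.sqrt (b v v) * Num.sqrt (gdot l (fun=> 1) w w).
Proof.
move=> M0 hv hw; have h := drift_form_sqr t hv hw.
have b0 : 0 <= b v v := ip_ge0 (semi_ip_LL2 l) hv.
rewrite -ler_sqr ?nnegrE ?mulr_ge0 ?sqrtr_ge0// real_normK ?num_real//.
rewrite !exprMn !sqr_sqrtr//; exact: gdot_ge0.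
Qed.

Lemma drift_form_measurable v w : LL2 l v -> VV l w ->
  measurable_fun `]0, T[ (fun t => drift_form u t v w).
Proof.
move=> /LL2P sv hw; have sw i := gderive_Sq N1 l0 i hw.
apply: (@measurable_funS _ _ RR _ setT) => //.
apply: measurable_sum => i.
pose v' := (v i : R -> R) \_ `]0, l i[; pose w' := gderive l w i \_ `]0, l i[.
have mv : measurable_fun (setT : set RR) v'.
  by rewrite /v'; apply/(measurable_restrictT _ (measurable_oo 0 (l i))); exact: (sv i).1.
have mw : measurable_fun (setT : set RR) w'.
  by rewrite /w'; apply/(measurable_restrictT _ (measurable_oo 0 (l i))); exact: (sw i).1.
have -> : (fun t => II (l i) (fun x => u i (x, t) * v i x * gderive l w i x)) =
    (fun t => \int[mu]_x (fun z : R * R => u i z * v' z.1 * w' z.1) (x, t)).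
  apply/funext => t; rewrite Rintegral_mkcond; apply: eq_Rintegral => x _.
  by rewrite /v' /w' !patchE /=; case: ifP => _; rewrite ?mulr0.
apply: (@Rintegral_section_measurable R (fun z => u i z * v' z.1 * w' z.1)).
by apply: (@measurable_funM _ (RR * RR)%type); [apply: (@measurable_funM _ (RR * RR)%type) => //|];
  exact: (measurableT_comp _ (@measurable_fst _ _ RR RR)).
Qed.

Lemma drift_formDl t v v' w (r : R) : LL2 l v -> LL2 l v' -> VV l w ->
  drift_form u t (r *: v + v') w = r * drift_form u t v w + drift_form u t v' w.
Proof.
move=> /LL2P sv /LL2P sv' hw; have sw i := gderive_Sq N1 l0 i hw.
rewrite /drift_form mulr_sumr -big_split; apply: eq_bigr => i _ /=.
have i1 := bounded_mulL1 t (sv i) (sw i); have i2 := bounded_mulL1 t (sv' i) (sw i).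
rewrite -(IntZ (measurable_oo 0 (l i)) _ i1) -(IntD (measurable_oo 0 (l i)) (L1Z _ i1) i2).
apply: eq_Rintegral => x _ /=.
have -> : (r *: v + v') i x = r * v i x + v' i x by [].
by ring.
Qed.

Lemma drift_formDr t v w w' (r : R) : LL2 l v -> VV l w -> VV l w' ->
  drift_form u t v (r *: w + w') = r * drift_form u t v w + drift_form u t v w'.
Proof.
move=> /LL2P sv hw hw'; have sw i := gderive_Sq N1 l0 i hw; have sw' i := gderive_Sq N1 l0 i hw'.
rewrite /drift_form mulr_sumr -big_split; apply: eq_bigr => i _ /=.
have i1 := bounded_mulL1 t (sv i) (sw i); have i2 := bounded_mulL1 t (sv i) (sw' i).
rewrite -(IntZ (measurable_oo 0 (l i)) _ i1) -(IntD (measurable_oo 0 (l i)) (L1Z _ i1) i2).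
apply: Rintegral_ae_cong.
by apply: ae_mono (gderive_lin N1 l0 r hw hw' i) => x H xl; rewrite H//; ring.
Qed.

Lemma FP_form_drift u' D t v w : VV l v -> VV l w ->
  (forall i, {ae mu, forall x, x \in `]0, l i[ -> u i (x, t) = u' i (x, t)}) ->
  FP_form l D u' t v w = gdot l D v w + drift_form u t v w.
Proof.
move=> hv hw uu; have /LL2P sv := VV_LL2 hv.
have sw i := gderive_Sq N1 l0 i hw; have sdv i := gderive_Sq N1 l0 i hv.
rewrite /gdot /drift_form -big_split; apply: eq_bigr => i _ /=.
have i1 := bounded_mulL1 t (sv i) (sw i); have i2 := Sq_mul (sdv i) (sw i).
rewrite -(IntZ (measurable_oo 0 (l i)) _ i2) -(IntD (measurable_oo 0 (l i)) (L1Z _ i2) i1).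
apply: Rintegral_ae_cong.
by apply: ae_mono (uu i) => x H xl; rewrite -H// /gderive; ring.
Qed.

End drift.

(** * The dual space *)

Section graph_norms.
Context (R : realType) (N : nat).
Notation mu := (@lebesgue_measure R).
Local Notation E := ('I_N -> R -> R^o).
Variable l : 'I_N -> R.
Hypotheses (N1 : (0 < N)%N) (l0 : forall i, 0 < l i).
Implicit Types (v w phi : E) (D : 'I_N -> R) (F G : E -> R^o).
Local Notation b := (inner_LL2 l).

Lemma seminorm_of_ip (V : lmodType R) (S : set V) (p : V -> V -> R) (nrm : V -> R) :
  subspace_set S -> semi_ip S p -> (forall x, S x -> nrm x = Num.sqrt (p x x)) ->
  seminorm_on S nrm.
Proof.
move=> hS hp nE; split.
- by move=> x Sx; rewrite nE// sqrtr_ge0.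
- move=> x y Sx Sy; rewrite !nE//; last exact: (subD hS).
  exact: (ip_triangle hS hp).
- move=> r x Sx; rewrite !nE//; last exact: (subZ hS).
  by rewrite (ip_sqZ hS hp)// sqrtrM ?sqr_ge0// sqrtr_sqr.
Qed.

Lemma norm_LL2E v : LL2 l v -> norm_LL2 l v = Num.sqrt (b v v).
Proof. by move=> hv; rewrite -norm_LL2_sqr// sqrtr_sqr ger0_norm// norm_LL2_ge0. Qed.

Lemma norm_HH1E v : VV l v -> norm_HH1 l v = Num.sqrt (energy_form l (fun=> 1) v v).
Proof.
by move=> hv; rewrite -(norm_HH1_sqr N1 l0 hv) sqrtr_sqr ger0_norm// norm_HH1_ge0.
Qed.

Lemma semi_ip_VV : semi_ip (VV l : set E) b.
Proof.
have [bC bD bZ bp] := semi_ip_LL2 l.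
split=> [x y hx hy|x y z hx hy hz|r x z hx hz|x hx].
+ by apply: bC; exact: VV_LL2.
+ by apply: bD; exact: VV_LL2.
+ by apply: bZ; exact: VV_LL2.
+ by apply: bp; exact: VV_LL2.
Qed.

Lemma seminorm_LL2 : seminorm_on (LL2 l : set E) (norm_LL2 l).
Proof. exact: (seminorm_of_ip (subspace_LL2 l) (semi_ip_LL2 l) norm_LL2E). Qed.

Lemma seminorm_HH1 : seminorm_on (VV l : set E) (norm_HH1 l).
Proof.
have h1 i : 0 <= (fun=> 1 : R) (i : 'I_N) by [].
exact: (seminorm_of_ip (subspace_VV N1 l0) (semi_ip_energy N1 l0 h1) norm_HH1E).
Qed.

Lemma energy_form_scale D D' (k : R) v : 1 <= k -> (forall i, D i <= k * D' i) -> VV l v ->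
  energy_form l D v v <= k * energy_form l D' v v.
Proof.
move=> k1 DD hv; rewrite /energy_form mulrDr; apply: lerD.
  by rewrite ler_peMl//; exact: (ip_ge0 semi_ip_VV hv).
rewrite /gdot mulr_sumr; apply: ler_sum => i _; rewrite mulrA.
by apply: ler_wpM2r => //; exact: inner_L2_ge0.
Qed.

Lemma gdot_scale D D' (k : R) v : (forall i, D i <= k * D' i) ->
  gdot l D v v <= k * gdot l D' v v.
Proof.
move=> DD; rewrite /gdot mulr_sumr; apply: ler_sum => i _; rewrite mulrA.
by apply: ler_wpM2r => //; exact: inner_L2_ge0.
Qed.

Lemma norm_VVdual_has_sup F : VVdual l F ->
  has_sup [set `|F phi| | phi in [set phi | VV l phi /\ norm_HH1 l phi <= 1]].
Proof.
move=> [_ [M HM]]; have V0 : VV l (0 : E) := sub0 (subspace_VV N1 l0).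
have n0 : norm_HH1 l (0 : E) = 0.
  by have [_ _ nZ] := seminorm_HH1; have := nZ 0 _ V0; rewrite scaler0 normr0 mul0r.
split; first by exists `|F 0|; exists 0 => //; split => //; rewrite n0.
exists `|M| => _ [phi [hphi nphi] <-].
apply: le_trans (HM _ hphi) _; apply: (@le_trans _ _ (`|M| * norm_HH1 l phi)).
  by rewrite ler_wpM2r ?norm_HH1_ge0// ler_norm.
by rewrite ler_piMr.
Qed.

Lemma norm_VVdual_ge0 F : VVdual l F -> 0 <= norm_VVdual l F.
Proof.
move=> hF; have [ne ub] := norm_VVdual_has_sup hF; have [y hy] := ne.
apply: (@le_trans _ _ y); first by have [phi _ <-] := hy.
exact: (ub_le_sup ub hy).
Qed.

Lemma VVdual_lin F (r : R) v w : VVdual l F -> VV l v -> VV l w ->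
  F (r *: v + w) = r * F v + F w.
Proof. by move=> [h _]; exact: h. Qed.

Lemma VVdualZ F (r : R) v : VVdual l F -> VV l v -> F (r *: v) = r * F v.
Proof.
move=> hF hv; have V0 : VV l (0 : E) := sub0 (subspace_VV N1 l0).
have F0 : F 0 = 0.
  have := VVdual_lin 1 hF V0 V0; rewrite scaler0 addr0 mul1r => h.
  by apply: (addrI (F 0)); rewrite addr0 -h.
by have := VVdual_lin r hF hv V0; rewrite addr0 F0 addr0.
Qed.

Lemma norm_VVdual_ub F v : VVdual l F -> VV l v ->
  `|F v| <= norm_VVdual l F * norm_HH1 l v.
Proof.
move=> hF hv; have [ne ub] := norm_VVdual_has_sup hF.
have [_ _ nZ] := seminorm_HH1.
have n0 := norm_HH1_ge0 l v; have [_ [M HM]] := hF.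
(* A null vector cannot be normalised; there the boundedness of [F] with some constant forces
   [F v = 0]. *)
have [nv0|nvn0] := eqVneq (norm_HH1 l v) 0.
  by have := HM v hv; rewrite nv0 !mulr0.
have npos : 0 < norm_HH1 l v by rewrite lt_neqAle eq_sym nvn0.
pose w : E := (norm_HH1 l v)^-1 *: v.
have hw : VV l w := subZ (subspace_VV N1 l0) _ hv.
have nw : norm_HH1 l w = 1 by rewrite nZ// ger0_norm ?invr_ge0// mulVf.
have Fw : F w = (norm_HH1 l v)^-1 * F v := VVdualZ _ hF hv.
have : `|F w| <= norm_VVdual l F.
  by apply: (ub_le_sup ub); exists w => //; split => //; rewrite nw.
by rewrite Fw normrM (@ger0_norm _ (_^-1)) ?invr_ge0// mulrC ler_pdivrMr.
Qed.

Lemma norm_VVdual_le F (K : R) : VVdual l F -> 0 <= K ->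
  (forall v, VV l v -> `|F v| <= K * norm_HH1 l v) -> norm_VVdual l F <= K.
Proof.
move=> hF K0 FK; have [ne _] := norm_VVdual_has_sup hF; apply: ge_sup => //.
move=> _ [phi [hphi nphi] <-]; apply: le_trans (FK _ hphi) _.
by rewrite ler_piMr.
Qed.

Lemma subspace_VVdual : subspace_set (VVdual l : set (E -> R^o)).
Proof.
split.
- split; first by move=> r v w _ _; rewrite mulr0 addr0.
  by exists 0 => v _; rewrite normr0 mul0r.
- move=> F G [lF [M HM]] [lG [M' HM']]; split.
    move=> r v w hv hw.
    have E1 z : (F + G) z = F z + G z by [].
    by rewrite !E1 lF// lG//; ring.
  exists (M + M') => v hv; rewrite mulrDl.
  by apply: le_trans (ler_normD _ _) _; apply: lerD; [exact: HM|exact: HM'].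
- move=> r F [lF [M HM]]; split.
    move=> s v w hv hw.
    have E1 z : (r *: F) z = r * F z by [].
    by rewrite !E1 lF//; ring.
  exists (`|r| * M) => v hv.
  have E1 : (r *: F) v = r * F v by [].
  by rewrite E1 normrM -mulrA; apply: ler_wpM2l => //; exact: HM.
Qed.

Lemma seminorm_VVdual : seminorm_on (VVdual l : set (E -> R^o)) (norm_VVdual l).
Proof.
have nZ1 (r : R) F : VVdual l F -> norm_VVdual l (r *: F) <= `|r| * norm_VVdual l F.
  move=> hF; have hrF := subZ subspace_VVdual r hF.
  apply: norm_VVdual_le => //; first by rewrite mulr_ge0 ?norm_VVdual_ge0.
  move=> v hv; have -> : (r *: F) v = r * F v by [].
  by rewrite normrM -mulrA ler_wpM2l//; exact: norm_VVdual_ub.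
split; first exact: norm_VVdual_ge0.
- move=> F G hF hG; have hFG := subD subspace_VVdual hF hG.
  apply: norm_VVdual_le => //; first by rewrite addr_ge0 ?norm_VVdual_ge0.
  move=> v hv; have -> : (F + G) v = F v + G v by [].
  apply: le_trans (ler_normD _ _) _; rewrite mulrDl.
  by apply: lerD; exact: norm_VVdual_ub.
- move=> r F hF; apply/eqP; rewrite eq_le nZ1//=.
  have [->|r0] := eqVneq r 0.
    by rewrite normr0 mul0r norm_VVdual_ge0//; exact: (subZ subspace_VVdual).
  (* Homogeneity follows from the inequality applied to both [r] and its inverse. *)
  have := nZ1 r^-1 _ (subZ subspace_VVdual r hF).
  rewrite scalerA mulVf// scale1r normfV => h.
  by rewrite -ler_pdivlMl ?normr_gt0.
Qed.

End graph_norms.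

(** * The evolution problem *)

Section evolution.
Context (R : realType) (N : nat).
Notation mu := (@lebesgue_measure R).
Local Notation E := ('I_N -> R -> R^o).
Variables (l D : 'I_N -> R) (T : R).
Hypotheses (N1 : (0 < N)%N) (l0 : forall i, 0 < l i) (D0 : forall i, 0 < D i) (T0 : 0 < T).
Local Notation L1 f := (mu.-integrable `]0, T[ (EFin \o f)).
Local Notation b := (inner_LL2 l).
Local Notation a := (energy_form l D).
Variables (e : nat -> E) (la : nat -> R).
Hypotheses (Se : forall n, VV l (e n)) (la1 : forall n, 1 <= la n).
Hypothesis orth : forall i j, i != j -> b (e i) (e j) = 0.
Hypothesis unit : forall n, b (e n) (e n) = 1 \/ e n = 0.
Hypothesis eigen : forall n w, VV l w -> a (e n) w = la n * b (e n) w.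
Hypothesis basis : forall w, VV l w -> forall d, 0 < d -> exists N, forall n, (N <= n)%N ->
  a (w - \sum_(i < n) b (e i) w *: e i) (w - \sum_(i < n) b (e i) w *: e i) <= d.
Implicit Types (c gc : nat -> R -> R) (rho : R -> E).

Let hS := subspace_VV N1 l0.
Let hL := subspace_LL2 l.
Let D0' i : 0 <= D i. Proof. exact: ltW. Qed.
Let ha := semi_ip_energy N1 l0 D0'.
Let hb := semi_ip_VV l.
Let hbL := semi_ip_LL2 l.
Let ba x (_ : VV l x) : b x x <= a x x. Proof. exact: energy_ge_L2. Qed.
Let SeL n : LL2 l (e n). Proof. exact: VV_LL2. Qed.
Let la0 j : 0 < la j. Proof. exact: lt_le_trans (la1 j). Qed.

Let unit_le n : b (e n) (e n) <= 1.
Proof. by have [->|->] := unit n => //; rewrite (ip0l hS hb)//; exact: (sub0 hS). Qed.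

Let unit_ge0 n : 0 <= b (e n) (e n).
Proof. exact: (ip_ge0 hb). Qed.

Lemma LL2_complete : forall u : nat -> E, (forall n, LL2 l (u n)) ->
  (forall d, 0 < d -> exists N, forall m n, (N <= m)%N -> (N <= n)%N ->
     b (u m - u n) (u m - u n) <= d) ->
  exists2 v, LL2 l v & forall d, 0 < d -> exists N, forall n, (N <= n)%N ->
     b (u n - v) (u n - v) <= d.
Proof.
move=> u hu cu.
have G i : exists g, sqint mu `]0, l i[ g /\ forall d, 0 < d -> exists N, forall n, (N <= n)%N ->
    \int[mu]_(x in `]0, l i[) ((u n i x - g x) ^+ 2) <= d.
  have [|d d0|g sg hg] := @riesz_fischer _ _ _ _ _ (measurable_oo 0 (l i)) (fun n => u n i) (mu_oo_fin 0 (l i)).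
  - by move=> n; have /LL2P := hu n; exact.
  - have [M HM] := cu _ d0; exists M => m n Mm Mn; apply: le_trans (HM m n Mm Mn).
    rewrite /inner_LL2 (bigD1 i)//= /inner_L2 -[leLHS]addr0; apply: lerD => //.
    by apply: sumr_ge0 => j _; exact: inner_L2_ge0.
  - by exists g.
have [g gP] := choice G.
exists g => [|d d0]; first by apply/LL2P => i; have [] := gP i.
have N0 : 0 < N%:R :> R by rewrite ltr0n.
have [M HM] := choice (fun i => (gP i).2 _ (divr_gt0 d0 N0)).
exists (\sum_i M i)%N => n Mn.
apply: (@le_trans _ _ (\sum_(i < N) d / N%:R)).
  apply: ler_sum => i _; apply: HM.
  by apply: leq_trans Mn; rewrite (bigD1 i)//= leq_addr.
by rewrite sumr_const card_ord -(mulr_natr (d / N%:R)) divfK// gt_eqF.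
Qed.

(** Stated for an abstract pair [v], [F] because it serves twice: for an element of W(0, T) with its
    derivative, and for the difference of two weak solutions. [G] is the majorant that justifies
    exchanging sums and time integrals. *)
Lemma coefficient_energy c gc (v : R -> E) (F : R -> E -> R) (G : R -> R) :
  (forall j, AC T (c j 0) (gc j) (c j)) -> L1 G ->
  {ae mu, forall t, t \in `]0, T[ -> [/\ VV l (v t),
     forall (r : R) x y, VV l x -> VV l y -> F t (r *: x + y) = r * F t x + F t y,
     exists K, [/\ 0 <= K, forall w, VV l w -> `|F t w| <= K * Num.sqrt (a w w) &
       a (v t) (v t) + K ^+ 2 <= G t] &
     forall j, c j t = b (e j) (v t) /\ gc j t = F t (e j)]} ->
  [/\ forall j, L1 (energy la gc c j),
      forall J, \sum_(0 <= j < J) prim (energy la gc c j) T <= prim G T &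
      exists p En, [/\ AC T (En 0) p En,
        forall t, 0 <= t -> t <= T -> \sum_(0 <= j < J) c j t ^+ 2 @[J --> \oo] --> En t,
        {ae mu, forall t, t \in `]0, T[ -> p t = 2 * F t (v t)} &
        {ae mu, forall t, t \in `]0, T[ -> En t = b (v t) (v t)}]].
Proof.
move=> hc hG H.
have e0 j t : 0 <= energy la gc c j t.
  have lj := ltW (la0 j).
  by apply: addr_ge0; [exact: mulr_ge0 lj (sqr_ge0 _)|exact: divr_ge0 (sqr_ge0 _) lj].
have EG : {ae mu, forall t, t \in `]0, T[ -> forall J, \sum_(0 <= j < J) energy la gc c j t <= G t}.
  apply: ae_mono H => t H tT J; have [hv lF [K [K0 FK aG]] cj] := H tT.
  apply: le_trans aG; rewrite /energy big_split /=; apply: lerD.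
    under eq_bigr do rewrite (cj _).1.
    exact: (bessel_a hS ha hb Se la1 orth unit eigen basis J hv).
  under eq_bigr do rewrite (cj _).2.
  exact: (dual_bessel hS ha Se la1 orth unit eigen lF K0 FK J).
have mgc j : measurable_fun `]0, T[ (gc j) by have [h _] := hc j; exact: itg_measurable h.
have mc j : measurable_fun `]0, T[ (c j) by exact: AC_measurable (ltW T0) (hc j).
have hL1 j : L1 (energy la gc c j).
  apply: (L1_ae_le _ hG).
    apply: measurable_funD; apply: measurable_funM => //; exact: measurable_funX.
  apply: ae_mono EG => t H' tT; rewrite ger0_norm//; apply: le_trans (H' tT j.+1).
  by rewrite big_nat_recr//= lerDr sumr_ge0.
have hB J : \sum_(0 <= j < J) prim (energy la gc c j) T <= prim G T.
  have -> : \sum_(0 <= j < J) prim (energy la gc c j) T =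
      prim (fun t => \sum_(0 <= j < J) energy la gc c j t) T.
    by symmetry; exact: (Int_sum (measurable_oo 0 T) _ (fun j _ => hL1 j)).
  apply: (prim_ae_le (L1_sum _ _) hG (lexx _)) => //.
  by apply: ae_mono EG => t H' tT; exact: H'.
split => //.
have lim : {ae mu, forall t, t \in `]0, T[ ->
    \sum_(0 <= j < J) (2 * (gc j t * c j t)) @[J --> \oo] --> 2 * F t (v t)}.
  apply: ae_mono H => t H tT; have [hv lF [K [K0 FK aG]] cj] := H tT.
  have -> : (fun J => \sum_(0 <= j < J) (2 * (gc j t * c j t))) =
      (fun J => 2 * \sum_(0 <= j < J) b (e j) (v t) * F t (e j)).
    apply/funext => J; rewrite mulr_sumr; apply: eq_bigr => j _.
    by have [-> ->] := cj j; rewrite (mulrC (F _ _)).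
  by apply: cvgMr; exact: (dual_expansion hS ha Se basis lF K0 FK).
have mf J : measurable_fun `]0, T[ (fun t => \sum_(0 <= j < J) (2 * (gc j t * c j t))).
  apply: measurable_sum => j; apply: measurable_funM; first exact: measurable_cst.
  exact: measurable_funM.
have [p mp hp] := @ae_limit_measurable _ _ _ mu `]0, T[ _ mf
  (ae_mono (fun t H tT => cvgP _ (H tT)) lim).
have [En [hE cE]] := energy_identity T0 la1 hc hL1 hB hG mp EG hp.
exists p, En; split => //.
  by apply: ae_mono (ae_and lim hp) => t [H1 H2] tT; exact: (cvg_unique _ (H2 tT) (H1 tT)).
apply: ae_mono H => t H tT; have [hv lF _ cj] := H tT.
have t01 : 0 <= t /\ t <= T by move: tT; rewrite in_itv/= => /andP[/ltW ? /ltW ?].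
have h1 := cE t t01.1 t01.2.
have h2 := parseval_b hS ha hb ba Se orth unit basis hv.
have E1 : (fun J => \sum_(0 <= j < J) b (e j) (v t) ^+ 2) = (fun J => \sum_(0 <= j < J) c j t ^+ 2).
  by apply/funext => J; apply: eq_bigr => j _; rewrite (cj j).1.
by rewrite E1 in h2; exact: (cvg_unique _ h1 h2).
Qed.

(** Each coefficient is continuous in time and the tails are uniformly small, so the sums converge
    at every [t] to a function that is continuous into L2. *)
Lemma coefficient_version c gc (k : nat -> R) (B : R) :
  (forall j, AC T (k j) (gc j) (c j)) -> (forall j, L1 (energy la gc c j)) ->
  (forall J, \sum_(0 <= j < J) prim (energy la gc c j) T <= B) ->
  exists r : R -> E, in_C_bochner T (LL2 l : set E) (norm_LL2 l) r /\
    forall t, t \in `[0, T] -> LL2 l (r t) /\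
      let s n := \sum_(0 <= j < n) c j t *: e j in
      b (s n - r t) (s n - r t) @[n --> \oo] --> (0 : R).
Proof.
move=> hc hL1 hB.
have ex t : exists w : E, t \in `[0, T] -> LL2 l w /\ let s n := \sum_(0 <= j < n) c j t *: e j in
      b (s n - w) (s n - w) @[n --> \oo] --> (0 : R).
  have [tT|tT] := boolP (t \in `[0, T]); last by exists 0.
  have [t1 t2] : 0 <= t /\ t <= T by move: tT; rewrite in_itv/= => /andP[].
  have xB J : \sum_(0 <= j < J) b (e j) (e j) * c j t ^+ 2 <= (T^-1 + 1) * B.
    apply: le_trans (coef_sum_le T0 la1 hc hL1 hB J t1 t2).
    by apply: ler_sum => j _; rewrite ler_piMl ?sqr_ge0.
  by have [w hw cw] := osum_complete hL hbL SeL orth LL2_complete xB; exists w.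
have [r rP] := choice ex.
exists r; split => // t tT; have [hr cr] := rP t tT; split => //.
apply/cvgrPdist_le => eps eps0; rewrite near_withinE.
(* The head contributes one eighth of [eps ^+ 2], and the tail at most twice the two tails at [s]
   and [t], that is four eighths. *)
have eps2 : 0 < eps ^+ 2 / 8 by rewrite divr_gt0// exprn_gt0.
have [M HM] := uniform_tails T0 la1 hc hL1 hB eps2.
have cont J : \sum_(0 <= j < J) (c j s - c j t) ^+ 2 @[s --> within `[0, T]%classic (nbhs t)] --> (0 : R).
  elim: J => [|J IH].
    have -> : (fun s => \sum_(0 <= j < 0) (c j s - c j t) ^+ 2) = cst 0.
      by apply/funext => s; rewrite big_geq.
    exact: cvg_cst.
  have -> : (fun s => \sum_(0 <= j < J.+1) (c j s - c j t) ^+ 2) =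
     (fun s => \sum_(0 <= j < J) (c j s - c j t) ^+ 2 + (c J s - c J t) * (c J s - c J t)).
    by apply/funext => s; rewrite big_nat_recr//= expr2.
  have /subspace_continuousP /(_ t tT) cJ := AC_continuous (ltW T0) (hc J).
  have cd : c J s - c J t @[s --> within `[0, T]%classic (nbhs t)] --> (0 : R).
    by apply/subr_cvg0; exact: cJ.
  rewrite -[X in _ --> X](addr0 (0 : R)); apply: cvgD; first exact: IH.
  by rewrite -[X in _ --> X](mulr0 (0 : R)); apply: cvgM; exact: cd.
have /cvgrPdist_lt /(_ _ eps2) := cont M.
rewrite near_withinE; apply: filterS => s + sT => /(_ sT).
rewrite sub0r normrN ger0_norm; last by apply: sumr_ge0 => j _; exact: sqr_ge0.
move=> lt; have [hrs crs] := rP s sT.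
rewrite sub0r normrN ger0_norm ?norm_LL2_ge0//.
have hd := subB hL hrs hr.
rewrite -ler_sqr ?nnegrE ?norm_LL2_ge0 ?(ltW eps0)// (norm_LL2_sqr hd).
have cd : let s' n := \sum_(0 <= j < n) (c j s - c j t) *: e j in
    b (s' n - (r s - r t)) (s' n - (r s - r t)) @[n --> \oo] --> (0 : R).
  have c2 : 2 * b (\sum_(0 <= j < n) c j s *: e j - r s) (\sum_(0 <= j < n) c j s *: e j - r s) +
     2 * b (\sum_(0 <= j < n) c j t *: e j - r t) (\sum_(0 <= j < n) c j t *: e j - r t) @[n --> \oo] --> (0 : R).
    rewrite -[X in _ --> X]addr0; apply: cvgD; rewrite -[X in _ --> X](mulr0 2); exact: cvgMr.
  apply: (cvg0_le _ c2); apply: nearW => n.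
  have h1 := subB hL (osum_in hL SeL 0 n (c^~ s)) hrs.
  have h2 := subB hL (osum_in hL SeL 0 n (c^~ t)) hr.
  have -> : \sum_(0 <= j < n) (c j s - c j t) *: e j - (r s - r t) =
    (\sum_(0 <= j < n) c j s *: e j - r s) - (\sum_(0 <= j < n) c j t *: e j - r t).
    under eq_bigr do rewrite scalerBl.
    rewrite sumrB; move: (\sum_(0 <= j < n) c j s *: e j) (\sum_(0 <= j < n) c j t *: e j) => x y.
    by rewrite (opprD (r s)) (opprD y) !opprK addrACA.
  by rewrite ger0_norm; [exact: (ip_sqB_le hL hbL)|exact: (ip_ge0 hbL (subB hL h1 h2))].
have [_ cn] := osum_limit hL hbL SeL orth hd cd.
apply: (cvgr_to_le cn); exists M => // n /= Mn.
have t01 : 0 <= t /\ t <= T by move: tT; rewrite in_itv/= => /andP[].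
have s01 : 0 <= s /\ s <= T by move: sT; rewrite /= in_itv/= => /andP[].
have h1 := HM M n t (leqnn _) t01.1 t01.2.
have h2 := HM M n s (leqnn _) s01.1 s01.2.
apply: (@le_trans _ _ (\sum_(0 <= j < n) (c j s - c j t) ^+ 2)).
  by apply: ler_sum => j _; rewrite ler_piMl ?sqr_ge0.
rewrite (big_cat_nat (leq0n M) Mn) /=.
have h3 : \sum_(M <= j < n) (c j s - c j t) ^+ 2 <=
    2 * \sum_(M <= j < n) c j s ^+ 2 + 2 * \sum_(M <= j < n) c j t ^+ 2.
  rewrite !mulr_sumr -big_split; apply: ler_sum => j _ /=.
  have aux (x y : R) : (x - y) ^+ 2 <= 2 * x ^+ 2 + 2 * y ^+ 2 by have := sqr_ge0 (x + y); nra.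
  exact: aux.
move: lt h1 h2 h3; set x1 := \sum_(0 <= j < M) _; set x2 := \sum_(M <= j < n) _.
set x3 := \sum_(M <= j < n) _; set x4 := \sum_(M <= j < n) _.
have aux (y1 y2 y3 y4 z : R) : 0 <= z -> y1 < z / 8 -> y4 <= z / 8 -> y3 <= z / 8 ->
   y2 <= 2 * y3 + 2 * y4 -> y1 + y2 <= z by lra.
by move=> i1 i2 i3 i4; exact: (aux _ _ _ _ _ (sqr_ge0 _) i1 i2 i3 i4).
Qed.

(** With [cb], the constants comparing [a] with the H1 norm. They depend on all of [D] and on the
    number of edges, so they serve qualitative steps only and stay out of the final bound. *)
Let ca : R := 1 + \sum_i D i.
Let cb : R := 1 + \sum_i (D i)^-1.

Let ca1 : 1 <= ca. Proof. by rewrite lerDl sumr_ge0// => i _; exact: ltW. Qed.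
Let cb1 : 1 <= cb.
Proof. by rewrite lerDl sumr_ge0// => i _; rewrite invr_ge0 ltW. Qed.
Let cb0 : 0 <= cb. Proof. exact: le_trans cb1. Qed.
Let ca0 : 0 <= ca. Proof. exact: le_trans ca1. Qed.

Let a_le v : VV l v -> a v v <= ca * norm_HH1 l v ^+ 2.
Proof.
move=> hv; rewrite (norm_HH1_sqr N1 l0 hv); apply: energy_form_scale => // i.
rewrite mulr1 /ca (bigD1 i)//= addrCA lerDl addr_ge0// sumr_ge0//.
Qed.

Let H_le v : VV l v -> norm_HH1 l v ^+ 2 <= cb * a v v.
Proof.
move=> hv; rewrite (norm_HH1_sqr N1 l0 hv); apply: energy_form_scale => // i.
rewrite -ler_pdivrMr// div1r /cb (bigD1 i)//= addrCA lerDl addr_ge0// sumr_ge0// => j _.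
by rewrite invr_ge0 ltW.
Qed.

Let H_le_sqrt v : VV l v -> norm_HH1 l v <= Num.sqrt cb * Num.sqrt (a v v).
Proof.
move=> hv; rewrite -sqrtrM// -[leLHS]ger0_norm ?norm_HH1_ge0// -sqrtr_sqr.
by apply: ler_wsqrtr; exact: H_le.
Qed.

Let b_le v w : LL2 l v -> VV l w -> `|b v w| <= norm_LL2 l v * norm_HH1 l w.
Proof.
move=> hv hw; have hw' := VV_LL2 hw.
apply: le_trans (ip_norm_le hL hbL hv hw') _; rewrite -!norm_LL2E//.
apply: ler_wpM2l; first exact: norm_LL2_ge0.
rewrite (norm_LL2E hw') (norm_HH1E N1 l0 hw); apply: ler_wsqrtr.
by apply: energy_ge_L2.
Qed.

Lemma VVdual_bound (F : E -> R) : VVdual l F ->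
  forall w, VV l w -> `|F w| <= norm_VVdual l F * Num.sqrt cb * Num.sqrt (a w w).
Proof.
move=> hF w hw; apply: le_trans (norm_VVdual_ub N1 l0 hF hw) _.
rewrite -mulrA ler_wpM2l ?norm_VVdual_ge0//; exact: H_le_sqrt.
Qed.

Lemma in_L2V_inner rho phi : in_L2V l T rho -> LL2 l phi ->
  exists2 h, sqint mu `]0, T[ h & {ae mu, forall t, t \in `]0, T[ -> b (rho t) phi = h t}.
Proof.
move=> hrho hphi.
apply: (in_L2_bochner_comp hS (seminorm_HH1 N1 l0) (h := fun _ v => b v phi) (K := norm_LL2 l phi) _ hrho).
- exact: norm_LL2_ge0.
- by move=> v _; exact: measurable_cst.
have B v : VV l v -> `|b v phi| <= norm_LL2 l phi * norm_HH1 l v.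
  by move=> hv; rewrite (ipC hbL (VV_LL2 hv) hphi); exact: b_le.
apply: ae_everywhere => t _; split=> [x y hx hy|//].
rewrite -(ipBl hL hbL (VV_LL2 hx) (VV_LL2 hy) hphi); apply: B.
exact: (subB hS).
Qed.

Lemma in_L2Vdual_eval (g : R -> E -> R) phi : in_L2Vdual l T g -> VV l phi ->
  exists2 h, sqint mu `]0, T[ h & {ae mu, forall t, t \in `]0, T[ -> g t phi = h t}.
Proof.
move=> hg hphi.
apply: (in_L2_bochner_comp (subspace_VVdual l) (seminorm_VVdual N1 l0) (h := fun _ (F : E -> R^o) => F phi)
  (K := norm_HH1 l phi) _ hg).
- exact: norm_HH1_ge0.
- by move=> v _; exact: measurable_cst.
have B (F : E -> R^o) : VVdual l F -> `|F phi| <= norm_HH1 l phi * norm_VVdual l F.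
  by move=> hF; rewrite mulrC; exact: norm_VVdual_ub.
apply: ae_everywhere => t _; split=> [F G hF hG|//].
have -> : F phi - G phi = (F - G) phi by [].
by apply: B; exact: (subB (subspace_VVdual l)).
Qed.

(** Tested against [e j], the time derivative becomes a scalar weak derivative, and
    [weak_derivativeP] provides an absolutely continuous coefficient. *)
Lemma W_coefficients rho g : in_L2V l T rho -> in_L2Vdual l T g -> time_derivative l T rho g ->
  exists c gc, (forall j, AC T (c j 0) (gc j) (c j)) /\
   {ae mu, forall t, t \in `]0, T[ -> [/\ VV l (rho t), VVdual l (g t) &
      forall j, c j t = b (e j) (rho t) /\ gc j t = g t (e j)]}.
Proof.
move=> hrho hg tdg.
have H j : exists cg : (R -> R) * (R -> R), AC T (cg.1 0) cg.2 cg.1 /\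
    {ae mu, forall t, t \in `]0, T[ -> b (rho t) (e j) = cg.1 t /\ g t (e j) = cg.2 t}.
  have [c sc hc] := in_L2V_inner hrho (SeL j).
  have [d sd hd] := in_L2Vdual_eval hg (Se j).
  have wd : weak_derivative T c d.
    move=> eta teta; have := tdg eta (e j) teta (Se j).
    rewrite (_ : \int[mu]_(t in `]0, T[) (inner_LL2 l (rho t) (e j) * derive1 eta t) =
      \int[mu]_(t in `]0, T[) (c t * derive1 eta t)); last first.
      by apply: Rintegral_ae_cong; apply: ae_mono hc => t H /= tT; rewrite H.
    rewrite (_ : \int[mu]_(t in `]0, T[) (g t (e j) * eta t) =
      \int[mu]_(t in `]0, T[) (d t * eta t))//.
    by apply: Rintegral_ae_cong; apply: ae_mono hd => t H /= tT; rewrite H.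
  have [k hk] := (weak_derivativeP T0 (SqL1 sc) (SqL1 sd)).1 wd.
  exists (fun t => k + prim d t, d); split.
    split; first exact: SqL1.
    by move=> t t0 tT; rewrite /= (@prim_le0 _ _ 0)// addr0.
  by apply: ae_mono (ae_and (ae_and hc hd) hk) => t [[h1 h2] h3] tT; rewrite h1// h2// h3.
have [cg cgP] := choice H.
exists (fun j => (cg j).1), (fun j => (cg j).2); split; first by move=> j; have [] := cgP j.
have aeV := in_L2_bochner_ae hrho; have aeF := in_L2_bochner_ae hg.
apply: ae_mono (ae_and (ae_and aeV aeF) (ae_alln (fun j => (cgP j).2))) => t [[h1 h2] h3] tT.
split; [exact: h1|exact: h2|move=> j; have [<- <-] := h3 j tT].
by rewrite (ipC hbL _ (SeL j))//; exact: VV_LL2 (h1 tT).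
Qed.

Lemma within_le_continuous (h : R -> R) (C : R -> R) (q : R -> R -> R) :
  (forall t, t \in `[0, T] -> q t s @[s --> within `[0, T]%classic (nbhs t)] --> (0 : R)) ->
  (forall s t, t \in `[0, T] -> s \in `[0, T] -> `|h s - h t| <= C t * q t s) ->
  {within `[0, T], continuous h}.
Proof.
move=> cq hq; apply/subspace_continuousP => t tT.
have c0 : C t * q t s @[s --> within `[0, T]%classic (nbhs t)] --> (0 : R).
  by rewrite -[X in _ --> X](mulr0 (C t)); apply: cvgMr; exact: cq.
apply/cvgrPdist_le => eps eps0; rewrite near_withinE.
have /cvgrPdist_le /(_ _ eps0) := c0; rewrite near_withinE.
apply: filterS => s + sT => /(_ sT); rewrite sub0r normrN => H.
by rewrite distrC; apply: le_trans (hq _ _ tT sT) _; apply: le_trans H; exact: ler_norm.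
Qed.

Lemma in_C_inner (r : R -> E) z : in_C_bochner T (LL2 l : set E) (norm_LL2 l) r -> LL2 l z ->
  {within `[0, T], continuous (fun t => b z (r t))}.
Proof.
move=> hr hz; apply: (@within_le_continuous _ (fun=> norm_LL2 l z) (fun t s => norm_LL2 l (r s - r t))).
  by move=> t tT; have [] := hr t tT.
move=> s t tT sT; have [ht _] := hr t tT; have [hs _] := hr s sT.
rewrite -(ipBr hL hbL)//; have hd := subB hL hs ht.
by rewrite !norm_LL2E//; exact: (ip_norm_le hL hbL).
Qed.

Lemma in_C_norm (r : R -> E) : in_C_bochner T (LL2 l : set E) (norm_LL2 l) r ->
  {within `[0, T], continuous (fun t => norm_LL2 l (r t))}.
Proof.
move=> hr; apply: (@within_le_continuous _ (fun=> 1) (fun t s => norm_LL2 l (r s - r t))).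
  by move=> t tT; have [] := hr t tT.
move=> s t tT sT; have [ht _] := hr t tT; have [hs _] := hr s sT.
by rewrite mul1r; exact: (seminorm_dist hL (seminorm_LL2 l)).
Qed.

Let in_oo t : t \in `]0, T[ -> 0 <= t /\ t <= T.
Proof. by rewrite in_itv/= => /andP[/ltW ? /ltW ?]. Qed.

Lemma ae_equalP v w : LL2 l v -> LL2 l w -> b (v - w) (v - w) = 0 -> ae_equal l v w.
Proof.
move=> hv hw h0 i; have /LL2P sd := subB hL hv hw.
have : inner_L2 (l i) ((v - w) i) ((v - w) i) = 0.
  move: h0; rewrite /inner_LL2 => /eqP; rewrite psumr_eq0 => [|j _]; last exact: inner_L2_ge0.
  by move=> /allP/(_ i); rewrite mem_index_enum => /(_ isT)/eqP.
move=> /(inner_L2_eq0 (sd i)); apply: ae_mono => x H /H /eqP.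
by have -> : (v - w) i x = v i x - w i x by []; rewrite subr_eq0 => /eqP.
Qed.

(** Collects what the estimates use about elements of W(0, T). Since [continuous_version] is an
    arbitrary choice among continuous representatives, its properties are transferred from almost
    every time to every time by continuity. *)
Lemma W_structure rho g : in_L2V l T rho -> in_L2Vdual l T g -> time_derivative l T rho g ->
  let r := continuous_version l T rho in
  exists c gc p En,
   [/\ (forall j, AC T (c j 0) (gc j) (c j)) /\ AC T (En 0) p En,
       {ae mu, forall t, t \in `]0, T[ -> [/\ VV l (rho t), VVdual l (g t),
          (forall j, c j t = b (e j) (rho t) /\ gc j t = g t (e j)),
          p t = 2 * g t (rho t) & En t = b (rho t) (rho t)]},
       (forall t, 0 <= t -> t <= T -> \sum_(0 <= j < J) c j t ^+ 2 @[J --> \oo] --> En t),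
       (forall t, 0 <= t -> t <= T -> [/\ LL2 l (r t), (forall j, b (e j) (r t) = c j t) &
           norm_LL2 l (r t) ^+ 2 = En t]) &
       {ae mu, forall t, t \in `]0, T[ -> ae_equal l (r t) (rho t)}].
Proof.
move=> hrho hg tdg r.
have [c [gc [hc cP]]] := W_coefficients hrho hg tdg.
have [_ [nV sV hV]] := (in_L2_bochnerP hS (seminorm_HH1 N1 l0) T rho).1 hrho.
have [_ [nG sG hG]] := (in_L2_bochnerP (subspace_VVdual l) (seminorm_VVdual N1 l0) T g).1 hg.
(* Square integrability of [rho] in V and of [g] in the dual space makes this majorant
   integrable. *)
pose G t := ca * nV t ^+ 2 + cb * nG t ^+ 2.
have iG : L1 G by apply: L1D; apply: L1Z; [exact: sV.2|exact: sG.2].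
have HH : {ae mu, forall t, t \in `]0, T[ -> [/\ VV l (rho t),
     forall (s : R) x y, VV l x -> VV l y -> g t (s *: x + y) = s * g t x + g t y,
     exists K, [/\ 0 <= K, forall w, VV l w -> `|g t w| <= K * Num.sqrt (a w w) &
       a (rho t) (rho t) + K ^+ 2 <= G t] &
     forall j, c j t = b (e j) (rho t) /\ gc j t = g t (e j)]}.
  apply: ae_mono (ae_and cP (ae_and hV hG)) => t [h1 [h2 h3]] tT.
  have [hv hF cj] := h1 tT; split => //; first by move=> s x y hx hy; exact: (hF.1 s x y hx hy).
  exists (norm_VVdual l (g t) * Num.sqrt cb); split.
  - by rewrite mulr_ge0 ?sqrtr_ge0// norm_VVdual_ge0.
  - exact: VVdual_bound.
  - rewrite exprMn sqr_sqrtr// /G -(h2 tT) -(h3 tT) [_ * cb]mulrC lerD2r.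
    exact: a_le.
have [hL1 hB [p [En [hE cE hp eE]]]] := coefficient_energy hc iG HH.
have [r0 [cr0 r0P]] := coefficient_version hc hL1 hB.
have r0ae : {ae mu, forall t, t \in `]0, T[ -> ae_equal l (r0 t) (rho t)}.
  apply: ae_mono cP => t H tT; have [hv _ cj] := H tT.
  have tT' : t \in `[0, T] by exact: subset_itv_oo_cc tT.
  have [hr cr] := r0P t tT'; have hv' := VV_LL2 hv.
  apply: ae_equalP => //.
  have [_ cr'] := osum_limit hL hbL SeL orth hr cr.
  have Ss n := osum_in hS Se 0 n (c^~ t).
  have [w1 _] := ip_cvg_sqr hL hbL (fun n => VV_LL2 (Ss n)) hr cr.
  have cv : (let s n := \sum_(0 <= i < n) c i t *: e i in
     b (s n - rho t) (s n - rho t) @[n --> \oo] --> (0 : R)).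
    apply: (cvg0_le _ (basis_cvg hS ha Se basis hv)); apply: nearW => n.
    have -> : \sum_(0 <= i < n) c i t *: e i = \sum_(0 <= i < n) b (e i) (rho t) *: e i.
      by apply: eq_bigr => j _; rewrite (cj j).1.
    have Sd := subB hS (osum_in hS Se 0 n (fun i => b (e i) (rho t))) hv.
    by rewrite ger0_norm ?ba//; exact: (ip_ge0 hb).
  have [w2 _] := ip_cvg_sqr hL hbL (fun n => VV_LL2 (Ss n)) hv' cv.
  have hd := subB hL hr hv'.
  rewrite (ipBr hL hbL)//; apply/eqP; rewrite subr_eq0; apply/eqP.
  exact: (cvg_unique _ (w1 _ hd) (w2 _ hd)).
(* [r0] only shows that the choice is made in a nonempty set; the chosen [r] need not be [r0]. *)
have [cr rae] : [set r | in_C_bochner T (LL2 l) (norm_LL2 l) r /\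
             {ae mu, forall t, t \in `]0, T[ -> ae_equal l (r t) (rho t)}] r.
  by apply: (@xgetPex _ (fun _ _ _ => 0)); exists r0.
exists c, gc, p, En; split => //.
- apply: ae_mono (ae_and cP (ae_and hp eE)) => t [h1 [h2 h3]] tT.
  by have [? ? ?] := h1 tT; split => //; [exact: h2|exact: h3].
move=> t t0 tT; have tT' : t \in `[0, T] by rewrite in_itv/= t0.
have [hr _] := cr t tT'.
have bae : {ae mu, forall s, s \in `]0, T[ -> (forall v, LL2 l v -> b v (r s) = b v (rho s)) /\
    b (r s) (r s) = b (rho s) (rho s)}.
  apply: ae_mono rae => s H sT; split.
    by move=> v hv; apply: eq_bigr => i _; apply: inner_L2_ae; [exact: ae_everywhere|exact: H].
  by apply: eq_bigr => i _; apply: inner_L2_ae; exact: H.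
split => //.
- move=> j; apply: (within_continuous_ae_eq T0 (in_C_inner cr (SeL j)) (AC_continuous (ltW T0) (hc j)) _ tT').
  apply: ae_mono (ae_and bae cP) => s [h1 h2] sT; have [_ _ cj] := h2 sT.
  rewrite (cj j).1; exact: ((h1 sT).1 _ (SeL j)).
- have cN : {within `[0, T], continuous (fun s => norm_LL2 l (r s) * norm_LL2 l (r s))}.
    apply/subspace_continuousP => x xT.
    by have /subspace_continuousP /(_ x xT) cx := in_C_norm cr; apply: cvgM; exact: cx.
  rewrite expr2.
  apply: (within_continuous_ae_eq T0 cN (AC_continuous (ltW T0) hE) _ tT').
  apply: ae_mono (ae_and bae eE) => s [h1 h2] sT.
  have sT' : s \in `[0, T] by exact: subset_itv_oo_cc sT.
  by rewrite -expr2 (norm_LL2_sqr (cr s sT').1) (h1 sT).2 h2.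
Qed.

(** * The weak equation at almost every time *)

Variables (u ub : 'I_N -> R * R -> R) (M : R).
Hypotheses (M0 : 0 <= M).
Hypothesis mub : forall i, measurable_fun (setT : set (measurableTypeR R * measurableTypeR R)) (ub i).
Hypothesis ubM : forall i z, `|ub i z| <= M.
Hypothesis ub_ae : {ae mu, forall t, t \in `]0, T[ -> forall i,
  {ae mu, forall x, x \in `]0, l i[ -> ub i (x, t) = u i (x, t)}}.

(* [FP_form] at almost every time, with [u] replaced by its truncation [ub]. *)
Definition weak_form t v w : R := gdot l D v w + drift_form l ub t v w.

Let semi_ip_gdot D1 : (forall i, 0 <= D1 i) -> semi_ip (VV l : set E) (gdot l D1).
Proof.
move=> D10; split.
- by move=> v w _ _; exact: gdotC.
- by move=> v w z hv hw hz; exact: gdotDl.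
- by move=> r v w hv hw; exact: gdotZl.
- by move=> v _; exact: gdot_ge0.
Qed.

Let one0 (i : 'I_N) : 0 <= (fun=> 1 : R) i. Proof. by []. Qed.

Let sqrt_b_le v : VV l v -> Num.sqrt (b v v) <= norm_HH1 l v.
Proof.
move=> hv; rewrite (norm_HH1E N1 l0 hv); apply: ler_wsqrtr.
exact: (energy_ge_L2 l v one0).
Qed.

Let sqrt_gdot_le v : VV l v -> Num.sqrt (gdot l (fun=> 1) v v) <= norm_HH1 l v.
Proof.
move=> hv; rewrite (norm_HH1E N1 l0 hv); apply: ler_wsqrtr.
by rewrite /energy_form lerDr; exact: (ip_ge0 hb hv).
Qed.

Lemma gdot_le (dm : R) v w : (forall i, D i <= dm) -> VV l v -> VV l w ->
  `|gdot l D v w| <= dm * norm_HH1 l v * norm_HH1 l w.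
Proof.
move=> Ddm hv hw; have dm0 : 0 <= dm := le_trans (D0' (Ordinal N1)) (Ddm _).
apply: le_trans (ip_norm_le hS (semi_ip_gdot D0') hv hw) _.
have H z : VV l z -> Num.sqrt (gdot l D z z) <= Num.sqrt dm * norm_HH1 l z.
  move=> hz; apply: (@le_trans _ _ (Num.sqrt (dm * gdot l (fun=> 1) z z))).
    by apply: ler_wsqrtr; apply: gdot_scale => i; rewrite mulr1.
  by rewrite sqrtrM// ler_wpM2l ?sqrtr_ge0// sqrt_gdot_le.
have -> : dm * norm_HH1 l v * norm_HH1 l w =
    (Num.sqrt dm * norm_HH1 l v) * (Num.sqrt dm * norm_HH1 l w).
  have aux (x y z : R) : x ^+ 2 * y * z = (x * y) * (x * z) by ring.
  by rewrite -{1}(sqr_sqrtr dm0) aux.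
by apply: ler_pM; rewrite ?sqrtr_ge0//; exact: H.
Qed.

Let drift_le t v w : VV l v -> VV l w ->
  `|drift_form l ub t v w| <= M * Num.sqrt (b v v) * Num.sqrt (gdot l (fun=> 1) w w).
Proof. by move=> hv hw; apply: (drift_form_le N1 l0 mub ubM) => //; exact: VV_LL2. Qed.

Lemma weak_form_le (dm : R) t v w : (forall i, D i <= dm) -> VV l v -> VV l w ->
  `|weak_form t v w| <= (dm + M) * norm_HH1 l v * norm_HH1 l w.
Proof.
move=> Ddm hv hw; apply: le_trans (ler_normD _ _) _; rewrite mulrDl mulrDl.
apply: lerD; first exact: gdot_le.
apply: le_trans (drift_le t hv hw) _; apply: ler_pM; rewrite ?mulr_ge0 ?sqrtr_ge0//.
  by rewrite ler_wpM2l// sqrt_b_le.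
exact: sqrt_gdot_le.
Qed.

Lemma weak_formDl t (r : R) v v' w : VV l v -> VV l v' -> VV l w ->
  weak_form t (r *: v + v') w = r * weak_form t v w + weak_form t v' w.
Proof.
move=> hv hv' hw; rewrite /weak_form (drift_formDl N1 l0 mub ubM)//; try exact: VV_LL2.
have hrv := subZ hS r hv.
rewrite (gdotDl N1 l0 D hrv hv' hw) (gdotZl N1 l0 D r hv hw).
have aux (x y z w' : R) : r * x + y + (r * z + w') = r * (x + z) + (y + w') by ring.
exact: aux.
Qed.

Lemma weak_formDr t (r : R) v w w' : VV l v -> VV l w -> VV l w' ->
  weak_form t v (r *: w + w') = r * weak_form t v w + weak_form t v w'.
Proof.
move=> hv hw hw'; rewrite /weak_form (drift_formDr N1 l0 mub ubM)//; last exact: VV_LL2.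
have hrw := subZ hS r hw.
rewrite gdotC (gdotDl N1 l0 D hrw hw' hv) (gdotZl N1 l0 D r hw hv) (gdotC l D w v) (gdotC l D w' v).
have aux (x y z t' : R) : r * x + y + (r * z + t') = r * (x + z) + (y + t') by ring.
exact: aux.
Qed.

Lemma weak_form_measurable v w : VV l v -> VV l w -> measurable_fun `]0, T[ (fun t => weak_form t v w).
Proof.
move=> hv hw; apply: measurable_funD; first exact: measurable_cst.
exact: (drift_form_measurable N1 l0 mub (VV_LL2 hv) hw).
Qed.

Let D_ca i : D i <= ca.
Proof.
rewrite /ca (bigD1 i)//= addrCA lerDl addr_ge0// sumr_ge0//.
Qed.

Lemma in_L2V_weak_form rho phi : in_L2V l T rho -> VV l phi ->
  exists2 h, sqint mu `]0, T[ h & {ae mu, forall t, t \in `]0, T[ -> weak_form t (rho t) phi = h t}.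
Proof.
move=> hrho hphi.
apply: (in_L2_bochner_comp hS (seminorm_HH1 N1 l0) (h := fun t v => weak_form t v phi)
  (K := (ca + M) * norm_HH1 l phi) _ hrho).
- by rewrite mulr_ge0 ?norm_HH1_ge0// addr_ge0.
- by move=> v hv; exact: weak_form_measurable.
apply: ae_everywhere => t _.
have B v : VV l v -> `|weak_form t v phi| <= (ca + M) * norm_HH1 l phi * norm_HH1 l v.
  by move=> hv; rewrite mulrAC; exact: weak_form_le.
split=> [x y hx hy|//].
have -> : weak_form t x phi - weak_form t y phi = weak_form t (x - y) phi.
  have := weak_formDl t (-1) hy hx hphi; rewrite scaleN1r mulN1r => E1.
  by rewrite (addrC x (- y)) E1 (addrC (weak_form t x phi)).
by apply: B; exact: (subB hS).
Qed.

Lemma FP_form_ae : {ae mu, forall t, t \in `]0, T[ -> forall v w, VV l v -> VV l w ->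
  FP_form l D u t v w = weak_form t v w}.
Proof.
apply: ae_mono ub_ae => t H tT v w hv hw.
exact: (FP_form_drift N1 l0 mub ubM D hv hw (H tT)).
Qed.

Let test_L1 h eta : sqint mu `]0, T[ h -> test_function T eta ->
  L1 (fun t => h t * eta t) /\ L1 (fun t => h t * derive1 eta t).
Proof.
move=> sh teta; have [_ ce cde _ _] := test_derive teta.
by split; apply: L1_mul_continuous => //; exact: SqL1.
Qed.

Let Int_version (h k q : R -> R) : {ae mu, forall t, t \in `]0, T[ -> h t = k t} ->
  \int[mu]_(t in `]0, T[) (h t * q t) = \int[mu]_(t in `]0, T[) (k t * q t).
Proof. by move=> H; apply: Rintegral_ae_cong; apply: ae_mono H => t H /= tT; rewrite H. Qed.

(** Exchanges the sum over edges with the time integral. Each summand is a pairing with [phi]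
    restricted to one edge, which lies in L2 though in general not in V, and so has a measurable
    version. *)
Lemma sum_inner_Int rho phi eta : in_L2V l T rho -> LL2 l phi -> test_function T eta ->
  \sum_i (- \int[mu]_(t in `]0, T[) (inner_L2 (l i) (rho t i) (phi i) * derive1 eta t)) =
  - \int[mu]_(t in `]0, T[) (b (rho t) phi * derive1 eta t).
Proof.
move=> hrho hphi teta.
pose ph i : E := fun j => if j == i then phi i else fun=> 0.
have hph i : LL2 l (ph i).
  apply/LL2P => j; rewrite /ph; case: eqP => [->|_]; last exact: Sq_cst.
  by have /LL2P := hphi; exact.
have bph i t : b (rho t) (ph i) = inner_L2 (l i) (rho t i) (phi i).
  rewrite /inner_LL2 (bigD1 i)//= big1 ?addr0 => [|j ji]; first by rewrite /ph eqxx.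
  by rewrite /ph (negbTE ji) inner_L2C inner_L20l.
have [h hP] := choice (fun i => (let: ex_intro2 h h1 h2 := in_L2V_inner hrho (hph i) in
  ex_intro _ h (conj h1 h2) : exists h, _ /\ _)).
have hi i : {ae mu, forall t, t \in `]0, T[ -> inner_L2 (l i) (rho t i) (phi i) = h i t}.
  by apply: ae_mono (hP i).2 => t H tT; rewrite -bph H.
have hall : {ae mu, forall t, t \in `]0, T[ -> b (rho t) phi = \sum_i h i t}.
  pose P n t := forall i : 'I_N, (i : nat) = n -> t \in `]0, T[ -> inner_L2 (l i) (rho t i) (phi i) = h i t.
  have : {ae mu, forall t, forall n, P n t}.
    apply: ae_alln => n; have [nN|Nn] := ltnP n N; last first.
      by apply: ae_everywhere => t i iE; move: Nn; rewrite -iE leqNgt ltn_ord.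
    apply: ae_mono (hi (Ordinal nN)) => t H i iE.
    by have -> : i = Ordinal nN by exact: val_inj.
  by apply: ae_mono => t H tT; apply: eq_bigr => i _; exact: (H i i erefl tT).
rewrite sumrN (Int_version _ hall); congr (- _).
have -> : (fun t => (\sum_i h i t) * derive1 eta t) = (fun t => \sum_i (h i t * derive1 eta t)).
  by apply/funext => t; rewrite mulr_suml.
rewrite (Int_sum (measurable_oo 0 T)); last by move=> i _; have [_] := test_L1 (hP i).1 teta.
by apply: eq_bigr => i _; exact: Int_version.
Qed.

Variable f : R -> E -> R.
Hypothesis hf : in_L2Vdual l T f.

Lemma weak_identity rho g phi eta : in_L2V l T rho -> in_L2Vdual l T g -> time_derivative l T rho g ->
  VV l phi -> test_function T eta ->
  {ae mu, forall t, t \in `]0, T[ -> g t phi = f t phi - weak_form t (rho t) phi} ->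
  \sum_i (- \int[mu]_(t in `]0, T[) (inner_L2 (l i) (rho t i) (phi i) * derive1 eta t))
    + \int[mu]_(t in `]0, T[) (FP_form l D u t (rho t) phi * eta t)
    = \int[mu]_(t in `]0, T[) (f t phi * eta t).
Proof.
move=> hrho hg tdg hphi teta gE.
rewrite (sum_inner_Int hrho (VV_LL2 hphi) teta) (tdg eta phi teta hphi) opprK.
have [B sB hB] := in_L2V_weak_form hrho hphi.
have [F sF hF] := in_L2Vdual_eval hf hphi.
rewrite (Int_version _ hF).
have hg' : {ae mu, forall t, t \in `]0, T[ -> g t phi = F t - B t}.
  by apply: ae_mono (ae_and gE (ae_and hB hF)) => t [h1 [h2 h3]] tT; rewrite h1// h2// h3.
have hFP : {ae mu, forall t, t \in `]0, T[ -> FP_form l D u t (rho t) phi = B t}.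
  apply: ae_mono (ae_and (ae_and FP_form_ae (in_L2_bochner_ae hrho)) hB) => t [[h1 h2] h3] tT.
  by rewrite h1 ?h3//; exact: h2.
rewrite (Int_version _ hg') (Int_version _ hFP).
have [i1 _] := test_L1 (SqB sF sB) teta; have [i2 _] := test_L1 sB teta.
rewrite -(IntD (measurable_oo 0 T) i1 i2).
by apply: eq_Rintegral => t _; rewrite mulrBl subrK.
Qed.

(** The fundamental lemma in time yields a null set for each test vector. It is used for the
    countably many [e j] only; at a remaining time the defect is a bounded functional that vanishes
    on the basis, hence on V. The exceptional times thus do not depend on [phi]. *)
Lemma weak_solution_pointwise (rho0 : E) rho : weak_solution l T D f u rho0 rho ->
  [/\ in_L2V l T rho, in_L2Vdual l T (time_derive l T rho),
      time_derivative l T rho (time_derive l T rho),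
      ae_equal l (continuous_version l T rho 0) rho0 &
      {ae mu, forall t, t \in `]0, T[ -> forall phi, VV l phi ->
         time_derive l T rho t phi = f t phi - weak_form t (rho t) phi}].
Proof.
move=> [[hrho exg] h0 wk].
have [hg tdg] : [set g | in_L2Vdual l T g /\ time_derivative l T rho g] (time_derive l T rho).
  exact: xgetPex.
set g := time_derive l T rho in hg tdg *.
split => //.
have He j : {ae mu, forall t, t \in `]0, T[ -> g t (e j) = f t (e j) - weak_form t (rho t) (e j)}.
  have [B sB hB] := in_L2V_weak_form hrho (Se j).
  have [F sF hF] := in_L2Vdual_eval hf (Se j).
  have [G sG hG] := in_L2Vdual_eval hg (Se j).
  have hFP : {ae mu, forall t, t \in `]0, T[ -> FP_form l D u t (rho t) (e j) = B t}.
    apply: ae_mono (ae_and (ae_and FP_form_ae (in_L2_bochner_ae hrho)) hB) => t [[h1 h2] h3] tT.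
    by rewrite h1 ?h3//; exact: h2.
  have := @fundamental_lemma R T (fun t => G t + B t - F t) (SqL1 (SqB (SqD sG sB) sF)).
  have H eta : test_function T eta -> \int[mu]_(t in `]0, T[) ((G t + B t - F t) * eta t) = 0.
    move=> teta; have := wk (e j) eta (Se j) teta.
    rewrite (sum_inner_Int hrho (SeL j) teta) (tdg eta (e j) teta (Se j)) opprK.
    rewrite (Int_version _ hF) (Int_version _ hG) (Int_version _ hFP) => EQ.
    have [i1 _] := test_L1 sG teta; have [i2 _] := test_L1 sB teta; have [i3 _] := test_L1 sF teta.
    have -> : (fun t => (G t + B t - F t) * eta t) = (fun t => (G t * eta t + B t * eta t) - F t * eta t).
      by apply/funext => t; ring.
    rewrite (IntB (measurable_oo 0 T) (L1D i1 i2) i3) (IntD (measurable_oo 0 T) i1 i2) EQ subrr.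
    by [].
  move=> /(_ H) HH; apply: ae_mono (ae_and HH (ae_and hB (ae_and hF hG))) => t [h1 [h2 [h3 h4]]] tT.
  rewrite h2// h3// h4//; have := h1 tT => /eqP; rewrite subr_eq0 => /eqP <-.
  by rewrite addrK.
have aeV := in_L2_bochner_ae hrho; have aeF := in_L2_bochner_ae hf; have aeG := in_L2_bochner_ae hg.
apply: ae_mono (ae_and (ae_alln He) (ae_and aeV (ae_and aeF aeG))) => t [h1 [h2 [h3 h4]]] tT phi hphi.
have hv := h2 tT; have hF := h3 tT; have hG := h4 tT.
pose L w := g t w - (f t w - weak_form t (rho t) w).
have linL (r : R) x y : VV l x -> VV l y -> L (r *: x + y) = r * L x + L y.
  move=> hx hy; rewrite /L weak_formDr//.
  have -> : g t (r *: x + y) = r * g t x + g t y := hG.1 r x y hx hy.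
  have -> : f t (r *: x + y) = r * f t x + f t y := hF.1 r x y hx hy.
  have aux (s g1 g2 f1 f2 w1 w2 : R) : s * g1 + g2 - (s * f1 + f2 - (s * w1 + w2)) =
    s * (g1 - (f1 - w1)) + (g2 - (f2 - w2)) by ring.
  exact: aux.
pose K := (norm_VVdual l (g t) + norm_VVdual l (f t) + (ca + M) * norm_HH1 l (rho t)).
have Kp : 0 <= K.
  apply: addr_ge0; last by apply: mulr_ge0; [exact: addr_ge0|exact: norm_HH1_ge0].
  apply: addr_ge0; first exact: (norm_VVdual_ge0 N1 l0 hG).
  exact: (norm_VVdual_ge0 N1 l0 hF).
have K0 : 0 <= K * Num.sqrt cb by exact: mulr_ge0 Kp (sqrtr_ge0 _).
have KL w : VV l w -> `|L w| <= K * Num.sqrt cb * Num.sqrt (a w w).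
  move=> hw; have n1 := norm_VVdual_ub N1 l0 hG hw; have n2 := norm_VVdual_ub N1 l0 hF hw.
  have n3 := weak_form_le t D_ca hv hw.
  have n4 := H_le_sqrt hw.
  apply: (@le_trans _ _ (K * norm_HH1 l w)).
    have aux (x y z p q r n : R) : `|x| <= p * n -> `|y| <= q * n -> `|z| <= r * n ->
        `|x - (y - z)| <= (p + q + r) * n.
      move=> h5 h6 h7; have h8 := ler_normB x (y - z); have h9 := ler_normB y z.
      rewrite !mulrDl; apply: le_trans h8 _; rewrite -addrA; apply: lerD => //.
      by apply: le_trans h9 _; exact: lerD.
    exact: aux.
  by rewrite -mulrA; exact: (ler_wpM2l Kp).
have L0 j : L (e j) = 0 by rewrite /L h1// subrr.
have := dual_eq0 hS ha Se basis linL K0 KL hphi L0.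
by rewrite /L => /eqP; rewrite subr_eq0 => /eqP.
Qed.

(** * Coercivity, a priori bounds and uniqueness *)

Variables (dl du : R).
Hypotheses (dl0 : 0 < dl) (Ddl : forall i, dl <= D i) (Ddu : forall i, D i <= du).

(** The Gronwall exponent: [2 * dl] pays for the L2 part of the H1 norm, and [4 * M ^+ 2 / dl] for
    absorbing the drift into the diffusion. *)
Let kap : R := 2 * dl + 4 * M ^+ 2 / dl.
Let kap0 : 0 <= kap.
Proof. by rewrite addr_ge0 ?mulr_ge0 ?invr_ge0 ?sqr_ge0// ltW. Qed.

Let du0 : 0 <= du. Proof. exact: le_trans (D0' (Ordinal N1)) (Ddu _). Qed.

(** Young's inequality with weight [dl / 4] is applied to the source and to the drift; what remains
    of twice the diffusion still dominates [dl] times the squared gradient norm. *)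
Lemma weak_form_coercive t v (F n : R) : VV l v -> `|F| <= n * norm_HH1 l v ->
  2 * (F - weak_form t v v) + dl * norm_HH1 l v ^+ 2 <= kap * b v v + 4 / dl * n ^+ 2.
Proof.
move=> hv hF.
have core (x y h G W m d X : R) : 0 < d -> h ^+ 2 = X + y ^+ 2 -> x ^+ 2 = X -> `|F| <= n * h -> d * y ^+ 2 <= G ->
    `|W| <= m * x * y -> 2 * (F - (G + W)) + d * h ^+ 2 <= (2 * d + 4 * m ^+ 2 / d) * X + 4 / d * n ^+ 2.
  move=> d0 hE XE FE dG WE; rewrite -XE in hE *.
  have h1 : 2 * (n * h) <= 4 / d * n ^+ 2 + d / 4 * h ^+ 2.
    rewrite -subr_ge0 (_ : _ - _ = (4 * n - d * h) ^+ 2 / (4 * d)); last by field; rewrite gt_eqF.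
    by rewrite divr_ge0 ?sqr_ge0// mulr_ge0// ltW.
  have h2 : 2 * (m * x * y) <= 4 * m ^+ 2 / d * x ^+ 2 + d / 4 * y ^+ 2.
    rewrite -subr_ge0 (_ : _ - _ = (4 * m * x - d * y) ^+ 2 / (4 * d)); last by field; rewrite gt_eqF.
    by rewrite divr_ge0 ?sqr_ge0// mulr_ge0// ltW.
  have h3 := mulr_ge0 (ltW d0) (sqr_ge0 x); have h4 := mulr_ge0 (ltW d0) (sqr_ge0 y).
  have h5 := ler_norm F; have h6 : - W <= `|W| by rewrite -normrN ler_norm.
  have aux (nh nn dx dy mm mxy : R) : `|F| <= nh -> dy <= G -> `|W| <= mxy ->
      2 * nh <= nn + (dx + dy) / 4 -> 2 * mxy <= mm + dy / 4 -> 0 <= dx -> 0 <= dy ->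
      2 * (F - (G + W)) + (dx + dy) <= 2 * dx + mm + nn by lra.
  have h1' : 2 * (n * h) <= 4 / d * n ^+ 2 + (d * x ^+ 2 + d * y ^+ 2) / 4.
    by apply: (le_trans h1); rewrite hE le_eqVlt; apply/orP; left; apply/eqP; ring.
  have h2' : 2 * (m * x * y) <= 4 * m ^+ 2 / d * x ^+ 2 + d * y ^+ 2 / 4.
    by apply: (le_trans h2); rewrite le_eqVlt; apply/orP; left; apply/eqP; ring.
  have := aux _ _ _ _ _ _ FE dG WE h1' h2' h3 h4.
  by rewrite hE (mulrDr d) (mulrDl (2 * d)) -(mulrA 2 d).
have b0 : 0 <= b v v := ip_ge0 hb hv.
have g0 : 0 <= gdot l (fun=> 1) v v := gdot_ge0 l v one0.
apply: (core (Num.sqrt (b v v)) (Num.sqrt (gdot l (fun=> 1) v v))) => //.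
- by rewrite (norm_HH1_sqr N1 l0 hv) sqr_sqrtr.
- exact: sqr_sqrtr.
- rewrite sqr_sqrtr// /gdot mulr_sumr; apply: ler_sum => i _.
  by rewrite mul1r; apply: ler_wpM2r => //; exact: inner_L2_ge0.
- exact: drift_le.
Qed.

Lemma inner_ae_equal v w : ae_equal l v w -> b v v = b w w.
Proof. by move=> H; apply: eq_bigr => i _; apply: inner_L2_ae; exact: H. Qed.

Lemma energy_estimate (rho0 : E) rho g (nV nF : R -> R) : LL2 l rho0 ->
  in_L2V l T rho -> in_L2Vdual l T g -> time_derivative l T rho g ->
  ae_equal l (continuous_version l T rho 0) rho0 ->
  {ae mu, forall t, t \in `]0, T[ -> forall phi, VV l phi ->
     g t phi = f t phi - weak_form t (rho t) phi} ->
  sqint mu `]0, T[ nV -> sqint mu `]0, T[ nF ->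
  {ae mu, forall t, t \in `]0, T[ -> norm_HH1 l (rho t) = nV t} ->
  {ae mu, forall t, t \in `]0, T[ -> norm_VVdual l (f t) = nF t} ->
  forall t, 0 <= t -> t <= T ->
    norm_LL2 l (continuous_version l T rho t) ^+ 2 + dl * prim (fun t => nV t ^+ 2) t <=
    expR (kap * T) * (norm_LL2 l rho0 ^+ 2 + 4 / dl * prim (fun t => nF t ^+ 2) T).
Proof.
move=> h0 hrho hg tdg r0 gE sV sF hV hF t t0 tT.
have [c [gc [p [En [[hc hE] cP cE rP rae]]]]] := W_structure hrho hg tdg.
have d4 : 0 <= 4 / dl by rewrite divr_ge0// ltW.
have [_ _ rt] := rP t t0 tT; rewrite rt.
have [hr0 _ r00] := rP 0 (lexx _) (ltW T0).
have -> : norm_LL2 l rho0 ^+ 2 = En 0.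
  by rewrite -r00 (norm_LL2_sqr h0) (norm_LL2_sqr hr0) (inner_ae_equal r0).
rewrite -(primZ dl sV.2 tT) -(primZ (4 / dl) sF.2 (lexx _)).
apply: (gronwall (ltW T0) kap0 hE) => //.
- exact: (L1Z _ sV.2).
- exact: (L1Z _ sF.2).
- move=> s s0 sT; apply: (cvgr_to_ge (cE s s0 sT)); apply: nearW => n.
  by apply: sumr_ge0 => j _; exact: sqr_ge0.
- by apply: ae_everywhere => s _; rewrite mulr_ge0 ?sqr_ge0// ltW.
- by apply: ae_everywhere => s _; rewrite mulr_ge0 ?sqr_ge0.
have aeF := in_L2_bochner_ae hf.
apply: ae_mono (ae_and (ae_and cP gE) (ae_and (ae_and hV hF) aeF)) => s [[h1 h2] [[h3 h4] h5]] sT.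
have [hv hG _ -> ->] := h1 sT; rewrite (h2 sT _ hv) -(h3 sT).
apply: weak_form_coercive => //; rewrite -(h4 sT).
by apply: (norm_VVdual_ub N1 l0) => //; exact: (h5 sT).
Qed.

(** [A] is the factor in the Gronwall estimate after its right side is bounded by a multiple of
    [Y ^+ 2]. The summands of [K] belong to the supremum in time, the norm in L2(0, T; V) and the
    norm of W(0, T). *)
Lemma weak_solution_bounds (rho0 : E) rho : LL2 l rho0 -> weak_solution l T D f u rho0 rho ->
  let A := expR (kap * T) * (1 + 4 / dl) in
  let K := A + (1 + A / dl) + (1 + (A / dl * (1 + 2 * (du + M) ^+ 2) + 2)) in
  let Y := norm_LL2 l rho0 + norm_L2Vdual l T f in
  norm_CL2 l T rho + norm_L2V l T rho <= K * Y /\ norm_W l T rho <= K * Y.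
Proof.
move=> h0 ws A K Y; have [hrho hg tdg r0 gE] := weak_solution_pointwise ws.
set g := time_derive l T rho in hg tdg gE.
have [_ [nV sV hV]] := (in_L2_bochnerP hS (seminorm_HH1 N1 l0) T rho).1 hrho.
have [_ [nF sF hF]] := (in_L2_bochnerP (subspace_VVdual l) (seminorm_VVdual N1 l0) T f).1 hf.
have [_ [nG sG hG]] := (in_L2_bochnerP (subspace_VVdual l) (seminorm_VVdual N1 l0) T g).1 hg.
have est := energy_estimate h0 hrho hg tdg r0 gE sV sF hV hF.
have VE : norm_L2V l T rho = Num.sqrt (prim (fun t => nV t ^+ 2) T) := norm_L2_bochnerE sV hV.
have FE : norm_L2Vdual l T f = Num.sqrt (prim (fun t => nF t ^+ 2) T) := norm_L2_bochnerE sF hF.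
have GE : norm_L2Vdual l T g = Num.sqrt (prim (fun t => nG t ^+ 2) T) := norm_L2_bochnerE sG hG.
have V2 : norm_L2V l T rho ^+ 2 = prim (fun t => nV t ^+ 2) T by rewrite VE sqr_sqrtr// Int_sqr_ge0.
have F2 : norm_L2Vdual l T f ^+ 2 = prim (fun t => nF t ^+ 2) T by rewrite FE sqr_sqrtr// Int_sqr_ge0.
have G2 : norm_L2Vdual l T g ^+ 2 = prim (fun t => nG t ^+ 2) T by rewrite GE sqr_sqrtr// Int_sqr_ge0.
have F0 : 0 <= norm_L2Vdual l T f by rewrite FE sqrtr_ge0.
have V0 : 0 <= norm_L2V l T rho by rewrite VE sqrtr_ge0.
have n0 := norm_LL2_ge0 l rho0.
have d4 : 0 <= 4 / dl by rewrite divr_ge0// ltW.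
have Y0 : 0 <= Y by exact: addr_ge0.
have e1 : 1 <= expR (kap * T) by rewrite -expR0 ler_expR mulr_ge0// ltW.
have A1 : 1 <= A.
  by apply: (le_trans e1); rewrite ler_peMr ?lerDl// (le_trans _ e1).
have A0 : 0 <= A by exact: le_trans A1.
have S_le : expR (kap * T) * (norm_LL2 l rho0 ^+ 2 + 4 / dl * prim (fun t => nF t ^+ 2) T) <= A * Y ^+ 2.
  rewrite -F2 /A -[leRHS]mulrA; apply: ler_wpM2l; first exact: expR_ge0.
  have aux (x y z : R) : 0 <= x -> 0 <= y -> 0 <= z -> x ^+ 2 + z * y ^+ 2 <= (1 + z) * (x + y) ^+ 2.
    move=> x0 y0 z0; have h1 := mulr_ge0 x0 y0; have h2 := mulr_ge0 z0 h1.
    have h3 := mulr_ge0 z0 (sqr_ge0 x); have h4 := sqr_ge0 y.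
    have -> : (1 + z) * (x + y) ^+ 2 = x ^+ 2 + z * y ^+ 2 + (2 * (x * y) + y ^+ 2 + z * x ^+ 2 + 2 * (z * (x * y))) by ring.
    by rewrite lerDl !addr_ge0 ?mulr_ge0.
  exact: aux.
(* [1 + z] stands in for the square root of [z], which keeps roots out of the constant. *)
have sqle (x z : R) : 0 <= x -> 0 <= z -> x ^+ 2 <= z * Y ^+ 2 -> x <= (1 + z) * Y.
  move=> x0 z0 H; rewrite -ler_sqr ?nnegrE ?mulr_ge0 ?addr_ge0//.
  apply: (le_trans H); rewrite exprMn; apply: ler_wpM2r; first exact: sqr_ge0.
  by have := sqr_ge0 z; nra.
have V_le : norm_L2V l T rho ^+ 2 <= A / dl * Y ^+ 2.
  rewrite V2 mulrAC ler_pdivlMr// mulrC; apply: le_trans S_le.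
  by apply: le_trans (est T (ltW T0) (lexx _)); rewrite lerDr sqr_ge0.
have Adl0 : 0 <= A / dl by rewrite divr_ge0// ltW.
have C_le : norm_CL2 l T rho <= A * Y.
  apply: ge_sup; first by exists (norm_LL2 l (continuous_version l T rho 0)), 0 => //=; rewrite in_itv/= lexx ltW.
  move=> _ [t /= tT <-]; move: tT; rewrite in_itv/= => /andP[t0 tT].
  have sqr_le (x y : R) : 0 <= x -> 0 <= y -> x ^+ 2 <= y ^+ 2 -> x <= y.
    by move=> x0 y0; rewrite ler_sqr.
  apply: sqr_le; [exact: norm_LL2_ge0|exact: mulr_ge0|rewrite [leRHS]exprMn].
  apply: (@le_trans _ _ (A * Y ^+ 2)).
    apply: le_trans S_le; apply: le_trans (est t t0 tT); rewrite lerDl mulr_ge0 ?(ltW dl0)//.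
    by apply: (@prim_ae_ge0 _ T) => //; apply: ae_everywhere => s _; exact: sqr_ge0.
  by apply: ler_wpM2r; [exact: sqr_ge0|rewrite expr2 ler_peMl].
(* The equation expresses the time derivative through [f] and [rho]; [du + M] bounds [weak_form] in
   the H1 norms. *)
have G_le : norm_L2Vdual l T g ^+ 2 <= 2 * norm_L2Vdual l T f ^+ 2 + 2 * (du + M) ^+ 2 * norm_L2V l T rho ^+ 2.
  rewrite G2 F2 V2 -(primZ 2 sF.2 (lexx T)) -(primZ _ sV.2 (lexx T)).
  rewrite -(primD (L1Z _ sF.2) (L1Z _ sV.2) (lexx T)).
  apply: (prim_ae_le sG.2 (L1D (L1Z _ sF.2) (L1Z _ sV.2)) (lexx T)).
  have aeV := in_L2_bochner_ae hrho; have aeF := in_L2_bochner_ae hf; have aeG := in_L2_bochner_ae hg.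
  apply: ae_mono (ae_and (ae_and hV (ae_and hF hG)) (ae_and gE (ae_and aeV (ae_and aeF aeG)))) =>
    t [[h1 [h2 h3]] [h4 [h5 [h6 h7]]]] tT.
  rewrite -(h1 tT) -(h2 tT) -(h3 tT).
  have hv := h5 tT; have hFt := h6 tT; have hGt := h7 tT.
  have dM : 0 <= du + M by exact: addr_ge0.
  have p0 : 0 <= norm_VVdual l (f t) + (du + M) * norm_HH1 l (rho t).
    by rewrite addr_ge0 ?(norm_VVdual_ge0 N1 l0 hFt)// mulr_ge0 ?norm_HH1_ge0.
  have H : norm_VVdual l (g t) <= norm_VVdual l (f t) + (du + M) * norm_HH1 l (rho t).
    apply: (norm_VVdual_le N1 l0) => // w hw; rewrite (h4 tT w hw) mulrDl.
    apply: le_trans (ler_normB _ _) _; apply: lerD; first exact: norm_VVdual_ub.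
    exact: weak_form_le.
  have g0 := norm_VVdual_ge0 N1 l0 hGt.
  have aux (x y k v : R) : 0 <= x -> x <= y + k * v -> x ^+ 2 <= 2 * y ^+ 2 + 2 * k ^+ 2 * v ^+ 2.
    move=> x0 xy; apply: (@le_trans _ _ ((y + k * v) ^+ 2)).
      by rewrite ler_sqr ?nnegrE// (le_trans x0).
    rewrite -subr_ge0 (_ : _ - _ = (y - k * v) ^+ 2) ?sqr_ge0//; ring.
  exact: aux.
have V1 := sqle _ _ V0 Adl0 V_le.
(* Adds the bound [A / dl] of the squared L2(0, T; V) norm to the bound of the derivative, in which
   the source contributes the summand 2. *)
pose Z := A / dl * (1 + 2 * (du + M) ^+ 2) + 2.
have Z0 : 0 <= Z by rewrite addr_ge0// mulr_ge0// addr_ge0// mulr_ge0// sqr_ge0.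
have W_le : norm_W l T rho <= (1 + Z) * Y.
  apply: sqle => //; first exact: sqrtr_ge0.
  rewrite sqr_sqrtr ?addr_ge0 ?sqr_ge0//.
  have FY : norm_L2Vdual l T f ^+ 2 <= Y ^+ 2 by rewrite ler_sqr ?nnegrE// lerDr.
  have q0 := sqr_ge0 (du + M).
  have aux (v w ff q y k : R) : v <= k * y -> w <= 2 * ff + 2 * q * v -> ff <= y -> 0 <= q ->
      v + w <= (k * (1 + 2 * q) + 2) * y.
    move=> i1 i2 i3 i4; have i5 := ler_wpM2l i4 i1.
    have -> : (k * (1 + 2 * q) + 2) * y = k * y + 2 * (q * (k * y)) + 2 * y by ring.
    by apply: le_trans (lerD i1 i2) _; rewrite -mulrA -addrA lerD2l addrC; apply: lerD; apply: ler_wpM2l.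
  exact: aux V_le G_le FY q0.
have K_ge : 0 <= A * Y /\ 0 <= (1 + A / dl) * Y /\ 0 <= (1 + Z) * Y.
  by split; [|split]; rewrite mulr_ge0// addr_ge0.
have [k1 [k2 k3]] := K_ge.
have -> : K * Y = A * Y + (1 + A / dl) * Y + (1 + Z) * Y by rewrite /K -/Z !mulrDl.
split; first by rewrite -[leLHS]addr0; apply: lerD => //; exact: lerD.
by apply: (le_trans W_le); rewrite lerDr addr_ge0.
Qed.

(** The difference is never shown to be a weak solution itself: its coefficients are the differences
    of two known families, and [coefficient_energy] supplies its energy identity directly. *)
Lemma weak_solution_unique (rho0 : E) rho rho' :
  weak_solution l T D f u rho0 rho -> weak_solution l T D f u rho0 rho' ->
  {ae mu, forall t, t \in `]0, T[ -> ae_equal l (rho t) (rho' t)}.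
Proof.
move=> ws ws'.
have [hrho hg tdg r0 gE] := weak_solution_pointwise ws.
have [hrho' hg' tdg' r0' gE'] := weak_solution_pointwise ws'.
set g := time_derive l T rho in hg tdg gE; set g' := time_derive l T rho' in hg' tdg' gE'.
have [c [gc [p [En [[hc hE] cP cE rP rae]]]]] := W_structure hrho hg tdg.
have [c' [gc' [p' [En' [[hc' hE'] cP' cE' rP' rae']]]]] := W_structure hrho' hg' tdg'.
have [_ [nV sV hV]] := (in_L2_bochnerP hS (seminorm_HH1 N1 l0) T rho).1 hrho.
have [_ [nV' sV' hV']] := (in_L2_bochnerP hS (seminorm_HH1 N1 l0) T rho').1 hrho'.
(* Differences are written in the shape [r *: x + y] in which linearity of the forms is stated. *)
pose d j t := -1 * c' j t + c j t; pose gd j t := -1 * gc' j t + gc j t.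
have hd j : AC T (d j 0) (gd j) (d j).
  have [i1 E1] := hc j; have [i2 E2] := hc' j; split; first exact: (L1D (L1Z _ i2) i1).
  move=> t t0 tT; rewrite /d (E1 t t0 tT) (E2 t t0 tT) (primD (L1Z _ i2) i1 tT) (primZ _ i2 tT).
  have aux (x y z w : R) : -1 * (x + y) + (z + w) = -1 * x + z + (-1 * y + w) by ring.
  exact: aux.
pose k := ((ca + M) * Num.sqrt cb) ^+ 2.
have k0 : 0 <= k by exact: sqr_ge0.
pose G t := (ca + k) * (2 * nV t ^+ 2 + 2 * nV' t ^+ 2).
have iG : L1 G by apply: L1Z; apply: L1D; apply: L1Z; [exact: sV.2|exact: sV'.2].
pose v t : E := -1 *: rho' t + rho t.
pose F t w := -1 * g' t w + g t w.
have nE t : VV l (rho t) -> VV l (rho' t) -> norm_HH1 l (v t) ^+ 2 <= 2 * norm_HH1 l (rho t) ^+ 2 + 2 * norm_HH1 l (rho' t) ^+ 2.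
  move=> hv hv'; have hd' : VV l (v t) := subD hS (subZ hS _ hv') hv.
  have H (x y z x' y' z' : R) : x = x' -> y = y' -> z = z' -> x' <= 2 * y' + 2 * z' ->
    x <= 2 * y + 2 * z by move=> -> -> ->.
  apply: (H _ _ _ _ _ _ (norm_HH1_sqr N1 l0 hd') (norm_HH1_sqr N1 l0 hv) (norm_HH1_sqr N1 l0 hv')).
  have -> : v t = rho t - rho' t by rewrite /v scaleN1r addrC.
  exact: (ip_sqB_le hS (semi_ip_energy N1 l0 one0)).
have FE : {ae mu, forall t, t \in `]0, T[ -> forall w, VV l w -> F t w = - weak_form t (v t) w}.
  apply: ae_mono (ae_and (ae_and gE gE') (ae_and cP cP')) => t [[h1 h2] [h3 h4]] tT w hw.
  have [hv _ _ _ _] := h3 tT; have [hv' _ _ _ _] := h4 tT.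
  rewrite /F (h1 tT w hw) (h2 tT w hw) /v (weak_formDl t (-1) hv' hv hw).
  have aux (x y z : R) : -1 * (x - y) + (x - z) = - (-1 * y + z) by ring.
  exact: aux.
have HH : {ae mu, forall t, t \in `]0, T[ -> [/\ VV l (v t),
     forall (s : R) x y, VV l x -> VV l y -> F t (s *: x + y) = s * F t x + F t y,
     exists K, [/\ 0 <= K, forall w, VV l w -> `|F t w| <= K * Num.sqrt (a w w) &
       a (v t) (v t) + K ^+ 2 <= G t] &
     forall j, d j t = b (e j) (v t) /\ gd j t = F t (e j)]}.
  apply: ae_mono (ae_and (ae_and cP cP') (ae_and FE (ae_and hV hV'))) => t [[h1 h2] [h3 [h4 h5]]] tT.
  have [hv hF cj _ _] := h1 tT; have [hv' hF' cj' _ _] := h2 tT.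
  have hd' : VV l (v t) := subD hS (subZ hS _ hv') hv.
  have dM : 0 <= ca + M by exact: addr_ge0.
  split => //.
  - move=> s x y hx hy; have hxy : VV l (s *: x + y) := subD hS (subZ hS _ hx) hy.
    rewrite !(h3 tT)// (weak_formDr t s hd' hx hy).
    have aux (z w : R) : - (s * z + w) = s * - z + - w by ring.
    exact: aux.
  - exists ((ca + M) * Num.sqrt cb * norm_HH1 l (v t)); split.
    + by rewrite mulr_ge0 ?norm_HH1_ge0// mulr_ge0 ?sqrtr_ge0.
    + move=> w hw; rewrite (h3 tT)// normrN; apply: le_trans (weak_form_le t D_ca hd' hw) _.
      have -> : (ca + M) * Num.sqrt cb * norm_HH1 l (v t) * Num.sqrt (a w w) =
         (ca + M) * norm_HH1 l (v t) * (Num.sqrt cb * Num.sqrt (a w w)).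
        have aux (x y z s : R) : x * y * z * s = x * z * (y * s) by ring.
        exact: aux.
      apply: ler_wpM2l; first by rewrite mulr_ge0 ?norm_HH1_ge0.
      exact: H_le_sqrt.
    + rewrite exprMn -/k; apply: (@le_trans _ _ ((ca + k) * norm_HH1 l (v t) ^+ 2)).
        by rewrite mulrDl lerD2r; exact: a_le.
      apply: ler_wpM2l; first exact: addr_ge0.
      by rewrite -(h4 tT) -(h5 tT); exact: nE.
  - move=> j; rewrite /d /gd /F (cj j).1 (cj j).2 (cj' j).1 (cj' j).2; split => //.
    by rewrite /v (ipDr hS hb (subZ hS _ hv') hv (Se j)) (ipZr hS hb _ hv' (Se j)).
have [_ _ [q [Ed [hEd cEd qP EdP]]]] := coefficient_energy hd iG HH.
(* Coefficients at time 0 are those of the continuous versions, which both agree with [rho0] almost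
   everywhere. *)
have d0 j : d j 0 = 0.
  have [hr0 /(_ j) c0 _] := rP 0 (lexx _) (ltW T0); have [hr0' /(_ j) c0' _] := rP' 0 (lexx _) (ltW T0).
  rewrite /d -c0 -c0'.
  have EQ : b (e j) (continuous_version l T rho' 0) = b (e j) (continuous_version l T rho 0).
    apply: eq_bigr => i _; apply: inner_L2_ae; first exact: ae_everywhere.
    by apply: ae_mono (ae_and (r0 i) (r0' i)) => x [i1 i2] xl; rewrite i1// i2.
  by rewrite EQ mulN1r addNr.
have Ed0 : Ed 0 = 0.
  have h1 := cEd 0 (lexx _) (ltW T0).
  have E1 : (fun J => \sum_(0 <= j < J) d j 0 ^+ 2) = (fun=> 0).
    by apply/funext => J; rewrite big1// => j _; rewrite d0 expr0n.
  by rewrite E1 in h1; exact: (cvg_unique _ h1 (cvg_cst (0 : R))).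
have z1 : L1 (fun=> 0 : R) by exact: L1_cst.
have Ed_ge s : 0 <= s -> s <= T -> 0 <= Ed s.
  move=> s0 sT; apply: (cvgr_to_ge (cEd s s0 sT)); apply: nearW => n.
  by apply: sumr_ge0 => j _; exact: sqr_ge0.
have gr := gronwall (ltW T0) kap0 hEd z1 z1 Ed_ge (ae_everywhere (fun _ _ => lexx 0)) (ae_everywhere (fun _ _ => lexx 0)).
have Hq : {ae mu, forall t, t \in `]0, T[ -> q t + 0 <= kap * Ed t + 0}.
  apply: ae_mono (ae_and (ae_and qP EdP) (ae_and FE HH)) => t [[h1 h2] [h3 h4]] tT.
  have [hv _ _ _] := h4 tT; rewrite (h1 tT) (h2 tT) (h3 tT _ hv) !addr0.
  have n00 : `|0 : R| <= 0 * norm_HH1 l (v t) by rewrite normr0 mul0r.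
  have := weak_form_coercive t hv n00; rewrite expr0n mulr0 addr0 sub0r; apply: le_trans.
  by rewrite lerDl mulr_ge0 ?sqr_ge0// ltW.
have {}gr := gr Hq.
apply: ae_mono (ae_and EdP (ae_and cP cP')) => t [h1 [h2 h3]] tT.
have [hv _ _ _ _] := h2 tT; have [hv' _ _ _ _] := h3 tT; have [t0 t1] := in_oo tT.
have p0 s : prim (fun=> 0) s = 0 :> R by rewrite /prim Int0.
have := gr t t0 t1; rewrite !p0 Ed0 !addr0 mulr0 => Et.
have Et0 : Ed t = 0 by apply/eqP; rewrite eq_le Et Ed_ge.
apply: (ae_equalP (VV_LL2 hv) (VV_LL2 hv')).
by have := h1 tT; rewrite Et0 /v scaleN1r addrC => <-.
Qed.

(* The part of [weak_form] left after [energy_form], for which the basis [e] is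
   diagonal; it is bounded from L2 to the dual of V. *)
Let lower_form t v w : R := drift_form l ub t v w - b v w.
Let kl : R := M * Num.sqrt cb + 1.
Let kl0 : 0 <= kl. Proof. by rewrite addr_ge0// mulr_ge0 ?sqrtr_ge0. Qed.

Let weak_formE t v w : weak_form t v w = a v w + lower_form t v w.
Proof.
have aux (x y z : R) : y + z = x + y + (z - x) by ring.
exact: aux.
Qed.

Let lower_Dl t w : VV l w -> forall (r : R) v v', VV l v -> VV l v' ->
  lower_form t (r *: v + v') w = r * lower_form t v w + lower_form t v' w.
Proof.
move=> hw r v v' hv hv'; rewrite /lower_form (drift_formDl N1 l0 mub ubM)//; try exact: VV_LL2.
rewrite (ipDl hb (subZ hS r hv) hv' hw) (ipZl hb r hv hw).
have aux (x y z z' : R) : r * x + y - (r * z + z') = r * (x - z) + (y - z') by ring.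
exact: aux.
Qed.

Let lower_Dr t v : VV l v -> forall (r : R) w w', VV l w -> VV l w' ->
  lower_form t v (r *: w + w') = r * lower_form t v w + lower_form t v w'.
Proof.
move=> hv r w w' hw hw'; rewrite /lower_form (drift_formDr N1 l0 mub ubM)//; last exact: VV_LL2.
rewrite (ipDr hS hb (subZ hS r hw) hw' hv) (ipZr hS hb r hw hv).
have aux (x y z z' : R) : r * x + y - (r * z + z') = r * (x - z) + (y - z') by ring.
exact: aux.
Qed.

Let lower_le t v w : VV l v -> VV l w ->
  `|lower_form t v w| <= kl * Num.sqrt (b v v) * Num.sqrt (a w w).
Proof.
move=> hv hw; apply: le_trans (ler_normB _ _) _.
have -> : kl * Num.sqrt (b v v) * Num.sqrt (a w w) =
   M * Num.sqrt (b v v) * (Num.sqrt cb * Num.sqrt (a w w)) + Num.sqrt (b v v) * Num.sqrt (a w w).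
  have aux (m s x y : R) : (m * s + 1) * x * y = m * x * (s * y) + x * y by ring.
  exact: aux.
apply: lerD.
  apply: le_trans (drift_le t hv hw) _; apply: ler_wpM2l; first by rewrite mulr_ge0 ?sqrtr_ge0.
  exact: le_trans (sqrt_gdot_le hw) (H_le_sqrt hw).
apply: le_trans (ip_norm_le hS hb hv hw) _; apply: ler_wpM2l; first exact: sqrtr_ge0.
by apply: ler_wsqrtr; exact: ba.
Qed.

(** The matrix bound asked for by [picard_solution]: it is [dual_bessel] for the functional obtained
    by fixing a finite combination of basis vectors in the first argument. *)
Let lower_bound t J n (x : nat -> R) :
  \sum_(0 <= j < J) (\sum_(0 <= k < n) x k * lower_form t (e k) (e j)) ^+ 2 / la j <=
  kl ^+ 2 * \sum_(0 <= k < n) x k ^+ 2.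
Proof.
set v : E := \sum_(0 <= k < n) x k *: e k.
have hv : VV l v := osum_in hS Se 0 n x.
have FE j : lower_form t v (e j) = \sum_(0 <= k < n) x k * lower_form t (e k) (e j).
  exact: (linF_sum hS Se (lower_Dl t (Se j)) 0 n x).
have K0 : 0 <= kl * Num.sqrt (b v v) by rewrite mulr_ge0 ?sqrtr_ge0.
have := dual_bessel hS ha Se la1 orth unit eigen (lower_Dr t hv) K0 (fun w hw => lower_le t hv hw) J.
have -> : \sum_(0 <= j < J) lower_form t v (e j) ^+ 2 / la j =
    \sum_(0 <= j < J) (\sum_(0 <= k < n) x k * lower_form t (e k) (e j)) ^+ 2 / la j.
  by apply: eq_bigr => j _; rewrite FE.
move=> h; apply: (le_trans h); rewrite exprMn (sqr_sqrtr (ip_ge0 hb hv)).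
apply: ler_wpM2l; first exact: sqr_ge0.
rewrite (osum_sqr hS hb Se orth 0 n x); apply: ler_sum => k _.
by rewrite ler_piMl ?sqr_ge0.
Qed.

(** The initial datum lies in L2 only, where [parseval_b] does not apply; nonnegativity of the
    squared distance to the partial sum is enough. *)
Let bessel_LL2 z n : LL2 l z -> \sum_(0 <= i < n) b (e i) z ^+ 2 <= b z z.
Proof.
move=> hz; set y := fun i => b (e i) z; pose s : E := \sum_(0 <= i < n) y i *: e i.
have hs : LL2 l s := osum_in hL SeL 0 n y.
have := ip_ge0 hbL (subB hL hz hs); rewrite (ip_sqB hL hbL hz hs) (ipC hbL hz hs).
rewrite {1}/s (osum_ip hL hbL SeL 0 n y hz) (osum_sqr hL hbL SeL orth 0 n y).
have h1 : \sum_(0 <= i < n) b (e i) (e i) * y i ^+ 2 <= \sum_(0 <= i < n) y i ^+ 2.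
  by apply: ler_sum => k _; rewrite ler_piMl ?sqr_ge0.
have -> : \sum_(0 <= i < n) y i * b (e i) z = \sum_(0 <= i < n) y i ^+ 2.
  by apply: eq_bigr => i _; rewrite expr2.
move: h1; move: (\sum_(0 <= i < n) y i ^+ 2) (\sum_(0 <= i < n) b (e i) (e i) * y i ^+ 2) (b z z).
by move=> p q r h1 h2; lra.
Qed.

(** By expansion [z] is orthogonal to all of V, which is dense in L2. *)
Let LL2_orth z : LL2 l z -> (forall j, b (e j) z = 0) -> forall i, {ae mu, forall x, x \in `]0, l i[ -> z i x = 0}.
Proof.
move=> hz h; apply: (VV_dense l0 hz) => phi hphi.
have linz (r : R) x y : VV l x -> VV l y -> b z (r *: x + y) = r * b z x + b z y.
  move=> /VV_LL2 hx /VV_LL2 hy.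
  by rewrite (ipDr hL hbL (subZ hL r hx) hy hz) (ipZr hL hbL r hx hz).
apply: (dual_eq0 hS ha Se basis linz (sqrtr_ge0 (b z z)) _ hphi) => [w hw|j].
  apply: le_trans (ip_norm_le hL hbL hz (VV_LL2 hw)) _.
  by apply: ler_wpM2l; [exact: sqrtr_ge0|apply: ler_wsqrtr; exact: ba].
by rewrite (ipC hbL hz (SeL j)).
Qed.

Let test_bounded eta : test_function T eta -> forall n, sqint mu `]0, T[ n ->
  L1 (fun t => n t * `|eta t|) /\ L1 (fun t => n t * `|derive1 eta t|).
Proof.
move=> teta n sn; have [_ ce cde _ _] := test_derive teta.
have H (h : R -> R) : continuous h -> continuous (fun t => `|h t|).
  by move=> ch t; apply: cvg_norm; exact: ch.
by split; apply: L1_mul_continuous; [exact: SqL1|exact: H|exact: SqL1|exact: H].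
Qed.

Let Int_bound (h n q : R -> R) (k : R) : sqint mu `]0, T[ h -> L1 (fun t => h t * q t) ->
  L1 (fun t => n t * `|q t|) -> {ae mu, forall t, t \in `]0, T[ -> `|h t| <= k * n t} ->
  `|\int[mu]_(t in `]0, T[) (h t * q t)| <= k * \int[mu]_(t in `]0, T[) (n t * `|q t|).
Proof.
move=> sh hq nq H; rewrite -(IntZ (measurable_oo 0 T) k nq).
apply: le_trans (le_norm_Int (measurable_oo 0 T) hq) _.
apply: (Int_ae_le (measurable_oo 0 T) (itg_norm hq) (L1Z k nq)).
apply: ae_mono H => t H /= tT; rewrite normrM mulrA; apply: ler_wpM2r => //; exact: H.
Qed.

(** For a fixed [eta] the defect of the identity is a bounded linear functional of the test vector,
    so it vanishes as soon as it does on the basis. *)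
Lemma time_derivative_of_coefficients rho g : in_L2V l T rho -> in_L2Vdual l T g ->
  (forall j eta, test_function T eta ->
    \int[mu]_(t in `]0, T[) (b (rho t) (e j) * derive1 eta t) =
    - \int[mu]_(t in `]0, T[) (g t (e j) * eta t)) ->
  time_derivative l T rho g.
Proof.
move=> hrho hg H eta phi teta hphi.
have [_ [nV sV hV]] := (in_L2_bochnerP hS (seminorm_HH1 N1 l0) T rho).1 hrho.
have [_ [nG sG hG]] := (in_L2_bochnerP (subspace_VVdual l) (seminorm_VVdual N1 l0) T g).1 hg.
have aeV := in_L2_bochner_ae hrho; have aeG := in_L2_bochner_ae hg.
pose L w := \int[mu]_(t in `]0, T[) (b (rho t) w * derive1 eta t) + \int[mu]_(t in `]0, T[) (g t w * eta t).
have linL (r : R) x y : VV l x -> VV l y -> L (r *: x + y) = r * L x + L y.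
  move=> hx hy.
  have [X sX hX] := in_L2V_inner hrho (VV_LL2 hx); have [Y sY hY] := in_L2V_inner hrho (VV_LL2 hy).
  have [X' sX' hX'] := in_L2Vdual_eval hg hx; have [Y' sY' hY'] := in_L2Vdual_eval hg hy.
  have [j1 i1] := test_L1 sX teta; have [j2 i2] := test_L1 sY teta.
  have [i3 j3] := test_L1 sX' teta; have [i4 j4] := test_L1 sY' teta.
  have E1 : {ae mu, forall t, t \in `]0, T[ -> b (rho t) (r *: x + y) = r * X t + Y t}.
    apply: ae_mono (ae_and aeV (ae_and hX hY)) => t [h1 [h2 h3]] tT; have hv := VV_LL2 (h1 tT).
    rewrite (ipDr hL hbL (subZ hL r (VV_LL2 hx)) (VV_LL2 hy) hv) (ipZr hL hbL r (VV_LL2 hx) hv).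
    by rewrite h2// h3.
  have E2 : {ae mu, forall t, t \in `]0, T[ -> g t (r *: x + y) = r * X' t + Y' t}.
    apply: ae_mono (ae_and aeG (ae_and hX' hY')) => t [h1 [h2 h3]] tT; have hv := h1 tT.
    have -> : g t (r *: x + y) = r * g t x + g t y := hv.1 r x y hx hy.
    by rewrite h2// h3.
  rewrite /L (Int_version _ E1) (Int_version _ E2) (Int_version _ hX) (Int_version _ hY).
  rewrite (Int_version _ hX') (Int_version _ hY').
  have -> : \int[mu]_(t in `]0, T[) ((r * X t + Y t) * derive1 eta t) =
     r * \int[mu]_(t in `]0, T[) (X t * derive1 eta t) + \int[mu]_(t in `]0, T[) (Y t * derive1 eta t).
    rewrite -(IntZ (measurable_oo 0 T) r i1) -(IntD (measurable_oo 0 T) (L1Z r i1) i2).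
    by apply: eq_Rintegral => t _; rewrite mulrDl mulrA.
  have -> : \int[mu]_(t in `]0, T[) ((r * X' t + Y' t) * eta t) =
     r * \int[mu]_(t in `]0, T[) (X' t * eta t) + \int[mu]_(t in `]0, T[) (Y' t * eta t).
    rewrite -(IntZ (measurable_oo 0 T) r i3) -(IntD (measurable_oo 0 T) (L1Z r i3) i4).
    by apply: eq_Rintegral => t _; rewrite mulrDl mulrA.
  have aux (x1 x2 x3 x4 : R) : r * x1 + x2 + (r * x3 + x4) = r * (x1 + x3) + (x2 + x4) by ring.
  exact: aux.
have [_ q1] := test_bounded teta sV; have [q2 _] := test_bounded teta sG.
set I1 := \int[mu]_(t in `]0, T[) (nV t * `|derive1 eta t|).
set I2 := \int[mu]_(t in `]0, T[) (nG t * `|eta t|).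
have KL0 w : VV l w -> `|L w| <= (`|I1| + `|I2|) * norm_HH1 l w.
  move=> hw; have [X sX hX] := in_L2V_inner hrho (VV_LL2 hw); have [X' sX' hX'] := in_L2Vdual_eval hg hw.
  have [_ i1] := test_L1 sX teta; have [i2 _] := test_L1 sX' teta.
  rewrite /L (Int_version _ hX) (Int_version _ hX'); apply: le_trans (ler_normD _ _) _.
  have B1 : `|\int[mu]_(t in `]0, T[) (X t * derive1 eta t)| <= norm_HH1 l w * I1.
    apply: Int_bound => //; apply: ae_mono (ae_and aeV (ae_and hV hX)) => t [h1 [h2 h3]] tT.
    have hv := h1 tT; rewrite -(h3 tT) -(h2 tT) mulrC.
    apply: le_trans (b_le (VV_LL2 hv) hw) _; apply: ler_wpM2r; first exact: norm_HH1_ge0.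
    by rewrite (norm_LL2E (VV_LL2 hv)); exact: sqrt_b_le.
  have B2 : `|\int[mu]_(t in `]0, T[) (X' t * eta t)| <= norm_HH1 l w * I2.
    apply: Int_bound => //; apply: ae_mono (ae_and aeG (ae_and hG hX')) => t [h1 [h2 h3]] tT.
    by rewrite -(h3 tT) -(h2 tT) mulrC; exact: (norm_VVdual_ub N1 l0 (h1 tT) hw).
  rewrite mulrC mulrDr; apply: lerD.
    by apply: (le_trans B1); apply: ler_wpM2l; [exact: norm_HH1_ge0|exact: ler_norm].
  by apply: (le_trans B2); apply: ler_wpM2l; [exact: norm_HH1_ge0|exact: ler_norm].
have K0 : 0 <= (`|I1| + `|I2|) * Num.sqrt cb by rewrite mulr_ge0 ?sqrtr_ge0// addr_ge0.
have KL w : VV l w -> `|L w| <= (`|I1| + `|I2|) * Num.sqrt cb * Num.sqrt (a w w).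
  move=> hw; apply: (le_trans (KL0 w hw)); rewrite -mulrA; apply: ler_wpM2l; first exact: addr_ge0.
  exact: H_le_sqrt.
have L0 j : L (e j) = 0 by rewrite /L (H j eta teta) addNr.
have := dual_eq0 hS ha Se basis linL K0 KL hphi L0.
by rewrite /L => /eqP; rewrite addr_eq0 => /eqP.
Qed.

Let dual_bessel_norm (F : E -> R) : VVdual l F -> forall J, \sum_(0 <= j < J) F (e j) ^+ 2 / la j <= cb * norm_VVdual l F ^+ 2.
Proof.
move=> hF J; have lF (r : R) x y : VV l x -> VV l y -> F (r *: x + y) = r * F x + F y := hF.1 r x y.
have K0 : 0 <= norm_VVdual l F * Num.sqrt cb.
  by rewrite mulr_ge0 ?sqrtr_ge0//; exact: (norm_VVdual_ge0 N1 l0 hF).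
have := dual_bessel hS ha Se la1 orth unit eigen lF K0 (VVdual_bound hF) J.
by rewrite exprMn sqr_sqrtr// mulrC.
Qed.

(** The last clause matters because a basis vector may be zero: the coefficient attached to it must
    vanish for [c] to be the coefficients of a vector. *)
Let coefficient_evolution (rho0 : E) : LL2 l rho0 -> exists (fj c S : nat -> R -> R) (B : R),
  let g := fun (j : nat) (t : R) => fj j t - S j t - la j * c j t in
  [/\ {ae mu, forall t, t \in `]0, T[ -> forall j, f t (e j) = fj j t},
      forall j, AC T (b (e j) rho0) (g j) (c j),
      forall j, L1 (energy la g c j),
      forall J, \sum_(0 <= j < J) prim (energy la g c j) T <= B &
      (forall t j, t \in `]0, T[ ->
        \sum_(0 <= k < n) c k t * lower_form t (e k) (e j) @[n --> \oo] --> S j t) /\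
      forall j, e j = 0 -> forall t, 0 <= t -> t <= T -> c j t = 0].
Proof.
move=> h0.
have [fj fjP] := choice (fun j => (let: ex_intro2 h h1 h2 := in_L2Vdual_eval hf (Se j) in
  ex_intro _ h (conj h1 h2) : exists h, _ /\ _)).
have [_ [nF sF hF]] := (in_L2_bochnerP (subspace_VVdual l) (seminorm_VVdual N1 l0) T f).1 hf.
have fae : {ae mu, forall t, t \in `]0, T[ -> forall j, f t (e j) = fj j t}.
  by apply: ae_mono (ae_alln (fun j => (fjP j).2)) => t H tT j; exact: H.
have mU j k : measurable_fun `]0, T[ (fun t => lower_form t (e k) (e j)).
  apply: measurable_funB; last exact: measurable_cst.
  exact: (drift_form_measurable N1 l0 mub (SeL k) (Se j)).
have M20 : 0 <= kl ^+ 2 by exact: sqr_ge0.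
have HU t J n (x : nat -> R) : t \in `]0, T[ ->
   \sum_(0 <= j < J) (\sum_(0 <= k < n) x k * (fun j k t => lower_form t (e k) (e j)) j k t) ^+ 2 / la j <=
   kl ^+ 2 * \sum_(0 <= k < n) x k ^+ 2.
  by move=> _; exact: lower_bound.
have fl j : L1 (fun t => fj j t ^+ 2 / la j).
  by apply: (L1_eq (L1Z (la j)^-1 (fjP j).1.2)) => t _ /=; rewrite mulrC.
have fB J : \sum_(0 <= j < J) prim (fun t => fj j t ^+ 2 / la j) T <= prim (fun t => cb * nF t ^+ 2) T.
  have -> : \sum_(0 <= j < J) prim (fun t => fj j t ^+ 2 / la j) T =
      prim (fun t => \sum_(0 <= j < J) fj j t ^+ 2 / la j) T.
    by symmetry; exact: (Int_sum (measurable_oo 0 T) _ (fun j _ => fl j)).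
  apply: (prim_ae_le (L1_sum _ (fun j _ => fl j)) (L1Z cb sF.2) (lexx T)).
  have aeF := in_L2_bochner_ae hf.
  apply: ae_mono (ae_and aeF (ae_and hF fae)) => t [h1 [h2 h3]] tT.
  rewrite -(h2 tT); under eq_bigr do rewrite -(h3 tT).
  exact: (dual_bessel_norm (h1 tT)).
have yB : ell2 (fun j => b (e j) rho0) (b rho0 rho0) by move=> n; exact: bessel_LL2.
have [c [S [B [hc hL1 hB hS']]]] := picard_solution T0 la1 M20 mU HU (fun j => SqL1 (fjP j).1)
  (fun j => (fjP j).1.2) fB yB.
exists fj, c, S, B; split => //; split => // j ej.
(* The mode of a zero basis vector receives neither coupling, nor source, nor initial value;
   Gronwall's lemma for its square makes it vanish. *)
have U0 k t : lower_form t (e k) (e j) = 0.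
  have aj : a (e j) (e j) = 0 by rewrite ej (ip0l hS ha (sub0 hS)).
  by have := lower_le t (Se k) (Se j); rewrite aj sqrtr0 mulr0 normr_le0 => /eqP.
have S0 t : t \in `]0, T[ -> S j t = 0.
  move=> tT; have h1 := hS' t j tT.
  have E1 : (fun n => \sum_(0 <= k < n) c k t * lower_form t (e k) (e j)) = (fun=> 0).
    by apply/funext => n; rewrite big1// => k _; rewrite U0 mulr0.
  by rewrite E1 in h1; exact: (cvg_unique _ h1 (cvg_cst (0 : R))).
have hcj := hc j; rewrite ej (ip0l hL hbL h0) in hcj.
have hsq := AC_sqr (ltW T0) hcj; rewrite expr0n in hsq.
have z1 : L1 (fun=> 0 : R) by exact: L1_cst.
have gr := gronwall (ltW T0) (lexx (0 : R)) hsq z1 z1 (fun t _ _ => sqr_ge0 _) (ae_everywhere (fun _ _ => lexx 0)) (ae_everywhere (fun _ _ => lexx 0)).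
have {}gr := gr _.
have f00 : {ae mu, forall t, t \in `]0, T[ -> fj j t = 0}.
  have aeF := in_L2_bochner_ae hf.
  apply: ae_mono (ae_and aeF fae) => t [h1 h2] tT; rewrite -(h2 tT) ej.
  have := VVdualZ N1 l0 0 (h1 tT) (Se j); rewrite ej scaler0 mul0r; exact.
have p0 s : prim (fun=> 0) s = 0 :> R by rewrite /prim Int0.
move=> t t0 tT; apply/eqP; rewrite -sqrf_eq0 eq_le sqr_ge0 andbT.
have := gr _ t t0 tT; rewrite !p0 !addr0 mulr0; apply.
apply: ae_mono f00 => s H sT; rewrite (H sT) (S0 s sT) !addr0 mul0r.
have aux (x y : R) : 0 <= x -> 2 * ((0 - 0 - x * y) * y) <= 0.
  move=> x0; have -> : 2 * ((0 - 0 - x * y) * y) = - (2 * (x * y ^+ 2)) by ring.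
  by rewrite oppr_le0 mulr_ge0// mulr_ge0 ?sqr_ge0.
by apply: aux; exact: ltW.
Qed.

Theorem weak_solution_exists (rho0 : E) : LL2 l rho0 -> exists rho, weak_solution l T D f u rho0 rho.
Proof.
move=> h0; have [fj [c [S [B [fae hc hL1 hB [hSj hz]]]]]] := coefficient_evolution h0.
set gj := fun (j : nat) (t : R) => fj j t - S j t - la j * c j t in hc hL1 hB.
have en0 j t : 0 <= energy la gj c j t.
  have lj := ltW (la0 j).
  by apply: addr_ge0; [exact: mulr_ge0 lj (sqr_ge0 _)|exact: divr_ge0 (sqr_ge0 _) lj].
have lac j t : la j * c j t ^+ 2 <= energy la gj c j t.
  by rewrite lerDl; exact: divr_ge0 (sqr_ge0 _) (ltW (la0 j)).
(* The time integrals of the energies have bounded partial sums, so at almost every time the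
   energies themselves are summable. *)
have bnd : {ae mu, forall t, t \in `]0, T[ -> exists Bt : R, forall J, \sum_(0 <= j < J) energy la gj c j t <= Bt}.
  have hB' J : \sum_(k < J) \int[mu]_(t in `]0, T[) (energy la gj c k t) <= B.
    by have := hB J; rewrite big_mkord.
  apply: ae_mono (ae_series_cvg (measurable_oo 0 T) hL1 en0 hB') => t H tT.
  have /cvg_ex[L hL'] := H tT; exists L => J.
  exact: (sum_le_lim J (fun j => en0 j t) hL').
have oa := basis_orth_a Se orth eigen.
(* At such times the series converges in V by completeness for [a]; at the other times any vector
   will do. *)
have ex t : exists w : E, (exists Bt : R, forall J, \sum_(0 <= j < J) energy la gj c j t <= Bt) ->
    VV l w /\ let s n := \sum_(0 <= j < n) c j t *: e j in a (s n - w) (s n - w) @[n --> \oo] --> (0 : R).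
  have [[Bt HB]|nB] := pselect (exists Bt : R, forall J, \sum_(0 <= j < J) energy la gj c j t <= Bt);
    last by exists 0 => /nB.
  have xB J : \sum_(0 <= j < J) a (e j) (e j) * c j t ^+ 2 <= Bt.
    apply: le_trans (HB J); apply: ler_sum => j _; apply: le_trans (lac j t).
    apply: ler_wpM2r; first exact: sqr_ge0.
    rewrite eigen// -[leRHS]mulr1; apply: ler_wpM2l => //; exact: ltW.
  by have [w hw cw] := osum_complete hS ha Se oa (energy_complete N1 l0 D0) xB; exists w.
have [rho rhoP] := choice ex.
have rhoA : {ae mu, forall t, t \in `]0, T[ -> [/\ VV l (rho t),
    (let s n := \sum_(0 <= j < n) c j t *: e j in a (s n - rho t) (s n - rho t) @[n --> \oo] --> (0 : R)),
    forall j, b (e j) (rho t) = c j t &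
    exists Bt : R, forall J, \sum_(0 <= j < J) energy la gj c j t <= Bt]}.
  apply: ae_mono bnd => t H tT; have [hv cv] := rhoP t (H tT); split => //; last exact: H.
  have [ej _] := osum_limit hS ha Se oa hv cv.
  have [t0 t1] := in_oo tT.
  move=> j; have := ej j; rewrite !eigen//.
  have [-> |e0] := unit j.
    have ln : la j != 0 by rewrite gt_eqF.
    by rewrite mulr1 [c j t * _]mulrC => /(mulfI ln).
  by move=> _; rewrite (hz j e0 t t0 t1) e0 (ip0l hS hb hv).
have mc j : measurable_fun `]0, T[ (c j) by exact: AC_measurable (ltW T0) (hc j).
have mgj j : measurable_fun `]0, T[ (gj j) by have [h _] := hc j; exact: itg_measurable h.
have sqb (x y : R) : x ^+ 2 <= y -> `|x| <= 1 + y.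
  by move=> xy; have := sqr_ge0 (`|x| - 1); have := real_normK (num_real x); nra.
have smr : strongly_measurable T (VV l : set E) (norm_HH1 l) rho.
  apply: (strongly_measurable_series hS (seminorm_HH1 N1 l0) (y := c) (d := e) mc Se).
  apply: ae_mono rhoA => t H tT; have [hv cv ej [Bt HB]] := H tT; split => //.
    exists (1 + Bt) => j; apply: sqb.
    apply: le_trans (HB j.+1); rewrite big_nat_recr//=.
    apply: (@le_trans _ _ (energy la gj c j t)); last by rewrite lerDr sumr_ge0.
    by apply: le_trans (lac j t); rewrite ler_peMl ?sqr_ge0.
  apply: sqr_cvg0.
  have c0 : cb * a (\sum_(0 <= j < n) c j t *: e j - rho t) (\sum_(0 <= j < n) c j t *: e j - rho t) @[n --> \oo] --> (0 : R).
    by rewrite -[X in _ --> X](mulr0 cb); apply: cvgMr; exact: cv.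
  apply: (cvg0_le _ c0); apply: nearW => n; rewrite ger0_norm ?sqr_ge0//.
  have hd : VV l (\sum_(0 <= j < n) c j t *: e j - rho t) := subB hS (osum_in hS Se 0 n _) hv.
  by rewrite -(big_mkord xpredT (fun j => c j t *: e j)); exact: H_le.
have hrho : in_L2V l T rho.
  apply/(in_L2_bochnerP hS (seminorm_HH1 N1 l0) T rho); split => //.
  have [n mn hn] := strongly_measurable_norm hS (seminorm_HH1 N1 l0) smr.
  exists n => //.
  (* Fatou's lemma on the Parseval sums: their time integrals stay below [B], so the squared V norm
     of [rho] is integrable. *)
  pose A J t := \sum_(0 <= j < J) la j * c j t ^+ 2.
  have iA J : L1 (A J).
    by apply: L1_sum => j _; apply: L1Z; exact: (AC_L1 (ltW T0) (AC_sqr (ltW T0) (hc j))).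
  have A0 J t : 0 <= A J t by apply: sumr_ge0 => j _; rewrite mulr_ge0 ?sqr_ge0// ltW.
  have limA : {ae mu, forall t, t \in `]0, T[ -> A J t @[J --> \oo] --> a (rho t) (rho t)}.
    apply: ae_mono rhoA => t H tT; have [hv _ ej _] := H tT.
    have := parseval_a hS ha hb Se orth unit eigen basis hv.
    have -> // : (fun n => \sum_(0 <= i < n) la i * b (e i) (rho t) ^+ 2) = (fun J => A J t).
    by apply/funext => J; apply: eq_bigr => j _; rewrite ej.
  have [h mh hh] := @ae_limit_measurable _ _ _ mu `]0, T[ A (fun J => itg_measurable (iA J))
    (ae_mono (fun t H tT => cvgP _ (H tT)) limA).
  have AB J : \int[mu]_(t in `]0, T[) A J t <= B.
    apply: le_trans (hB J).
    have -> : \sum_(0 <= j < J) prim (energy la gj c j) T = prim (fun t => \sum_(0 <= j < J) energy la gj c j t) T.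
      by symmetry; exact: (Int_sum (measurable_oo 0 T) _ (fun j _ => hL1 j)).
    apply: (prim_ae_le (iA J) (L1_sum _ (fun j _ => hL1 j)) (lexx T)).
    by apply: ae_everywhere => t _; apply: ler_sum => j _; exact: lac.
  have [ih _] := Int_fatou (measurable_oo 0 T) iA (fun J t _ => A0 J t) mh hh AB.
  split => //; apply: (L1_ae_le _ (L1Z cb ih)); first exact: measurable_funX.
  apply: ae_mono (ae_and (ae_and rhoA hn) (ae_and limA hh)) => t [[h1 h2] [h3 h4]] tT.
  have [hv _ _ _] := h1 tT; rewrite ger0_norm ?sqr_ge0// -(h2 tT).
  have -> : h t = a (rho t) (rho t) by exact: (cvg_unique _ (h4 tT) (h3 tT)).
  exact: H_le.
(* The equation itself defines the candidate for the time derivative. *)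
pose g t w := f t w - weak_form t (rho t) w.
have aeF := in_L2_bochner_ae hf.
have dM : 0 <= ca + M by exact: addr_ge0.
have gV : {ae mu, forall t, t \in `]0, T[ -> VVdual l (g t) /\
    forall w, VV l w -> `|g t w| <= (norm_VVdual l (f t) + (ca + M) * norm_HH1 l (rho t)) * norm_HH1 l w}.
  apply: ae_mono (ae_and rhoA aeF) => t [h1 h2] tT; have [hv _ _ _] := h1 tT; have hFt := h2 tT.
  have H w : VV l w -> `|g t w| <= (norm_VVdual l (f t) + (ca + M) * norm_HH1 l (rho t)) * norm_HH1 l w.
    move=> hw; rewrite /g mulrDl; apply: le_trans (ler_normB _ _) _; apply: lerD.
      exact: (norm_VVdual_ub N1 l0 hFt hw).
    exact: (weak_form_le t D_ca hv hw).
  split => //; split; last by eexists; exact: H.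
  move=> r x y hx hy; rewrite /g.
  have -> : f t (fun i z => r * x i z + y i z) = r * f t x + f t y := hFt.1 r x y hx hy.
  have -> : weak_form t (rho t) (fun i z => r * x i z + y i z) = r * weak_form t (rho t) x + weak_form t (rho t) y.
    exact: (weak_formDr t r hv hx hy).
  have aux (x1 x2 x3 x4 : R) : r * x1 + x2 - (r * x3 + x4) = r * (x1 - x3) + (x2 - x4) by ring.
  exact: aux.
have gE : {ae mu, forall t, t \in `]0, T[ -> forall j, g t (e j) = gj j t}.
  apply: ae_mono (ae_and rhoA fae) => t [h1 h2] tT j; have [hv cv ej _] := h1 tT.
  rewrite /g /gj weak_formE (h2 tT) (ipC ha hv (Se j)) eigen// ej.
  (* [S j t] is a limit along partial sums of [rho t]; [lower_form] is continuous in its first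
     argument, so the limit is its value at [rho t]. *)
  suff -> : S j t = lower_form t (rho t) (e j).
    have aux (x y z : R) : x - (y + z) = x - z - y by ring.
    exact: aux.
  have Ss n : VV l (\sum_(0 <= k < n) c k t *: e k) := osum_in hS Se 0 n _.
  have lowB x y : VV l x -> VV l y -> lower_form t (x - y) (e j) = lower_form t x (e j) - lower_form t y (e j).
    move=> hx hy; have := lower_Dl t (Se j) (-1) hy hx; rewrite scaleN1r mulN1r => E1.
    by rewrite (addrC x (- y)) E1 (addrC (lower_form t x (e j))).
  have E1 : (fun n => \sum_(0 <= k < n) c k t * lower_form t (e k) (e j)) =
     (fun n => lower_form t (\sum_(0 <= k < n) c k t *: e k) (e j)).
    apply/funext => n; symmetry.
    exact: (linF_sum hS Se (lower_Dl t (Se j)) 0 n (c^~ t)).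
  have h3 := hSj t j tT; rewrite E1 in h3.
  suff h4 : lower_form t (\sum_(0 <= k < n) c k t *: e k) (e j) @[n --> \oo] --> lower_form t (rho t) (e j).
    exact: (cvg_unique _ h3 h4).
  apply/subr_cvg0; apply: sqr_cvg0.
  have c0 : (kl ^+ 2 * a (e j) (e j)) * a (\sum_(0 <= k < n) c k t *: e k - rho t) (\sum_(0 <= k < n) c k t *: e k - rho t) @[n --> \oo] --> (0 : R).
    by rewrite -[X in _ --> X](mulr0 (kl ^+ 2 * a (e j) (e j))); apply: cvgMr; exact: cv.
  apply: (cvg0_le _ c0); apply: nearW => n; rewrite ger0_norm ?sqr_ge0// -lowB//.
  have hd := subB hS (Ss n) hv.
  have := lower_le t hd (Se j); rewrite -ler_sqr ?nnegrE ?mulr_ge0 ?sqrtr_ge0//.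
  rewrite real_normK ?num_real// !exprMn (sqr_sqrtr (ip_ge0 hb hd)) (sqr_sqrtr (ip_ge0 ha (Se j))).
  move=> h; apply: (le_trans h); rewrite mulrAC; apply: ler_wpM2l; last exact: ba.
  by rewrite mulr_ge0 ?sqr_ge0//; exact: (ip_ge0 ha (Se j)).
have smg : strongly_measurable T (VVdual l : set (E -> R^o)) (norm_VVdual l) g.
  (* The pairing with [e j] is scaled by the square root of [la j], so that the square of the
     coefficient [y j] of [g t] is the dual part of [energy] and stays bounded in [j]. *)
  pose d j : E -> R^o := fun w => Num.sqrt (la j) * b (e j) w.
  have hd j : VVdual l (d j).
    split.
      move=> r x y hx hy; rewrite /d.
      have -> : b (e j) (fun i z => r * x i z + y i z) = r * b (e j) x + b (e j) y.
        by have := ipDr hS hb (subZ hS r hx) hy (Se j); rewrite (ipZr hS hb r hx (Se j)).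
      have aux (s x1 x2 : R) : s * (r * x1 + x2) = r * (s * x1) + s * x2 by ring.
      exact: aux.
    exists (Num.sqrt (la j) * norm_LL2 l (e j)) => w hw; rewrite /d normrM (ger0_norm (sqrtr_ge0 _)) -mulrA.
    by apply: ler_wpM2l; [exact: sqrtr_ge0|exact: b_le].
  pose y j t := gj j t * (Num.sqrt (la j))^-1.
  have my j : measurable_fun `]0, T[ (y j) by apply: measurable_funM => //; exact: measurable_cst.
  have sla j : Num.sqrt (la j) != 0 by rewrite gt_eqF// sqrtr_gt0.
  apply: (strongly_measurable_series (subspace_VVdual l) (seminorm_VVdual N1 l0) (y := y) (d := d) my hd).
  apply: ae_mono (ae_and gV (ae_and rhoA gE)) => t [h1 [h2 h3]] tT.
  have [hG _] := h1 tT; have [_ _ _ [Bt HB]] := h2 tT; split => //.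
    exists (1 + Bt) => j; apply: sqb; rewrite /y exprMn exprVn sqr_sqrtr ?(ltW (la0 j))//.
    apply: le_trans (HB j.+1); rewrite big_nat_recr//=.
    apply: (@le_trans _ _ (energy la gj c j t)); last by rewrite lerDr sumr_ge0.
    by rewrite lerDr mulr_ge0 ?sqr_ge0// ltW.
  have hs k : VVdual l (\sum_(j < k) y j t *: d j : E -> R^o).
    by apply: (sub_sum (subspace_VVdual l)) => j _; exact: (subZ (subspace_VVdual l)).
  have hdiff k : VVdual l ((\sum_(j < k) y j t *: d j) - g t : E -> R^o) := subB (subspace_VVdual l) (hs k) hG.
  have sumE k w : ((\sum_(j < k) y j t *: d j) - g t : E -> R^o) w = \sum_(0 <= j < k) b (e j) w * g t (e j) - g t w.
    have -> : ((\sum_(j < k) y j t *: d j) - g t : E -> R^o) w = (\sum_(j < k) y j t *: d j : E -> R^o) w - g t w by [].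
    congr (_ - _); rewrite big_mkord; elim/big_ind2: _ => // [x1 x2 y1 y2 <- <-//|j _].
    have -> : (y j t *: d j : E -> R^o) w = gj j t * (Num.sqrt (la j))^-1 * (Num.sqrt (la j) * b (e j) w) by [].
    by rewrite (h3 tT) mulrA divfK// mulrC.
  have lg (r : R) x z : VV l x -> VV l z -> g t (r *: x + z) = r * g t x + g t z := hG.1 r x z.
  have K0 : 0 <= norm_VVdual l (g t) * Num.sqrt cb.
    by rewrite mulr_ge0 ?sqrtr_ge0//; exact: (norm_VVdual_ge0 N1 l0 hG).
  apply: eps_cvg0 => [k|eps eps0]; first exact: (norm_VVdual_ge0 N1 l0 (hdiff k)).
  have ca_gt0 : 0 < ca by exact: lt_le_trans ca1.
  have tau0 : 0 < eps ^+ 2 / ca by rewrite divr_gt0// exprn_gt0.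
  have q0 j : 0 <= g t (e j) ^+ 2 / la j by rewrite divr_ge0 ?sqr_ge0// ltW.
  (* A dual tail below [eps ^+ 2 / ca] gives an error of at most [eps] in the dual norm, [ca] being
     the price of passing from [a] to the H1 norm. *)
  have [NN HN] := series_cauchy q0 (dual_bessel_norm hG) tau0.
  exists NN => k Nk; apply: (norm_VVdual_le N1 l0 (hdiff k) (ltW eps0)) => w hw.
  rewrite sumE distrC.
  apply: le_trans (dual_tail hS ha hb Se la1 orth unit eigen basis lg K0 (VVdual_bound hG) hw (fun n => HN k n Nk)) _.
  rewrite -sqrtrM ?(ltW tau0)//.
  apply: (@le_trans _ _ (Num.sqrt ((eps * norm_HH1 l w) ^+ 2))).
    apply: ler_wsqrtr; rewrite exprMn; apply: (@le_trans _ _ (eps ^+ 2 / ca * (ca * norm_HH1 l w ^+ 2))).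
      by apply: ler_wpM2l; [exact: ltW|exact: a_le].
    by rewrite mulrA divfK// gt_eqF.
  by rewrite sqrtr_sqr ger0_norm// mulr_ge0 ?norm_HH1_ge0// ltW.
have [_ [nV sV hV]] := (in_L2_bochnerP hS (seminorm_HH1 N1 l0) T rho).1 hrho.
have [_ [nF sF hF]] := (in_L2_bochnerP (subspace_VVdual l) (seminorm_VVdual N1 l0) T f).1 hf.
have hg : in_L2Vdual l T g.
  apply/(in_L2_bochnerP (subspace_VVdual l) (seminorm_VVdual N1 l0) T (g : R -> E -> R^o)); split => //.
  have [n mn hn] := strongly_measurable_norm (subspace_VVdual l) (seminorm_VVdual N1 l0) smg.
  exists n => //; apply: (sqint_ae_le _ (SqD sF (SqZ (ca + M) sV))); first exact: mn.
  apply: ae_mono (ae_and (ae_and gV aeF) (ae_and hn (ae_and hV hF))) => t [[h1 h2] [h3 [h4 h5]]] tT.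
  have [hG Hw] := h1 tT; rewrite -(h3 tT) -(h4 tT) -(h5 tT).
  have p0 : 0 <= norm_VVdual l (f t) + (ca + M) * norm_HH1 l (rho t).
    apply: addr_ge0; first exact: (norm_VVdual_ge0 N1 l0 (h2 tT)).
    by apply: mulr_ge0 => //; exact: norm_HH1_ge0.
  rewrite (ger0_norm p0) ger0_norm; last exact: (norm_VVdual_ge0 N1 l0 hG).
  exact: (norm_VVdual_le N1 l0 hG p0 Hw).
have tdg : time_derivative l T rho g.
  apply: time_derivative_of_coefficients => // j eta teta.
  have E1 : {ae mu, forall t, t \in `]0, T[ -> b (rho t) (e j) = c j t}.
    by apply: ae_mono rhoA => t H tT; have [hv _ ej _] := H tT; rewrite (ipC hb hv (Se j)) ej.
  have E2 : {ae mu, forall t, t \in `]0, T[ -> g t (e j) = gj j t} by apply: ae_mono gE => t H tT; exact: H.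
  rewrite (Int_version _ E1) (Int_version _ E2).
  have [i1 Ec] := hc j; have i2 := AC_L1 (ltW T0) (hc j).
  have wd : weak_derivative T (c j) (gj j).
    apply/(weak_derivativeP T0 i2 i1); exists (b (e j) rho0).
    by apply: ae_everywhere => t /in_oo[t0 t1]; exact: Ec.
  exact: wd.
exists rho; split.
- by split => //; exists g.
- have [c' [gc' [p [En [[hc' _] cP _ rP _]]]]] := W_structure hrho hg tdg.
  have [hr0 r0c _] := rP 0 (lexx _) (ltW T0).
  (* The coefficients [c'] of the continuous version agree with [c] at almost every time, hence at 0
     by continuity. *)
  have cE j : c' j 0 = b (e j) rho0.
    rewrite -(AC0 (ltW T0) (hc j)).
    have z0 : (0 : R) \in `[0, T] by rewrite in_itv/= lexx ltW.
    apply: (within_continuous_ae_eq T0 (AC_continuous (ltW T0) (hc' j)) (AC_continuous (ltW T0) (hc j)) _ z0).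
    by apply: ae_mono (ae_and cP rhoA) => t [h1 h2] tT; have [_ _ cj _ _] := h1 tT; have [_ _ ej _] := h2 tT; rewrite (cj j).1 ej.
  have hd := subB hL hr0 h0.
  have dj j : b (e j) (continuous_version l T rho 0 - rho0) = 0.
    by rewrite (ipBr hL hbL hr0 h0 (SeL j)) r0c cE subrr.
  move=> i; apply: ae_mono (LL2_orth hd dj i) => x H /H /eqP.
  have -> : ((continuous_version l T rho 0 : E) - rho0) i x = continuous_version l T rho 0 i x - rho0 i x by [].
  by rewrite subr_eq0 => /eqP.
- move=> phi eta hphi teta; apply: weak_identity hrho hg tdg hphi teta _.
  by apply: ae_everywhere => t _.
Qed.

End evolution.

(** The constant of [weak_solution_bounds] with the Gronwall exponent unfolded; neither the lengths
    nor the number of edges occur in it. *)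
Definition bound_constant (R : realType) (T dl du m : R) : R :=
  let A := expR ((2 * dl + 4 * m ^+ 2 / dl) * T) * (1 + 4 / dl) in
  A + (1 + A / dl) + (1 + (A / dl * (1 + 2 * (du + m) ^+ 2) + 2)).

Lemma bound_constant_gt0 (R : realType) (T dl du m : R) : 0 < dl -> 0 < bound_constant T dl du m.
Proof.
move=> dl0; rewrite /bound_constant /=.
have d4 : 0 <= 4 / dl by rewrite divr_ge0// ltW.
have A0 : 0 < expR ((2 * dl + 4 * m ^+ 2 / dl) * T) * (1 + 4 / dl).
  by rewrite mulr_gt0 ?expR_gt0// ltr_wpDr.
move: A0; set A := expR _ * _ => A0.
have Ad : 0 <= A / dl by rewrite divr_ge0// ltW.
apply: addr_gt0; first by apply: addr_gt0 => //; rewrite ltr_wpDr.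
rewrite ltr_wpDr// addr_ge0// mulr_ge0// addr_ge0// mulr_ge0//.
exact: sqr_ge0.
Qed.

Lemma bound_constant_continuous (R : realType) (T dl du : R) :
  continuous (bound_constant T dl du).
Proof.
move=> m.
have csq (h : R -> R) : h x @[x --> m] --> h m -> h x ^+ 2 @[x --> m] --> h m ^+ 2.
  by move=> ch; rewrite expr2; under eq_fun do rewrite expr2; exact: cvgM.
have cA : expR ((2 * dl + 4 * x ^+ 2 / dl) * T) * (1 + 4 / dl) @[x --> m] -->
    expR ((2 * dl + 4 * m ^+ 2 / dl) * T) * (1 + 4 / dl).
  have ck : (2 * dl + 4 * x ^+ 2 / dl) * T @[x --> m] --> (2 * dl + 4 * m ^+ 2 / dl) * T.
    apply: cvgMl; apply: cvgD; first exact: cvg_cst.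
    by apply: cvgMl; apply: cvgMr; apply: (csq id); exact: cvg_id.
  apply: cvgMl; exact: (cvg_comp _ _ ck (@continuous_expR R _)).
apply: cvgD.
  apply: cvgD; first exact: cA.
  by apply: cvgD; [exact: cvg_cst|apply: cvgMl; exact: cA].
apply: cvgD; first exact: cvg_cst.
apply: cvgD; last exact: cvg_cst.
apply: cvgM; first by apply: cvgMl; exact: cA.
apply: cvgD; first exact: cvg_cst.
apply: cvgMr; apply: (csq (fun x => du + x)).
by apply: cvgD; [exact: cvg_cst|exact: cvg_id].
Qed.

Lemma range_bounds (R : realType) (N : nat) (D : 'I_N -> R) : (0 < N)%N -> (forall i, 0 < D i) ->
  [/\ 0 < inf (range D), forall i, inf (range D) <= D i & forall i, D i <= sup (range D)].
Proof.
move=> N1 D0; have ne : range D !=set0 by exists (D (Ordinal N1)), (Ordinal N1).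
(* Every inverse of a [D i] is at most [s], so [s^-1] is a positive lower bound of the range. *)
pose s := 1 + \sum_i (D i)^-1.
have s0 : 0 < s by rewrite ltr_wpDr// sumr_ge0// => i _; rewrite invr_ge0 ltW.
have low i : s^-1 <= D i.
  rewrite -[leRHS]invrK lef_pV2 ?posrE ?invr_gt0// /s (bigD1 i)//= addrCA lerDl addr_ge0//.
  by apply: sumr_ge0 => j _; rewrite invr_ge0 ltW.
have lbs : lbound (range D) s^-1 by move=> _ [i _ <-]; exact: low.
have ubs : ubound (range D) (\sum_i D i).
  by move=> _ [i _ <-]; rewrite (bigD1 i)//= lerDl sumr_ge0// => j _; exact: ltW.
split.
- apply: (@lt_le_trans _ _ s^-1); first by rewrite invr_gt0.
  exact: lb_le_inf.
- by move=> i; apply: ge_inf; [exists s^-1|exists i].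
- by move=> i; apply: ub_le_sup; [exists (\sum_i D i)|exists i].
Qed.

(** The function [C] is chosen before the number of edges, the lengths and the data, which expresses
    that the constant depends on its four arguments alone. *)
Theorem theorem3p2 (R : realType) :
  exists C : R -> R -> R -> R -> R,
    (forall T Dmin Dmax : R, 0 < T -> 0 < Dmin -> Dmin <= Dmax ->
       (forall m : R, 0 <= m -> 0 < C T Dmin Dmax m) /\
       {within `[0, +oo[, continuous (C T Dmin Dmax)}) /\
    forall (N : nat) (T : R) (l D : 'I_N -> R)
           (f : R -> @graph_fun R N -> R)
           (u : 'I_N -> R * R -> R)
           (rho0 : @graph_fun R N),
      (1 <= N)%N -> 0 < T -> (forall i, 0 < l i) -> (forall i, 0 < D i) ->
      in_L2Vdual l T f -> in_LLoo l T u -> LL2 l rho0 ->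
      [/\ (exists rho, weak_solution l T D f u rho0 rho),
          (forall rho rho' : R -> @graph_fun R N,
             weak_solution l T D f u rho0 rho ->
             weak_solution l T D f u rho0 rho' ->
             {ae @lebesgue_measure R, forall t, t \in `]0, T[ ->
                ae_equal l (rho t) (rho' t)}) &
          (forall rho, weak_solution l T D f u rho0 rho ->
             let K := C T (inf (range D)) (sup (range D)) (norm_LLoo l T u) in
             norm_CL2 l T rho + norm_L2V l T rho
               <= K * (norm_LL2 l rho0 + norm_L2Vdual l T f) /\
             norm_W l T rho
               <= K * (norm_LL2 l rho0 + norm_L2Vdual l T f))].
Proof.
exists (@bound_constant R); split=> [T dl du T0 dl0 _|].
  split=> [m _|]; first exact: bound_constant_gt0.
  exact/continuous_subspaceT/bound_constant_continuous.
move=> N T l D f u rho0 N1 T0 l0 D0 hf hu h0.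
have [ub [mub ubM ub_ae]] := drift_representative hu.
have M0 := norm_LLoo_ge0 l T u.
have [e [la [Se la1 orth unit [eigen basis]]]] := VV_spectral_basis N1 l0 D0.
have [dl0 Ddl Ddu] := range_bounds N1 D0.
split.
- exact: (weak_solution_exists N1 l0 D0 T0 Se la1 orth unit eigen basis M0 mub ubM ub_ae hf h0).
- move=> rho rho'.
  exact: (weak_solution_unique N1 l0 D0 T0 Se la1 orth unit eigen basis M0 mub ubM ub_ae hf dl0 Ddl).
- move=> rho ws K.
  exact: (weak_solution_bounds N1 l0 D0 T0 Se la1 orth unit eigen basis M0 mub ubM ub_ae hf dl0 Ddl Ddu h0 ws).
Qed.
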